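(* Let $\mathcal D\subset\mathbb C$ be a domain containing $0$ and let $A:\mathcal D\to\mathcal S_\infty(\mathcal H)$ be a holomorphic operator-valued function such that $A(0)$ is selfadjoint and $I-A'(0)\Pi_0$ is invertible. Let $\Omega$ be a bounded domain with $\overline\Omega$ a compact subset of $\mathbb C\setminus\{0\}$, with smooth boundary $\partial\Omega$ which is transverse to the real axis at each point of $\partial\Omega\cap\mathbb R$. Put $J:=\Omega\cap\mathbb R$ and $I_\delta:=(\partial\Omega\cap\mathbb R)+[-\delta,\delta]$. Then $$\mathcal N(s\Omega)=n(sJ)+\mathcal O\big(n(sI_\delta)\,|\ln\delta|^2\big)$$ in the following sense: there exist constants $C>0$ and $\delta_1>0$ such that for all $0<\delta<\delta_1$ there exists $s(\delta)>0$ such that for all $0<s<s(\delta)$, $$\big|\mathcal N(s\Omega)-n(sJ)\big|\le C\,n(sI_\delta)\,|\ln\delta|^2 .$$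
   Context: $\mathcal H$ is a separable complex Hilbert space and $\mathcal S_\infty(\mathcal H)$ is the space of compact operators on $\mathcal H$. $\Pi_0$ is the orthogonal projection onto $\ker A(0)$, and $A'(0)$ is the derivative of $A$ at $0$. For $\Omega\subset\mathbb C$ and $s>0$, $s\Omega=\{sz:\ z\in\Omega\}$. A characteristic value of $I-A(z)/z$ is a point $w\in\mathcal D\setminus\{0\}$ such that $F(w):=I-A(w)/w$ is not invertible. Under the hypotheses the characteristic values form a discrete closed subset of $\mathcal D\setminus\{0\}$; the multiplicity of a characteristic value $w$ is the integer $\frac1{2i\pi}\operatorname{tr}\int_{|z-w|=\rho}F'(z)F(z)^{-1}\,dz$ for $\rho>0$ small enough that $w$ is the only characteristic value in $\{|z-w|\le\rho\}$ (and this disc lies in $\mathcal D\setminus\{0\}$). For $\Omega\subset\mathcal D$, $\mathcal N(\Omega)$ is the number of characteristic values in $\Omega\setminus\{0\}$, counted with multiplicities. For $\Lambda\subset\mathbb R$, $n(\Lambda):=\operatorname{tr}\mathbf 1_\Lambda(A(0))$ is the number of eigenvalues of $A(0)$ in $\Lambda$, counted with multiplicities. *)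

(* Defs.v *)
From HB Require Import structures.
From mathcomp Require Import all_boot all_order all_algebra.
From mathcomp Require Import all_classical all_reals all_analysis.
From mathcomp Require Import complex.
Set Implicit Arguments.
Unset Strict Implicit.
Unset Printing Implicit Defensive.
Import Order.TTheory GRing.Theory Num.Theory.
Import numFieldNormedType.Exports.
Local Open Scope classical_set_scope.
Local Open Scope ring_scope.
Local Open Scope complex_scope.

(* R[i] carries no topology in the library; give it the one of R[i]^o. *)
HB.instance Definition _ (R : realType) := NormedModule.copy R[i] R[i]^o.

Section BoundedOperators.
Variables (R : realType) (H : normedModType R[i]).

Definition bounded_linear : {pred H -> H} :=
  mem [set f : H -> H | linear f /\ continuous f].

Record bop : Type := Bop {
  bop_fun :> H -> H;
  bop_funP : bop_fun \in bounded_linear }.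

HB.instance Definition _ := [isSub for bop_fun].
HB.instance Definition _ := [Choice of bop by <:].

Lemma bounded_linear_submod : submod_closed bounded_linear.
Proof.
split.
  rewrite inE; split=> [a x y|]; first by rewrite scaler0 addr0.
  exact: cst_continuous.
move=> a f g; rewrite !inE => -[lf cf] [lg cg]; split.
  move=> b x y; rewrite /= !fctE lf lg !scalerDr !scalerA [b * a]mulrC.
  by rewrite addrACA.
move=> x; apply: cvgD; last exact: cg.
by apply: cvgZr; exact: cf.
Qed.

HB.instance Definition _ :=
  GRing.isSubmodClosed.Build _ _ bounded_linear bounded_linear_submod.
HB.instance Definition _ := [SubChoice_isSubLmodule of bop by <:].

Lemma bop_linear (f : bop) : linear f.
Proof. by have := bop_funP f; rewrite inE => -[]. Qed.

Lemma bop_continuous (f : bop) : continuous f.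
Proof. by have := bop_funP f; rewrite inE => -[]. Qed.

HB.instance Definition _ (f : bop) :=
  GRing.isLinear.Build _ _ _ _ (bop_fun f) (@bop_linear f).

Lemma bop_eqP (f g : bop) : f = g <-> f =1 g.
Proof. by split=> [->//|fg]; apply: val_inj; apply/funext. Qed.

Definition opnorm_set (f : bop) : set R :=
  [set r | exists2 x : H, `|x| <= 1 & `|f x| = r%:C].

(* The norm of a normed module over R[i] takes its values in R[i]. *)
Definition opnorm (f : bop) : R[i] := (sup (opnorm_set f))%:C.

Lemma normRe (V : normedModType R[i]) (x : V) : `|x| = (complex.Re `|x|)%:C.
Proof. by have := normr_real x => /complex_realP[r ->]. Qed.

Lemma opnorm_has_sup (f : bop) : has_sup (opnorm_set f).
Proof.
split; first by exists 0; exists 0; rewrite ?normr0 ?ler01// linear0 normr0.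
have /linear_bounded_continuous/bounded_funP/(_ 1)[M MP] :=
  @bop_continuous f.
exists (complex.Re M) => r [x x1 fx].
have := MP x x1; rewrite fx lecE/= => /andP[_].
by [].
Qed.

Lemma opnorm_set_ub (f : bop) (r : R) :
  opnorm_set f r -> r <= sup (opnorm_set f).
Proof. by move=> fr; apply: ub_le_sup => //; have [] := opnorm_has_sup f. Qed.

Lemma opnorm_set_le (f : bop) (M : R) :
  (forall r, opnorm_set f r -> r <= M) -> sup (opnorm_set f) <= M.
Proof. by move=> fM; apply: ge_sup => //; have [] := opnorm_has_sup f. Qed.

Lemma opnorm_set_memE (f : bop) (x : H) :
  `|x| <= 1 -> opnorm_set f (complex.Re `|f x|).
Proof. by move=> x1; exists x => //; exact: normRe. Qed.

Lemma opnorm_set_ge0 (f : bop) : 0 <= sup (opnorm_set f).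
Proof.
apply: opnorm_set_ub; exists 0; rewrite ?normr0 ?ler01//.
by rewrite linear0 normr0.
Qed.

Lemma opnormD (f g : bop) : opnorm (f + g) <= opnorm f + opnorm g.
Proof.
rewrite /opnorm -rmorphD/= lecR; apply: opnorm_set_le => r [x x1 fgx].
rewrite -lecR -fgx (le_trans (ler_normD _ _))// rmorphD/=.
by rewrite lerD// normRe lecR; apply: opnorm_set_ub; exact: opnorm_set_memE.
Qed.

Lemma opnormZ (a : R[i]) (f : bop) : opnorm (a *: f) = `|a| * opnorm f.
Proof.
have le1 (b : R[i]) (g : bop) : opnorm (b *: g) <= `|b| * opnorm g.
  have -> : `|b| = (complex.Re `|b|)%:C by [].
  rewrite /opnorm -rmorphM/= lecR; apply: opnorm_set_le => r [x x1 gx].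
  rewrite -lecR -gx normrZ rmorphM/= ler_wpM2l//.
  by rewrite normRe lecR; apply: opnorm_set_ub; exact: opnorm_set_memE.
apply/eqP; rewrite eq_le le1/=.
have [->|a0] := eqVneq a 0.
  by rewrite normr0 mul0r /opnorm lecR opnorm_set_ge0.
have /(ler_wpM2l (normr_ge0 a)) := le1 a^-1 (a *: f).
rewrite scalerA mulVf// scale1r mulrA -normrM mulfV// normr1 mul1r.
exact.
Qed.

Lemma opnorm0_eq0 (f : bop) : opnorm f = 0 -> f = 0.
Proof.
move=> /complexI f0; apply/bop_eqP => x; change (f x = 0).
have [->|x0] := eqVneq x 0; first by rewrite linear0.
have nx0 : `|x| != 0 by rewrite normr_eq0.
have x1 : `| `|x|^-1 *: x| <= 1.
  by rewrite normrZ normfV normr_id mulVf.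
have := opnorm_set_ub (opnorm_set_memE f x1); rewrite f0 -lecR -normRe.
rewrite normr_le0 linearZ/= scaler_eq0 invr_eq0 (negbTE nx0)/=.
by move/eqP.
Qed.

HB.instance Definition _ :=
  Lmodule_isNormed.Build R[i] bop opnormD opnormZ opnorm0_eq0.

Lemma bop_id_subproof : (idfun : H -> H) \in bounded_linear.
Proof. by rewrite inE; split=> // x; exact: cvg_id. Qed.
Definition bop_id : bop := Bop bop_id_subproof.

Lemma bop_comp_subproof (f g : bop) :
  ((f : H -> H) \o g) \in bounded_linear.
Proof.
rewrite inE; split=> [a x y|x] /=; first by rewrite !linearP.
by apply: continuous_comp; exact: bop_continuous.
Qed.
Definition bop_comp (f g : bop) : bop := Bop (bop_comp_subproof f g).

Lemma bop_compA : associative bop_comp.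
Proof. by move=> f g h; apply/bop_eqP. Qed.
Lemma bop_comp1l : left_id bop_id bop_comp.
Proof. by move=> f; apply/bop_eqP. Qed.
Lemma bop_comp1r : right_id bop_id bop_comp.
Proof. by move=> f; apply/bop_eqP. Qed.
Lemma bop_compDl : left_distributive bop_comp +%R.
Proof. by move=> f g h; apply/bop_eqP. Qed.
Lemma bop_compDr : right_distributive bop_comp +%R.
Proof. by move=> f g h; apply/bop_eqP => x; exact: linearD. Qed.

(* The product of the ring bop is the composition of operators. *)
HB.instance Definition _ := GRing.Zmodule_isPzRing.Build bop
  bop_compA bop_comp1l bop_comp1r bop_compDl bop_compDr.

Definition is_inverse (T S : bop) : Prop := T * S = 1 /\ S * T = 1.

Definition invertible (T : bop) : Prop := exists S, is_inverse T S.

(* A junk value when T is not invertible. *)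
Definition inverse (T : bop) : bop := xget 0 [set S | is_inverse T S].

Definition compact_operator (T : bop) : Prop :=
  compact (closure (T @` [set x | `|x| <= 1])).

End BoundedOperators.

Section Hilbert.
Variables (R : realType) (H : normedModType R[i]) (dot : {dot H for Num.Def.conjC}).

Definition separable (T : topologicalType) : Prop :=
  exists2 S : set T, countable S & dense S.

Definition selfadjoint (T : bop H) : Prop :=
  forall x y, dot (T x) y = dot x (T y).

Definition orthogonal_projection (K : set H) (P : bop H) : Prop :=
  forall x, K (P x) /\ (forall y, K y -> dot (x - P x) y = 0).

(* A complete orthonormal system indexed by nat; zero vectors are allowed as  *)
(* padding, so that spaces of finite dimension have such systems too.         *)
Definition orthonormal_basis (e : nat -> H) : Prop :=
  [/\ forall i, e i = 0 \/ dot (e i) (e i) = 1,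
      forall i j, i <> j -> dot (e i) (e j) = 0 &
      forall x, (forall i, dot x (e i) = 0) -> x = 0].

(* For a trace-class operator the value does not depend on the basis. *)
Definition trace (T : bop H) : R[i] :=
  let e := xget (fun=> 0) [set e | orthonormal_basis e] in
  limn (series (fun i => dot (T (e i)) (e i))).

Definition lin_indep (n : nat) (e : 'I_n -> H) : Prop :=
  forall c : 'I_n -> R[i], \sum_i c i *: e i = 0 -> forall i, c i = 0.

(* dimension in \bar R of a linear subspace, +oo if it is infinite *)
Definition edim (V : set H) : \bar R :=
  ereal_sup [set n%:R%:E | n in
    [set n | exists e : 'I_n -> H, (forall i, V (e i)) /\ lin_indep e]].

Definition eigenspace (T : bop H) (l : R[i]) : set H :=
  [set x | T x = l *: x].

(* Real numbers that are not eigenvalues contribute 0 to the sum. *)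
Definition eigenvalue_count (T : bop H) (L : set R) : \bar R :=
  \esum_(l in L) edim (eigenspace T l%:C).

End Hilbert.

Section CircleIntegral.
Variables (R : realType) (V : normedModType R[i]).

(* the Riemann integral, with tagged partitions t 0 <= xi 0 <= t 1 <= ... *)
Definition is_Riemann_integral (f : R -> V) (a b : R) (l : V) : Prop :=
  forall e : R, 0 < e -> exists2 d : R, 0 < d &
    forall (n : nat) (t xi : nat -> R), t 0%N = a -> t n = b ->
      (forall i, (i < n)%N -> t i <= xi i <= t i.+1 /\ t i.+1 - t i < d) ->
      `|\sum_(i < n) (t i.+1 - t i)%:C *: f (xi i) - l| < e%:C.

Definition Riemann_integral (f : R -> V) (a b : R) : V :=
  xget 0 [set l | is_Riemann_integral f a b l].

Definition expi (t : R) : R[i] := cos t +i* sin t.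

(* integral of f along z = w + r e^{it}, where dz = i r e^{it} dt *)
Definition circle_integral (f : R[i] -> V) (w : R[i]) (r : R) : V :=
  Riemann_integral
    (fun t => ((0 +i* 1) * r%:C * expi t) *: f (w + r%:C * expi t)) 0 (pi *+ 2).

End CircleIntegral.

Section CharacteristicValues.
Variables (R : realType) (H : normedModType R[i]) (dot : {dot H for Num.Def.conjC}).
Variables (D : set R[i]) (A : R[i] -> bop H).

Definition holomorphic_on : Prop := forall z, D z -> derivable A z 1.

Definition charF (z : R[i]) : bop H := 1 - z^-1 *: A z.

Definition charval (w : R[i]) : Prop := [/\ D w, w != 0 & ~ invertible (charF w)].

Definition isolating_radius (w : R[i]) (r : R) : Prop :=
  0 < r /\ forall z, `|z - w| <= r%:C ->
    [/\ D z, z != 0 & charval z -> z = w].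

(* The value does not depend on the isolating radius. *)
Definition multiplicity (w : R[i]) : R[i] :=
  let r := xget 1 [set r | isolating_radius w r] in
  ((0 +i* 1) * (pi *+ 2)%:C)^-1 *
  trace dot (circle_integral (fun z => derive1 charF z * inverse (charF z)) w r).

(* The multiplicities are integers; complex.Re only casts them to R. *)
Definition charval_count (Omega : set R[i]) : \bar R :=
  \esum_(w in [set w | Omega w /\ charval w]) (complex.Re (multiplicity w))%:E.

End CharacteristicValues.

Section PlaneDomains.
Variable R : realType.

Definition domain (Omega : set R[i]) : Prop :=
  [/\ open Omega, connected Omega & Omega !=set0].

Definition boundary (Omega : set R[i]) : set R[i] :=
  closure Omega `\` interior Omega.

Definition smooth_fun (g : R -> R) : Prop :=
  forall n x, derivable (derive1n n g) x 1.

(* After the rotation z |-> u z, Omega is near p the strict epigraph of g. *)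
Definition boundary_chart (Omega : set R[i]) (p : R[i])
    (r : R) (u : R[i]) (g : R -> R) : Prop :=
  [/\ 0 < r, `|u| = 1, smooth_fun g &
      forall z, `|z - p| < r%:C ->
        (Omega z <-> g (complex.Re (u * z)) < complex.Im (u * z))].

Definition smooth_boundary (Omega : set R[i]) : Prop :=
  forall p, boundary Omega p -> exists r u g, boundary_chart Omega p r u g.

(* The graph of g has tangent direction 1 + i g' in the rotated coordinate. *)
Definition tangent_space (Omega : set R[i]) (p : R[i]) : set R[i] :=
  [set v | exists r u g, boundary_chart Omega p r u g /\
    exists t : R, v = t%:C * (u^-1 * (1 +i* derive1 g (complex.Re (u * p))))].

(* T_x(boundary) + T_x(real axis) = C at the real points x of the boundary *)
Definition transverse_to_real_axis (Omega : set R[i]) : Prop :=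
  forall x : R, boundary Omega x%:C ->
    forall z : R[i], exists v (a : R), tangent_space Omega x%:C v /\ z = v + a%:C.

Definition real_trace (Omega : set R[i]) : set R := [set x | Omega x%:C].

(* (boundary of Omega \cap R) + [-delta, delta] *)
Definition boundary_nbhd (Omega : set R[i]) (delta : R) : set R :=
  [set x + t | x in real_trace (boundary Omega) & t in `[- delta, delta]].

End PlaneDomains.

(* Main.v *)
(* Near z = 0 the equation is reduced to a finite matrix.  Let e_i, l_i be the
   eigenvectors and eigenvalues of A(0) and let P be the projection onto the
   e_i with |l_i| comparable to s.  On an annulus |z| ~ s one has
     I - A(z)/z = U(z) (1 - Y(z) P) V(z)
   with U and V invertible: V collects the eigenvalues that are much larger or
   much smaller than s, and U is a small perturbation of 1 - A'(0) Pi0, because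
   the compact operator A'(0) maps the spectral projections on the small non-zero
   eigenvalues to operators of small norm.  Hence the characteristic values are,
   with multiplicity, the zeros of det (z - diag(l_i) - E(z)), where E is
   holomorphic and |E| <= eps s, eps being as small as we like.  In particular
   they lie within eps s of the real axis, and s Omega only matters through the
   intervals of J and the transversality cones at their end points.

   Over an interval ]a, b[ of s J, split the l_i into those at distance at most
   delta s of a or b, n of them, and the others.  The Schur complement
   factorizes the determinant.  The block of the others keeps its number of zeros
   along the homotopy t E, 0 <= t <= 1.  The remaining factor has logarithmic
   growth O(n), so that Jensen's bound, the Borel-Caratheodory inequality and the
   argument principle on a rectangle give O(n) for its number of zeros.  The sum
   over the intervals is O(n(s I_delta)), and |ln delta|^2 >= 1. *)

(* Three obstacles shape the proof. First, the number of eigenvalues well inside an interval is not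
   controlled by the number near its ends, so the growth of the full determinant is of no use on a
   contour; after division by the determinant of the inner block only the [n] near eigenvalues
   govern the growth. The long horizontal sides then cost [O(n)] provided that the perturbation is
   of order [delta^2] relative to the scale; this is allowed because the threshold for [s] is chosen
   after [delta], and it is why no logarithm of [delta] ever appears. Second, a multiplicity is the
   trace, in some basis, of an operator-valued integral over a circle of arbitrary isolating radius.
   The polar part of [F' F^-1] has finite rank, so its coefficients have explicit traces and no
   trace is exchanged with an integral. Third, [A'(0)] is reached only through difference quotients:
   its smallness on the small eigenvalues is inherited from the compact operators [A(h)] and [A(0)]
   for one fixed [h]. *)
Require Import Defs.
From HB Require Import structures.
From mathcomp Require Import all_boot all_order all_algebra.
From mathcomp Require Import all_classical all_reals all_analysis.
From mathcomp Require Import complex ring lra perm.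
Set Implicit Arguments.
Unset Strict Implicit.
Unset Printing Implicit Defensive.
Import Order.TTheory GRing.Theory Num.Theory.
Import numFieldNormedType.Exports.
Local Open Scope classical_set_scope.
Local Open Scope ring_scope.
Local Open Scope complex_scope.

(* A reflexive decision procedure for linear identities in a module: both sides
   are expanded on the atoms and the scalar coefficients are compared by [ring]. *)
Section ModuleExpr.
Variables (K : comPzRingType) (V : lmodType K).

Inductive mexp := MV of nat | MA of mexp & mexp | MO of mexp | MZ of K & mexp | M0.

Fixpoint mev (env : seq V) e : V :=
  match e with
  | MV n => nth 0 env n
  | MA a b => mev env a + mev env b
  | MO a => - mev env a
  | MZ k a => k *: mev env a
  | M0 => 0
  end.

Fixpoint mcoef e n : K :=
  match e with
  | MV m => if m == n then 1 else 0
  | MA a b => mcoef a n + mcoef b n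
  | MO a => - mcoef a n
  | MZ k a => k * mcoef a n
  | M0 => 0
  end.

Fixpoint mwf N e : bool :=
  match e with
  | MV m => (m < N)%N
  | MA a b => mwf N a && mwf N b
  | MO a | MZ _ a => mwf N a
  | M0 => true
  end.

Lemma mev_coef env e : mwf (size env) e ->
  mev env e = \sum_(i < size env) mcoef e i *: nth 0 env i.
Proof.
elim: e => [m|a iha b ihb|a iha|k a iha|] /=.
- move=> h; rewrite (bigD1 (Ordinal h))//= eqxx scale1r big1 ?addr0// => i.
  rewrite -val_eqE/= eq_sym => /negbTE ->; exact: scale0r.
- move=> /andP[/iha -> /ihb ->]; rewrite -big_split/=.
  by apply: eq_bigr => i _; rewrite scalerDl.
- by move=> /iha ->; rewrite -sumrN; apply: eq_bigr => i _; rewrite scaleNr.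
- by move=> /iha ->; rewrite scaler_sumr; apply: eq_bigr => i _; rewrite scalerA.
- by move=> _; rewrite big1// => i _; rewrite scale0r.
Qed.

Fixpoint mall N (e1 e2 : mexp) : Prop :=
  if N is n.+1 then mcoef e1 n = mcoef e2 n /\ mall n e1 e2 else True.

Lemma mev_eq env e1 e2 : mwf (size env) e1 && mwf (size env) e2 ->
  mall (size env) e1 e2 -> mev env e1 = mev env e2.
Proof.
move=> /andP[h1 h2] h; rewrite !mev_coef//; apply: eq_bigr => -[i hi] _ /=.
suff -> : mcoef e1 i = mcoef e2 i by [].
elim: (size env) h hi => // n ih /= [h3 h4]; rewrite ltnS leq_eqVlt.
by case/orP => [/eqP -> //|]; exact: ih.
Qed.

End ModuleExpr.

Ltac mod_index x l :=
  lazymatch l with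
  | x :: _ => constr:(0%N)
  | _ :: ?l' => let n := mod_index x l' in constr:(S n)
  end.
Ltac mod_mem x l :=
  lazymatch l with
  | nil => constr:(false)
  | x :: _ => constr:(true)
  | _ :: ?l' => mod_mem x l'
  end.
Ltac mod_atoms t l :=
  lazymatch t with
  | (?a + ?b)%R => let l1 := mod_atoms a l in mod_atoms b l1
  | (- ?a)%R => mod_atoms a l
  | (?k *: ?a)%R => mod_atoms a l
  | (0)%R => l
  | _ => lazymatch mod_mem t l with true => l | false => constr:(t :: l) end
  end.
Ltac mod_reify K t l :=
  lazymatch t with
  | (?a + ?b)%R => let x := mod_reify K a l in let y := mod_reify K b l in
                   constr:(@MA K x y)
  | (- ?a)%R => let x := mod_reify K a l in constr:(@MO K x)
  | (?k *: ?a)%R => let x := mod_reify K a l in constr:(@MZ K k x)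
  | (0)%R => constr:(@M0 K)
  | _ => let n := mod_index t l in constr:(@MV K n)
  end.
Ltac module_with K V :=
  lazymatch goal with |- ?x = ?y =>
    let l0 := constr:(@nil V) in
    let l1 := mod_atoms x l0 in let l := mod_atoms y l1 in
    let e1 := mod_reify K x l in let e2 := mod_reify K y l in
    refine (@mev_eq K V l e1 e2 isT _); cbn [mall size mcoef eqn eq_op];
    simpl
  end.
Ltac module_solve K V := module_with K V; repeat split; try by [|ring|field].

(** * Real-valued norms and complex differentiability *)

Section RealNorm.
Variable R : realType.

Section OneSpace.
Variable V : normedModType R[i].
Implicit Types x y : V.

(** Norms over [R[i]] are complex numbers that happen to be real. The real part loses nothing
    ([nrE]) and puts every estimate in the ordered field [R], within reach of [lra] and [nra]. *)
Definition nr x : R := complex.Re `|x|.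

Lemma nrE x : `|x| = (nr x)%:C. Proof. exact: normRe. Qed.

Lemma nr_ge0 x : 0 <= nr x. Proof. rewrite -lecR -nrE; exact: normr_ge0. Qed.

Lemma nr0 : nr (0 : V) = 0. Proof. by rewrite /nr normr0. Qed.

Lemma nr_eq0 x : (nr x == 0) = (x == 0).
Proof. by rewrite -[RHS]normr_eq0 nrE eq_complex /= eqxx andbT. Qed.

Lemma nrD x y : nr (x + y) <= nr x + nr y.
Proof. by rewrite -lecR rmorphD /= -!nrE ler_normD. Qed.

Lemma nrN x : nr (- x) = nr x. Proof. by rewrite /nr normrN. Qed.

Lemma nrC x y : nr (x - y) = nr (y - x). Proof. by rewrite /nr distrC. Qed.

Lemma nrB x y : nr (x - y) <= nr x + nr y.
Proof. by rewrite -(nrN y) nrD. Qed.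

Lemma nr_triang y x z : nr (x - z) <= nr (x - y) + nr (y - z).
Proof. by rewrite -[x - z](subrKA y) nrD. Qed.

Lemma nrBr x y : nr x - nr y <= nr (x - y).
Proof. by rewrite lerBlDr -{1}[x](subrK y) nrD. Qed.

Lemma nr_sum (I : Type) (s : seq I) (P : pred I) (F : I -> V) :
  nr (\sum_(i <- s | P i) F i) <= \sum_(i <- s | P i) nr (F i).
Proof.
elim/big_ind2 : _ => [|a b c d h1 h2|//]; first by rewrite nr0.
by apply: (le_trans (nrD _ _)); apply: lerD.
Qed.

End OneSpace.

Lemma nrZ (V : normedModType R[i]) (a : R[i]) (x : V) :
  nr (a *: x) = nr a * nr x.
Proof.
by apply: (@complexI R); rewrite rmorphM /= -!nrE normrZ.
Qed.

Lemma nrM (a b : R[i]) : nr (a * b) = nr a * nr b.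
Proof. exact: (@nrZ R[i]). Qed.

Lemma nr1 : nr (1 : R[i]) = 1. Proof. by rewrite /nr normr1. Qed.

Lemma nrV (a : R[i]) : nr a^-1 = (nr a)^-1.
Proof.
have [->|a0] := eqVneq a 0; first by rewrite invr0 nr0 invr0.
have h : nr a != 0 by rewrite nr_eq0.
by apply: (mulfI h); rewrite -nrM !mulfV // nr1.
Qed.

Lemma nrX (a : R[i]) n : nr (a ^+ n) = nr a ^+ n.
Proof. by elim: n => [|n ih]; rewrite ?expr0 ?nr1// !exprS nrM ih. Qed.

Lemma nr_prod (I : Type) (s : seq I) (P : pred I) (F : I -> R[i]) :
  nr (\prod_(i <- s | P i) F i) = \prod_(i <- s | P i) nr (F i).
Proof. exact: (big_morph _ nrM nr1). Qed.

Lemma nr_sqr (a : R[i]) : nr a ^+ 2 = complex.Re a ^+ 2 + complex.Im a ^+ 2.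
Proof. by apply: (@complexI R); rewrite rmorphXn /= -nrE -add_Re2_Im2. Qed.

Lemma nr_real (r : R) : nr (r%:C) = `|r|.
Proof.
by apply/eqP; rewrite -(eqrXn2 (n:=2))// ?nr_ge0// nr_sqr /= expr0n addr0 real_normK// num_real.
Qed.

Lemma nrRe (a : R[i]) : `|complex.Re a| <= nr a.
Proof.
by rewrite -ler_sqr ?nnegrE ?nr_ge0// nr_sqr real_normK ?num_real// lerDl sqr_ge0.
Qed.

Lemma nrIm (a : R[i]) : `|complex.Im a| <= nr a.
Proof.
by rewrite -ler_sqr ?nnegrE ?nr_ge0// nr_sqr real_normK ?num_real// lerDr sqr_ge0.
Qed.

Lemma nr_le_ReIm (a : R[i]) : nr a <= `|complex.Re a| + `|complex.Im a|.
Proof.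
rewrite -ler_sqr ?nnegrE ?nr_ge0 ?addr_ge0// nr_sqr sqrrD !real_normK ?num_real//.
by rewrite -addrA lerD2l lerDr mulrn_wge0// mulr_ge0.
Qed.

Definition cv (V : normedModType R[i]) (u : nat -> V) (l : V) :=
  forall e : R, 0 < e -> exists N, forall n, (N <= n)%N -> nr (u n - l) <= e.

Definition cauchy_nr (V : normedModType R[i]) (u : nat -> V) :=
  forall e : R, 0 < e -> exists N, forall m n, (N <= m)%N -> (N <= n)%N ->
    nr (u m - u n) <= e.

(** Completeness is a plain hypothesis, because the calculus below is applied alike to [R[i]], to
    [H] and to [bop H], whose completeness is proved only later ([bop_complete]). *)
Definition complete_nm (V : normedModType R[i]) :=
  forall u : nat -> V, cauchy_nr u -> exists l, cv u l.

Definition lims (V : normedModType R[i]) (u : nat -> V) : V :=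
  xget 0 [set l | cv u l].

Lemma eq_nr_le (V : normedModType R[i]) (x y : V) :
  (forall e : R, 0 < e -> nr (x - y) <= e) -> x = y.
Proof.
move=> h; apply/eqP; rewrite -subr_eq0 -nr_eq0 eq_le nr_ge0 andbT.
by apply/ler_addgt0Pr => e e0; rewrite add0r h.
Qed.

Section Cv.
Variable V : normedModType R[i].
Implicit Types (u v : nat -> V) (l m : V).

Lemma cv_unique u l m : cv u l -> cv u m -> l = m.
Proof.
move=> ul um; apply: eq_nr_le => e e0.
have e2 : 0 < e / 2 by rewrite divr_gt0.
have [N1 h1] := ul _ e2; have [N2 h2] := um _ e2.
apply: (le_trans (nr_triang (u (maxn N1 N2)) _ _)).
rewrite nrC (splitr e); apply: lerD; first exact/h1/leq_maxl.
exact/h2/leq_maxr.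
Qed.

Lemma lims_cv u : (exists l, cv u l) -> cv u (lims u).
Proof. by rewrite /lims; case: xgetP => [l ->//|h [l /h]]. Qed.

Lemma limsE u l : cv u l -> lims u = l.
Proof. by move=> ul; apply: (@cv_unique u) => //; apply: lims_cv; exists l. Qed.

Lemma cv_le u l a e : cv u l -> (exists N, forall n, (N <= n)%N -> nr (u n - a) <= e) -> nr (l - a) <= e.
Proof.
move=> ul [N h]; apply/ler_addgt0Pr => d d0.
have [M hM] := ul _ d0.
apply: (le_trans (nr_triang (u (maxn N M)) _ _)).
rewrite addrC; apply: lerD; first exact/h/leq_maxl.
by rewrite nrC; exact/hM/leq_maxr.
Qed.

Lemma cvD u v l m : cv u l -> cv v m -> cv (fun n => u n + v n) (l + m).
Proof.
move=> ul vm e e0; have e2 : 0 < e / 2 by rewrite divr_gt0.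
have [N1 h1] := ul _ e2; have [N2 h2] := vm _ e2.
exists (maxn N1 N2) => n; rewrite geq_max => /andP[n1 n2].
have -> : u n + v n - (l + m) = (u n - l) + (v n - m) by rewrite opprD addrACA.
apply: (le_trans (nrD _ _)); rewrite (splitr e); apply: lerD; [exact: h1|exact: h2].
Qed.

Lemma cv_lip (W : normedModType R[i]) (g : V -> W) (c : R) u l :
  (forall x y, nr (g x - g y) <= c * nr (x - y)) -> cv u l ->
  cv (fun n => g (u n)) (g l).
Proof.
move=> gc ul e e0; have c1 : 0 < `|c| + 1 by rewrite ltr_wpDl.
have [N h] := ul _ (divr_gt0 e0 c1).
exists N => n /h hn; apply: (le_trans (gc _ _)).
rewrite ler_pdivlMr// mulrC in hn; apply: le_trans hn.
by rewrite ler_wpM2r ?nr_ge0// (le_trans (ler_norm _))// lerDl.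
Qed.

Lemma cvZ u l a : cv u l -> cv (fun n => a *: u n) (a *: l).
Proof.
by apply: (@cv_lip _ _ (nr a)) => x y; rewrite -scalerBr nrZ.
Qed.

Lemma cv_cst l : cv (fun=> l) l.
Proof. by move=> e e0; exists 0%N => n _; rewrite subrr nr0 ltW. Qed.

Lemma cvS u l : cv u l -> cv (fun n => u n.+1) l.
Proof. by move=> h e /h[N hN]; exists N => n Nn; apply/hN/(leq_trans Nn). Qed.

Lemma nr_cv_le u l e : cv u l -> (forall n, nr (u n) <= e) -> nr l <= e.
Proof.
move=> ul h; rewrite -[l]subr0; apply: (cv_le ul); exists 0%N => n _.
by rewrite subr0.
Qed.

Lemma cauchy_geo u (d : R) : 0 <= d ->
  (forall n, nr (u n.+1 - u n) <= d / 2 ^+ n) -> cauchy_nr u.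
Proof.
move=> d0 h.
(* Keeping the exact geometric sum, with its factor [1 - 2^-k], turns the induction step into an
   identity. *)
have st n k : nr (u (n + k)%N - u n) <= 2 * d / 2 ^+ n * (1 - (2 ^+ k)^-1).
  elim: k => [|k ih]; first by rewrite addn0 subrr nr0 expr0 invr1 subrr mulr0.
  rewrite addnS; apply: (le_trans (nr_triang (u (n + k)%N) _ _)).
  apply: (le_trans (lerD (h _) ih)); rewrite le_eqVlt; apply/orP; left.
  apply/eqP; rewrite exprD exprS; field.
  by rewrite !expf_neq0.
move=> e e0.
have [N hN] : exists N : nat, 4 * d / e <= N%:R.
  exists (Num.truncn (4 * d / e)).+1; exact/ltW/truncnS_gt.
have hN2 : 4 * d / e <= 2 ^+ N.
  by apply: (le_trans hN); rewrite -natrX ler_nat ltnW// ltn_expl.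
have key n : (N <= n)%N -> nr (u n - u N) <= e / 2.
  move=> Nn; rewrite -(subnKC Nn); apply: (le_trans (st _ _)).
  apply: (@le_trans _ _ (2 * d / 2 ^+ N)).
    by rewrite ler_piMr ?mulr_ge0 ?invr_ge0 ?exprn_ge0// gerBl invr_ge0 exprn_ge0.
  move: hN2; rewrite ler_pdivrMr// => hN2.
  rewrite ler_pdivrMr ?exprn_gt0//; lra.
exists N => m n /key hm /key hn.
by apply: (le_trans (nr_triang (u N) _ _)); rewrite (nrC (u N)) (splitr e) lerD.
Qed.

End Cv.

Lemma complete_completeType (H : completeNormedModType R[i]) : complete_nm H.
Proof.
move=> u cu.
have /cauchy_cvg/cvg_ex[l ul] : cauchy (u @ \oo).
  apply/cauchy_ballP => e; rewrite ltcE/= => /andP[/eqP Ie Re0].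
  have /cu[N hN] : 0 < complex.Re e / 2 by rewrite divr_gt0.
  near=> x; near: x.
  exists (u @` [set n | (N <= n)%N], u @` [set n | (N <= n)%N]) => /=.
    by split; exists N => // n Nn; exists n.
  move=> [_ _] /= [[m Nm <-] [n Nn <-]].
  rewrite -ball_normE /ball_/= nrE ltcE/= -Ie eqxx/=.
  by apply: le_lt_trans (hN _ _ Nm Nn) _; rewrite ltr_pdivrMr// ltr_pMr// ltr1n.
exists l => e e0; have ec : 0 < e%:C :> R[i] by rewrite ltcR.
have /cvgrPdist_lt/(_ _ ec)[N _ hN] := ul.
exists N => n /hN; rewrite distrC nrE ltcR; exact: ltW.
Unshelve. all: by end_near.
Qed.

Lemma real_cauchy (u : nat -> R) :
  (forall e : R, 0 < e -> exists N, forall m n, (N <= m)%N -> (N <= n)%N ->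
    `|u m - u n| <= e) ->
  exists l, forall e : R, 0 < e -> exists N, forall n, (N <= n)%N -> `|u n - l| <= e.
Proof.
move=> cu.
have /cauchy_cvg/cvg_ex[l ul] : cauchy (u @ \oo).
  apply/cauchy_ballP => e e0.
  have /cu[N hN] : 0 < e / 2 by rewrite divr_gt0.
  near=> x; near: x.
  exists (u @` [set n | (N <= n)%N], u @` [set n | (N <= n)%N]) => /=.
    by split; exists N => // n Nn; exists n.
  move=> [_ _] /= [[m Nm <-] [n Nn <-]].
  rewrite -ball_normE /ball_/=.
  by apply: le_lt_trans (hN _ _ Nm Nn) _; rewrite ltr_pdivrMr// ltr_pMr// ltr1n.
exists l => e e0.
have /cvgrPdist_lt/(_ _ e0)[N _ hN] := ul.
exists N => n /hN; rewrite distrC; exact: ltW.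
Unshelve. all: by end_near.
Qed.

Lemma complete_complex : complete_nm R[i].
Proof.
move=> u cu.
have [|a ha] := @real_cauchy (fun n => complex.Re (u n)).
  move=> e /cu[N hN]; exists N => m n Nm Nn; rewrite -raddfB/=.
  exact: le_trans (nrRe _) (hN _ _ _ _).
have [|b hb] := @real_cauchy (fun n => complex.Im (u n)).
  move=> e /cu[N hN]; exists N => m n Nm Nn; rewrite -raddfB/=.
  exact: le_trans (nrIm _) (hN _ _ _ _).
exists (a +i* b) => e e0; have e2 : 0 < e / 2 by rewrite divr_gt0.
have [N1 h1] := ha _ e2; have [N2 h2] := hb _ e2.
exists (maxn N1 N2) => n; rewrite geq_max => /andP[n1 n2].
apply: (le_trans (nr_le_ReIm _)); rewrite !raddfB/= (splitr e).
by apply: lerD; [exact: h1|exact: h2].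
Qed.

(* Cells shrinking to a point: the common core of the bisection of segments
   and of the subdivision of triangles. *)
Lemma nested_cells (X : Type) (Bad : X -> Prop) (c : X -> R[i]) (d : X -> R) (x0 : X) :
  (forall x, 0 <= d x) -> Bad x0 ->
  (forall x, Bad x -> exists y, [/\ Bad y, d y <= d x / 2 & nr (c y - c x) <= d x]) ->
  exists z, forall r : R, 0 < r -> exists y,
    [/\ Bad y, d y < r & nr (c y - z) <= 2 * d y].
Proof.
move=> d0 b0 hs.
have /choice[f hf] (x : {x | Bad x}) : exists y : {x | Bad x},
    d (sval y) <= d (sval x) / 2 /\ nr (c (sval y) - c (sval x)) <= d (sval x).
  by have [y [By h1 h2]] := hs _ (svalP x); exists (exist _ y By).
pose s n := iter n f (exist _ x0 b0).
have ds n k : d (sval (s (n + k)%N)) <= d (sval (s n)) / 2 ^+ k.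
  elim: k => [|k ih]; first by rewrite addn0 expr0 divr1.
  rewrite addnS; apply: (le_trans (hf _).1); rewrite exprSr invfM mulrA.
  by rewrite ler_wpM2r// invr_ge0.
have [//|z hz] := @complete_complex (fun n => c (sval (s n))).
  apply: (@cauchy_geo _ _ (d x0)) => // n.
  by apply: (le_trans (hf _).2); exact: (ds 0%N n).
exists z => r r0.
have [N hN] : exists N : nat, d x0 / r < N%:R.
  by exists (Num.truncn (d x0 / r)).+1; exact/truncnS_gt.
exists (sval (s N)); split; first exact: svalP.
  apply: le_lt_trans (ds 0%N N) _ => /=.
  rewrite ltr_pdivrMr ?exprn_gt0// mulrC -ltr_pdivrMr//.
  by apply: (lt_trans hN); rewrite -natrX ltr_nat ltn_expl.
rewrite nrC; apply: (cv_le hz); exists N => n Nn; rewrite -(subnKC Nn).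
elim: (n - N)%N => [|k ih] {Nn n}.
  by rewrite addn0 subrr nr0 mulr_ge0.
suff st k' : nr (c (sval (s (N + k')%N)) - c (sval (s N))) <=
   2 * d (sval (s N)) * (1 - (2 ^+ k')^-1).
  apply: (le_trans (st _)); rewrite ler_piMr ?mulr_ge0// gerBl invr_ge0 exprn_ge0//.
elim: k' => [|k' ih']; first by rewrite addn0 subrr nr0 expr0 invr1 subrr mulr0.
rewrite addnS; apply: (le_trans (nr_triang (c (sval (s (N + k')%N))) _ _)).
apply: (le_trans (lerD (le_trans (hf _).2 (ds _ _)) ih')).
rewrite le_eqVlt; apply/orP; left; apply/eqP; rewrite exprS; field.
by rewrite expf_neq0.
Qed.

End RealNorm.

(** * Complex differentiability of vector-valued functions *)

Section Derivative.
Variable R : realType.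
Section OneSpace.
Variable V : normedModType R[i].
Implicit Types (f g : R[i] -> V) (z w : R[i]) (d : V).

(** The derivative through its remainder instead of a quotient: the point [w = z] needs no exclusion
    and only real norms occur. *)
Definition hd f z d := forall e : R, 0 < e -> exists2 r : R, 0 < r &
  forall w, nr (w - z) < r -> nr (f w - f z - (w - z) *: d) <= e * nr (w - z).

Definition cts f z := forall e : R, 0 < e -> exists2 r : R, 0 < r &
  forall w, nr (w - z) < r -> nr (f w - f z) <= e.

Definition hol (U : set R[i]) f := forall z, U z -> exists d, hd f z d.

Definition opn (U : set R[i]) := forall z, U z -> exists2 r : R, 0 < r &
  forall w, nr (w - z) < r -> U w.

Definition df f z : V := xget 0 [set d | hd f z d].

Lemma hd_bound f z d : hd f z d -> exists2 r : R, 0 < r &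
  forall w, nr (w - z) < r -> nr (f w - f z) <= (1 + nr d) * nr (w - z).
Proof.
move=> /(_ 1 ltr01)[r r0 h]; exists r => // w /h hw.
rewrite -[f w - f z](subrK ((w - z) *: d)); apply: (le_trans (nrD _ _)).
by rewrite nrZ mulrDl (mulrC (nr d)) lerD.
Qed.

Lemma hd_cts f z d : hd f z d -> cts f z.
Proof.
move=> /hd_bound[r r0 h] e e0; have d1 : 0 < 1 + nr d by rewrite ltr_pwDl// nr_ge0.
exists (Num.min r (e / (1 + nr d))); first by rewrite lt_min r0 divr_gt0.
move=> w; rewrite lt_min => /andP[/h hw]; rewrite ltr_pdivlMr// mulrC => /ltW.
exact: le_trans.
Qed.

Lemma hol_cts U f z : hol U f -> U z -> cts f z.
Proof. by move=> h /h[d]; exact: hd_cts. Qed.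

Lemma opn_dir (z : R[i]) (r : R) : 0 < r -> exists2 w, nr (w - z) < r & w != z.
Proof.
move=> r0; have e : z + (r / 2)%:C - z = (r / 2)%:C by rewrite addrC addKr.
exists (z + (r / 2)%:C); first rewrite e nr_real.
  by rewrite ger0_norm ?divr_ge0 ?ltW// ltr_pdivrMr// ltr_pMr// ltr1n.
by rewrite -subr_eq0 e eq_complex/= eqxx andbT mulf_neq0 ?gt_eqF// invr_gt0.
Qed.

Lemma hd_unique f z d d' : hd f z d -> hd f z d' -> d = d'.
Proof.
move=> h h'; apply: eq_nr_le => e e0.
have e2 : 0 < e / 2 by rewrite divr_gt0.
have [r r0 hr] := h _ e2; have [r' r'0 hr'] := h' _ e2.
have rr : 0 < Num.min r r' by rewrite lt_min r0.
have [w] := opn_dir z rr; rewrite lt_min => /andP[/hr h1 /hr' h2] wz.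
have p : 0 < nr (w - z) by rewrite lt_neqAle nr_ge0 eq_sym nr_eq0 subr_eq0 wz.
rewrite -(ler_pM2r p) [leLHS]mulrC -nrZ scalerBr.
have -> : (w - z) *: d - (w - z) *: d' =
  (f w - f z - (w - z) *: d') - (f w - f z - (w - z) *: d).
  by module_solve (R[i] : comPzRingType) V.
by apply: (le_trans (nrB _ _)); rewrite (splitr e) mulrDl lerD.
Qed.

Lemma df_hd f z d : hd f z d -> df f z = d.
Proof.
move=> h; rewrite /df; case: xgetP => [d' _ h'|/(_ d)//].
exact: hd_unique h' h.
Qed.

Lemma hol_hd U f z : hol U f -> U z -> hd f z (df f z).
Proof. by move=> h /h[d hdz]; rewrite (df_hd hdz). Qed.

Lemma hd_near f g z d (r : R) : 0 < r -> (forall w, nr (w - z) < r -> f w = g w) ->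
  hd f z d -> hd g z d.
Proof.
move=> r0 fg h e /h[r' r'0 hr]; exists (Num.min r r'); first by rewrite lt_min r0.
move=> w; rewrite lt_min => /andP[h1 /hr]; rewrite !fg//.
by rewrite subrr nr0.
Qed.

Lemma hd_ext f g z d : (forall w, f w = g w) -> hd f z d -> hd g z d.
Proof. by move=> fg; apply: (@hd_near _ _ _ _ 1). Qed.

Lemma hd_cst (v : V) z : hd (fun=> v) z 0.
Proof.
move=> e e0; exists 1 => // w _.
by rewrite subrr scaler0 subr0 nr0 mulr_ge0 ?nr_ge0 ?ltW.
Qed.

Lemma hdD f g z d d' : hd f z d -> hd g z d' -> hd (fun w => f w + g w) z (d + d').
Proof.
move=> h h' e e0; have e2 : 0 < e / 2 by rewrite divr_gt0.
have [r r0 hr] := h _ e2; have [r' r'0 hr'] := h' _ e2.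
exists (Num.min r r'); first by rewrite lt_min r0.
move=> w; rewrite lt_min => /andP[/hr h1 /hr' h2].
have -> : f w + g w - (f z + g z) - (w - z) *: (d + d') =
  (f w - f z - (w - z) *: d) + (g w - g z - (w - z) *: d').
  by module_solve (R[i] : comPzRingType) V.
by apply: (le_trans (nrD _ _)); rewrite (splitr e) mulrDl lerD.
Qed.

End OneSpace.

Lemma hd_id (z : R[i]) : hd (fun w => w : R[i]) z 1.
Proof.
move=> e e0; exists 1 => // w _.
by rewrite -[(w - z) *: 1]/((w - z) * 1) mulr1 subrr nr0 mulr_ge0 ?nr_ge0 ?ltW.
Qed.

Lemma hd_lin (V W : normedModType R[i]) (L : V -> W) (c : R) (f : R[i] -> V) z d :
  (forall x y, L (x - y) = L x - L y) -> (forall (a : R[i]) x, L (a *: x) = a *: L x) ->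
  (forall x, nr (L x) <= c * nr x) -> hd f z d -> hd (fun w => L (f w)) z (L d).
Proof.
move=> LB LZ Lc h e e0; have c1 : 0 < `|c| + 1 by rewrite ltr_wpDl.
have [r r0 hr] := h _ (divr_gt0 e0 c1); exists r => // w /hr hw.
rewrite -!LB -LZ -LB; apply: (le_trans (Lc _)).
apply: (@le_trans _ _ ((`|c| + 1) * nr (f w - f z - (w - z) *: d))).
  by rewrite ler_wpM2r ?nr_ge0// (le_trans (ler_norm _))// lerDl.
by move: hw; rewrite mulrAC ler_pdivlMr// mulrC.
Qed.

Lemma hdZ (V : normedModType R[i]) (a : R[i]) (f : R[i] -> V) z d :
  hd f z d -> hd (fun w => a *: f w) z (a *: d).
Proof.
apply: (@hd_lin _ _ (fun x => a *: x) (nr a)) => [x y|b x|x].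
- by rewrite scalerBr.
- by rewrite !scalerA mulrC.
- by rewrite nrZ.
Qed.

Lemma hdN (V : normedModType R[i]) (f : R[i] -> V) z d :
  hd f z d -> hd (fun w => - f w) z (- d).
Proof.
move=> /(hdZ (-1)); rewrite scaleN1r; apply: hd_ext => w; exact: scaleN1r.
Qed.

Lemma hdB (V : normedModType R[i]) (f g : R[i] -> V) z d d' :
  hd f z d -> hd g z d' -> hd (fun w => f w - g w) z (d - d').
Proof. by move=> h /hdN; exact: hdD. Qed.

Lemma hd_sum (V : normedModType R[i]) (I : Type) (s : seq I) (P : pred I) (F : I -> R[i] -> V) (D : I -> V) z :
  (forall i, P i -> hd (F i) z (D i)) ->
  hd (fun w => \sum_(i <- s | P i) F i w) z (\sum_(i <- s | P i) D i).
Proof.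
move=> h; elim: s => [|i s ih].
  rewrite big_nil; apply: hd_ext (hd_cst 0 z) => w; by rewrite big_nil.
rewrite big_cons; case: ifPn => Pi.
  by apply: hd_ext (hdD (h _ Pi) ih) => w; rewrite big_cons Pi.
by apply: hd_ext ih => w; rewrite big_cons (negbTE Pi).
Qed.

(** One product rule for all bounded bilinear maps: its instances are products of scalars, scaling,
    composition of operators, evaluation at a vector, and inner products. *)
Lemma hd_bil (V1 V2 W : normedModType R[i]) (B : V1 -> V2 -> W) (c : R)
   (f : R[i] -> V1) (g : R[i] -> V2) z d d' :
  (forall x x' y, B (x - x') y = B x y - B x' y) ->
  (forall x y y', B x (y - y') = B x y - B x y') ->
  (forall (a : R[i]) x y, B (a *: x) y = a *: B x y) ->
  (forall (a : R[i]) x y, B x (a *: y) = a *: B x y) ->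
  (forall x y, nr (B x y) <= c * nr x * nr y) ->
  hd f z d -> hd g z d' -> hd (fun w => B (f w) (g w)) z (B d (g z) + B (f z) d').
Proof.
move=> B1 B2 Z1 Z2 Bc hf hg.
have c0 : 0 <= `|c| by [].
have Bc' x y : nr (B x y) <= `|c| * nr x * nr y.
  apply: (le_trans (Bc _ _)); rewrite !ler_wpM2r ?nr_ge0//; exact: ler_norm.
have h1 : hd (fun w => B (f w) (g z) + B (f z) (g w)) z (B d (g z) + B (f z) d').
  apply: hdD.
    apply: (@hd_lin _ _ (fun x => B x (g z)) (`|c| * nr (g z)) f) => // x.
    by rewrite mulrAC Bc'.
  exact: (@hd_lin _ _ (fun x => B (f z) x) (`|c| * nr (f z)) g).
move=> e e0; have e2 : 0 < e / 2 by rewrite divr_gt0.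
have [r r0 hr] := h1 _ e2.
have [r1 r10 hr1] := hd_bound hf; have [r2 r20 hr2] := hd_bound hg.
pose K := `|c| * (1 + nr d) * (1 + nr d') + 1.
have K0 : 0 < K by rewrite ltr_wpDl// !mulr_ge0 ?addr_ge0 ?nr_ge0.
exists (Num.min (Num.min r (e / 2 / K)) (Num.min r1 r2)).
  by rewrite !lt_min r0 r10 r20 divr_gt0.
move=> w; rewrite !lt_min => /andP[/andP[/hr h3 h4] /andP[/hr1 h5 /hr2 h6]].
(* The remainder is that of the two partial maps plus [B (f w - f z) (g w - g z)], which is
   quadratic in [w - z]. *)
have -> : B (f w) (g w) - B (f z) (g z) - (w - z) *: (B d (g z) + B (f z) d') =
  (B (f w) (g z) + B (f z) (g w) - (B (f z) (g z) + B (f z) (g z)) -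
    (w - z) *: (B d (g z) + B (f z) d')) + B (f w - f z) (g w - g z).
  by rewrite B1 !B2; module_solve (R[i] : comPzRingType) W.
apply: (le_trans (nrD _ _)); rewrite (splitr e) mulrDl; apply: lerD => //.
apply: (le_trans (Bc' _ _)).
apply: (@le_trans _ _ (`|c| * ((1 + nr d) * nr (w - z)) * ((1 + nr d') * nr (w - z)))).
  apply: ler_pM; rewrite ?mulr_ge0 ?nr_ge0//.
  by apply: ler_pM; rewrite ?mulr_ge0 ?nr_ge0.
rewrite ltr_pdivlMr// in h4.
have -> : `|c| * ((1 + nr d) * nr (w - z)) * ((1 + nr d') * nr (w - z)) = (nr (w - z) * (K - 1)) * nr (w - z).
  by rewrite /K; ring.
rewrite ler_wpM2r ?nr_ge0// (le_trans _ (ltW h4))// ler_wpM2l ?nr_ge0// gerBl//.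
Qed.

End Derivative.

(** * Segment integrals and Cauchy's formula *)

Section Segments.
Variable R : realType.
Implicit Types p q a b x z : R[i].

Definition onseg p q x := exists2 t : R, 0 <= t <= 1 & x = p + t%:C * (q - p).

Definition mid p q := (p + q) / 2.

Definition cvx (K : set R[i]) := forall p q x, K p -> K q -> onseg p q x -> K x.

Definition seqclosed (K : set R[i]) :=
  forall x, (forall e : R, 0 < e -> exists2 y, K y & nr (y - x) <= e) -> K x.

Lemma onseg_l p q : onseg p q p.
Proof. by exists 0; rewrite ?lexx ?ler01// mul0r addr0. Qed.

Lemma onseg_r p q : onseg p q q.
Proof. by exists 1; rewrite ?lexx ?ler01// mul1r addrC subrK. Qed.

Lemma onseg_mid p q : onseg p q (mid p q).
Proof.
exists 2^-1; first by rewrite invr_ge0 ler0n/= invf_le1// ler1n.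
by rewrite /mid fmorphV/= rmorph_nat; field.
Qed.

Lemma onseg_cvx p q : cvx (onseg p q).
Proof.
move=> _ _ _ [s /andP[s0 s1] ->] [t /andP[t0 t1] ->] [u /andP[u0 u1] ->].
exists (s + u * (t - s)); first by apply/andP; split; nra.
by rewrite rmorphD rmorphM rmorphB /=; ring.
Qed.

Lemma onseg_closed p q : seqclosed (onseg p q).
Proof.
move=> x hx; have [pq|pq] := eqVneq p q.
  suff -> : x = p by exact: onseg_l.
  apply: eq_nr_le => e /hx[_ [t _ ->]]; rewrite pq subrr mulr0 addr0 nrC.
  done.
have qp0 : q - p != 0 by rewrite subr_eq0 eq_sym.
have d0 : 0 < nr (q - p) by rewrite lt_neqAle nr_ge0 eq_sym nr_eq0 qp0.
pose t := complex.Re ((x - p) / (q - p)).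
have key e : 0 < e -> exists2 s : R, 0 <= s <= 1 & `|s - t| <= e /\
    nr (x - (p + s%:C * (q - p))) <= e * nr (q - p).
  move=> e0; have [y [s s01 ->] hs] := hx _ (mulr_gt0 e0 d0); exists s => //.
  split; last by rewrite nrC.
  have -> : s - t = complex.Re ((p + s%:C * (q - p) - x) / (q - p)).
    rewrite (_ : (p + _ - x) / _ = s%:C - (x - p) / (q - p)) ?raddfB//.
    by field.
  apply: (le_trans (nrRe _)); rewrite nrM nrV ler_pdivrMr//.
exists t.
  apply/andP; split; apply/ler_addgt0Pr => e /key[s /andP[s0 s1] [h _]];
  move: h; rewrite ler_norml => /andP[h1 h2]; lra.
apply: eq_nr_le => e e0; have e2 : 0 < e / 2 / nr (q - p) by rewrite !divr_gt0.
have [s _ [h1 h2]] := key _ e2.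
apply: (le_trans (nr_triang (p + s%:C * (q - p)) _ _)).
have -> : p + s%:C * (q - p) - (p + t%:C * (q - p)) = (s - t)%:C * (q - p).
  by rewrite rmorphB /=; ring.
rewrite nrM nr_real (splitr e); apply: lerD.
  by apply: (le_trans h2); rewrite divfK ?gt_eqF.
by rewrite -ler_pdivlMr.
Qed.

Lemma onseg_sym p q x : onseg p q x -> onseg q p x.
Proof.
move=> [t /andP[t0 t1] ->]; exists (1 - t); first by apply/andP; split; lra.
by rewrite rmorphB /=; ring.
Qed.

Lemma onseg_dist p q x : onseg p q x -> nr (x - p) <= nr (q - p).
Proof.
move=> [t /andP[t0 t1] ->]; rewrite addrC addKr nrM nr_real ger0_norm//.
by rewrite ler_piMl// nr_ge0.
Qed.

Lemma mid_dist p q : nr (mid p q - p) = nr (q - p) / 2.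
Proof.
have -> : mid p q - p = (q - p) * 2^-1 by rewrite /mid; field.
by rewrite nrM nrV -(rmorph_nat (real_complex R)) nr_real ger0_norm.
Qed.

Lemma mid_distr p q : nr (q - mid p q) = nr (q - p) / 2.
Proof.
have -> : q - mid p q = (q - p) * 2^-1 by rewrite /mid; field.
by rewrite nrM nrV -(rmorph_nat (real_complex R)) nr_real ger0_norm.
Qed.

Lemma midC p q : mid p q = mid q p. Proof. by rewrite /mid addrC. Qed.

(** A counterexample could be halved forever, and its cells would shrink to a point where the local
    hypothesis applies. About that point [nested_cells] controls only the distance to the first end,
    hence the condition [nr (a - x) <= 2 * nr (b - a)]. This is the form in which compactness of a
    segment is used throughout. *)
Lemma bisection (G : R[i] -> R[i] -> Prop) p q :
  (forall a b, onseg p q a -> onseg p q b -> G a (mid a b) -> G (mid a b) b -> G a b) ->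
  (forall x, onseg p q x -> exists2 r : R, 0 < r & forall a b,
      onseg p q a -> onseg p q b -> nr (b - a) < r -> nr (a - x) <= 2 * nr (b - a) -> G a b) ->
  G p q.
Proof.
move=> Gh Gl; apply: contrapT => nG.
pose Bad (ab : R[i] * R[i]) := [/\ onseg p q ab.1, onseg p q ab.2 & ~ G ab.1 ab.2].
have [|||z hz] := @nested_cells R _ Bad fst (fun ab => nr (ab.2 - ab.1)) (p, q).
- by move=> ?; exact: nr_ge0.
- by split; [exact: onseg_l|exact: onseg_r|].
- move=> [a b] [/= oa ob ng]; have om := onseg_cvx oa ob (onseg_mid a b).
  have [g1|g1] := pselect (G a (mid a b)); last first.
    exists (a, mid a b); split => //=; first by rewrite mid_dist.
    by rewrite subrr nr0 nr_ge0.
  exists (mid a b, b); split => //=; first by split=> // g2; exact/ng/Gh.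
    by rewrite mid_distr.
  by rewrite mid_dist ler_pdivrMr// ler_peMr ?nr_ge0// ler1n.
have oz : onseg p q z.
  apply: onseg_closed => e e0; have /hz[[a b] [[/= oa _ _] h1 h2]] : 0 < e / 2 by rewrite divr_gt0.
  exists a => //; rewrite (le_trans h2)//; rewrite ltr_pdivlMr// in h1.
  by rewrite mulrC ltW.
have [r r0 hr] := Gl _ oz; have [[a b] [[/= oa ob ng] h1 h2]] := hz _ r0.
by apply: ng; apply: hr.
Qed.

End Segments.

Section Mean.
Variables (R : realType) (V : normedModType R[i]).
Implicit Types (f g : R[i] -> V) (p q : R[i]).

(** A mean over [2^k] equal pieces sampled at their left ends. Its limit [smean] is the integral
    along the segment divided by [q - p], and it makes sense also for [p = q]. *)
Fixpoint dmean f k p q : V :=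
  if k is k'.+1 then 2^-1 *: (dmean f k' p (mid p q) + dmean f k' (mid p q) q)
  else f p.

Definition smean f p q := lims (fun k => dmean f k p q).

Lemma nr_half : nr (2^-1 : R[i]) = 2^-1.
Proof. by rewrite nrV -(rmorph_nat (real_complex R)) nr_real ger0_norm. Qed.

Lemma halfsum_le (x y v : V) e : nr (x - v) <= e -> nr (y - v) <= e ->
  nr (2^-1 *: (x + y) - v) <= e.
Proof.
move=> h1 h2; have -> : 2^-1 *: (x + y) - v = 2^-1 *: ((x - v) + (y - v)).
  by module_solve (R[i] : comPzRingType) V.
rewrite nrZ nr_half ler_pdivrMl//; apply: (le_trans (nrD _ _)); lra.
Qed.

Lemma dmean_le f p q k v e : (forall x, onseg p q x -> nr (f x - v) <= e) ->
  nr (dmean f k p q - v) <= e.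
Proof.
elim: k p q => [|k ih] p q h /=; first exact/h/onseg_l.
apply: halfsum_le; apply: ih => x hx; apply: h; apply: onseg_cvx hx => //.
- exact: onseg_l.
- exact: onseg_mid.
- exact: onseg_mid.
- exact: onseg_r.
Qed.

(** The dyadic substitute for uniform continuity; [osc_exists] derives it from pointwise continuity
    by bisection. *)
Fixpoint osc f (e : R) k p q : Prop :=
  if k is k'.+1 then osc f e k' p (mid p q) /\ osc f e k' (mid p q) q
  else forall x y, onseg p q x -> onseg p q y -> nr (f x - f y) <= e.

Lemma oscS f e k p q : osc f e k p q -> osc f e k.+1 p q.
Proof.
elim: k p q => [|k ih] p q; last by move=> [h1 h2]; split; exact: ih.
move=> h; split=> x y hx hy; apply: h; (apply: onseg_cvx; [| |exact: hx]) ||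
  (apply: onseg_cvx; [| |exact: hy]);
  by [exact: onseg_l|exact: onseg_mid|exact: onseg_r].
Qed.

Lemma osc_exists f e p q : 0 < e -> (forall x, onseg p q x -> cts f x) ->
  exists k, osc f e k p q.
Proof.
move=> e0 fc; apply: (@bisection _ (fun a b => exists k, osc f e k a b)).
  move=> a b _ _ [k1 h1] [k2 h2]; exists (maxn k1 k2).+1.
  have mono k j u v : osc f e k u v -> osc f e (k + j)%N u v.
    by move=> h; elim: j => [|j ih]; rewrite ?addn0// addnS; exact: oscS.
  split.
    by rewrite -(subnKC (leq_maxl k1 k2)); exact: mono.
  by rewrite -(subnKC (leq_maxr k1 k2)); exact: mono.
move=> x ox; have e2 : 0 < e / 2 by rewrite divr_gt0.
have [r r0 hr] := fc _ ox _ e2; exists (r / 4); first by rewrite divr_gt0.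
move=> a b oa ob ab ax; exists 0%N => u v ou ov.
have near w : onseg a b w -> nr (f w - f x) <= e / 2.
  move=> /onseg_dist ow; apply: hr; apply: (le_lt_trans (nr_triang a _ _)).
  rewrite ltr_pdivlMr// in ab; lra.
apply: (le_trans (nr_triang (f x) _ _)); rewrite (splitr e).
by apply: lerD; [exact: near|rewrite nrC; exact: near].
Qed.

Lemma dmean_osc f e k j p q : osc f e k p q ->
  nr (dmean f (k + j)%N p q - dmean f k p q) <= e.
Proof.
elim: k p q => [|k ih] p q.
  by move=> h; rewrite add0n; apply: dmean_le => x hx /=; apply: h => //; exact: onseg_l.
move=> [h1 h2]; rewrite addSn /= -scalerBr nrZ nr_half ler_pdivrMl//.
rewrite opprD addrACA; apply: (le_trans (nrD _ _)).
by rewrite mulrDl mul1r lerD// ih.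
Qed.

Hypothesis cV : complete_nm V.

Lemma smean_cv f p q : (forall x, onseg p q x -> cts f x) ->
  cv (fun k => dmean f k p q) (smean f p q).
Proof.
move=> fc; apply: lims_cv; apply: cV => e e0.
have e2 : 0 < e / 2 by rewrite divr_gt0.
have [k hk] := osc_exists e2 fc; exists k => m n km kn.
apply: (le_trans (nr_triang (dmean f k p q) _ _)); rewrite (splitr e); apply: lerD.
  by rewrite -(subnKC km); exact: dmean_osc.
by rewrite nrC -(subnKC kn); exact: dmean_osc.
Qed.

Lemma smean_half f p q : (forall x, onseg p q x -> cts f x) ->
  smean f p q = 2^-1 *: (smean f p (mid p q) + smean f (mid p q) q).
Proof.
move=> fc; apply: (@cv_unique _ _ (fun k => dmean f k.+1 p q)).
  exact: (cvS (smean_cv fc)).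
apply: cvZ; apply: cvD; apply: smean_cv => x hx; apply: fc; apply: onseg_cvx hx;
  by [exact: onseg_l|exact: onseg_mid|exact: onseg_r].
Qed.

Lemma smean_le f p q v e : (forall x, onseg p q x -> cts f x) ->
  (forall x, onseg p q x -> nr (f x - v) <= e) -> nr (smean f p q - v) <= e.
Proof.
move=> fc h; apply: (cv_le (smean_cv fc)); exists 0%N => n _; exact: dmean_le.
Qed.

Lemma smean_nr_le f p q e : (forall x, onseg p q x -> cts f x) ->
  (forall x, onseg p q x -> nr (f x) <= e) -> nr (smean f p q) <= e.
Proof.
move=> fc h; rewrite -[smean _ _ _]subr0; apply: smean_le => // x hx.
by rewrite subr0 h.
Qed.

Lemma smeanD f g p q : (forall x, onseg p q x -> cts f x) ->
  (forall x, onseg p q x -> cts g x) ->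
  smean (fun x => f x + g x) p q = smean f p q + smean g p q.
Proof.
move=> fc gc; apply: limsE.
have -> : (fun k => dmean (fun x => f x + g x) k p q) =
    (fun k => dmean f k p q + dmean g k p q).
  apply/funext => k; elim: k p q {fc gc} => [//|k ih] p q /=.
  by rewrite !ih -scalerDr addrACA.
by apply: cvD; exact: smean_cv.
Qed.

Lemma smean_ext f g p q : (forall x, onseg p q x -> f x = g x) -> smean f p q = smean g p q.
Proof.
move=> h; congr lims; apply/funext => k.
elim: k p q h => [|k ih] p q h /=; first exact/h/onseg_l.
congr (_ *: (_ + _)); apply: ih => x hx; apply: h; apply: onseg_cvx hx;
  by [exact: onseg_l|exact: onseg_mid|exact: onseg_r].
Qed.

End Mean.
Arguments smean {R V}.

Section MeanLin.
Variables (R : realType) (V W : normedModType R[i]).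
Hypothesis cV : complete_nm V.

Lemma smean_lin (L : V -> W) (c : R) (f : R[i] -> V) p q :
  (forall x y, L (x - y) = L x - L y) -> (forall (a : R[i]) x, L (a *: x) = a *: L x) ->
  (forall x, nr (L x) <= c * nr x) -> (forall x, onseg p q x -> cts f x) ->
  smean (fun x => L (f x)) p q = L (smean f p q).
Proof.
move=> LB LZ Lc fc; apply: limsE.
have LD x y : L (x + y) = L x + L y.
  have -> : L y = - L (- y) by rewrite -(scaleN1r y) LZ scaleN1r opprK.
  by rewrite -{1}[y]opprK LB.
have -> : (fun k => dmean (fun x => L (f x)) k p q) = (fun k => L (dmean f k p q)).
  apply/funext => k; elim: k p q {fc} => [//|k ih] p q /=.
  by rewrite !ih LZ LD.
apply: (cv_lip (c := c)); last exact: smean_cv.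
by move=> x y; rewrite -LB.
Qed.

End MeanLin.

(** * The fundamental theorem of calculus and Goursat's theorem *)

Section Goursat.
Variables (R : realType) (V : normedModType R[i]).
Hypothesis cV : complete_nm V.
Implicit Types (f g : R[i] -> V) (p q a b c x z : R[i]) (K : set R[i]).

(** The difference is additive and is [o] of the length near each point, so by bisection it is at
    most [e] times the length for every [e]. The fundamental theorem, the antisymmetry of the
    integral and [Im_segint_FTC] all come from this. *)
Lemma additive_unique (P Q : R[i] -> R[i] -> V) p q :
  (forall a b, onseg p q a -> onseg p q b -> P a b = P a (mid a b) + P (mid a b) b) ->
  (forall a b, onseg p q a -> onseg p q b -> Q a b = Q a (mid a b) + Q (mid a b) b) ->
  (forall (e : R) x, 0 < e -> onseg p q x -> exists2 r : R, 0 < r & forall a b,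
     onseg p q a -> onseg p q b -> nr (b - a) < r -> nr (a - x) <= 2 * nr (b - a) ->
     nr (P a b - Q a b) <= e * nr (b - a)) ->
  P p q = Q p q.
Proof.
move=> hP hQ h; apply: eq_nr_le => e e0.
have d0 : 0 < 1 + nr (q - p) by rewrite ltr_pwDl// nr_ge0.
apply: (@le_trans _ _ (e / (1 + nr (q - p)) * nr (q - p))); last first.
  by rewrite mulrAC ler_pdivrMr// ler_wpM2l ?ltW// ltrDr.
have : 0 < e / (1 + nr (q - p)) by rewrite divr_gt0.
move: (e / _) => {d0}e' e'0.
apply: (@bisection _ (fun a b => nr (P a b - Q a b) <= e' * nr (b - a))); last first.
  by move=> x ox; exact: h.
move=> a b oa ob; rewrite mid_dist mid_distr => h1 h2; rewrite hP// hQ//.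
by rewrite opprD addrACA (le_trans (nrD _ _))// (le_trans (lerD h1 h2))//; lra.
Qed.

Definition segint f p q : V := (q - p) *: smean f p q.

Lemma onseg_sub p q a b x : onseg p q a -> onseg p q b -> onseg a b x -> onseg p q x.
Proof. exact: onseg_cvx. Qed.

Lemma segint_half f p q : (forall x, onseg p q x -> cts f x) ->
  segint f p q = segint f p (mid p q) + segint f (mid p q) q.
Proof.
move=> fc; rewrite /segint smean_half// /mid.
set s1 := smean _ _ _; set s2 := smean _ _ _.
by module_solve (R[i] : comPzRingType) V.
Qed.

Lemma segint_le f p q v e : (forall x, onseg p q x -> cts f x) ->
  (forall x, onseg p q x -> nr (f x - v) <= e) ->
  nr (segint f p q - (q - p) *: v) <= e * nr (q - p).
Proof.
move=> fc h; rewrite /segint -scalerBr nrZ mulrC ler_wpM2r ?nr_ge0//.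
exact: smean_le.
Qed.

Lemma segint_nr_le f p q e : (forall x, onseg p q x -> cts f x) ->
  (forall x, onseg p q x -> nr (f x) <= e) -> nr (segint f p q) <= e * nr (q - p).
Proof.
move=> fc h; have := @segint_le f p q 0 e fc.
by rewrite scaler0 subr0; apply => x /h; rewrite subr0.
Qed.

Lemma segint_FTC f (G : R[i] -> V) p q : (forall x, onseg p q x -> cts f x) ->
  (forall x, onseg p q x -> hd G x (f x)) -> segint f p q = G q - G p.
Proof.
move=> fc Gf; apply: (@additive_unique (segint f) (fun a b => G b - G a)).
- by move=> a b oa ob; apply: segint_half => x ox; apply: fc; exact: onseg_sub ox.
- by move=> a b _ _ /=; rewrite [RHS]addrC addrA subrK.
move=> e x e0 ox; have e5 : 0 < e / 10 by rewrite divr_gt0.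
have [r1 r10 h1] := fc _ ox _ e5; have [r2 r20 h2] := Gf _ ox _ e5.
exists (Num.min r1 r2 / 4); first by rewrite divr_gt0// lt_min r10.
move=> a b oa ob; rewrite ltr_pdivlMr// lt_min => /andP[ab1 ab2] ax.
have n0 := nr_ge0 (b - a).
have bx : nr (b - x) <= 3 * nr (b - a).
  by apply: (le_trans (nr_triang a _ _)); lra.
have k1 : nr (segint f a b - (b - a) *: f x) <= e / 10 * nr (b - a).
  apply: segint_le => y oy; first by apply: fc; exact: onseg_sub oy.
  apply: h1; apply: (le_lt_trans (nr_triang a _ _)).
  have := onseg_dist oy; lra.
have k2 := h2 a (_ : nr (a - x) < r2); have k3 := h2 b (_ : nr (b - x) < r2).
have -> : segint f a b - (G b - G a) = (segint f a b - (b - a) *: f x) +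
   ((G a - G x - (a - x) *: f x) - (G b - G x - (b - x) *: f x)).
  by set s := segint _ _ _; module_solve (R[i] : comPzRingType) V.
apply: (le_trans (nrD _ _)); apply: (le_trans (lerD k1 (nrB _ _))).
have := k2 ltac:(lra); have := k3 ltac:(lra); nra.
Qed.

Lemma segint_sym f p q : (forall x, onseg p q x -> cts f x) ->
  segint f q p = - segint f p q.
Proof.
move=> fc; apply: esym.
apply: (@additive_unique (fun a b => - segint f a b) (fun a b => segint f b a)).
- move=> a b oa ob; rewrite -opprD; congr (- _); apply: segint_half => x ox; apply: fc; exact: onseg_sub ox.
- move=> a b oa ob; rewrite midC addrC; apply: segint_half => x ox; apply: fc; exact: onseg_sub ox.
move=> e x e0 ox; have e5 : 0 < e / 2 by rewrite divr_gt0.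
have [r1 r10 h1] := fc _ ox _ e5.
exists (r1 / 4); first by rewrite divr_gt0.
move=> a b oa ob; rewrite ltr_pdivlMr// => ab1 ax.
have near y : onseg a b y -> nr (f y - f x) <= e / 2.
  move=> oy; apply: h1; apply: (le_lt_trans (nr_triang a _ _)).
  have := onseg_dist oy; lra.
have k1 : nr (segint f a b - (b - a) *: f x) <= e / 2 * nr (b - a).
  by apply: segint_le => // y oy; apply: fc; exact: onseg_sub oy.
have k2 : nr (segint f b a - (a - b) *: f x) <= e / 2 * nr (a - b).
  apply: segint_le => y oy; first by apply: fc; exact: onseg_sub oy.
  exact/near/onseg_sym.
have -> : - segint f a b - segint f b a = - ((segint f a b - (b - a) *: f x) +
   (segint f b a - (a - b) *: f x)).
  by set s := segint _ _ _; set s' := segint _ _ _; module_solve (R[i] : comPzRingType) V.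
rewrite nrN (le_trans (nrD _ _))// (le_trans (lerD k1 k2))// (nrC a); lra.
Qed.

Lemma segintD f g p q : (forall x, onseg p q x -> cts f x) ->
  (forall x, onseg p q x -> cts g x) ->
  segint (fun x => f x + g x) p q = segint f p q + segint g p q.
Proof. by move=> fc gc; rewrite /segint smeanD// scalerDr. Qed.

Lemma segint_ext f g p q : (forall x, onseg p q x -> f x = g x) ->
  segint f p q = segint g p q.
Proof. by move=> h; rewrite /segint (smean_ext h). Qed.

Definition triint f a b c := segint f a b + segint f b c + segint f c a.

Lemma cvx_mid K a b : cvx K -> K a -> K b -> K (mid a b).
Proof. by move=> cK Ka Kb; apply: (cK a b) => //; exact: onseg_mid. Qed.

Lemma triint_sub f K a b c : cvx K -> (forall x, K x -> cts f x) ->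
  K a -> K b -> K c ->
  triint f a b c = triint f a (mid a b) (mid a c) + triint f (mid a b) b (mid b c) +
    triint f (mid a c) (mid b c) c + triint f (mid a b) (mid b c) (mid a c).
Proof.
move=> cK fc Ka Kb Kc.
have fc' p q : K p -> K q -> forall x, onseg p q x -> cts f x.
  by move=> Kp Kq x ox; apply/fc/(cK p q).
have Kab := cvx_mid cK Ka Kb; have Kbc := cvx_mid cK Kb Kc; have Kac := cvx_mid cK Ka Kc.
rewrite /triint (segint_half (fc' _ _ Ka Kb)) (segint_half (fc' _ _ Kb Kc)).
rewrite (segint_half (fc' _ _ Kc Ka)) (midC c a).
rewrite (segint_sym (fc' _ _ Kab Kac)) (segint_sym (fc' _ _ Kbc Kac)) (segint_sym (fc' _ _ Kab Kbc)).
module_solve (R[i] : comPzRingType) V.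
Qed.

Definition per a b c : R := nr (b - a) + nr (c - b) + nr (a - c).

Lemma mid_sub a b c : nr (mid b c - mid a c) = nr (b - a) / 2.
Proof.
have -> : mid b c - mid a c = (b - a) * 2^-1 by rewrite /mid; field.
by rewrite nrM nr_half.
Qed.

Lemma hd_affine (u v : V) (x0 w : R[i]) : hd (fun w => u + (w - x0) *: v) w v.
Proof.
have := hdD (hd_cst u w) (@hd_lin R R[i] V (fun t => t *: v) (nr v) _ _ _ _ _ _
   (hdB (hd_id w) (hd_cst x0 w))); rewrite subr0 add0r scale1r; apply.
- by move=> x y; rewrite scalerBl.
- by move=> k x; rewrite scalerA.
- by move=> x; rewrite nrZ mulrC.
Qed.

Lemma hd_quad (u v : V) (x0 w : R[i]) :
  hd (fun w => w *: u + ((w - x0) * (w - x0) / 2) *: v) w (u + (w - x0) *: v).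
Proof.
move=> e e0; have v1 : 0 < 1 + nr v by rewrite ltr_pwDl// nr_ge0.
exists (e / (1 + nr v)); first by rewrite divr_gt0.
move=> y; rewrite ltr_pdivlMr// => hy.
rewrite (_ : _ - _ = ((y - w) * (y - w) / 2) *: v); last first.
  by module_solve (R[i] : comPzRingType) V.
by rewrite nrZ !nrM nr_half; have := nr_ge0 (y - w); have := nr_ge0 v; nra.
Qed.

Lemma triint_affine (u v : V) (x0 a b c : R[i]) :
  triint (fun w => u + (w - x0) *: v) a b c = 0.
Proof.
have F p q := @segint_FTC _ _ p q (fun x _ => hd_cts (hd_affine u v x0 x))
  (fun x _ => hd_quad u v x0 x).
rewrite /triint !F; module_solve (R[i] : comPzRingType) V.
Qed.

(** Subtracting the affine part, whose integral around a triangle vanishes, leaves an integrand of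
    size [e] times the distance to [x]. *)
Lemma triint_local f K (d : V) (e : R) a b c x : cvx K -> (forall x, K x -> cts f x) ->
  K a -> K b -> K c -> 0 <= e ->
  (forall w, K w -> nr (w - x) <= 4 * per a b c -> nr (f w - f x - (w - x) *: d) <= e * nr (w - x)) ->
  nr (a - x) <= 2 * per a b c ->
  nr (triint f a b c) <= 4 * e * per a b c ^+ 2.
Proof.
move=> cK fc Ka Kb Kc e0 h ax.
pose g w := f w - (f x + (w - x) *: d).
have hdl w := hd_affine (f x) d x w.
have gc w : K w -> cts g w.
  move=> /fc fw e' e'0; have e2 : 0 < e' / 2 by rewrite divr_gt0.
  have [r1 r10 h1] := fw _ e2; have [r2 r20 h2] := hd_cts (hdl w) e2.
  exists (Num.min r1 r2); first by rewrite lt_min r10.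
  move=> y; rewrite lt_min => /andP[/h1 k1 /h2 k2].
  have -> : g y - g w = (f y - f w) - ((f x + (y - x) *: d) - (f x + (w - x) *: d)).
    by rewrite /g; module_solve (R[i] : comPzRingType) V.
  by apply: (le_trans (nrB _ _)); rewrite (splitr e') lerD.
have tE : triint f a b c = triint g a b c.
  have st p q : K p -> K q -> segint f p q = segint g p q + segint (fun w => f x + (w - x) *: d) p q.
    move=> Kp Kq; rewrite -segintD.
    - by apply: segint_ext => w _; rewrite /g subrK.
    - by move=> w ow; apply/gc/(cK p q).
    - by move=> w _; exact: hd_cts (hdl w).
  have := triint_affine (f x) d x a b c.
  rewrite /triint !st// => T0; set A := segint (fun _ => _) _ _ in T0 *.
  set B := segint (fun _ => _) _ _ in T0 *; set C := segint (fun _ => _) _ _ in T0 *.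
  transitivity (segint g a b + segint g b c + segint g c a + (A + B + C)).
    by module_solve (R[i] : comPzRingType) V.
  by rewrite T0 addr0.
have p0 : 0 <= per a b c by rewrite /per !addr_ge0 ?nr_ge0.
have hg p q : K p -> K q -> nr (p - a) <= per a b c -> nr (q - p) <= per a b c ->
    nr (segint g p q) <= 4 * e * per a b c * nr (q - p).
  move=> Kp Kq pa qp; apply: segint_nr_le => w ow; first by apply/gc/(cK p q).
  have wx : nr (w - x) <= 4 * per a b c.
    apply: (le_trans (nr_triang p _ _)); have := onseg_dist ow.
    have := nr_triang a p x; lra.
  have Kw : K w by apply: (cK p q).
  rewrite /g opprD addrA (le_trans (h _ Kw wx))//.
  by rewrite -mulrA mulrCA ler_wpM2l.
have n1 := nr_ge0 (b - a); have n2 := nr_ge0 (c - b); have n3 := nr_ge0 (a - c).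
rewrite tE /triint (le_trans (nrD _ _))// (le_trans (lerD (nrD _ _) (lexx _)))//.
have k1 : nr (segint g a b) <= 4 * e * per a b c * nr (b - a).
  by apply: hg => //; rewrite ?subrr ?nr0// /per; lra.
have k2 : nr (segint g b c) <= 4 * e * per a b c * nr (c - b).
  by apply: hg => //; rewrite /per; lra.
have k3 : nr (segint g c a) <= 4 * e * per a b c * nr (a - c).
  by apply: hg => //; rewrite ?(nrC c) /per; lra.
apply: (le_trans (lerD (lerD k1 k2) k3)).
by rewrite le_eqVlt; apply/orP; left; apply/eqP; rewrite /per; ring.
Qed.

Theorem goursat f K a b c : cvx K -> seqclosed K -> hol K f ->
  K a -> K b -> K c -> triint f a b c = 0.
Proof.
move=> cK clK fh Ka Kb Kc.
have fc x : K x -> cts f x by exact: hol_cts.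
apply/eqP; rewrite -nr_eq0 eq_le nr_ge0 andbT; apply/ler_addgt0Pr => e0 e00.
rewrite add0r; have q1 : 0 < 1 + per a b c ^+ 2 by rewrite ltr_pwDl// sqr_ge0.
have e0' : 0 < e0 / (1 + per a b c ^+ 2) by rewrite divr_gt0.
pose e := e0 / (1 + per a b c ^+ 2).
have E : nr (triint f a b c) <= e * per a b c ^+ 2 -> nr (triint f a b c) <= e0.
  move=> /le_trans; apply; rewrite /e mulrAC ler_pdivrMr// ler_wpM2l ?ltW// ltrDr//.
apply: E; apply: contrapT => nG.
(* The threshold is quadratic in the perimeter: it is divided by 4 when the perimeter is halved, so
   one of the four quarters of a bad triangle is bad. *)
pose Bad (t : R[i] * R[i] * R[i]) := [/\ K t.1.1, K t.1.2, K t.2 &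
   ~ nr (triint f t.1.1 t.1.2 t.2) <= e * per t.1.1 t.1.2 t.2 ^+ 2].
pose c1 (t : R[i] * R[i] * R[i]) := t.1.1.
pose d1 (t : R[i] * R[i] * R[i]) := per t.1.1 t.1.2 t.2.
have d1ge0 t : 0 <= d1 t by rewrite /d1/per !addr_ge0 ?nr_ge0.
have [|||z hz] := @nested_cells R _ Bad c1 d1 (a, b, c) => //.
  move=> [[p q] r] [/= Kp Kq Kr ng].
  have Kpq := cvx_mid cK Kp Kq; have Kqr := cvx_mid cK Kq Kr; have Kpr := cvx_mid cK Kp Kr.
  have n1 := nr_ge0 (q - p); have n2 := nr_ge0 (r - q); have n3 := nr_ge0 (p - r).
  have s1 : per p (mid p q) (mid p r) = per p q r / 2.
    rewrite /per mid_dist (midC p q) (midC p r) mid_sub nrC mid_distr; lra.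
  have s2 : per (mid p q) q (mid q r) = per p q r / 2.
    by rewrite /per mid_distr mid_dist (midC q r) (nrC (mid p q)) mid_sub (nrC r p); lra.
  have s3 : per (mid p r) (mid q r) r = per p q r / 2.
    by rewrite /per mid_sub mid_distr (nrC (mid p r)) mid_distr (nrC r p); lra.
  have s4 : per (mid p q) (mid q r) (mid p r) = per p q r / 2.
    rewrite /per mid_sub (midC q r) mid_sub (midC p q) (midC p r) mid_sub.
    by rewrite (nrC r p) (nrC p q) (nrC q r); lra.
  have [g1|g1] := pselect (nr (triint f p (mid p q) (mid p r)) <= e * (per p q r / 2) ^+ 2); last first.
    exists (p, mid p q, mid p r); split => //=; rewrite /d1 /c1 /= ?s1//.
      by split => //=; rewrite s1.
    by rewrite subrr nr0; exact: (d1ge0 (p, q, r)).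
  have [g2|g2] := pselect (nr (triint f (mid p q) q (mid q r)) <= e * (per p q r / 2) ^+ 2); last first.
    exists (mid p q, q, mid q r); split => //=; rewrite /d1 /c1 /= ?s2//.
      by split => //=; rewrite s2.
    by rewrite mid_dist /per; lra.
  have [g3|g3] := pselect (nr (triint f (mid p r) (mid q r) r) <= e * (per p q r / 2) ^+ 2); last first.
    exists (mid p r, mid q r, r); split => //=; rewrite /d1 /c1 /= ?s3//.
      by split => //=; rewrite s3.
    by rewrite mid_dist (nrC r p) /per; lra.
  exists (mid p q, mid q r, mid p r); split => //=; rewrite /d1 /c1 /= ?s4//.
    split => //=; rewrite s4 => g4; apply: ng; rewrite (triint_sub cK)//.
    apply: (le_trans (nrD _ _)).
    have : nr (triint f p (mid p q) (mid p r) + triint f (mid p q) q (mid q r) +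
       triint f (mid p r) (mid q r) r) <= 3 * (e * (per p q r / 2) ^+ 2).
      apply: (le_trans (nrD _ _)).
      by have := nrD (triint f p (mid p q) (mid p r)) (triint f (mid p q) q (mid q r)); lra.
    move: g4; rewrite expr_div_n; lra.
  by rewrite mid_dist /per; lra.
have Kz : K z.
  apply: clK => r r0; have /hz[[[p q] s] [[/= Kp _ _ _] h1 h2]] : 0 < r / 2 by rewrite divr_gt0.
  by exists p => //; rewrite (le_trans h2)//; lra.
have [d hd] := fh _ Kz; have e4 : 0 < e / 4 by rewrite divr_gt0.
have [r r0 hr] := hd _ e4.
have /hz[[[p q] s] [[/= Kp Kq Ks ng] h1 h2]] : 0 < r / 4 by rewrite divr_gt0.
apply: ng; have -> : e = 4 * (e / 4) by lra.
rewrite /d1 /c1 /= in h1 h2.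
apply: (@triint_local f K d _ p q s z) => //; first exact: ltW.
by move=> w Kw wz; apply: hr; lra.
Qed.

(** Goursat's theorem is stated on a convex and sequentially closed set, which an open disc is not.
    It is enough that any three points of [U] lie in such a subset; [tri_dsk] provides a closed
    concentric disc. *)
Lemma primitive (U : set R[i]) f c0 :
  (forall a b c, U a -> U b -> U c -> exists K, [/\ cvx K, seqclosed K, K `<=` U, K a & K b /\ K c]) ->
  opn U -> hol U f -> U c0 ->
  forall z, U z -> hd (fun w => segint f c0 w) z (f z).
Proof.
move=> tU oU fh U0 z Uz e e0.
have [r1 r10 h1] := hol_cts fh Uz e0; have [r2 r20 h2] := oU _ Uz.
exists (Num.min r1 r2); first by rewrite lt_min r10.
move=> w; rewrite lt_min => /andP[wz1 wz2].
have Uw := h2 _ wz2; have [K [cK clK KU K0 [Kz Kw]]] := tU _ _ _ U0 Uz Uw.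
have fK : hol K f by move=> x /KU; exact: fh.
have fc p q : K p -> K q -> forall x, onseg p q x -> cts f x.
  by move=> Kp Kq x ox; apply: (hol_cts fK); apply: (cK p q).
have := goursat cK clK fK K0 Kz Kw; rewrite /triint (segint_sym (fc _ _ K0 Kw)) => T.
have -> : segint f c0 w - segint f c0 z - (w - z) *: f z = segint f z w - (w - z) *: f z.
  congr (_ - _); apply/eqP; rewrite subr_eq addrC -subr_eq0 -oppr_eq0 opprB.
  by rewrite T.
apply: segint_le => [x ox|x ox]; first exact: (fc z w).
apply: h1; exact: le_lt_trans (onseg_dist ox) wz1.
Qed.

Lemma hd0_const f p q : (forall x, onseg p q x -> hd f x 0) -> f p = f q.
Proof.
move=> h; have := @segint_FTC (fun=> 0) f p q _ h.
rewrite /segint; have -> : smean (fun _ : R[i] => (0 : V)) p q = 0.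
  apply: limsE; have -> : (fun k => dmean (fun _ : R[i] => (0 : V)) k p q) = fun=> 0.
    by apply/funext => k; elim: k (p) (q) => [//|k ih] a b /=; rewrite !ih addr0 scaler0.
  exact: cv_cst.
rewrite scaler0 => /(_ (fun x _ => hd_cts (hd_cst 0 x)))/esym/eqP.
by rewrite subr_eq0 => /eqP.
Qed.

End Goursat.

(** * Comparison with [derivable] and [is_derive] *)

Section Bridges.
Variable R : realType.

Lemma real_derive_eps (f : R -> R) (x d : R) : is_derive x 1 f d ->
  forall e : R, 0 < e -> exists2 r : R, 0 < r &
  forall h, `|h| < r -> `|f (x + h) - f x - h * d| <= e * `|h|.
Proof.
move=> [fd fE] e e0; have := fd; rewrite /derivable => /cvgrPdist_le/(_ _ e0).
rewrite -/(derive f x 1) fE; move=> /nbhs_ballP[r /= r0 hr]; exists r => // h hr'.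
have [->|h0] := eqVneq h 0; first by rewrite addr0 subrr mul0r subr0 normr0 mulr0.
have /= := hr h; rewrite /ball/= sub0r normrN => /(_ hr' h0).
have -> : f (x + h) - f x - h * d = - (h * (d - h^-1 * (f (x + h) - f x))).
  by field.
rewrite normrN normrM mulrC => hh; rewrite ler_wpM2r//.
move: hh; rewrite /shift /= -[h *: 1]/(h * 1) mulr1 (addrC h); exact.
Qed.

Lemma derivable_hd (V : normedModType R[i]) (f : R[i] -> V) z :
  derivable f z 1 -> hd f z (derive1 f z).
Proof.
move=> fd e e0; have ec : 0 < e%:C :> R[i] by rewrite ltcR.
rewrite derive1E; have := fd; rewrite /derivable => /cvgrPdist_le/(_ _ ec).
rewrite -/(derive f z 1); move=> /nbhs_ballP[r /= r0 hr].
have Rr : r = (complex.Re r)%:C by rewrite (RRe_real (gtr0_real r0)).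
exists (complex.Re r); first by rewrite -ltcR -Rr.
move=> w wr; have [->|wz] := eqVneq w z.
  by rewrite !subrr scale0r subr0 !nr0 mulr0.
have h0 : w - z != 0 by rewrite subr_eq0.
have /= := hr (w - z); rewrite -ball_normE /ball_/= sub0r normrN nrE {1}Rr ltcR => /(_ wr h0).
rewrite /shift /= -[(w - z) *: 1]/((w - z) * 1) mulr1 subrK => hh.
rewrite -nrN.
have -> : - (f w - f z - (w - z) *: 'D_1 f z) =
   (w - z) *: ('D_1 f z - (w - z)^-1 *: (f w - f z)).
  by rewrite scalerBr scalerA divff// scale1r opprB.
by rewrite nrZ mulrC ler_wpM2r ?nr_ge0// -lecR -nrE.
Qed.

Lemma hd_derivable (V : normedModType R[i]) (f : R[i] -> V) z d :
  hd f z d -> is_derive z 1 f d.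
Proof.
move=> h; suff H : (h^-1 *: ((f \o shift z) (h *: 1) - f z) @[h --> 0^']) --> d.
  split; first by apply/cvg_ex; exists d.
  exact: (cvg_lim (@norm_hausdorff _ V)).
apply/cvgrPdist_le => e e0.
have Re : e = (complex.Re e)%:C by rewrite (RRe_real (gtr0_real e0)).
have e1 : 0 < complex.Re e by rewrite -ltcR -Re.
have [r r0 hr] := h _ e1; rewrite Re.
apply/nbhs_ballP; exists r%:C; first by rewrite /= ltcR.
move=> w /=; rewrite -ball_normE /ball_/= sub0r normrN nrE ltcR => wr w0.
rewrite -[w *: 1]/(w * 1) mulr1 nrE lecR.
have p : 0 < nr w by rewrite lt_neqAle nr_ge0 eq_sym nr_eq0 w0.
rewrite -(ler_pM2r p) [leLHS]mulrC -nrZ -nrN.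
have := hr (w + z); rewrite addrK => /(_ wr).
suff -> : - (w *: (d - w^-1 *: (f (w + z) - f z))) = f (w + z) - f z - w *: d by [].
by rewrite scalerBr scalerA divff// scale1r opprB.
Qed.

Lemma derive1_df (V : normedModType R[i]) (f : R[i] -> V) z d :
  hd f z d -> derive1 f z = d.
Proof. by move=> /hd_derivable[_ <-]; rewrite derive1E. Qed.

End Bridges.

(** * Rules of differentiation and the complex exponential *)

Section Rules.
Variable R : realType.
Implicit Types (z w : R[i]).

Lemma hd_comp (V : normedModType R[i]) (f : R[i] -> V) (g : R[i] -> R[i]) z a d :
  hd g z a -> hd f (g z) d -> hd (fun w => f (g w)) z (a *: d).
Proof.
move=> hg hf e e0.
pose A := 1 + nr a; have A0 : 0 < A by rewrite ltr_pwDl// nr_ge0.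
pose D := 1 + nr d; have D0 : 0 < D by rewrite ltr_pwDl// nr_ge0.
have e1 : 0 < e / 2 / A by rewrite !divr_gt0.
have e2 : 0 < e / 2 / D by rewrite !divr_gt0.
have [r1 r10 h1] := hf _ e1; have [r2 r20 h2] := hg _ e2.
have [r3 r30 h3] := hd_bound hg; have [r4 r40 h4] := hd_cts hg (divr_gt0 r10 (ltr0n _ 2)).
exists (Num.min (Num.min r2 r3) r4); first by rewrite !lt_min r20 r30.
move=> w; rewrite !lt_min => /andP[/andP[/h2 k2 /h3 k3] /h4 k4].
have k1 := h1 (g w) (le_lt_trans k4 _).
have -> : f (g w) - f (g z) - (w - z) *: (a *: d) =
   (f (g w) - f (g z) - (g w - g z) *: d) + (g w - g z - (w - z) *: a) *: d.
  have -> : (w - z) *: a = (w - z) * a by [].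
  by module_solve (R[i] : comPzRingType) V.
apply: (le_trans (nrD _ _)); rewrite nrZ (splitr e) mulrDl; apply: lerD.
  apply: (le_trans (k1 _)); first by rewrite ltr_pdivrMr// ltr_pMr// ltr1n.
  have := ler_wpM2l (ltW e1) k3; rewrite -/A mulrA [e / 2 / A * A]divfK ?gt_eqF//.
have := ler_wpM2r (nr_ge0 d) k2 => /le_trans; apply.
rewrite mulrAC ler_wpM2r ?nr_ge0// mulrAC ler_pdivrMr// ler_wpM2l ?divr_ge0 ?ltW//.
by rewrite /D ltrDr.
Qed.

Lemma hdM (f g : R[i] -> R[i]) z d d' :
  hd f z d -> hd g z d' -> hd (fun w => f w * g w) z (d * g z + f z * d').
Proof.
apply: (@hd_bil R R[i] R[i] R[i] (fun x y => x * y) 1) => [x x' y|x y y'|a x y|a x y|x y].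
- exact: mulrBl.
- exact: mulrBr.
- by rewrite -[a *: x]/(a * x) -[RHS]/(a * (x * y)) mulrA.
- by rewrite -[a *: y]/(a * y) -[RHS]/(a * (x * y)) mulrCA.
- by rewrite nrM mul1r.
Qed.

Lemma hd_scale (V : normedModType R[i]) (a : R[i] -> R[i]) (f : R[i] -> V) z d d' :
  hd a z d -> hd f z d' -> hd (fun w => a w *: f w) z (d *: f z + a z *: d').
Proof.
apply: (@hd_bil R R[i] V V (fun x y => x *: y) 1) => [x x' y|x y y'|b x y|b x y|x y].
- exact: scalerBl.
- exact: scalerBr.
- by rewrite -[b *: x]/(b * x) scalerA.
- by rewrite !scalerA mulrC.
- by rewrite nrZ mul1r.
Qed.

Lemma hd_inv z : z != 0 -> hd (fun w => w^-1 : R[i]) z (- (z ^+ 2)^-1).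
Proof.
move=> z0; have p : 0 < nr z by rewrite lt_neqAle nr_ge0 eq_sym nr_eq0 z0.
move=> e e0; exists (Num.min (nr z / 2) (e * nr z ^+ 3 / 2)).
  by rewrite lt_min !divr_gt0 ?mulr_gt0 ?exprn_gt0.
move=> w; rewrite lt_min => /andP[h1 h2].
have wz : nr z / 2 <= nr w.
  have := nr_triang w z 0; rewrite !subr0 nrC; lra.
have w0 : w != 0 by rewrite -nr_eq0 gt_eqF// (lt_le_trans _ wz)// divr_gt0.
have -> : w^-1 - z^-1 - (w - z) *: (- (z ^+ 2)^-1) = (w - z) ^+ 2 / (w * z ^+ 2).
  by rewrite -[_ *: _]/((w - z) * _); field; rewrite z0 w0.
rewrite nrM nrX nrV nrM nrX ler_pdivrMr ?mulr_gt0 ?exprn_gt0//; last first.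
  exact: lt_le_trans (divr_gt0 p _) wz.
have key : nr (w - z) <= e * (nr w * nr z ^+ 2).
  apply: (le_trans (ltW h2)); rewrite -mulrA ler_wpM2l ?(ltW e0)//.
  by have := ler_wpM2r (sqr_ge0 (nr z)) wz; lra.
by have := ler_wpM2l (nr_ge0 (w - z)) key; lra.
Qed.

Lemma hdV (g : R[i] -> R[i]) z d : hd g z d -> g z != 0 ->
  hd (fun w => (g w)^-1) z (- d / g z ^+ 2).
Proof.
move=> hg g0; have := hd_comp hg (hd_inv g0).
by rewrite -[_ *: _]/(d * _) mulrN -mulNr.
Qed.

Lemma hdX (f : R[i] -> R[i]) z d n : hd f z d -> hd (fun w => f w ^+ n) z (n%:R * f z ^+ n.-1 * d).
Proof.
move=> h; elim: n => [|n ih].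
  rewrite mulr0n !mul0r; apply: (@hd_ext R R[i] (fun=> 1)); last exact: hd_cst.
  by move=> w; rewrite expr0.
have := hdM h ih; rewrite (_ : _ + _ = n.+1%:R * f z ^+ n.+1.-1 * d).
  by apply: hd_ext => w; rewrite exprS.
case: n {ih} => [|n] /=; first by rewrite !expr0; ring.
rewrite exprS -(natr1 n.+1); ring.
Qed.

Lemma hd_prod (I : Type) (s : seq I) (P : pred I) (F : I -> R[i] -> R[i]) z :
  (forall i, P i -> exists d, hd (F i) z d) ->
  exists d, hd (fun w => \prod_(i <- s | P i) F i w) z d.
Proof.
move=> h; elim: s => [|i s [d ih]].
  exists 0; apply: (@hd_ext R R[i] (fun=> 1)); last exact: hd_cst.
  by move=> w; rewrite big_nil.
have [Pi|nP] := boolP (P i).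
  have [d' h'] := h i Pi.
  by eexists; apply: hd_ext (hdM h' ih) => w; rewrite big_cons Pi.
by exists d; apply: hd_ext ih => w; rewrite big_cons (negbTE nP).
Qed.

Definition cexp z : R[i] := (expR (complex.Re z))%:C * expi (complex.Im z).

Lemma expiD (a b : R) : expi (a + b) = expi a * expi b :> R[i].
Proof. by apply/eqP; rewrite /expi cosD sinD eq_complex /= eqxx /= addrC. Qed.

Lemma cexpD z w : cexp (z + w) = cexp z * cexp w.
Proof. rewrite /cexp !raddfD/= expRD rmorphM expiD /=; ring. Qed.

Lemma nr_expi (a : R) : nr (expi a) = 1.
Proof.
apply/eqP; rewrite -(eqrXn2 (n:=2))// ?nr_ge0// nr_sqr /= cos2Dsin2 expr1n//.
Qed.

Lemma nr_cexp z : nr (cexp z) = expR (complex.Re z).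
Proof. by rewrite /cexp nrM nr_expi mulr1 nr_real gtr0_norm ?expR_gt0. Qed.

Lemma cexp0 : cexp 0 = 1.
Proof. by rewrite /cexp /= expR0 /expi cos0 sin0 mul1r. Qed.

Lemma cexp_neq0 z : cexp z != 0.
Proof. by rewrite -nr_eq0 nr_cexp gt_eqF ?expR_gt0. Qed.

Lemma cexpN z : cexp (- z) = (cexp z)^-1.
Proof. by apply: (mulfI (cexp_neq0 z)); rewrite -cexpD subrr cexp0 divff ?cexp_neq0. Qed.

(** The derivatives at 0 of the three real functions suffice, since [cexpD] carries the result from
    0 to any other point. *)
Lemma hd_cexp0 : hd cexp 0 1.
Proof.
move=> e e0; have e8 : 0 < Num.min (e / 16) 1 by rewrite lt_min ltr01 divr_gt0.
have [r1 r10 h1] := real_derive_eps (is_derive_expR 0) e8.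
have [r2 r20 h2] := real_derive_eps (is_derive_cos 0) e8.
have [r3 r30 h3] := real_derive_eps (is_derive_sin 0) e8.
pose e' := Num.min (e / 16) 1.
have e'1 : e' <= e / 16 by rewrite ge_min lexx.
have e'0 : 0 <= e' by exact: ltW.
have e'2 : e' <= 1 by rewrite ge_min lexx orbT.
exists (Num.min (Num.min r1 r2) (Num.min r3 (Num.min 1 (e / 16)))).
  by rewrite !lt_min r10 r20 r30 ltr01 divr_gt0.
move=> w; rewrite !lt_min !subr0 => /and3P[/andP[w1 w2] w3 /andP[w4 w5]].
set x := complex.Re w; set y := complex.Im w.
have nx := nrRe w; have ny := nrIm w; rewrite -/x -/y in nx ny.
have := h1 x; have := h2 y; have := h3 y.
rewrite !add0r expR0 cos0 sin0 !mulr1 oppr0 !mulr0 !subr0 !addr0 => k3 k2 k1.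
have {}k1 := k1 (le_lt_trans nx w1); have {}k2 := k2 (le_lt_trans ny w2).
have {}k3 := k3 (le_lt_trans ny w3).
rewrite -/e' in k1 k2 k3.
have x0 : 0 <= `|x| by []. have y0 : 0 <= `|y| by [].
have l1 : `|expR x - 1| <= 2 * `|x|.
  rewrite -[expR x - 1](subrK x); apply: (le_trans (ler_normD _ _)).
  have hh : e' * `|x| <= `|x| by rewrite ler_piMl.
  by lra.
have l2 : `|expR x| <= 3.
  rewrite -[expR x](subrK 1); apply: (le_trans (ler_normD _ _)).
  rewrite normr1; lra.
rewrite cexp0 -[w *: 1]/(w * 1) mulr1; apply: (le_trans (nr_le_ReIm _)).
rewrite /cexp !raddfB /= -/x -/y !mul0r !subr0 addr0.
have -> : expR x * cos y - 1 - x = (expR x - 1 - x) + expR x * (cos y - 1) by ring.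
have -> : expR x * sin y - y = expR x * (sin y - y) + (expR x - 1) * y by ring.
have m1 := ler_normD (expR x - 1 - x) (expR x * (cos y - 1)).
have m2 := ler_normD (expR x * (sin y - y)) ((expR x - 1) * y).
rewrite !normrM in m1 m2.
have q1 : `|expR x| * `|cos y - 1| <= 3 * (e' * `|y|) by apply: ler_pM.
have q2 : `|expR x| * `|sin y - y| <= 3 * (e' * `|y|) by apply: ler_pM.
have q3 : `|expR x - 1| * `|y| <= 2 * `|x| * `|y| by apply: ler_wpM2r.
have q4 : `|x| * `|y| <= e / 16 * nr w by apply: ler_pM => //; exact: (le_trans nx (ltW _)).
have q5 : e' * `|y| <= e / 16 * nr w by apply: ler_pM.
have q6 : e' * `|x| <= e / 16 * nr w by apply: ler_pM.
have := nr_ge0 w; have : 0 <= e by exact: ltW.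
nra.
Qed.

Lemma hd_cexp z : hd cexp z (cexp z).
Proof.
have h : hd (fun w => cexp z * cexp (w - z)) z (cexp z * 1).
  apply: (@hdZ R R[i] (cexp z) (fun w => cexp (w - z)) z 1).
  have := @hd_comp R[i] cexp (fun w => w - z) z 1 1 _ _.
  rewrite scale1r subrr; apply; last exact: hd_cexp0.
  by have := hdB (hd_id z) (hd_cst z z); rewrite subr0.
by rewrite mulr1 in h; apply: hd_ext h => w; rewrite -cexpD addrC subrK.
Qed.

End Rules.

(** * Discs and circles *)

Section Disc.
Variable R : realType.
Implicit Types (c z w u t : R[i]) (r : R).

Definition dsk c r : set R[i] := [set z | nr (z - c) < r].
Definition cdsk c r : set R[i] := [set z | nr (z - c) <= r].

Lemma cvx_cdsk c r : cvx (cdsk c r).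
Proof.
move=> p q _ /= Kp Kq [s /andP[s0 s1] ->]; rewrite /cdsk/=.
have -> : p + s%:C * (q - p) - c = (1 - s)%:C * (p - c) + s%:C * (q - c).
  by rewrite rmorphB /=; ring.
apply: (le_trans (nrD _ _)); rewrite !nrM !nr_real !ger0_norm ?subr_ge0//.
rewrite /cdsk/= in Kp Kq; have s1' : 0 <= 1 - s by rewrite subr_ge0.
have := ler_wpM2l s0 Kq; have := ler_wpM2l s1' Kp; lra.
Qed.

Lemma seqclosed_cdsk c r : seqclosed (cdsk c r).
Proof.
move=> x h; apply/ler_addgt0Pr => e /h[y Ky xy]; apply: (le_trans (nr_triang y _ _)).
by rewrite addrC lerD// nrC.
Qed.

Lemma opn_dsk c r : opn (dsk c r).
Proof.
move=> z hz; exists (r - nr (z - c)); first by rewrite subr_gt0.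
move=> w hw; rewrite /dsk/= (le_lt_trans (nr_triang z _ _))//; lra.
Qed.

Lemma tri_dsk c r x y z : dsk c r x -> dsk c r y -> dsk c r z ->
  exists K, [/\ cvx K, seqclosed K, K `<=` dsk c r, K x & K y /\ K z].
Proof.
rewrite /dsk/= => hx hy hz.
pose m := Num.max (nr (x - c)) (Num.max (nr (y - c)) (nr (z - c))).
exists (cdsk c m); split.
- exact: cvx_cdsk.
- exact: seqclosed_cdsk.
- by move=> w /le_lt_trans; apply; rewrite !gt_max hx hy.
- by rewrite /cdsk/= le_max lexx.
- by split; rewrite /cdsk/= !le_max lexx ?orbT.
Qed.

Lemma cvx_dsk c r : cvx (dsk c r).
Proof.
move=> p q x hp hq ox; have [K [cK _ KU Kp [Kq _]]] := tri_dsk hp hq hq.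
by apply: KU; apply: (cK p q).
Qed.

Definition tpi : R[i] := 0 +i* (pi *+ 2).

Lemma tpi_neq0 : tpi != 0.
Proof. by rewrite eq_complex /= eqxx /= mulrn_eq0 /= gt_eqF ?pi_gt0. Qed.

(** An entire function of a complex [t], used on the segment from 0 to 1: contour integrals become
    segment integrals, and complex derivatives apply along the path. *)
Definition circ c r t := c + r%:C * cexp (tpi * t).

Lemma hd_circ c r t : hd (circ c r) t (tpi * (circ c r t - c)).
Proof.
have h1 : hd (fun t => tpi * t) t tpi.
  by have := @hdZ R R[i] tpi _ _ _ (hd_id t); rewrite -[tpi *: 1]/(tpi * 1) mulr1.
have h2 : hd (fun t => r%:C * cexp (tpi * t)) t (r%:C * (tpi * cexp (tpi * t))).
  exact: (@hdZ R R[i] r%:C _ _ _ (@hd_comp R R[i] _ _ _ _ _ h1 (hd_cexp _))).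
have := hdD (hd_cst c t) h2; rewrite add0r; congr (hd _ _ _).
by rewrite /circ; ring.
Qed.

Lemma onseg01 t : onseg 0 1 t -> exists2 s : R, 0 <= s <= 1 & t = s%:C.
Proof. by move=> [s h ->]; exists s => //; rewrite subr0 mulr1 add0r. Qed.

Lemma nr_circ c r t : 0 <= r -> onseg 0 1 t -> nr (circ c r t - c) = r.
Proof.
move=> r0 /onseg01[s _ ->]; rewrite /circ addrC addKr nrM nr_real ger0_norm//.
by rewrite nr_cexp /tpi /= mul0r mulr0 subr0 expR0 mulr1.
Qed.

Lemma circ01 c r : circ c r 1 = circ c r 0.
Proof.
rewrite /circ mulr0 mulr1 cexp0; congr (_ + _ * _).
by rewrite /cexp /tpi /= expR0 mul1r /expi cos2pi sin2pi.
Qed.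

End Disc.

Section Kernel.
Variables (R : realType).
Implicit Types (c z w u t : R[i]) (r : R).

(** With [a] and [b] the inverses of [zeta - z] and [zeta - w], the relation [b - a = eta * a * b]
    is the resolvent identity for [eta = w - z]. The constant is independent of [zeta], which
    justifies differentiation under the integral in [hd_cker]. *)
Lemma ker_alg k (M : R) : 0 <= M -> exists2 C : R, 0 <= C & forall a b eta : R[i],
  nr a <= M -> nr b <= M -> b - a = eta * a * b ->
  nr (b ^+ k - a ^+ k) <= C * nr eta /\
  nr (b ^+ k - a ^+ k - eta * (k%:R * a ^+ k.+1)) <= C * nr eta ^+ 2.
Proof.
move=> M0; elim: k => [|k [C C0 ih]].
  by exists 0 => // a b eta _ _ _; rewrite !expr0 subrr sub0r mulr0n !mul0r mulr0 oppr0 nr0.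
have m0 : 0 <= M ^+ k.+2 by exact: exprn_ge0.
have mc0 : 0 <= M * C by exact: mulr_ge0.
have mm0 : 0 <= M * (M ^+ k.+2 + M * C) by rewrite mulr_ge0// addr_ge0.
exists (M ^+ k.+2 + M * C + M * (M ^+ k.+2 + M * C)); first by rewrite !addr_ge0.
move=> a b eta ha hb hab; have [h1 h2] := ih _ _ _ ha hb hab.
have n0 := nr_ge0 eta.
have k1 : nr (b ^+ k.+1 - a ^+ k.+1) <= (M ^+ k.+2 + M * C) * nr eta.
  have -> : b ^+ k.+1 - a ^+ k.+1 = (b - a) * b ^+ k + a * (b ^+ k - a ^+ k).
    by rewrite !exprS; ring.
  apply: (le_trans (nrD _ _)); rewrite [leRHS]mulrDl; apply: lerD; last first.
    by rewrite nrM -mulrA ler_pM ?nr_ge0.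
  have -> : (b - a) * b ^+ k = eta * (a * b ^+ k.+1) by rewrite hab exprS; ring.
  rewrite nrM [leRHS]mulrC ler_wpM2l// nrM (exprS M) ler_pM ?nr_ge0//.
  by rewrite nrX ler_pXn2r// nnegrE nr_ge0.
split.
  by apply: (le_trans k1); rewrite ler_wpM2r// lerDl.
have -> : b ^+ k.+1 - a ^+ k.+1 - eta * (k.+1%:R * a ^+ k.+2) =
   eta * a * (b ^+ k.+1 - a ^+ k.+1) + a * (b ^+ k - a ^+ k - eta * (k%:R * a ^+ k.+1)).
  have e1 : b ^+ k.+1 = a * b ^+ k + eta * a * b * b ^+ k.
    by rewrite -hab exprS; ring.
  have -> : b ^+ k.+1 - a ^+ k.+1 - eta * (k.+1%:R * a ^+ k.+2) = (a * b ^+ k + eta * a * b * b ^+ k) - a ^+ k.+1 - eta * (k.+1%:R * a ^+ k.+2).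
    by rewrite -e1.
  rewrite -(natr1 k) !exprS; ring.
apply: (le_trans (nrD _ _)); rewrite !nrM.
have k2 : nr eta * nr a * nr (b ^+ k.+1 - a ^+ k.+1) <= nr eta * M * ((M ^+ k.+2 + M * C) * nr eta).
  by rewrite ler_pM ?mulr_ge0 ?nr_ge0// ler_wpM2l.
have k3 : nr a * nr (b ^+ k - a ^+ k - eta * (k%:R * a ^+ k.+1)) <= M * (C * nr eta ^+ 2).
  by rewrite ler_pM ?nr_ge0.
apply: (le_trans (lerD k2 k3)).
have k4 : 0 <= M ^+ k.+2 * nr eta ^+ 2 by rewrite mulr_ge0// sqr_ge0.
move: k4; set m := M ^+ k.+2; lra.
Qed.

Lemma cts_scale (V : normedModType R[i]) (a : R[i] -> R[i]) (f : R[i] -> V) z :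
  cts a z -> cts f z -> cts (fun w => a w *: f w) z.
Proof.
move=> ha hf e e0.
pose A := 1 + nr (a z); pose F := 1 + nr (f z).
have A0 : 0 < A by rewrite ltr_pwDl// nr_ge0.
have F0 : 0 < F by rewrite ltr_pwDl// nr_ge0.
have [r1 r10 h1] := ha _ (divr_gt0 (divr_gt0 e0 (ltr0n _ 2)) F0).
have [r2 r20 h2] := hf _ (divr_gt0 (divr_gt0 e0 (ltr0n _ 2)) A0).
have [r3 r30 h3] := ha _ ltr01.
exists (Num.min (Num.min r1 r2) r3); first by rewrite !lt_min r10 r20.
move=> w; rewrite !lt_min => /andP[/andP[/h1 k1 /h2 k2] /h3 k3].
have -> : a w *: f w - a z *: f z = a w *: (f w - f z) + (a w - a z) *: f z.
  by module_solve (R[i] : comPzRingType) V.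
apply: (le_trans (nrD _ _)); rewrite !nrZ (splitr e); apply: lerD.
  have aw : nr (a w) <= A by have := nrBr (a w) (a z); rewrite /A; lra.
  have := ler_pM (nr_ge0 _) (nr_ge0 _) aw k2; rewrite [A * _]mulrC divfK ?gt_eqF//.
have fz : nr (f z) <= F by rewrite /F; lra.
by have := ler_pM (nr_ge0 _) (nr_ge0 _) k1 fz; rewrite divfK ?gt_eqF.
Qed.

Lemma ctsX (a : R[i] -> R[i]) k z : cts a z -> cts (fun w => a w ^+ k) z.
Proof.
move=> ha; elim: k => [|k ih].
  by move=> e e0; exists 1 => // w _; rewrite !expr0 subrr nr0 ltW.
have := @cts_scale R[i] _ _ _ ha ih; apply: iffLR.
split => h e /h[r r0 hr]; exists r => // w /hr;
by rewrite !exprS.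
Qed.

Variable V : normedModType R[i].
Hypothesis cV : complete_nm V.

Lemma seg_bounded (f : R[i] -> V) p q : (forall x, onseg p q x -> cts f x) ->
  exists2 M : R, 0 <= M & forall x, onseg p q x -> nr (f x) <= M.
Proof.
move=> fc; apply: (@bisection _ (fun a b => exists2 M : R, 0 <= M &
  forall x, onseg a b x -> nr (f x) <= M)) => [a b oa ob [M1 M10 h1] [M2 M20 h2]|x ox].
  exists (Num.max M1 M2); first by rewrite le_max M10.
  move=> x [s /andP[s0 s1] ->]; have [s2|s2] := leP s (2^-1).
    rewrite le_max h1//; exists (2 * s); first by apply/andP; split; lra.
    by rewrite /mid rmorphM rmorph_nat /=; field.
  rewrite le_max h2 ?orbT//; exists (2 * s - 1); first by apply/andP; split; lra.
  by rewrite /mid rmorphB rmorphM rmorph_nat /=; field.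
have [r r0 hr] := fc _ ox _ ltr01; exists (r / 3); first by rewrite divr_gt0.
move=> a b oa ob ab ax; exists (1 + nr (f x)); first by rewrite addr_ge0 ?nr_ge0.
move=> y /onseg_dist oy; have yx : nr (y - x) < r.
  by apply: (le_lt_trans (nr_triang a _ _)); lra.
by have := hr _ yx; have := nrBr (f y) (f x); lra.
Qed.

Lemma smeanZ (a : R[i]) (f : R[i] -> V) p q : (forall x, onseg p q x -> cts f x) ->
  smean (fun x => a *: f x) p q = a *: smean f p q.
Proof.
apply: (@smean_lin R V V cV (fun x => a *: x) (nr a)) => [x y|b x|x].
- exact: scalerBr.
- by rewrite !scalerA mulrC.
- by rewrite nrZ.
Qed.

Lemma ctsB (f g : R[i] -> V) z : cts f z -> cts g z -> cts (fun w => f w - g w) z.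
Proof.
move=> hf hg e e0; have e2 : 0 < e / 2 by rewrite divr_gt0.
have [r1 r10 h1] := hf _ e2; have [r2 r20 h2] := hg _ e2.
exists (Num.min r1 r2); first by rewrite lt_min r10.
move=> w; rewrite lt_min => /andP[/h1 k1 /h2 k2].
have -> : f w - g w - (f z - g z) = (f w - f z) - (g w - g z).
  by module_solve (R[i] : comPzRingType) V.
by apply: (le_trans (nrB _ _)); rewrite (splitr e) lerD.
Qed.

Lemma ctsZ (a : R[i]) (f : R[i] -> V) z : cts f z -> cts (fun w => a *: f w) z.
Proof. by apply: cts_scale; exact: hd_cts (@hd_cst R R[i] a z). Qed.

Lemma smeanB (f g : R[i] -> V) p q : (forall x, onseg p q x -> cts f x) ->
  (forall x, onseg p q x -> cts g x) ->
  smean (fun x => f x - g x) p q = smean f p q - smean g p q.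
Proof.
move=> fc gc; transitivity (smean (fun x => f x + (-1) *: g x) p q).
  by apply: smean_ext => x _; rewrite scaleN1r.
rewrite smeanD ?smeanZ ?scaleN1r// => x ox; exact/ctsZ/gc.
Qed.

Variables (c : R[i]) (r : R) (phi : R[i] -> V).
Hypothesis r0 : 0 < r.
Hypothesis phic : forall t, onseg 0 1 t -> cts phi t.

(** For [k = 1] a Cauchy transform of the density [phi]; higher [k] are its derivatives up to
    factorials. *)
Definition cker k z := smean (fun t => ((circ c r t - z)^-1) ^+ k *: phi t) 0 1.

Lemma circ_far z t : nr (z - c) < r -> onseg 0 1 t -> r - nr (z - c) <= nr (circ c r t - z).
Proof.
move=> _ ot; have := nr_triang z (circ c r t) c; rewrite (nr_circ c (ltW r0) ot); lra.
Qed.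

Lemma circ_inv_hd z t : nr (z - c) < r -> onseg 0 1 t ->
  exists d, hd (fun t => (circ c r t - z)^-1) t d.
Proof.
move=> zr ot; eexists; apply: hdV; first exact: (hdB (hd_circ c r t) (hd_cst z t)).
by rewrite -nr_eq0 gt_eqF// (lt_le_trans _ (circ_far zr ot))// subr_gt0.
Qed.

Lemma circ_inv_cts z t : nr (z - c) < r -> onseg 0 1 t ->
  cts (fun t => (circ c r t - z)^-1) t.
Proof. by move=> zr ot; have [d] := circ_inv_hd zr ot; exact: hd_cts. Qed.

Lemma cker_cts k z t : nr (z - c) < r -> onseg 0 1 t ->
  cts (fun t => ((circ c r t - z)^-1) ^+ k *: phi t) t.
Proof.
by move=> zr ot; apply: cts_scale; [apply/ctsX/circ_inv_cts|exact: phic].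
Qed.

Lemma hd_cker k z : nr (z - c) < r -> hd (cker k) z (k%:R *: cker k.+1 z).
Proof.
move=> zr; pose rho := r - nr (z - c); have rho0 : 0 < rho by rewrite subr_gt0.
have M0 : 0 <= 2 / rho by rewrite divr_ge0 ?ltW.
have [C C0 hC] := ker_alg k M0; have [M Mge0 hM] := seg_bounded phic.
have CM : 0 < C * M + 1 by rewrite ltr_wpDl// mulr_ge0.
move=> e e0; exists (Num.min (rho / 2) (e / (C * M + 1))).
  by rewrite lt_min !divr_gt0.
move=> w; rewrite lt_min => /andP[w1]; rewrite ltr_pdivlMr// => w2.
have wr : nr (w - c) < r.
  by apply: (le_lt_trans (nr_triang z _ _)); rewrite /rho in w1; lra.
have fw t : onseg 0 1 t -> cts (fun t => ((circ c r t - w)^-1) ^+ k *: phi t) t by exact: cker_cts.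
have fz t : onseg 0 1 t -> cts (fun t => ((circ c r t - z)^-1) ^+ k *: phi t) t by exact: cker_cts.
have fz' t : onseg 0 1 t -> cts (fun t => ((circ c r t - z)^-1) ^+ k.+1 *: phi t) t by exact: cker_cts.
rewrite /cker scalerA -smeanZ// -smeanB// -smeanB; last first.
- by move=> t ot; exact/ctsZ/fz'.
- by move=> t ot; apply: ctsB; [exact: fw|exact: fz].
apply: (@le_trans _ _ (C * nr (w - z) ^+ 2 * M)); last first.
  have := nr_ge0 (w - z); rewrite expr2.
  have -> : C * (nr (w - z) * nr (w - z)) * M = (nr (w - z) * (C * M)) * nr (w - z) by ring.
  move=> n0; rewrite ler_wpM2r// (le_trans _ (ltW w2))// ler_wpM2l// lerDl//.
apply: smean_nr_le => [//|t ot|t ot].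
  by apply: ctsB; [apply: ctsB; [exact: fw|exact: fz]|exact/ctsZ/fz'].
rewrite scalerA -!scalerBl -mulrA.
rewrite nrZ ler_pM ?nr_ge0 ?hM//.
have far1 : rho <= nr (circ c r t - z) by exact: circ_far.
have far2 : rho / 2 <= nr (circ c r t - w).
  by have := nr_triang w (circ c r t) z; have := nr_triang (circ c r t) w z; have := nr_triang w z (circ c r t); rewrite !(nrC _ (circ c r t)) ?(nrC z w); lra.
have z0 : circ c r t - z != 0 by rewrite -nr_eq0 gt_eqF// (lt_le_trans rho0).
have w0 : circ c r t - w != 0 by rewrite -nr_eq0 gt_eqF// (lt_le_trans _ far2)// divr_gt0.
apply: (hC _ _ _ _ _ _).2.
- rewrite nrV -div1r ler_pdivrMr ?(lt_le_trans rho0)// mulrAC ler_pdivlMr//; lra.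
- rewrite nrV -div1r ler_pdivrMr ?(lt_le_trans _ far2) ?divr_gt0// mulrAC ler_pdivlMr//; lra.
- by field; rewrite w0 z0.
Qed.

End Kernel.

Section Cauchy.
Variables (R : realType) (V : normedModType R[i]).
Hypothesis cV : complete_nm V.
Implicit Types (f F : R[i] -> V) (c z w u t : R[i]) (r rho : R).

Lemma smean_cst (v : V) p q : smean (fun=> v) p q = v.
Proof.
apply: limsE; have -> : (fun k => dmean (fun=> v) k p q) = (fun=> v); last exact: cv_cst.
apply/funext => k; elim: k p q => [//|k ih] p q /=; rewrite !ih.
by module_solve (R[i] : comPzRingType) V.
Qed.

Lemma smean_pp f z : cts f z -> smean f z z = f z.
Proof.
move=> fz; have st x : onseg z z x -> x = z by move=> [s _ ->]; rewrite subrr mulr0 addr0.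
apply: eq_nr_le => e e0; apply: smean_le => // x /st -> //.
by rewrite subrr nr0 ltW.
Qed.

Lemma smean_hd_center f c rho z d : hol (dsk c rho) f -> dsk c rho z -> hd f z d ->
  hd (fun u => smean f z u) z (2^-1 *: d).
Proof.
move=> fh zd hz e e0; have [r1 r10 h1] := hz _ e0; have [r2 r20 h2] := opn_dsk zd.
exists (Num.min r1 r2); first by rewrite lt_min r10.
move=> u; rewrite lt_min => /andP[u1 u2].
have ud := h2 _ u2.
have fc x : onseg z u x -> cts f x.
  by move=> ox; apply: (hol_cts fh); exact: cvx_dsk ox.
rewrite (smean_pp (hol_cts fh zd)); have [->|uz] := eqVneq u z.
  by rewrite !subrr scale0r subr0 (smean_pp (hol_cts fh zd)) subrr !nr0 mulr0.
have uz0 : u - z != 0 by rewrite subr_eq0.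
have E : smean (fun w => f z + (w - z) *: d) z u = f z + ((u - z) / 2) *: d.
  have := @segint_FTC _ _ cV _ _ z u (fun x _ => hd_cts (hd_affine (f z) d z x))
    (fun x _ => hd_quad (f z) d z x).
  rewrite /segint => /(congr1 (fun y => (u - z)^-1 *: y)).
  rewrite scalerA mulVf// scale1r => ->.
  by module_solve (R[i] : comPzRingType) V.
have -> : smean f z u - f z - (u - z) *: (2^-1 *: d) =
   smean (fun w => f w - (f z + (w - z) *: d)) z u.
  rewrite (smeanB cV)// ?E; last by move=> x _; exact: hd_cts (hd_affine _ _ _ _).
  by set s := smean _ _ _; module_solve (R[i] : comPzRingType) V.
apply: smean_nr_le => // [x ox|x ox].
  by apply: ctsB; [exact: fc|exact: hd_cts (hd_affine _ _ _ _)].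
have xz := onseg_dist ox; rewrite opprD addrA (le_trans (h1 _ (le_lt_trans xz u1)))//.
by rewrite ler_wpM2l// ltW.
Qed.

(* The difference quotient of F is an average of F' over a segment, hence
   holomorphic even at the base point. *)
Lemma slope_hol f F c rho z : hol (dsk c rho) f ->
  (forall u, dsk c rho u -> hd F u (f u)) -> dsk c rho z ->
  hol (dsk c rho) (fun u => smean f z u) /\
  forall u, dsk c rho u -> F u - F z = (u - z) *: smean f z u.
Proof.
move=> fh Ff zd.
have E u : dsk c rho u -> F u - F z = (u - z) *: smean f z u.
  move=> ud; rewrite -[RHS]/(segint f z u) (@segint_FTC _ _ cV f F)// => x ox.
    by apply: (hol_cts fh); exact: cvx_dsk ox.
  by apply: Ff; exact: cvx_dsk ox.
split => // u ud; have [->|uz] := eqVneq u z.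
  have [d hz] := fh _ zd; exists (2^-1 *: d). apply: smean_hd_center hz; eassumption.
have uz0 : u - z != 0 by rewrite subr_eq0.
have [r2 r20 h2] := opn_dsk ud.
have h : exists d, hd (fun w => (w - z)^-1 *: (F w - F z)) u d.
  eexists; apply: hd_scale; last exact: (hdB (Ff _ ud) (hd_cst _ _)).
  by apply: hdV => //; exact: (hdB (hd_id u) (hd_cst z u)).
have [d hd] := h; exists d.
have m0 : 0 < Num.min r2 (nr (u - z)).
  by rewrite lt_min r20 lt_neqAle nr_ge0 eq_sym nr_eq0 uz0.
apply: hd_near m0 _ hd => w; rewrite lt_min => /andP[/h2 wd wu].
have wz : w - z != 0.
  apply: contraTneq wu => /eqP; rewrite subr_eq0 => /eqP ->.
  by rewrite nrC ltxx.
by rewrite E// scalerA mulVf// scale1r.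
Qed.

Lemma cts_comp f (g : R[i] -> R[i]) z : cts g z -> cts f (g z) -> cts (fun w => f (g w)) z.
Proof.
move=> hg hf e /hf[r r0 hr]; have r2 : 0 < r / 2 by rewrite divr_gt0.
have [r' r'0 hr'] := hg _ r2; exists r' => // w /hr' h; apply: hr.
by apply: (le_lt_trans h); rewrite ltr_pdivrMr// ltr_pMr// ltr1n.
Qed.

Lemma circ_mean0 f F c rho r : 0 < r < rho -> hol (dsk c rho) f ->
  (forall t, onseg 0 1 t -> hd F (circ c r t) (f (circ c r t))) ->
  smean (fun t => (circ c r t - c) *: f (circ c r t)) 0 1 = 0.
Proof.
move=> /andP[r0 rr] fh Ff.
have cd t : onseg 0 1 t -> dsk c rho (circ c r t).
  by move=> ot; rewrite /dsk/= nr_circ// ltW.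
have fc t : onseg 0 1 t -> cts (fun t => (circ c r t - c) *: f (circ c r t)) t.
  move=> ot; apply: cts_scale.
    exact: hd_cts (hdB (hd_circ c r t) (hd_cst c t)).
  by apply: (@cts_comp f); [exact: hd_cts (hd_circ c r t)|exact: hol_cts fh (cd _ ot)].
have := @segint_FTC _ _ cV (fun t => tpi R *: ((circ c r t - c) *: f (circ c r t)))
  (fun t => F (circ c r t)) 0 1.
rewrite /segint smeanZ// subr0 scale1r circ01 subrr => H.
have {}H := H (fun t ot => ctsZ _ (fc _ ot)).
suff /H/eqP : forall t, onseg 0 1 t -> hd (fun t => F (circ c r t)) t
     (tpi R *: ((circ c r t - c) *: f (circ c r t))).
  by rewrite scaler_eq0 (negbTE (tpi_neq0 R)) /= => /eqP.
move=> t ot.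
by rewrite scalerA; apply: hd_comp; [exact: hd_circ|exact: Ff].
Qed.

End Cauchy.

Section Cauchy2.
Variable R : realType.
Implicit Types (c z w u t : R[i]) (r rho : R).

(** The derivative of this mean in [z] is the integral of an exact form over a closed path, hence
    zero; at [z = c] the integrand is constantly 1. *)
Lemma circ_kernel_mean c r z : 0 < r -> nr (z - c) < r ->
  smean (fun t => (circ c r t - z)^-1 *: (circ c r t - c)) 0 1 = 1 :> R[i].
Proof.
move=> r0 zr; pose phi (t : R[i]) : R[i] := circ c r t - c.
have phic t : onseg 0 1 t -> cts phi t.
  by move=> ot; exact: hd_cts (hdB (hd_circ c r t) (hd_cst c t)).
have cC := @complete_complex R.
have E k w : smean (fun t => ((circ c r t - w)^-1) ^+ k *: phi t) 0 1 = cker c r phi k w by [].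
have -> : smean (fun t => (circ c r t - z)^-1 *: (circ c r t - c)) 0 1 = cker c r phi 1 z.
  by [].
have dz w : nr (w - c) < r -> hd (cker c r phi 1) w 0.
  move=> wr; have := hd_cker cC r0 phic 1 wr; suff -> : cker c r phi 2 w = 0.
    by rewrite scaler0.
  have h t : onseg 0 1 t -> circ c r t - w != 0.
    by move=> ot; rewrite -nr_eq0 gt_eqF// (lt_le_trans _ (circ_far r0 wr ot))// subr_gt0.
  have := @segint_FTC _ R[i] cC (fun t => tpi R * (((circ c r t - w)^-1) ^+ 2 * phi t))
    (fun t => - (circ c r t - w)^-1) 0 1.
  rewrite /segint (smeanZ cC); last first.
    by move=> t ot; apply: (@cker_cts R R[i] c r phi r0 phic 2).
  rewrite subr0 scale1r circ01 subrr => H.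
  have {}H := H (fun t ot => ctsZ _ (@cker_cts R R[i] c r phi r0 phic 2 w t wr ot)).
  suff /H/eqP : forall t, onseg 0 1 t -> hd (fun t => - (circ c r t - w)^-1 : R[i]) t
     (tpi R * (((circ c r t - w)^-1) ^+ 2 * phi t)).
    by rewrite scaler_eq0 (negbTE (tpi_neq0 R)) /= => /eqP.
  move=> t ot.
  have := @hdN R R[i] _ _ _ (hdV (@hdB R R[i] _ _ _ _ _ (hd_circ c r t) (hd_cst w t)) (h _ ot)).
  congr (hd _ _ _); rewrite subr0 /phi mulNr opprK exprVn; ring.
transitivity (cker c r phi 1 c).
  apply: (@hd0_const R R[i] cC) => x ox; apply: dz; apply: (cvx_dsk _ _ ox) => //=.
  by rewrite /dsk/= subrr nr0.
rewrite /cker (smean_ext (g := fun=> 1 : R[i])) ?smean_cst// => t ot.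
rewrite expr1 -[_ *: _]/(_ * _) mulVf// -nr_eq0 nr_circ ?gt_eqF// ltW//.
Qed.

Variables (V : normedModType R[i]).
Hypothesis cV : complete_nm V.
Implicit Types (f F : R[i] -> V).

Definition ccker c r f k z := cker c r (fun t => (circ c r t - c) *: f (circ c r t)) k z.

Lemma ccker_cts c r rho f t : 0 < r < rho -> hol (dsk c rho) f -> onseg 0 1 t ->
  cts (fun t => (circ c r t - c) *: f (circ c r t)) t.
Proof.
move=> /andP[r0 rr] fh ot; apply: cts_scale.
  exact: hd_cts (hdB (hd_circ c r t) (hd_cst c t)).
apply: (@cts_comp R V f); first exact: hd_cts (hd_circ c r t).
by apply: hol_cts fh _; rewrite /dsk/= nr_circ// ltW.
Qed.

(** Cauchy's formula follows from the holomorphy of the difference quotient, which [slope_hol] gives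
    only for a function with holomorphic derivative. So it is first proved for a primitive [F]. The
    formula makes [F] infinitely differentiable, hence [f] too ([df_hol_dsk]), and then every
    holomorphic function meets the hypothesis, with its own derivative in the place of [f]. *)
Lemma cauchy_formula_primitive c r rho f F z : 0 < r < rho -> hol (dsk c rho) f ->
  (forall u, dsk c rho u -> hd F u (f u)) -> nr (z - c) < r ->
  F z = ccker c r F 1 z.
Proof.
move=> rr fh Ff zr; have /andP[r0 rrho] := rr.
have zd : dsk c rho z by rewrite /dsk/= (lt_trans zr).
have Fh : hol (dsk c rho) F by move=> u /Ff; exists (f u).
have [Kh KE] := slope_hol cV fh Ff zd.
have cd t : onseg 0 1 t -> dsk c rho (circ c r t).
  by move=> ot; rewrite /dsk/= nr_circ// ltW.
have h t : onseg 0 1 t -> circ c r t - z != 0.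
  by move=> ot; rewrite -nr_eq0 gt_eqF// (lt_le_trans _ (circ_far r0 zr ot))// subr_gt0.
have cdc : dsk c rho c by rewrite /dsk/= subrr nr0 (lt_trans r0).
have K0 : smean (fun t => (circ c r t - c) *: smean f z (circ c r t)) 0 1 = 0.
  apply: (@circ_mean0 R V cV (fun u => smean f z u) (fun w => segint (fun u => smean f z u) c w) _ rho) => // t ot.
  by apply: (primitive cV (@tri_dsk R c rho) (@opn_dsk R c rho) Kh) => //; exact: cd.
rewrite /ccker /cker.
have -> : smean (fun t => ((circ c r t - z)^-1) ^+ 1 *: ((circ c r t - c) *: F (circ c r t))) 0 1 =
  smean (fun t => ((circ c r t - z)^-1 *: (circ c r t - c)) *: F z + (circ c r t - c) *: smean f z (circ c r t)) 0 1.
  apply: smean_ext => t ot.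
  have -> : F (circ c r t) = F z + (circ c r t - z) *: smean f z (circ c r t).
    by rewrite -(KE _ (cd _ ot)) addrC subrK.
  have := h _ ot; move: (smean f z _) => s; move: (circ c r t) => x x0.
  rewrite expr1 scalerDr scalerDr !scalerA; congr (_ + _ *: _).
  by rewrite mulrCA mulVf// mulr1.
rewrite smeanD//; last first.
- by move=> t ot; apply: (ccker_cts rr Kh ot).
- move=> t ot; apply: cts_scale; last exact: hd_cts (hd_cst (F z) t).
  apply: cts_scale; last exact: hd_cts (hdB (hd_circ c r t) (hd_cst c t)).
  exact: circ_inv_cts.
rewrite K0 addr0.
rewrite (@smean_lin R R[i] V (@complete_complex R) (fun x => x *: F z) (nr (F z))).
- by rewrite circ_kernel_mean// scale1r.
- by move=> x y; rewrite scalerBl.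
- by move=> a x; rewrite scalerA.
- by move=> x; rewrite nrZ mulrC.
move=> t ot; apply: cts_scale; last exact: hd_cts (hdB (hd_circ c r t) (hd_cst c t)).
exact: circ_inv_cts.
Qed.

Lemma df_hol_dsk c rho f : 0 < rho -> hol (dsk c rho) f -> hol (dsk c rho) (df f).
Proof.
move=> rho0 fh z zd; rewrite /dsk/= in zd.
pose r := (nr (z - c) + rho) / 2.
have n0 := nr_ge0 (z - c).
have rr : 0 < r < rho by rewrite /r; apply/andP; split; lra.
have zr : nr (z - c) < r by rewrite /r; lra.
have cdc : dsk c rho c by rewrite /dsk/= subrr nr0.
pose F w := segint f c w.
have Ff u : dsk c rho u -> hd F u (f u).
  by move=> ud; apply: (primitive cV (@tri_dsk R c rho) (@opn_dsk R c rho) fh).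
have Fh : hol (dsk c rho) F by move=> u /Ff; exists (f u).
have /andP[r0 _] := rr.
have ct t : onseg 0 1 t -> cts (fun t => (circ c r t - c) *: F (circ c r t)) t.
  exact: ccker_cts rr Fh.
have kd k u : nr (u - c) < r -> hd (ccker c r F k) u (k%:R *: ccker c r F k.+1 u).
  by move=> ur; apply: hd_cker.
have fE u : nr (u - c) < r -> f u = ccker c r F 2 u.
  move=> ur; have [r2 r20 h2] := @opn_dsk R c r u ur.
  have k1 := kd 1%N u ur; rewrite scale1r in k1.
  have k2 : hd F u (ccker c r F 2 u).
    apply: hd_near r20 _ k1 => w /h2 wr.
    by rewrite -(cauchy_formula_primitive rr fh Ff wr).
  by apply: hd_unique k2; apply: Ff; rewrite /dsk/= (lt_trans ur)//; case/andP: rr.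
have dfE u : nr (u - c) < r -> df f u = 2%:R *: ccker c r F 3 u.
  move=> ur; have [r2 r20 h2] := @opn_dsk R c r u ur.
  apply: df_hd; apply: hd_near r20 _ (kd 2%N u ur) => w /h2 wr.
  by rewrite fE.
have [r2 r20 h2] := @opn_dsk R c r z zr.
exists (2%:R *: (3%:R *: ccker c r F 4 z)).
apply: hd_near r20 _ (hdZ 2%:R (kd 3%N z zr)) => w /h2 wr.
by rewrite dfE.
Qed.

Theorem cauchy_formula c r rho f z : 0 < r < rho -> hol (dsk c rho) f ->
  nr (z - c) < r -> f z = ccker c r f 1 z.
Proof.
move=> rr fh zr; have /andP[r0 rrho] := rr.
apply: (cauchy_formula_primitive rr (df_hol_dsk (lt_trans r0 rrho) fh)) => // u ud.
exact: hol_hd fh ud.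
Qed.

Lemma df_hol (U : set R[i]) f : opn U -> hol U f -> hol U (df f).
Proof.
move=> oU fh z Uz; have [r r0 h] := oU _ Uz.
apply: (@df_hol_dsk z r) => //; last by rewrite /dsk/= subrr nr0.
by move=> w /h; exact: fh.
Qed.

(** Near [a] the quotient coincides with the mean of the derivative over the segment from [a], which
    is holomorphic by [slope_hol]. *)
Lemma hol_div (U : set R[i]) f a : opn U -> hol U f -> f a = 0 ->
  exists2 f1 : R[i] -> V, hol U f1 & forall z, U z -> f z = (z - a) *: f1 z.
Proof.
move=> oU fh fa.
pose f1 z := if z == a then df f a else (z - a)^-1 *: f z.
exists f1 => [z Uz|z Uz]; last first.
  rewrite /f1; case: eqVneq => [->|za]; first by rewrite fa subrr scale0r.
  by rewrite scalerA divff ?scale1r// subr_eq0.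
have [r r0 hr] := oU _ Uz; have [za|za] := eqVneq z a; last first.
  have za0 : z - a != 0 by rewrite subr_eq0.
  have [d h0] := fh _ Uz.
  have [d' hd'] : exists d, hd (fun w => (w - a)^-1 *: f w) z d.
    by eexists; apply: hd_scale h0; apply: hdV => //; exact: (hdB (hd_id z) (hd_cst a z)).
  have m0 : 0 < nr (z - a) by rewrite lt_neqAle nr_ge0 eq_sym nr_eq0 za0.
  exists d'; apply: hd_near m0 _ hd'.
  move=> w wz; rewrite /f1; case: eqVneq => // wa; move: wz.
  by rewrite wa nrC ltxx.
have Ua : dsk a r a by rewrite /dsk/= subrr nr0.
have fha : hol (dsk a r) f by move=> w; rewrite -za => /hr; exact: fh.
have dfh := df_hol_dsk r0 fha.
have [Kh KE] := slope_hol cV dfh (fun u ud => hol_hd fha ud) Ua.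
rewrite za; have [d h0] := Kh _ Ua; exists d; apply: hd_near r0 _ h0 => w wa.
rewrite /f1; case: eqVneq => [->|wna].
  by rewrite smean_pp//; exact: hol_cts dfh Ua.
have := KE _ wa; rewrite fa subr0 => ->.
by rewrite scalerA mulVf ?scale1r// subr_eq0.
Qed.

Lemma cauchy_bound c r rho f M z : 0 < r < rho -> hol (dsk c rho) f ->
  (forall w, nr (w - c) = r -> nr (f w) <= M) -> nr (z - c) < r ->
  nr (f z) <= r / (r - nr (z - c)) * M.
Proof.
move=> rr fh fM zr; have /andP[r0 rrho] := rr.
rewrite (cauchy_formula rr fh zr); apply: smean_nr_le => // t ot.
  by apply: (cker_cts r0 _ 1 zr) => // t' ot'; exact: ccker_cts rr fh ot'.
have far := circ_far r0 zr ot; have p : 0 < r - nr (z - c) by rewrite subr_gt0.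
rewrite expr1 !nrZ (nr_circ c (ltW r0) ot) nrV mulrA ler_pM ?nr_ge0//.
- by rewrite mulr_ge0 ?invr_ge0 ?nr_ge0// ltW.
- by rewrite mulrC ler_wpM2l ?(ltW r0)// lef_pV2// posrE// (lt_le_trans p).
- by apply: fM; rewrite (nr_circ c (ltW r0) ot).
Qed.

End Cauchy2.

(** * Zeros of scalar holomorphic functions *)

Section Scalar.
Variable R : realType.
Implicit Types (f g phi : R[i] -> R[i]) (U K : set R[i]) (c z w u y a : R[i]) (r rho M B : R).

Let cC := @complete_complex R.

Lemma hol_sub (V : normedModType R[i]) (U U' : set R[i]) (f : R[i] -> V) :
  U' `<=` U -> hol U f -> hol U' f.
Proof. by move=> s h z /s; exact: h. Qed.

Lemma hol_cst (V : normedModType R[i]) U (v : V) : hol U (fun=> v).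
Proof. by move=> z _; exists 0; exact: hd_cst. Qed.

Lemma hol_id U : hol U (fun w => w : R[i]).
Proof. by move=> z _; exists 1; exact: hd_id. Qed.

Lemma holB (V : normedModType R[i]) U (f g : R[i] -> V) :
  hol U f -> hol U g -> hol U (fun w => f w - g w).
Proof. by move=> hf hg z Uz; have [d h] := hf _ Uz; have [d' h'] := hg _ Uz; exists (d - d'); exact: hdB. Qed.

Lemma holM U f g : hol U f -> hol U g -> hol U (fun w => f w * g w).
Proof. by move=> hf hg z Uz; have [d h] := hf _ Uz; have [d' h'] := hg _ Uz; eexists; exact: (hdM h h'). Qed.

Lemma hol_scale (V : normedModType R[i]) U f (g : R[i] -> V) :
  hol U f -> hol U g -> hol U (fun w => f w *: g w).
Proof. by move=> hf hg z Uz; have [d h] := hf _ Uz; have [d' h'] := hg _ Uz; eexists; exact: (hd_scale h h'). Qed.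

Lemma holX U f n : hol U f -> hol U (fun w => f w ^+ n).
Proof. by move=> hf z Uz; have [d h] := hf _ Uz; eexists; exact: (hdX _ h). Qed.

Lemma holV U f : (forall z, U z -> f z != 0) -> hol U f -> hol U (fun w => (f w)^-1).
Proof. by move=> f0 hf z Uz; have [d h] := hf _ Uz; eexists; apply: (hdV h); exact: f0. Qed.

Lemma hol_sum (V : normedModType R[i]) U (I : Type) (s : seq I) (P : pred I) (F : I -> R[i] -> V) :
  (forall i, P i -> hol U (F i)) -> hol U (fun w => \sum_(i <- s | P i) F i w).
Proof.
move=> h; elim: s => [|i s ih].
  by move=> z _; exists 0; apply: hd_ext (hd_cst 0 z) => w; rewrite big_nil.
have [Pi|nP] := boolP (P i); move=> z Uz; have [d hz] := ih _ Uz; last first.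
  by exists d; apply: hd_ext hz => w; rewrite big_cons (negbTE nP).
have [d' hz'] := h _ Pi _ Uz; exists (d' + d).
by apply: hd_ext (hdD hz' hz) => w; rewrite big_cons Pi.
Qed.

Lemma hol_prod U (I : Type) (s : seq I) (P : pred I) (F : I -> R[i] -> R[i]) :
  (forall i, P i -> hol U (F i)) -> hol U (fun w => \prod_(i <- s | P i) F i w).
Proof. by move=> h z Uz; apply: hd_prod => i /h/(_ _ Uz). Qed.

(** Passage to k-th roots: by Bernoulli's inequality the powers of a ratio above 1 exceed any
    [A]. *)
Lemma pow_bound (x y A : R) : 0 <= x -> 0 <= y -> (forall k, x ^+ k <= A * y ^+ k) -> x <= y.
Proof.
move=> x0 y0 h; rewrite leNgt; apply/negP => yx.
have [y00|yn0] := eqVneq y 0.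
  by have := h 1%N; rewrite y00 !expr1 mulr0 leNgt -y00 yx.
have yp : 0 < y by rewrite lt_neqAle eq_sym yn0.
pose q := x / y - 1; have q0 : 0 < q by rewrite subr_gt0 ltr_pdivlMr// mul1r.
have bern k : 1 + k%:R * q <= (1 + q) ^+ k.
  elim: k => [|k ih]; first by rewrite mul0r addr0 expr0.
  rewrite exprS; have := ler_wpM2l (ltW (ltr_wpDl ler01 q0)) ih.
  rewrite -(natr1 k); have : 0 <= k%:R * q * q by rewrite !mulr_ge0// ltW.
  by move: (_ ^+ k) => E; nra.
have hk k : (1 + q) ^+ k <= A.
  rewrite /q addrC subrK expr_div_n ler_pdivrMr ?exprn_gt0//.
pose k := (Num.truncn (A / q)).+1.
have : A / q < k%:R by exact: truncnS_gt.
by rewrite ltr_pdivrMr// => h1; have := le_trans (bern k) (hk k); lra.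
Qed.

(** [cauchy_bound] loses a factor [r / (r - nr (z - c))]. Applied to the powers of [f] it loses the
    same factor at every exponent, and k-th roots remove it. *)
Lemma max_modulus c r rho f M z : 0 < r < rho -> hol (dsk c rho) f ->
  (forall w, nr (w - c) = r -> nr (f w) <= M) -> nr (z - c) < r -> nr (f z) <= M.
Proof.
move=> rr fh fM zr; have /andP[r0 rrho] := rr.
have M0 : 0 <= M.
  apply: (le_trans (nr_ge0 (f (c + r%:C)))); apply: fM.
  by rewrite addrC addKr nr_real ger0_norm// ltW.
apply: (@pow_bound _ _ (r / (r - nr (z - c)))) => [|//|k]; first exact: nr_ge0.
rewrite -nrX; apply: (@cauchy_bound R R[i] cC c r rho (fun w => f w ^+ k) (M ^+ k) z) => //.
  exact: holX.
by move=> w /fM h; rewrite nrX lerXn2r ?nnegrE ?nr_ge0.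
Qed.

(** Zeros are split off one by one with [hol_div], and the a priori bound [N] stops the process. The
    bound concerns every partial factorization, which is the form in which Jensen's inequality gives
    it. *)
Lemma zero_factor U K f N : opn U -> K `<=` U -> hol U f ->
  (forall zs phi, {in zs, forall z, K z} -> hol U phi ->
    (forall w, U w -> f w = \prod_(z <- zs) (w - z) * phi w) -> (size zs <= N)%N) ->
  exists zs phi, [/\ {in zs, forall z, K z}, hol U phi,
    forall w, U w -> f w = \prod_(z <- zs) (w - z) * phi w & forall z, K z -> phi z != 0].
Proof.
move=> oU KU fh hN; apply: contrapT => nex.
have step n : exists zs phi, [/\ {in zs, forall z, K z}, hol U phi,
    forall w, U w -> f w = \prod_(z <- zs) (w - z) * phi w & size zs = n].
  elim: n => [|n [zs [phi [zK ph fE sz]]]].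
    by exists [::], f; split => // w _; rewrite big_nil mul1r.
  have [z Kz pz] : exists2 z, K z & phi z = 0.
    apply: contrapT => h; apply: nex; exists zs, phi; split => // z Kz.
    by apply/eqP => pz; apply: h; exists z.
  have [phi1 p1 pE] := hol_div cC oU ph pz.
  exists (z :: zs), phi1; split => //=; last by rewrite sz.
    by move=> x; rewrite inE => /orP[/eqP ->//|]; exact: zK.
  move=> w Uw; rewrite big_cons fE// pE// -[_ *: _]/(_ * _); ring.
have [zs [phi [zK ph fE sz]]] := step N.+1.
by have := hN _ _ zK ph fE; rewrite sz ltnn.
Qed.

(** On the circle of radius [rho], a zero within [rho / 3] of [y] satisfies
    [nr (w - z) >= 2 * nr (y - z)]. Freezing its factor at [y] gains a factor 2, and the maximum
    principle carries the bound to the centre. The second conclusion says that removing these zeros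
    does not worsen the growth relative to the centre. *)
Lemma jensen_count y rho r1 f (zs : seq R[i]) phi B : 0 < rho < r1 ->
  hol (dsk y r1) phi ->
  (forall w, dsk y r1 w -> f w = \prod_(z <- zs) (w - z) * phi w) ->
  {in zs, forall z, nr (z - y) <= rho / 3} ->
  (forall w, nr (w - y) = rho -> nr (f w) <= B) ->
  2 ^+ (size zs) * nr (f y) <= B /\
  forall w, nr (w - y) < rho -> nr (phi w) * nr (f y) <= B * nr (phi y).
Proof.
move=> /andP[r0 rr] ph fE zsr fB.
pose P := \prod_(z <- zs) (y - z).
have yd : dsk y r1 y by rewrite /dsk/= subrr nr0 (lt_trans r0).
have B0 : 0 <= B.
  apply: (le_trans (nr_ge0 (f (y + rho%:C)))); apply: fB.
  by rewrite addrC addKr nr_real ger0_norm// ltW.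
have key w : nr (w - y) = rho -> 2 ^+ (size zs) * nr (P * phi w) <= B.
  move=> wr; have wd : dsk y r1 w by rewrite /dsk/= wr.
  apply: le_trans (fB _ wr); rewrite fE// !nrM mulrA ler_wpM2r ?nr_ge0//.
  rewrite /P !nr_prod; elim: zs zsr {ph fE P} => [|z zs ih] zsr.
    by rewrite !big_nil expr0 mulr1.
  rewrite !big_cons /= exprS.
  have -> : 2 * 2 ^+ size zs * (nr (y - z) * \prod_(j <- zs) nr (y - j)) =
    (2 * nr (y - z)) * (2 ^+ size zs * \prod_(j <- zs) nr (y - j)) by ring.
  apply: ler_pM.
  - by rewrite mulr_ge0// nr_ge0.
  - by rewrite mulr_ge0 ?exprn_ge0// prodr_ge0// => j _; exact: nr_ge0.
  - have h : nr (z - y) <= rho / 3 by apply: zsr; rewrite mem_head.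
    have := nr_triang z w y; rewrite wr (nrC y z); lra.
  - by apply: ih => j js; apply: zsr; rewrite inE js orbT.
have Ph : hol (dsk y r1) (fun w => P * phi w) by apply: holM => //; exact: hol_cst.
have p2 : 0 < 2 ^+ (size zs) :> R by rewrite exprn_gt0.
have mm w : nr (w - y) < rho -> 2 ^+ (size zs) * nr (P * phi w) <= B.
  move=> wr; rewrite mulrC -ler_pdivlMr//.
  apply: (@max_modulus y rho r1 (fun w => P * phi w)) => //; first by rewrite r0.
  by move=> u /key; rewrite mulrC -ler_pdivlMr.
split; first by rewrite fE//; apply: mm; rewrite subrr nr0.
move=> w /mm; rewrite (fE y)// !nrM => h.
have h2 : nr P * nr (phi w) <= B.
  apply: le_trans h; rewrite ler_peMl ?mulr_ge0 ?nr_ge0//.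
  by rewrite exprn_ege1// ler1n.
have := ler_wpM2r (nr_ge0 (phi y)) h2; rewrite -/P; lra.
Qed.

(* Borel--Caratheodory: a logarithm of phi is controlled by an upper bound of
   |phi|, through the Schwarz lemma for l / (2 M - l). *)
Lemma borel_caratheodory y r1 phi M : 0 < r1 -> 0 < M -> hol (dsk y r1) phi ->
  (forall w, dsk y r1 w -> phi w != 0) ->
  (forall w, dsk y r1 w -> nr (phi w) <= expR M * nr (phi y)) ->
  exists2 l : R[i] -> R[i],
    forall w, dsk y r1 w -> hd l w (df phi w / phi w) &
    forall w s r, nr (w - y) <= r -> r < s < r1 -> nr (l w - l y) <= 2 * M * r / (s - r).
Proof.
move=> r10 M0 ph p0 pM.
have yd : dsk y r1 y by rewrite /dsk/= subrr nr0.
have lh : hol (dsk y r1) (fun w => df phi w / phi w).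
  by apply: holM; [exact: (df_hol cC (@opn_dsk R y r1) ph)|exact: holV].
pose l w := segint (fun w => df phi w / phi w) y w.
have ld w : dsk y r1 w -> hd l w (df phi w / phi w).
  by move=> wd; apply: (primitive cC (@tri_dsk R y r1) (@opn_dsk R y r1) lh).
have ly : l y = 0 by rewrite /l /segint subrr scale0r.
exists l => //.
have pE w : dsk y r1 w -> phi w = phi y * cexp (l w).
  move=> wd; have E : phi y * cexp (- l y) = phi w * cexp (- l w).
    apply: (@hd0_const R R[i] cC (fun w => phi w * cexp (- l w))) => x ox.
    have xd : dsk y r1 x by exact: cvx_dsk ox.
    have h1 := @hd_comp R R[i] _ _ _ _ _ (@hdN R R[i] _ _ _ (ld _ xd)) (hd_cexp _).
    have := hdM (hol_hd ph xd) h1; congr (hd _ _ _).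
    by rewrite -[_ *: _]/(_ * _); field; exact: p0.
  rewrite ly oppr0 cexp0 mulr1 in E.
  by rewrite E cexpN -mulrA mulVf ?mulr1 ?cexp_neq0.
have lM w : dsk y r1 w -> complex.Re (l w) <= M.
  move=> wd; rewrite -ler_expR -nr_cexp.
  have := pM _ wd; rewrite pE// nrM mulrC ler_pM2r//.
  by rewrite lt_neqAle nr_ge0 eq_sym nr_eq0 p0.
pose M2 : R[i] := (2 * M)%:C.
have den w : dsk y r1 w -> nr (l w) <= nr (M2 - l w) /\ M2 - l w != 0.
  move=> /lM h; have hh : M <= complex.Re (M2 - l w) by rewrite raddfB/=; lra.
  split; last by apply: contraTneq hh => ->; rewrite /= -ltNge.
  rewrite -ler_sqr ?nnegrE ?nr_ge0// !nr_sqr !raddfB/= sub0r sqrrN lerD2r; nra.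
pose om w := l w / (M2 - l w).
have omh : hol (dsk y r1) om.
  have lh' : hol (dsk y r1) l by move=> w /ld h; eexists; exact: h.
  apply: holM => //; apply: holV => [w /den[]//|].
  by apply: holB => //; exact: hol_cst.
have om1 w : dsk y r1 w -> nr (om w) <= 1.
  move=> wd; have [h1 h2] := den _ wd; rewrite /om nrM nrV ler_pdivrMr ?mul1r//.
  by rewrite lt_neqAle nr_ge0 eq_sym nr_eq0 h2.
have omy : om y = 0 by rewrite /om ly mul0r.
have [om' omh' omE] := hol_div cC (@opn_dsk R y r1) omh omy.
move=> w s r wr /andP[rs sr1]; have r0 : 0 <= r by apply: le_trans wr; exact: nr_ge0.
  have s0 : 0 < s by apply: le_lt_trans rs.
  have wd : dsk y r1 w by rewrite /dsk/= (le_lt_trans wr)// (lt_trans rs).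
  have ws : nr (w - y) < s by apply: le_lt_trans rs.
  have h : nr (om' w) <= s^-1.
    apply: (@max_modulus y s r1 om') => //; first by rewrite s0.
    move=> u us; have ud : dsk y r1 u by rewrite /dsk/= us.
    have := om1 _ ud; rewrite omE// nrZ us -ler_pdivlMl// mulr1//.
  have [h1 h2] := den _ wd.
  have h3 : s * nr (om w) <= r.
    rewrite omE// nrZ mulrCA; have : s * nr (om' w) <= 1 by rewrite mulrC -ler_pdivlMr// div1r.
    by have := nr_ge0 (w - y); have := nr_ge0 (om' w); nra.
  rewrite ly subr0.
  have lE : l w = om w * (M2 - l w) by rewrite /om divfK.
  have h4 : nr (l w) <= nr (om w) * (2 * M + nr (l w)).
    rewrite {1}lE nrM ler_wpM2l ?nr_ge0//; apply: (le_trans (nrB _ _)).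
    by rewrite /M2 nr_real ger0_norm// mulr_ge0// (ltW M0).
  rewrite ler_pdivlMr ?subr_gt0//.
  have k1 := ler_wpM2l (ltW s0) h4.
  have k0 : 0 <= 2 * M + nr (l w) by rewrite addr_ge0 ?nr_ge0// mulr_ge0// (ltW M0).
  have k2 := ler_wpM2r k0 h3; lra.
Qed.

(** The logarithmic derivative at the centre is the limit of difference quotients of the logarithm,
    which [borel_caratheodory] bounds. *)
Lemma log_deriv_bound y r1 phi M s : 0 < s < r1 -> 0 <= M -> hol (dsk y r1) phi ->
  (forall w, dsk y r1 w -> phi w != 0) ->
  (forall w, dsk y r1 w -> nr (phi w) <= expR M * nr (phi y)) ->
  nr (df phi y / phi y) <= 4 * M / s.
Proof.
move=> /andP[s0 sr] M0 ph p0 pM; have r10 := lt_trans s0 sr.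
apply/ler_addgt0Pr => e e0.
(* [borel_caratheodory] wants a positive exponent; the surplus contributes [e / 2] to the final
   bound. *)
pose M' := M + e * s / 8.
have es : 0 < e * s / 8 by rewrite divr_gt0// mulr_gt0.
have M'0 : 0 < M' by rewrite /M' ltr_wpDl.
have [|l ld lb] := @borel_caratheodory y r1 phi M' r10 M'0 ph p0.
  move=> w /pM/le_trans; apply; rewrite ler_wpM2r ?nr_ge0// ler_expR /M' lerDl ltW//.
have yd : dsk y r1 y by rewrite /dsk/= subrr nr0.
have e2 : 0 < e / 2 by rewrite divr_gt0.
have [r r0 hr] := ld _ yd _ e2.
have rm : 0 < Num.min r (s / 2) by rewrite lt_min r0 divr_gt0.
have [w] := opn_dir y rm; rewrite lt_min => /andP[wr ws] wy.
have p : 0 < nr (w - y) by rewrite lt_neqAle nr_ge0 eq_sym nr_eq0 subr_eq0 wy.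
have k1 := hr _ wr.
have k2 : nr (l w - l y) <= 2 * M' * nr (w - y) / (s - nr (w - y)).
  by apply: (lb w s (nr (w - y))) => //; rewrite sr andbT; lra.
have k3 : nr (l w - l y) <= 4 * M' / s * nr (w - y).
  apply: (le_trans k2); rewrite ler_pdivrMr; last by lra.
  have -> : 4 * M' / s * nr (w - y) * (s - nr (w - y)) = 2 * M' * nr (w - y) * (2 * (s - nr (w - y)) / s).
    by field; rewrite gt_eqF.
  have a0 : 0 <= 2 * M' * nr (w - y) by rewrite mulr_ge0 ?nr_ge0// mulr_ge0// (ltW M'0).
  rewrite ler_peMr//.
  rewrite ler_pdivlMr//; lra.
have k4 : nr ((w - y) *: (df phi y / phi y)) <= nr (l w - l y) + e / 2 * nr (w - y).
  have := nr_triang (l w - l y) ((w - y) *: (df phi y / phi y)) 0; rewrite !subr0 nrC; lra.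
rewrite nrZ in k4.
have k5 : nr (df phi y / phi y) * nr (w - y) <= (4 * M' / s + e / 2) * nr (w - y) by lra.
rewrite ler_pM2r// in k5; apply: (le_trans k5); rewrite le_eqVlt; apply/orP; left.
by rewrite /M'; apply/eqP; field; rewrite gt_eqF.
Qed.

End Scalar.

(** * Variation of the argument along segments *)

Section ArgumentPrinciple.
Variable R : realType.
Implicit Types (f g phi : R[i] -> R[i]) (w z p q : R[i]) (zs : seq R[i]).

Let cC := @complete_complex R.

Lemma atanDV (x : R) : 0 < x -> atan x + atan x^-1 = pi / 2.
Proof.
move=> x0; have a0 : 0 < atan x by rewrite -(atan0 R) lt_atan.
have a1 := atan_ltpi2 x.
have -> : x^-1 = tan (pi / 2 - atan x).
  have ht : tan (atan x) = x by rewrite atanK.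
  rewrite -{1}ht /tan sinB cosB sin_pihalf cos_pihalf !mul0r !mul1r subr0 add0r.
  by rewrite invf_div.
rewrite tanK; first by rewrite addrC subrK.
by rewrite in_itv /=; have := pi_gt0 R => p0; apply/andP; split; lra.
Qed.

Lemma Im_inv (x y : R) : complex.Im (x +i* y)^-1 = - (y / (x ^+ 2 + y ^+ 2)).
Proof. by []. Qed.

Lemma Re_inv (x y : R) : complex.Re (x +i* y)^-1 = x / (x ^+ 2 + y ^+ 2).
Proof. by []. Qed.

Lemma ImB z w : complex.Im (z - w) = complex.Im z - complex.Im w.
Proof. exact: raddfB. Qed.

Lemma ImZ (r : R) z : complex.Im (r%:C * z) = r * complex.Im z.
Proof. by case: z => a b /=; rewrite mul0r addr0. Qed.

(** Imaginary parts are enough to count zeros, and they need a real antiderivative only: on the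
    sides of a rectangle arctangents serve, with no branch of the logarithm. *)
Lemma Im_segint_FTC g p q (h : R -> R) : (forall x, onseg p q x -> cts g x) ->
  (forall t : R, 0 <= t <= 1 -> is_derive t 1 h (complex.Im ((q - p) * g (p + t%:C * (q - p))))) ->
  complex.Im (segint g p q) = h 1 - h 0.
Proof.
move=> gc hh; have [pq|pq] := eqVneq p q.
  have d0 (t : R) : 0 <= t <= 1 -> is_derive t 1 h 0.
    by move=> /hh; rewrite pq subrr mul0r.
  rewrite pq /segint subrr scale0r /=.
  have hc : {within `[0, 1], continuous h}.
    by apply: derivable_within_continuous => t; rewrite in_itv/= => /d0[].
  have hd0 (t : R) : t \in `]0, 1[ -> is_derive t 1 h ((fun=> 0) t).
    by rewrite in_itv/= => /andP[t0 t1]; apply: d0; rewrite !ltW.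
  by have [t _ ->] := MVT_segment ler01 hd0 hc; rewrite mul0r.
have qp0 : q - p != 0 by rewrite subr_eq0 eq_sym.
have n0 : 0 < nr (q - p) by rewrite lt_neqAle nr_ge0 eq_sym nr_eq0 qp0.
pose tau w : R := complex.Re ((w - p) / (q - p)).
have tauE (t : R) : tau (p + t%:C * (q - p)) = t.
  by rewrite /tau addrC addKr mulfK.
suff : (complex.Im (segint g p q))%:C = (h (tau q) - h (tau p))%:C :> R[i].
  move=> /complexI ->; congr (h _ - h _).
    by rewrite /tau divff.
  by rewrite /tau subrr mul0r.
apply: (@additive_unique R R[i] (fun a b => (complex.Im (segint g a b))%:C) (fun a b => (h (tau b) - h (tau a))%:C)).
- move=> a b oa ob; rewrite (segint_half cC) ?raddfD// ?rmorphD//.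
  by move=> x ox; apply: gc; exact: onseg_sub ox.
- by move=> a b _ _ /=; rewrite -rmorphD /= [in RHS]addrC addrA subrK.
move=> e x e0 ox; have e5 : 0 < e / 10 by rewrite divr_gt0.
have [t0 t01 xE] := ox.
have [r1 r10 h1] := gc _ ox _ e5.
have e6 : 0 < e / 10 * nr (q - p) by rewrite mulr_gt0.
have [r2 r20 h2] := real_derive_eps (hh _ t01) e6.
exists (Num.min r1 (r2 * nr (q - p)) / 4); first by rewrite divr_gt0// lt_min r10 mulr_gt0.
move=> a b [ta ta1 aE] [tb tb1 bE]; rewrite ltr_pdivlMr// lt_min => /andP[ab1 ab2] ax.
have m0 := nr_ge0 (b - a).
have bx : nr (b - x) <= 3 * nr (b - a).
  by apply: (le_trans (nr_triang a _ _)); lra.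
have oab : forall y, onseg a b y -> onseg p q y.
  by move=> y; apply: onseg_sub; [exists ta|exists tb].
have k1 : nr (segint g a b - (b - a) *: g x) <= e / 10 * nr (b - a).
  apply: segint_le => // y oy; first by apply: gc; exact: oab.
  apply: h1; apply: (le_lt_trans (nr_triang a _ _)).
  have := onseg_dist oy; lra.
have dx u tu : u = p + tu%:C * (q - p) -> nr (u - x) = `|tu - t0| * nr (q - p).
  move=> uE; rewrite -nr_real -nrM; congr nr; rewrite uE xE rmorphB /=; ring.
have k2 u tu : u = p + tu%:C * (q - p) -> nr (u - x) <= 3 * nr (b - a) ->
   `|h tu - h t0 - (tu - t0) * complex.Im ((q - p) * g x)| <= e / 10 * (3 * nr (b - a)).
  move=> uE; rewrite (dx _ _ uE) => hu.
  have := h2 (tu - t0); rewrite (addrC t0 (tu - t0)) subrK -xE => H.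
  have H1 : `|tu - t0| < r2 by rewrite -(ltr_pM2r n0); lra.
  apply: (le_trans (H H1)); rewrite -mulrA ler_wpM2l ?(ltW e5)// mulrC//.
have k3 := k2 _ _ aE ltac:(lra); have k4 := k2 _ _ bE bx.
rewrite -rmorphB /= nr_real aE bE !tauE -aE -bE.
have -> : complex.Im (segint g a b) - (h tb - h ta) =
  complex.Im (segint g a b - (b - a) *: g x) -
  ((h tb - h t0 - (tb - t0) * complex.Im ((q - p) * g x)) -
   (h ta - h t0 - (ta - t0) * complex.Im ((q - p) * g x))).
  have -> : (b - a) *: g x = (tb - ta)%:C * ((q - p) * g x).
    by rewrite -[_ *: _]/(_ * _) aE bE rmorphB /=; ring.
  by rewrite ImB ImZ; ring.
have k5 := le_trans (nrIm _) k1.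
have t1 := ler_normB (complex.Im (segint g a b - (b - a) *: g x))
  ((h tb - h t0 - (tb - t0) * complex.Im ((q - p) * g x)) -
   (h ta - h t0 - (ta - t0) * complex.Im ((q - p) * g x))).
have t2 := ler_normB (h tb - h t0 - (tb - t0) * complex.Im ((q - p) * g x))
   (h ta - h t0 - (ta - t0) * complex.Im ((q - p) * g x)).
have : 0 <= e * nr (b - a) by rewrite mulr_ge0// ltW.
lra.
Qed.

Lemma is_derive_atan_aff (u l v t : R) :
  is_derive t 1 (fun t => atan ((u + t * l) / v)) (l / v / (1 + ((u + t * l) / v) ^+ 2)).
Proof.
have h : is_derive t 1 (fun t : R => (u + t * l) / v) (l / v).
  have -> : (fun t : R => (u + t * l) / v) = cst (u / v) + (l / v) *: (id : R -> R).
    by apply/funext => x; rewrite !fctE /= -[_ *: x]/(_ * x); ring.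
  have h1 : is_derive t 1 (cst (u / v) : R -> R) 0 by exact: is_derive_cst.
  have h2 : is_derive t 1 ((l / v) *: (id : R -> R)) ((l / v) *: 1) by exact: is_deriveZ.
  by have := is_deriveD h1 h2; rewrite add0r -[_ *: 1]/(_ * 1) mulr1.
have := @is_derive1_comp R atan (fun t : R => (u + t * l) / v) t _ _ (is_derive1_atan _) h.
by rewrite mulrC.
Qed.

Lemma sq_sum_neq0 (x v : R) : v != 0 -> x ^+ 2 + v ^+ 2 != 0.
Proof.
move=> v0; rewrite gt_eqF// ltr_wpDl ?sqr_ge0//.
by rewrite lt_neqAle eq_sym sqrf_eq0 v0 sqr_ge0.
Qed.

Lemma Im_inv_horizontal (x0 x1 y0 : R) z : y0 - complex.Im z != 0 ->
  complex.Im (segint (fun w => (w - z)^-1 : R[i]) (x0 +i* y0) (x1 +i* y0)) =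
  atan ((x0 - complex.Re z) / (y0 - complex.Im z)) - atan ((x1 - complex.Re z) / (y0 - complex.Im z)).
Proof.
case: z => al be /= v0; set v := y0 - be in v0 *.
pose h t := - atan ((x0 - al + t * (x1 - x0)) / v).
have -> : atan ((x0 - al) / v) - atan ((x1 - al) / v) = h 1 - h 0.
  by rewrite /h mul1r mul0r addr0 opprK [RHS]addrC; congr (_ - atan (_ / _)); ring.
refine (@Im_segint_FTC _ _ _ h _ _).
- move=> w [t _ ->]; apply: (@hd_cts R R[i]); apply: hdV; first exact: (hdB (hd_id _) (hd_cst _ _)).
  rewrite eq_complex /= negb_and; apply/orP; right.
  by rewrite mul0r subrr mulr0 addr0 addr0.
move=> t _; have D := @is_deriveN R R R _ _ _ _ (is_derive_atan_aff (x0 - al) (x1 - x0) v t).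
rewrite (_ : complex.Im _ = - ((x1 - x0) / v / (1 + ((x0 - al + t * (x1 - x0)) / v) ^+ 2))); first exact: D.
have -> : x1 +i* y0 - (x0 +i* y0) = (x1 - x0)%:C :> R[i].
  by apply/eqP; rewrite eq_complex /= eqxx subrr eqxx.
rewrite ImZ.
have -> : x0 +i* y0 + t%:C * (x1 - x0)%:C - (al +i* be) = (x0 - al + t * (x1 - x0)) +i* v.
  apply/eqP; rewrite eq_complex /=; apply/andP; split; apply/eqP; rewrite /v; ring.
rewrite Im_inv; have h' := sq_sum_neq0 (x0 - al + t * (x1 - x0)) v0.
by field; rewrite v0 /= addrC h'.
Qed.

Lemma Im_inv_vertical (x0 y0 y1 : R) z : x0 - complex.Re z != 0 ->
  complex.Im (segint (fun w => (w - z)^-1 : R[i]) (x0 +i* y0) (x0 +i* y1)) =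
  atan ((y1 - complex.Im z) / (x0 - complex.Re z)) - atan ((y0 - complex.Im z) / (x0 - complex.Re z)).
Proof.
case: z => al be /= v0; set v := x0 - al in v0 *.
pose h t := atan ((y0 - be + t * (y1 - y0)) / v).
have -> : atan ((y1 - be) / v) - atan ((y0 - be) / v) = h 1 - h 0.
  by rewrite /h mul1r mul0r addr0; congr (atan (_ / _) - _); ring.
refine (@Im_segint_FTC _ _ _ h _ _).
- move=> w [t _ ->]; apply: (@hd_cts R R[i]); apply: hdV; first exact: (hdB (hd_id _) (hd_cst _ _)).
  rewrite eq_complex /= negb_and; apply/orP; left.
  by rewrite mul0r subrr mulr0 subr0 addr0.
move=> t _; have D := is_derive_atan_aff (y0 - be) (y1 - y0) v t.
rewrite (_ : complex.Im _ = (y1 - y0) / v / (1 + ((y0 - be + t * (y1 - y0)) / v) ^+ 2)); first exact: D.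
have -> : x0 +i* y1 - (x0 +i* y0) = (y1 - y0)%:C * 'i%C :> R[i].
  by apply/eqP; rewrite eq_complex /= subrr !mul0r !mulr0 mulr1 subrr addr0 !eqxx.
rewrite -mulrA ImZ.
have -> : x0 +i* y0 + t%:C * ((y1 - y0)%:C * 'i%C) - (al +i* be) = v +i* (y0 - be + t * (y1 - y0)).
  apply/eqP; rewrite eq_complex /=; apply/andP; split; apply/eqP; rewrite /v; ring.
rewrite [X in complex.Im X]mulrC ImiRe Re_inv; have h' := sq_sum_neq0 (y0 - be + t * (y1 - y0)) v0.
by field; rewrite v0 /= addrC h'.
Qed.

End ArgumentPrinciple.

(** * The argument principle on rectangles *)

Section Rectangles.
Variable R : realType.
Implicit Types (f g phi : R[i] -> R[i]) (w z p q : R[i]) (zs : seq R[i]).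

Let cC := @complete_complex R.

Lemma ImD z w : complex.Im (z + w) = complex.Im z + complex.Im w.
Proof. exact: raddfD. Qed.

Lemma logd_prod zs phi w d : w \notin zs -> phi w != 0 -> hd phi w d ->
  hd (fun w => \prod_(z <- zs) (w - z) * phi w) w
     (\prod_(z <- zs) (w - z) * phi w * (\sum_(z <- zs) (w - z)^-1 + d / phi w)).
Proof.
move=> wz p0 hp; elim: zs wz => [|z zs ih].
  move=> _; have : hd phi w (\prod_(z <- [::]) (w - z) * phi w * (\sum_(z <- [::]) (w - z)^-1 + d / phi w)).
    by rewrite !big_nil mul1r add0r mulrC divfK.
  by apply: hd_ext => u; rewrite big_nil mul1r.
rewrite inE negb_or => /andP[wz /ih h].
have := hdM (@hdB R R[i] _ _ _ _ _ (hd_id w) (hd_cst z w)) h.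
rewrite !big_cons; set P := \prod_(_ <- _) _; set S := \sum_(_ <- _) _.
have -> : (1 - 0) * (P * phi w) + (w - z) * (P * phi w * (S + d / phi w)) =
  (w - z) * P * phi w * ((w - z)^-1 + S + d / phi w).
  by field; rewrite p0 subr_eq0 wz.
by apply: hd_ext => u; rewrite big_cons mulrA.
Qed.

Lemma logd_dfE (U : set R[i]) f zs phi w : opn U -> U w -> hol U phi ->
  (forall w, U w -> f w = \prod_(z <- zs) (w - z) * phi w) -> f w != 0 ->
  df f w / f w = \sum_(z <- zs) (w - z)^-1 + df phi w / phi w.
Proof.
move=> oU Uw ph fE f0; have [r r0 hr] := oU _ Uw.
have fw := fE _ Uw; move: f0; rewrite fw mulf_eq0 negb_or => /andP[P0 p0].
have wz : w \notin zs.
  apply: contraNN P0 => wz; rewrite prodf_seq_eq0; apply/hasP; exists w => //=.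
  by rewrite subrr.
rewrite (@df_hd _ _ f w _ (hd_near r0 _ (logd_prod wz p0 (hol_hd ph Uw)))).
  by rewrite mulrC mulKf// mulf_neq0.
by move=> u /hr/fE ->.
Qed.

Variables (a b eta : R).

Definition corner1 : R[i] := a +i* (- eta).
Definition corner2 : R[i] := b +i* (- eta).
Definition corner3 : R[i] := b +i* eta.
Definition corner4 : R[i] := a +i* eta.

Definition rect : set R[i] := [set w | a <= complex.Re w <= b /\ - eta <= complex.Im w <= eta].

Definition cont w := [\/ onseg corner1 corner2 w, onseg corner2 corner3 w,
  onseg corner3 corner4 w | onseg corner4 corner1 w].

Definition cint (V : normedModType R[i]) (g : R[i] -> V) : V :=
  segint g corner1 corner2 + segint g corner2 corner3 +
  segint g corner3 corner4 + segint g corner4 corner1.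

Lemma cintD f g : (forall w, cont w -> cts f w) -> (forall w, cont w -> cts g w) ->
  cint (fun w => f w + g w) = cint f + cint g.
Proof.
move=> fc gc; rewrite /cint !(segintD cC); try by move=> w ow; (apply: fc || apply: gc);
  by [apply: Or41|apply: Or42|apply: Or43|apply: Or44].
move: (segint f _ _) (segint f _ _) (segint f _ _) (segint f _ _).
move: (segint g _ _) (segint g _ _) (segint g _ _) (segint g _ _) => *; ring.
Qed.

Lemma cint_ext (V : normedModType R[i]) (f g : R[i] -> V) :
  (forall w, cont w -> f w = g w) -> cint f = cint g.
Proof.
move=> fg; rewrite /cint; congr (_ + _ + _ + _); apply: segint_ext => w ow; apply: fg;
  by [apply: Or41|apply: Or42|apply: Or43|apply: Or44].
Qed.

Lemma Re_onseg p q w : onseg p q w -> exists2 t : R, 0 <= t <= 1 &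
  complex.Re w = complex.Re p + t * (complex.Re q - complex.Re p) /\
  complex.Im w = complex.Im p + t * (complex.Im q - complex.Im p).
Proof.
move=> [t t01 ->]; exists t => //; case: p => p1 p2; case: q => q1 q2 /=.
by rewrite !mul0r subr0 addr0.
Qed.

Lemma cvx_rect : cvx rect.
Proof.
move=> p q w [/andP[p1 p2] /andP[p3 p4]] [/andP[q1 q2] /andP[q3 q4]].
move=> /Re_onseg[t /andP[t0 t1] [h1 h2]]; rewrite /rect /= h1 h2.
by split; apply/andP; split; nra.
Qed.

Lemma seqclosed_rect : seqclosed rect.
Proof.
move=> w h; split; apply/andP; split; apply/ler_addgt0Pr => e /h[y [/andP[y1 y2] /andP[y3 y4]] yw].
all: have h1 := le_trans (nrRe (y - w)) yw; have h2 := le_trans (nrIm (y - w)) yw.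
all: rewrite ImB ler_norml in h2; rewrite raddfB /= ler_norml in h1.
all: by case/andP: h1 => h11 h12; case/andP: h2 => h21 h22; lra.
Qed.

Lemma rect_corners : a <= b -> 0 <= eta ->
  [/\ rect corner1, rect corner2, rect corner3 & rect corner4].
Proof.
by move=> ab e0; split; rewrite /rect /=; split; apply/andP; split; lra.
Qed.

Lemma cont_rect w : a <= b -> 0 <= eta -> cont w -> rect w.
Proof.
by move=> ab e0; have [c1 c2 c3 c4] := rect_corners ab e0; case; apply: cvx_rect.
Qed.

Lemma cint_hol0 (V : normedModType R[i]) (cV : complete_nm V) (g : R[i] -> V) :
  a <= b -> 0 <= eta -> hol rect g -> cint g = 0.
Proof.
move=> ab e0 gh; have [c1 c2 c3 c4] := rect_corners ab e0.
have gc p q : rect p -> rect q -> forall w, onseg p q w -> cts g w.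
  by move=> rp rq w ow; apply: (hol_cts gh); exact: cvx_rect ow.
have t1 := goursat cV cvx_rect seqclosed_rect gh c1 c2 c3.
have t2 := goursat cV cvx_rect seqclosed_rect gh c1 c3 c4.
have s := segint_sym cV (gc _ _ c1 c3).
rewrite -[RHS]addr0 -{1}t1 -t2 /triint s /cint.
by module_solve (R[i] : comPzRingType) V.
Qed.

Definition inside z := a < complex.Re z < b /\ - eta < complex.Im z < eta.

Lemma cont_inside w z : a <= b -> 0 <= eta -> cont w -> inside z -> w != z.
Proof.
move=> ab e0 cw [/andP[z1 z2] /andP[z3 z4]]; apply/eqP => wz; subst w.
by case: cw => /Re_onseg[t t01 /= [h1 h2]]; move: z1 z2 z3 z4; rewrite h1 h2; nra.
Qed.

(** Each side contributes two arctangents, angles seen from [z]. Regrouped at the corners by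
    [atanDV] they amount to four times [pi / 2]. *)
Lemma cint_inv z : inside z -> complex.Im (cint (fun w => (w - z)^-1)) = pi *+ 2.
Proof.
move=> [/andP[z1 z2] /andP[z3 z4]].
rewrite /cint !ImD /corner1 /corner2 /corner3 /corner4.
rewrite !Im_inv_horizontal ?Im_inv_vertical; try by [rewrite subr_eq0 lt_eqF|rewrite subr_eq0 gt_eqF].
set al := complex.Re z in z1 z2 *; set be := complex.Im z in z3 z4 *.
have A (x y : R) : 0 < x -> 0 < y -> atan (x / y) + atan (y / x) = pi / 2.
  by move=> x0 y0; rewrite -[y / x]invf_div atanDV// divr_gt0.
have N (x y : R) : atan (- x / y) = - atan (x / y) by rewrite mulNr atanN.
have N' (x y : R) : atan (x / - y) = - atan (x / y) by rewrite invrN mulrN atanN.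
have x1 : 0 < al - a by lra. have x2 : 0 < b - al by lra.
have x3 : 0 < be + eta by lra. have x4 : 0 < eta - be by lra.
have := A _ _ x1 x3; have := A _ _ x2 x3; have := A _ _ x1 x4; have := A _ _ x2 x4.
have -> : a - al = - (al - a) by ring.
have -> : - eta - be = - (be + eta) by ring.
rewrite !(N, N') !opprK (mulr2n pi); lra.
Qed.

Lemma cint_sum_inv zs : a <= b -> 0 <= eta -> {in zs, forall z, inside z} ->
  (forall w, cont w -> cts (fun w => \sum_(z <- zs) (w - z)^-1) w) /\
  complex.Im (cint (fun w => \sum_(z <- zs) (w - z)^-1)) = (pi *+ 2) * (size zs)%:R.
Proof.
move=> ab e0; elim: zs => [|z zs ih] zi.
  split; first by move=> w _; apply: (@hd_cts R R[i] _ _ 0); apply: hd_ext (@hd_cst R R[i] 0 w) => u; rewrite big_nil.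
  rewrite (@cint_ext _ _ (fun=> 0)) => [|w _]; last by rewrite big_nil.
  by rewrite (cint_hol0 cC) ?mulr0//; exact: hol_cst.
have [|ic iE] := ih; first by move=> x xs; apply: zi; rewrite inE xs orbT.
have iz : inside z by apply: zi; rewrite mem_head.
have zc w : cont w -> cts (fun w => (w - z)^-1) w.
  move=> cw; apply: (@hd_cts R R[i]); apply: hdV; first exact: (hdB (hd_id _) (hd_cst _ _)).
  by rewrite subr_eq0 (cont_inside ab e0 cw iz).
have E w : \sum_(z0 <- z :: zs) (w - z0)^-1 = (w - z)^-1 + \sum_(z0 <- zs) (w - z0)^-1.
  by rewrite big_cons.
split.
  move=> w cw e e1; have e2 : 0 < e / 2 by rewrite divr_gt0.
  have [r1 r10 h1] := zc _ cw _ e2; have [r2 r20 h2] := ic _ cw _ e2.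
  exists (Num.min r1 r2); first by rewrite lt_min r10.
  move=> u; rewrite lt_min => /andP[/h1 k1 /h2 k2]; rewrite !E opprD addrACA.
  by rewrite (splitr e) (le_trans (nrD _ _))// lerD.
have -> : cint (fun w => \sum_(z0 <- z :: zs) (w - z0)^-1) =
    cint (fun w => (w - z)^-1 + \sum_(z0 <- zs) (w - z0)^-1).
  by apply: cint_ext => w _; exact: E.
rewrite (cintD zc ic) ImD [X in _ + X]iE [X in X + _](cint_inv iz).
have -> : (size (z :: zs))%:R = 1 + (size zs)%:R :> R by rewrite nat1r.
by rewrite mulrDr mulr1.
Qed.

Theorem argument_principle (U : set R[i]) f zs phi : a <= b -> 0 <= eta ->
  opn U -> rect `<=` U -> hol U phi ->
  (forall w, U w -> f w = \prod_(z <- zs) (w - z) * phi w) ->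
  (forall w, rect w -> phi w != 0) -> {in zs, forall z, inside z} ->
  complex.Im (cint (fun w => df f w / f w)) = (pi *+ 2) * (size zs)%:R.
Proof.
move=> ab e0 oU rU ph fE p0 zi.
have [sc sE] := cint_sum_inv ab e0 zi.
have lh : hol rect (fun w => df phi w / phi w).
  apply: holM; first exact: hol_sub rU (df_hol cC oU ph).
  by apply: holV => //; exact: hol_sub rU ph.
rewrite (@cint_ext _ _ (fun w => \sum_(z <- zs) (w - z)^-1 + df phi w / phi w)).
  rewrite cintD// ?(cint_hol0 cC ab e0 lh) ?addr0// => w cw.
  by apply: (hol_cts lh); exact: cont_rect.
move=> w cw; have rw := cont_rect ab e0 cw; have Uw := rU _ rw.
apply: (logd_dfE oU Uw ph fE); rewrite (fE _ Uw) mulf_neq0 ?p0//.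
rewrite prodf_seq_neq0; apply/allP => z zs' /=.
by rewrite subr_eq0 (cont_inside ab e0 cw (zi _ zs')).
Qed.

End Rectangles.

(** * Zeros of perturbed diagonal determinants *)

Section MatrixNorm.
Variable R : realType.
Notation C := R[i].

Lemma cauchy_schwarz_sum (n : nat) (x y : 'I_n -> R) :
  (\sum_i x i * y i) ^+ 2 <= (\sum_i x i ^+ 2) * (\sum_i y i ^+ 2).
Proof.
set P := \sum_i _ * _; set A := \sum_i x i ^+ 2; set B := \sum_i y i ^+ 2.
have B0 : 0 <= B by apply: sumr_ge0 => i _; exact: sqr_ge0.
have [Bz|Bn] := eqVneq B 0.
  suff -> : P = 0 by rewrite expr0n /= Bz mulr0.
  apply: big1 => i _; suff -> : y i = 0 by rewrite mulr0.
  apply/eqP; rewrite -sqrf_eq0; move/eqP: Bz; rewrite psumr_eq0 => [/allP/(_ i)|j _]; last exact: sqr_ge0.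
  by rewrite mem_index_enum => /(_ isT).
have Bp : 0 < B by rewrite lt_neqAle eq_sym Bn.
have : 0 <= \sum_i (x i * B - y i * P) ^+ 2 by apply: sumr_ge0 => i _; exact: sqr_ge0.
have -> : \sum_i (x i * B - y i * P) ^+ 2 = B * (A * B - P ^+ 2).
  transitivity (\sum_i (x i ^+ 2 * B ^+ 2 - x i * y i * (2 * (B * P)) + y i ^+ 2 * P ^+ 2)).
    by apply: eq_bigr => i _; ring.
  rewrite !big_split /= sumrN -!mulr_suml -/A -/B -/P; ring.
by rewrite pmulr_rge0// subr_ge0.
Qed.

Definition vn2 n (v : 'cV[C]_n) : R := \sum_i nr (v i 0) ^+ 2.
Definition vn n (v : 'cV[C]_n) : R := Num.sqrt (vn2 v).

Lemma vn2_ge0 n (v : 'cV[C]_n) : 0 <= vn2 v.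
Proof. by apply: sumr_ge0 => i _; exact: sqr_ge0. Qed.

Lemma vn_ge0 n (v : 'cV[C]_n) : 0 <= vn v. Proof. exact: sqrtr_ge0. Qed.

Lemma vn_sqr n (v : 'cV[C]_n) : vn v ^+ 2 = vn2 v.
Proof. by rewrite sqr_sqrtr// vn2_ge0. Qed.

Lemma vn_eq0 n (v : 'cV[C]_n) : (vn v == 0) = (v == 0).
Proof.
rewrite sqrtr_eq0; apply/idP/eqP => [h|->]; last first.
  by rewrite /vn2 big1// => i _; rewrite mxE nr0 expr0n.
have : vn2 v == 0 by rewrite eq_le h vn2_ge0.
rewrite psumr_eq0 => [/allP h2|j _]; last exact: sqr_ge0.
apply/matrixP => i j; rewrite ord1 mxE; apply/eqP.
by have := h2 i; rewrite mem_index_enum sqrf_eq0 nr_eq0 => /(_ isT).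
Qed.

Lemma vnD n (u v : 'cV[C]_n) : vn (u + v) <= vn u + vn v.
Proof.
rewrite -ler_sqr ?nnegrE ?addr_ge0 ?vn_ge0// sqrrD !vn_sqr.
have cs : \sum_i nr (u i 0) * nr (v i 0) <= vn u * vn v.
  apply: le_trans (ler_norm _) _; rewrite -ler_sqr ?nnegrE ?mulr_ge0 ?vn_ge0//.
  by rewrite real_normK ?num_real// exprMn !vn_sqr cauchy_schwarz_sum.
apply: (@le_trans _ _ (vn2 u + (\sum_i nr (u i 0) * nr (v i 0)) *+ 2 + vn2 v)); last first.
  by rewrite lerD2r lerD2l lerMn2r.
rewrite /vn2 -sumrMnl -!big_split /=; apply: ler_sum => i _.
by rewrite mxE -sqrrD lerXn2r ?nnegrE ?addr_ge0 ?nr_ge0// nrD.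
Qed.

Lemma vnZ n (a : C) (v : 'cV[C]_n) : vn (a *: v) = nr a * vn v.
Proof.
rewrite /vn -[nr a in RHS]ger0_norm ?nr_ge0// -sqrtr_sqr -sqrtrM ?sqr_ge0//.
by rewrite /vn2 mulr_sumr; congr Num.sqrt; apply: eq_bigr => i _; rewrite mxE nrM exprMn.
Qed.

Lemma vnN n (v : 'cV[C]_n) : vn (- v) = vn v.
Proof. by rewrite -scaleN1r vnZ nrN nr1 mul1r. Qed.

Lemma vn2_col n k (u : 'cV[C]_n) (v : 'cV[C]_k) : vn2 (col_mx u v) = vn2 u + vn2 v.
Proof.
rewrite /vn2 big_split_ord /=; congr (_ + _); apply: eq_bigr => i _.
  by rewrite col_mxEu.
by rewrite col_mxEd.
Qed.

Lemma vn_col0 n k (u : 'cV[C]_n) : vn (col_mx u (0 : 'cV[C]_k)) = vn u.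
Proof.
rewrite /vn vn2_col; have -> : vn2 (0 : 'cV[C]_k) = 0; last by rewrite addr0.
by rewrite -vn_sqr (_ : vn 0 = 0) ?expr0n//; apply/eqP; rewrite vn_eq0.
Qed.

Lemma vn_0col n k (u : 'cV[C]_n) : vn (col_mx (0 : 'cV[C]_k) u) = vn u.
Proof.
rewrite /vn vn2_col; have -> : vn2 (0 : 'cV[C]_k) = 0; last by rewrite add0r.
by rewrite -vn_sqr (_ : vn 0 = 0) ?expr0n//; apply/eqP; rewrite vn_eq0.
Qed.

Lemma vn_col_le n k (u : 'cV[C]_n) (v : 'cV[C]_k) :
  vn u <= vn (col_mx u v) /\ vn v <= vn (col_mx u v).
Proof.
by rewrite /vn vn2_col; split; rewrite ler_sqrt ?addr_ge0 ?vn2_ge0// ?lerDl ?lerDr vn2_ge0.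
Qed.

(** Bounds of the Euclidean operator norm, from above by [mxb] and from below by [mxlb]; predicates
    spare the norm itself. *)
Definition mxb m n (X : 'M[C]_(m, n)) (c : R) := forall v, vn (X *m v) <= c * vn v.
Definition mxlb m n (X : 'M[C]_(m, n)) (c : R) := forall v, c * vn v <= vn (X *m v).

Lemma mxbD m n (X Y : 'M[C]_(m, n)) c d : mxb X c -> mxb Y d -> mxb (X + Y) (c + d).
Proof.
by move=> hX hY v; rewrite mulmxDl mulrDl (le_trans (vnD _ _))// lerD.
Qed.

Lemma mxbN m n (X : 'M[C]_(m, n)) c : mxb X c -> mxb (- X) c.
Proof. by move=> h v; rewrite mulNmx vnN. Qed.

Lemma mxbM m n p (X : 'M[C]_(m, n)) (Y : 'M[C]_(n, p)) c d : 0 <= c ->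
  mxb X c -> mxb Y d -> mxb (X *m Y) (c * d).
Proof.
move=> c0 hX hY v; rewrite -mulmxA (le_trans (hX _))// -mulrA ler_wpM2l//.
Qed.

Lemma mxb_le m n (X : 'M[C]_(m, n)) c d : c <= d -> mxb X c -> mxb X d.
Proof. by move=> cd h v; apply: (le_trans (h v)); rewrite ler_wpM2r// vn_ge0. Qed.

Lemma mxb1 n : mxb (1%:M : 'M[C]_n) 1.
Proof. by move=> v; rewrite mul1mx mul1r. Qed.

Lemma mxbZ m n (a : C) (X : 'M[C]_(m, n)) c : mxb X c -> mxb (a *: X) (nr a * c).
Proof. by move=> h v; rewrite -scalemxAl vnZ -mulrA ler_wpM2l ?nr_ge0. Qed.

Lemma mxlbB n m (X Y : 'M[C]_(m, n)) c d : mxlb X c -> mxb Y d -> mxlb (X - Y) (c - d).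
Proof.
move=> hX hY v; rewrite mulmxBl mulrBl lerBlDr (le_trans (hX v))//.
rewrite -{1}[X *m v](subrK (Y *m v)) (le_trans (vnD _ _))// lerD2l; exact: hY.
Qed.

Lemma mxlb_unit n (X : 'M[C]_n) c : 0 < c -> mxlb X c ->
  X \in unitmx /\ mxb (invmx X) c^-1.
Proof.
move=> c0 hX.
have U : X \in unitmx.
  rewrite -unitmx_tr -row_free_unit -kermx_eq0.
  apply/eqP/row_matrixP => i; rewrite row0.
  have /sub_kermxP h := row_sub i (kermx X^T).
  have : vn (row i (kermx X^T))^T = 0.
    apply/eqP; rewrite eq_le vn_ge0 andbT -(ler_pM2l c0) mulr0 (le_trans (hX _))//.
    by rewrite -[X in vn (X *m _)]trmxK -trmx_mul h trmx0 le_eqVlt; apply/orP; left; rewrite vn_eq0.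
  move/eqP; rewrite vn_eq0 => /eqP /(congr1 trmx); by rewrite trmxK trmx0.
split => // v; rewrite -(ler_pM2l c0) mulrA divff ?gt_eqF// mul1r.
by apply: (le_trans (hX _)); rewrite mulKVmx.
Qed.

Lemma mxlb_diag n (d : 'rV[C]_n) c : (forall i, c <= nr (d 0 i)) -> 0 <= c -> mxlb (diag_mx d) c.
Proof.
move=> h c0 v; rewrite -ler_sqr ?nnegrE ?vn_ge0 ?mulr_ge0 ?vn_ge0// exprMn !vn_sqr.
rewrite /vn2 mulr_sumr; apply: ler_sum => i _.
by rewrite mul_diag_mx mxE nrM exprMn ler_wpM2r ?sqr_ge0// lerXn2r ?nnegrE ?nr_ge0.
Qed.

Lemma mxb_diag n (d : 'rV[C]_n) c : (forall i, nr (d 0 i) <= c) -> 0 <= c -> mxb (diag_mx d) c.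
Proof.
move=> h c0 v; rewrite -ler_sqr ?nnegrE ?vn_ge0 ?mulr_ge0 ?vn_ge0// exprMn !vn_sqr.
rewrite /vn2 mulr_sumr; apply: ler_sum => i _.
by rewrite mul_diag_mx mxE nrM exprMn ler_wpM2r ?sqr_ge0// lerXn2r ?nnegrE ?nr_ge0.
Qed.

Lemma mxb_ul m1 m2 n1 n2 (X : 'M[C]_(m1 + m2, n1 + n2)) c : mxb X c ->
  [/\ mxb (ulsubmx X) c, mxb (ursubmx X) c, mxb (dlsubmx X) c & mxb (drsubmx X) c].
Proof.
move=> h; split=> v.
- have := h (col_mx v 0); rewrite vn_col0; apply: le_trans.
  have -> : X *m col_mx v 0 = col_mx (ulsubmx X *m v) (dlsubmx X *m v).
    by rewrite -[in LHS](submxK X) mul_block_col !mulmx0 !addr0.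
  exact: (vn_col_le _ _).1.
- have := h (col_mx 0 v); rewrite vn_0col; apply: le_trans.
  have -> : X *m col_mx 0 v = col_mx (ursubmx X *m v) (drsubmx X *m v).
    by rewrite -[in LHS](submxK X) mul_block_col !mulmx0 !add0r.
  exact: (vn_col_le _ _).1.
- have := h (col_mx v 0); rewrite vn_col0; apply: le_trans.
  have -> : X *m col_mx v 0 = col_mx (ulsubmx X *m v) (dlsubmx X *m v).
    by rewrite -[in LHS](submxK X) mul_block_col !mulmx0 !addr0.
  exact: (vn_col_le _ _).2.
- have := h (col_mx 0 v); rewrite vn_0col; apply: le_trans.
  have -> : X *m col_mx 0 v = col_mx (ursubmx X *m v) (drsubmx X *m v).
    by rewrite -[in LHS](submxK X) mul_block_col !mulmx0 !add0r.
  exact: (vn_col_le _ _).2.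
Qed.

(** Up to sign the determinant is the product of the roots of the characteristic polynomial, and
    each root is an eigenvalue of modulus at most [c]. The transpose enters because eigenvalues come
    with row eigenvectors. *)
Lemma det_bound n (X : 'M[C]_n) c : mxb X c -> nr (\det X) <= c ^+ n.
Proof.
move=> h; rewrite -det_tr.
have [rs rsE] := closed_field_poly_normal (char_poly X^T).
have /monicP lc := char_poly_monic X^T; rewrite lc scale1r in rsE.
have sz : size rs = n.
  by have := size_char_poly X^T; rewrite rsE size_prod_XsubC => -[].
have := congr1 (horner^~ 0) rsE; rewrite /= horner_prod /char_poly -horner_evalE -det_map_mx.
have -> : map_mx (horner_eval 0) (char_poly_mx X^T) = - X^T.
  apply/matrixP => i j; rewrite !mxE /horner_eval hornerD hornerN hornerC hornerMn hornerX.
  by rewrite mul0rn add0r.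
rewrite -scaleN1r detZ => /(congr1 (@nr R C)); rewrite nrM nrX nrN nr1 expr1n mul1r => ->.
rewrite nr_prod -sz; have : {in rs, forall r, nr r <= c}.
  move=> r rin.
  have : root (char_poly X^T) r by rewrite rsE root_prod_XsubC.
  rewrite -eigenvalue_root_char => /eigenvalueP[v vX v0].
  have := h v^T; rewrite -[X in vn (X *m _)]trmxK -trmx_mul vX linearZ /= vnZ.
  rewrite ler_pM2r// lt_neqAle vn_ge0 eq_sym vn_eq0 andbT.
  by rewrite -(inj_eq trmx_inj) trmxK trmx0.
elim: rs {rsE sz} => [|r rs ih] hr; first by rewrite big_nil expr0.
rewrite big_cons exprS; apply: ler_pM.
- exact: nr_ge0.
- by apply: prodr_ge0 => j _; exact: nr_ge0.
- by rewrite hornerXsubC sub0r nrN; apply: hr; rewrite mem_head.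
- by apply: ih => x xs; apply: hr; rewrite inE xs orbT.
Qed.

(** The exponent is the size of the matrix. For the full determinant it would be the number of all
    eigenvalues in play, which is the reason for passing to a Schur complement of size [n]. *)
Lemma det_ratio_bound n (X Y : 'M[C]_n) c : X \in unitmx -> mxb (invmx X *m Y) c ->
  nr (\det Y) <= nr (\det X) * c ^+ n.
Proof.
move=> uX /det_bound; rewrite det_mulmx nrM => h.
have -> : nr (\det Y) = nr (\det X) * (nr (\det (invmx X)) * nr (\det Y)).
  by rewrite mulrA -nrM -det_mulmx mulmxV// det1 nr1 mul1r.
by rewrite ler_wpM2l ?nr_ge0.
Qed.

Lemma det_schur n k (X : 'M[C]_(n + k)) : drsubmx X \in unitmx ->
  \det X = \det (drsubmx X) *
    \det (ulsubmx X - ursubmx X *m invmx (drsubmx X) *m dlsubmx X).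
Proof.
move=> u; rewrite -{1}(submxK X).
have -> : block_mx (ulsubmx X) (ursubmx X) (dlsubmx X) (drsubmx X) =
  block_mx 1%:M (ursubmx X *m invmx (drsubmx X)) 0 1%:M *m
  block_mx (ulsubmx X - ursubmx X *m invmx (drsubmx X) *m dlsubmx X) 0 (dlsubmx X) (drsubmx X).
  by rewrite mulmx_block !mul1mx !mul0mx !add0r subrK mulmxKV.
by rewrite det_mulmx det_ublock det_lblock !det1 !mul1r mulrC.
Qed.

Lemma hol_det (U : set C) n (X : C -> 'M[C]_n) :
  (forall i j, hol U (fun w => X w i j)) -> hol U (fun w => \det (X w)).
Proof.
move=> h; apply: hol_sum => s _; apply: holM; first exact: hol_cst.
by apply: hol_prod => i _.
Qed.

End MatrixNorm.

(** * Determinants of perturbed diagonal matrices *)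

Section SpectralMatrix.
Variable R : realType.
Notation C := R[i].
Implicit Types (w z y : C) (f g phi u v : C -> C) (zs : seq C).

Let cC := @complete_complex R.

(** Apply [log_deriv_bound] to [u / v]: the two comparisons together bound it by [expR (2 * A)]
    times its modulus at [y]. *)
Lemma log_deriv_diff y r1 u v A s : 0 < s < r1 -> 0 <= A ->
  hol (dsk y r1) u -> hol (dsk y r1) v ->
  (forall w, dsk y r1 w -> u w != 0) -> (forall w, dsk y r1 w -> v w != 0) ->
  (forall w, dsk y r1 w -> nr (u w) <= expR A * nr (v w)) ->
  nr (v y) <= expR A * nr (u y) ->
  nr (df u y / u y - df v y / v y) <= 8 * A / s.
Proof.
move=> sr A0 uh vh u0 v0 uv vu; have /andP[s0 sr1] := sr.
have yd : dsk y r1 y by rewrite /dsk/= subrr nr0 (lt_trans s0).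
pose q w := u w / v w.
have qh : hol (dsk y r1) q by apply: holM => //; exact: holV.
have q0 w : dsk y r1 w -> q w != 0 by move=> wd; rewrite mulf_neq0 ?invr_eq0 ?u0 ?v0.
have -> : df u y / u y - df v y / v y = df q y / q y.
  have hu := hol_hd uh yd; have hv := hol_hd vh yd.
  have -> : df q y = df u y * (v y)^-1 + u y * (- df v y / v y ^+ 2).
    exact: (df_hd (hdM hu (hdV hv (v0 _ yd)))).
  by rewrite /q; field; rewrite u0 ?v0.
have -> : 8 * A / s = 4 * (2 * A) / s by ring.
have vp w : dsk y r1 w -> 0 < nr (v w).
  by move=> wd; rewrite lt_neqAle nr_ge0 eq_sym nr_eq0 v0.
apply: (@log_deriv_bound R y r1 q (2 * A) s) => //; first by rewrite mulr_ge0.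
move=> w wd; rewrite /q !nrM !nrV ler_pdivrMr ?vp//.
have h1 := uv _ wd; have up : 0 < nr (u y) by rewrite lt_neqAle nr_ge0 eq_sym nr_eq0 u0.
have h2 : 1 <= expR A * (nr (u y) / nr (v y)) by rewrite mulrA ler_pdivlMr ?vp// mul1r.
apply: (le_trans h1); rewrite (_ : 2 * A = A + A); last by ring.
have e0 := expR_ge0 A; have n0 := nr_ge0 (v w).
have := ler_wpM2l (mulr_ge0 e0 n0) h2; rewrite expRD mulr1; lra.
Qed.

Definition spm n (l : 'I_n -> R) (E : C -> 'M[C]_n) w : 'M[C]_n :=
  diag_mx (\row_i (w - (l i)%:C)) - E w.

Lemma spm_lb n (l : 'I_n -> R) E w d e : (forall i, d <= nr (w - (l i)%:C)) -> 0 <= d ->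
  mxb (E w) e -> mxlb (spm l E w) (d - e).
Proof. by move=> h d0 hE; apply: mxlbB => //; apply: mxlb_diag => // i; rewrite mxE. Qed.

Lemma nr_sub_real (w : C) (x : R) : `|complex.Im w| <= nr (w - x%:C).
Proof. by have := nrIm (w - x%:C); rewrite ImB /= subr0. Qed.

Lemma nr_sub_Re (w : C) (x : R) : `|complex.Re w - x| <= nr (w - x%:C).
Proof. by have := nrRe (w - x%:C); rewrite raddfB. Qed.

Lemma spm_det_neq0 n (l : 'I_n -> R) E w d e : (forall i, d <= nr (w - (l i)%:C)) -> 0 <= e < d ->
  mxb (E w) e -> \det (spm l E w) != 0.
Proof.
move=> h /andP[e0 ed] hE; have [|u _] := @mxlb_unit R n (spm l E w) (d - e) _ (spm_lb h (le_trans e0 (ltW ed)) hE).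
  by rewrite subr_gt0.
by rewrite unitmxE unitfE in u.
Qed.

Lemma spm_hol n (l : 'I_n -> R) (E : C -> 'M[C]_n) (U : set C) : (forall i j, hol U (fun w => E w i j)) ->
  hol U (fun w => \det (spm l E w)).
Proof.
move=> h; apply: hol_det => i j z Uz.
have [d hdE] := h i j z Uz.
have h1 := hdB (hd_id z) (@hd_cst R C ((l i)%:C) z).
have [ij|ij] := eqVneq i j.
  exists (1 - 0 - d); apply: hd_ext (hdB h1 hdE) => w.
  by rewrite /spm !mxE ij eqxx mulr1n.
exists (0 - d); apply: hd_ext (hdB (@hd_cst R C 0 z) hdE) => w.
by rewrite /spm !mxE (negbTE ij) mulr0n.
Qed.

Lemma spm_det_ratio n (l : 'I_n -> R) E1 E2 w be ga : 0 < be -> 0 <= ga ->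
  mxlb (spm l E1 w) be -> mxb (E1 w - E2 w) ga ->
  nr (\det (spm l E2 w)) <= expR (n%:R * (ga / be)) * nr (\det (spm l E1 w)).
Proof.
move=> be0 ga0 lb hE; have [uX bX] := mxlb_unit be0 lb.
have h : mxb (invmx (spm l E1 w) *m spm l E2 w) (1 + ga / be).
  have -> : spm l E2 w = spm l E1 w + (E1 w - E2 w).
    by rewrite /spm addrA subrK.
  rewrite mulmxDr mulVmx//; apply: mxbD; first exact: mxb1.
  rewrite mulrC; apply: mxbM => //; rewrite invr_ge0 ltW//.
have := det_ratio_bound uX h; rewrite mulrC => /le_trans; apply.
rewrite ler_wpM2r ?nr_ge0// expRM_natl lerXn2r ?nnegrE ?expR_ge0//.
  by rewrite addr_ge0// divr_ge0// ltW.
exact: expR_ge1Dx.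
Qed.

Definition orect (a b d : R) : set C :=
  [set w | a < complex.Re w < b /\ - d < complex.Im w < d].

Lemma opn_orect a b d : opn (orect a b d).
Proof.
move=> w [/andP[w1 w2] /andP[w3 w4]].
exists (Num.min (Num.min (complex.Re w - a) (b - complex.Re w))
  (Num.min (complex.Im w + d) (d - complex.Im w))).
  by rewrite !lt_min; apply/andP; split; apply/andP; split; lra.
move=> u; rewrite !lt_min => /andP[/andP[h1 h2] /andP[h3 h4]].
have k1 := nrRe (u - w); have k2 := nrIm (u - w).
rewrite ImB ler_norml in k2; rewrite raddfB /= ler_norml in k1.
case/andP: k1 => k11 k12; case/andP: k2 => k21 k22.
by split; apply/andP; split; lra.
Qed.

Lemma rect_cont a b eta w : a < b -> 0 < eta -> rect a b eta w -> ~ inside a b eta w -> cont a b eta w.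
Proof.
move=> ab e0 [/andP[w1 w2] /andP[w3 w4]] ni.
have seg (p q : C) (t : R) : 0 <= t <= 1 -> complex.Re w = complex.Re p + t * (complex.Re q - complex.Re p) ->
   complex.Im w = complex.Im p + t * (complex.Im q - complex.Im p) -> onseg p q w.
  move=> t01 h1 h2; exists t => //; apply/eqP; rewrite eq_complex h1 h2.
  by case: p q {h1 h2} => p1 p2 [q1 q2] /=; rewrite !mul0r subr0 addr0 !eqxx.
have [wa|wa] := eqVneq (complex.Re w) a.
  apply: Or44; apply: (seg _ _ ((eta - complex.Im w) / (2 * eta))) => /=.
  - by rewrite divr_ge0 ?ler_pdivrMr ?mulr_gt0//=; lra.
  - by rewrite wa; ring.
  - by field; rewrite gt_eqF.
have [wb|wb] := eqVneq (complex.Re w) b.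
  apply: Or42; apply: (seg _ _ ((complex.Im w + eta) / (2 * eta))) => /=.
  - by rewrite divr_ge0 ?ler_pdivrMr ?mulr_gt0//=; lra.
  - by rewrite wb; ring.
  - by field; rewrite gt_eqF.
have w1' : a < complex.Re w by rewrite lt_neqAle eq_sym wa.
have w2' : complex.Re w < b by rewrite lt_neqAle wb.
have ba : 0 < b - a by lra.
have [we|we] := eqVneq (complex.Im w) (- eta).
  apply: Or41; apply: (seg _ _ ((complex.Re w - a) / (b - a))) => /=.
  - by rewrite divr_ge0 ?ler_pdivrMr//=; lra.
  - by rewrite divfK ?gt_eqF//; ring.
  - by rewrite we; ring.
have [we'|we'] := eqVneq (complex.Im w) eta.
  apply: Or43; apply: (seg _ _ ((b - complex.Re w) / (b - a))) => /=.
  - by rewrite divr_ge0 ?ler_pdivrMr//=; lra.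
  - by rewrite -[a - b]opprB mulrN divfK ?gt_eqF//; ring.
  - by rewrite we'; ring.
exfalso; apply: ni; split; first by rewrite w1' w2'.
by rewrite lt_neqAle eq_sym we w3 lt_neqAle we' w4.
Qed.

Definition insideb (a b eta : R) (z : C) :=
  (a < complex.Re z < b) && (- eta < complex.Im z < eta).

Lemma insideP a b eta z : reflect (inside a b eta z) (insideb a b eta z).
Proof. exact: andP. Qed.

(** The zeros outside the rectangle are absorbed into the zero-free factor. *)
Lemma argument_principle_split a b eta (U : set C) f zs phi : a < b -> 0 < eta ->
  opn U -> rect a b eta `<=` U -> hol U phi ->
  (forall w, U w -> f w = \prod_(z <- zs) (w - z) * phi w) ->
  (forall w, rect a b eta w -> phi w != 0) -> (forall w, cont a b eta w -> f w != 0) ->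
  complex.Im (cint a b eta (fun w => df f w / f w)) = (pi *+ 2) * (count (insideb a b eta) zs)%:R.
Proof.
move=> ab e0 oU rU ph fE p0 f0; rewrite -size_filter.
pose phi' w := \prod_(z <- zs | ~~ insideb a b eta z) (w - z) * phi w.
apply: (@argument_principle R a b eta U f _ phi') => //; try exact: ltW.
- by apply: holM => //; apply: hol_prod => z _; apply: (@holB R C); [exact: hol_id|exact: hol_cst].
- move=> w Uw; rewrite fE// /phi' mulrA; congr (_ * _).
  by rewrite big_filter (bigID (insideb a b eta)).
- move=> w rw; rewrite mulf_neq0 ?p0//; rewrite prodf_seq_neq0.
  apply/allP => z zz; apply/implyP => /insideP ni; rewrite subr_eq0; apply/eqP => wz.
  have cw : cont a b eta w by apply: rect_cont => //; rewrite wz.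
  have := f0 _ cw; rewrite fE; last exact: rU.
  by rewrite mulf_eq0 prodf_seq_eq0 negb_or => /andP[/hasPn/(_ z zz)]; rewrite wz subrr eqxx.
- by move=> z; rewrite mem_filter => /andP[/insideP].
Qed.

Lemma avoid_finite (s : seq R) (x y : R) : x < y -> exists2 t, x < t < y & t \notin s.
Proof.
move=> xy; pose p (j : nat) := x + (y - x) / j.+2%:R.
have d0 : 0 < y - x by rewrite subr_gt0.
have pj j : x < p j < y.
  have h1 : 0 < (y - x) / j.+2%:R by rewrite divr_gt0.
  have h2 : (y - x) / j.+2%:R < y - x by rewrite ltr_pdivrMr// ltr_pMr// ltr1n.
  by rewrite /p; move: h1 h2; set q := _ / _ => h1 h2; apply/andP; split; lra.
have inj : injective p.
  move=> i j /addrI/(mulfI (lt0r_neq0 d0))/invr_inj/eqP.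
  by rewrite eqr_nat => /eqP[].
apply: contrapT => h.
have all_in j : p j \in s.
  by apply: contrapT => /negP h'; apply: h; exists (p j).
have : (size (map p (iota 0 (size s).+1)) <= size s)%N.
  apply: uniq_leq_size; first by rewrite map_inj_uniq ?iota_uniq.
  by move=> t /mapP[j _ ->].
by rewrite size_map size_iota ltnn.
Qed.

End SpectralMatrix.

(** * A finite factorization of the determinant over a strip *)

Section SpectralZeros.
Variable R : realType.
Notation C := R[i].
Implicit Types (w z y : C) (f g phi u v : C -> C) (zs : seq C).

Let cC := @complete_complex R.

Lemma nr_le_sqr (w : C) (r : R) : 0 <= r ->
  complex.Re w ^+ 2 + complex.Im w ^+ 2 <= r ^+ 2 -> nr w <= r.
Proof. by move=> r0 h; rewrite -ler_sqr ?nnegrE ?nr_ge0// nr_sqr. Qed.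

Lemma count_le_cover (T : Type) (s : seq T) (p : pred T) (J : nat) (q : nat -> pred T) :
  (forall x, p x -> exists2 j, (j < J)%N & q j x) ->
  (count p s <= \sum_(j < J) count (q j) s)%N.
Proof.
move=> h; elim: s => [|x s ih] /=; first by [].
rewrite big_split /= leq_add//; case px : (p x) => //=.
have [j jJ qx] := h x px.
by rewrite (bigD1 (Ordinal jJ))//= qx.
Qed.

Lemma dsk_orect (c : C) (r a b d : R) : a <= complex.Re c - r -> complex.Re c + r <= b ->
  - d <= complex.Im c - r -> complex.Im c + r <= d -> dsk c r `<=` orect a b d.
Proof.
move=> h1 h2 h3 h4 w; rewrite /dsk/= => wr.
have k1 := le_lt_trans (nrRe (w - c)) wr; have k2 := le_lt_trans (nrIm (w - c)) wr.
rewrite ImB ltr_norml in k2; rewrite raddfB /= ltr_norml in k1.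
case/andP: k1 => k11 k12; case/andP: k2 => k21 k22.
by split; apply/andP; split; lra.
Qed.

Lemma sum_inv_bound (p q : C) (s : seq C) :
  {in s, forall z, (forall w, onseg p q w -> w != z) /\
    `|complex.Im (segint (fun w => (w - z)^-1) p q)| <= pi} ->
  (forall w, onseg p q w -> cts (fun w => \sum_(z <- s) (w - z)^-1) w) /\
  `|complex.Im (segint (fun w => \sum_(z <- s) (w - z)^-1) p q)| <= (size s)%:R * pi.
Proof.
elim: s => [|z s ih] hs.
  split.
    by move=> w _; apply: (@hd_cts R C _ _ 0); apply: hd_ext (@hd_cst R C 0 w) => u; rewrite big_nil.
  rewrite (@segint_ext _ _ _ (fun=> 0)) => [|w _]; last by rewrite big_nil.
  by rewrite /segint smean_cst scaler0 /= normr0 mul0r.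
have [|sc sb] := ih; first by move=> u us; apply: hs; rewrite inE us orbT.
have [zx zb] := hs z (mem_head _ _).
have zc w : onseg p q w -> cts (fun w => (w - z)^-1) w.
  move=> ow; apply: (@hd_cts R C); apply: hdV; first exact: (hdB (hd_id _) (hd_cst _ _)).
  by rewrite subr_eq0 zx.
have Es w : \sum_(z0 <- z :: s) (w - z0)^-1 = (w - z)^-1 + \sum_(z0 <- s) (w - z0)^-1.
  by rewrite big_cons.
split.
  move=> w cw e e1; have e2 : 0 < e / 2 by rewrite divr_gt0.
  have [r1 r10 h1] := zc _ cw _ e2; have [r2 r20 h2] := sc _ cw _ e2.
  exists (Num.min r1 r2); first by rewrite lt_min r10.
  move=> u; rewrite lt_min => /andP[/h1 k1 /h2 k2]; rewrite !Es opprD addrACA.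
  by rewrite (splitr e) (le_trans (nrD _ _))// lerD.
have -> : segint (fun w => \sum_(z0 <- z :: s) (w - z0)^-1) p q =
   segint (fun w => (w - z)^-1 + \sum_(z0 <- s) (w - z0)^-1) p q.
  by apply: segint_ext => w _; exact: Es.
rewrite (segintD cC zc sc) ImD (le_trans (ler_normD _ _))//.
have -> : (size (z :: s))%:R * pi = pi + (size s)%:R * pi :> R by rewrite /= -nat1r mulrDl mul1r.
exact: lerD.
Qed.

Lemma atan_diff_le (x y : R) : `|atan x - atan y| <= pi.
Proof.
have h1 := atan_ltpi2 x; have h2 := atan_gtNpi2 x.
have h3 := atan_ltpi2 y; have h4 := atan_gtNpi2 y.
by rewrite ler_norml; apply/andP; split; lra.
Qed.

Variables (a b de ep : R).
Hypotheses (de0 : 0 < de) (ab : a < b) (ep0 : 0 < ep) (epde : ep <= de / 2048).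

Let W := orect (a - de) (b + de) de.
Let K := rect (a - de / 8) (b + de / 8) (de / 64).

Lemma K_sub_W : K `<=` W.
Proof.
move=> w [/andP[w1 w2] /andP[w3 w4]]; have d0 := de0.
by split; apply/andP; split; lra.
Qed.

(** Jensen's inequality serves here only to make the number of zeros finite, so the bound may be
    crude. The zeros lie within [ep] of the real axis, and they are reached by discs centred at
    height [de / 8], where the determinant does not vanish. *)
Lemma spm_zeros n (l : 'I_n -> R) (E : C -> 'M[C]_n) :
  (forall i j, hol W (fun w => E w i j)) -> (forall w, W w -> mxb (E w) ep) ->
  exists zs phi, [/\ {in zs, forall z, K z}, hol W phi,
    forall w, W w -> \det (spm l E w) = \prod_(z <- zs) (w - z) * phi w &
    forall w, W w -> a - de / 8 <= complex.Re w <= b + de / 8 -> phi w != 0].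
Proof.
move=> Eh Eb; pose f w := \det (spm l E w).
have fh : hol W f by exact: spm_hol.
have d0 := de0; have e0 := ep0; have ed := epde.
have fnz w : W w -> ep < `|complex.Im w| -> f w != 0.
  move=> Ww wi; apply: (@spm_det_neq0 R n l E w `|complex.Im w| ep).
  - by move=> i; exact: nr_sub_real.
  - by rewrite wi ltW.
  - exact: Eb.
suff [zs [phi [zK ph fE p0]]] : exists zs phi, [/\ {in zs, forall z, K z}, hol W phi,
    forall w, W w -> f w = \prod_(z <- zs) (w - z) * phi w & forall z, K z -> phi z != 0].
  exists zs, phi; split => // w Ww /andP[w1 w2].
  have [h|h] := leP `|complex.Im w| ep.
    apply: p0; split; first by rewrite w1 w2.
    by move: h; rewrite ler_norml => /andP[h1 h2]; apply/andP; split; lra.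
  by have := fnz _ Ww h; rewrite fE// mulf_eq0 negb_or => /andP[].
have [J hJ] : exists J : nat, (b - a + de / 4) / (de / 16) < J%:R.
  by exists (Num.truncn ((b - a + de / 4) / (de / 16))).+1; exact: truncnS_gt.
(* Centres [de / 16] apart at height [de / 8]: discs of radius [(de / 2) / 3] cover [K], since
   [(1/16)^2 + (9/64)^2 < (1/6)^2]. *)
pose x (j : nat) : R := a - de / 8 + j%:R * (de / 16).
pose y (j : nat) : C := x j +i* (de / 8).
pose q (j : nat) (z : C) := nr (z - y j) <= (de / 2) / 3.
pose B j := (de / 2 + \sum_i nr (y j - (l i)%:C) + ep) ^+ n.
pose N j := (Num.truncn (B j / nr (f (y j)))).+1.
(* Centres beyond [b + de / 8] are discarded, which keeps the discs of radius [3 * de / 4] inside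
   [W]. *)
pose qq j z := q j z && (x j <= b + de / 8).
apply: (@zero_factor R W K f (\sum_(j < J) N j)%N) => //.
- exact: opn_orect.
- exact: K_sub_W.
move=> zs phi zK ph fE.
have cov z : z \in zs -> exists2 j, (j < J)%N & qq j z.
  move=> /zK[/andP[z1 z2] /andP[z3 z4]].
  pose t := (complex.Re z - (a - de / 8)) / (de / 16).
  have d16 : 0 < de / 16 by rewrite divr_gt0.
  have t0 : 0 <= t by rewrite divr_ge0 ?(ltW d16)//; lra.
  have /andP[t1 t2] := truncn_itv t0.
  pose j := Num.truncn t; rewrite -/j in t1 t2.
  have x1 : x j <= complex.Re z.
    by move: t1; rewrite /t ler_pdivlMr// /x; lra.
  have x2 : complex.Re z < x j + de / 16.
    by move: t2; rewrite /t ltr_pdivrMr// /x -(natr1 j); lra.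
  exists j.
    rewrite -(ltr_nat R); apply: le_lt_trans t1 _; apply: le_lt_trans hJ.
    by rewrite /t ler_pM2r ?invr_gt0//; lra.
  rewrite /qq /q; apply/andP; split; last by lra.
  apply: nr_le_sqr; first by lra.
  rewrite ImB raddfB /=.
  have h1 : (complex.Re z - x j) ^+ 2 <= (de / 16) ^+ 2 by rewrite lerXn2r ?nnegrE; lra.
  have h2 : (complex.Im z - de / 8) ^+ 2 <= (de * 9 / 64) ^+ 2.
    rewrite -[leLHS]sqrrN lerXn2r ?nnegrE; lra.
  by nra.
apply: (@leq_trans (count [in zs] zs)).
  by rewrite (@eq_in_count _ _ predT) ?count_predT// => z ->.
apply: (leq_trans (@count_le_cover _ zs _ J qq _)); first by move=> z /cov.
apply: leq_sum => j _; have [xj|xj] := leP (x j) (b + de / 8); last first.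
  rewrite (@eq_count _ _ pred0) ?count_pred0// => z.
  by rewrite /qq leNgt xj andbF.
have xa : a - de / 8 <= x j by rewrite /x lerDl mulr_ge0// ltW// divr_gt0.
have dW : dsk (y j) (3 * de / 4) `<=` W by apply: dsk_orect => /=; lra.
have yW : W (y j) by apply: dW; rewrite /dsk/= subrr nr0; lra.
have fy0 : f (y j) != 0 by apply: fnz => //=; rewrite ger0_norm; lra.
have fyp : 0 < nr (f (y j)) by rewrite lt_neqAle nr_ge0 eq_sym nr_eq0 fy0.
pose phi' w := \prod_(z <- zs | ~~ qq j z) (w - z) * phi w.
have jc := @jensen_count R (y j) (de / 2) (3 * de / 4) f [seq z <- zs | qq j z] phi' (B j).
have [|||||h _] := jc.
- by apply/andP; split; lra.
- apply: (hol_sub dW); apply: holM => //; apply: hol_prod => z _.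
  by apply: (@holB R C); [exact: hol_id|exact: hol_cst].
- move=> w /dW Ww; rewrite fE// /phi' mulrA; congr (_ * _).
  by rewrite big_filter (bigID (qq j)).
- by move=> z; rewrite mem_filter => /andP[/andP[]].
- move=> w wr; apply: det_bound.
  have Ww : W w by apply: dW; rewrite /dsk/= wr; lra.
  apply: mxbD; last exact/mxbN/Eb.
  apply: mxb_diag => [i|]; last by rewrite addr_ge0 ?sumr_ge0// => *; rewrite ?nr_ge0//; lra.
  rewrite mxE (le_trans (nr_triang (y j) _ _))// wr lerD2l (bigD1 i)//= lerDl sumr_ge0// => *.
  exact: nr_ge0.
rewrite -size_filter; apply: ltnW; rewrite -(ltr_nat R); apply: le_lt_trans (truncnS_gt _).
rewrite ler_pdivlMr//; apply: le_trans h; rewrite ler_wpM2r ?nr_ge0//.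
by rewrite -natrX ler_nat ltnW// ltn_expl.
Qed.

End SpectralZeros.

(** * The quotient by the block of the far eigenvalues *)

Section ZeroComparison.
Variable R : realType.
Notation C := R[i].
Implicit Types (w z : C) (zs : seq C).

Let cC := @complete_complex R.

Variables (a b de ep : R) (n k : nat) (lP : 'I_n -> R) (lQ : 'I_k -> R).
Variable E : C -> 'M[C]_(n + k).
Hypotheses (de0 : 0 < de) (ab : 8 * de <= b - a) (ep0 : 0 < ep) (epde : ep <= de / 2048).
Hypothesis epab : 256 * ep * (b - a) <= (de / 64) ^+ 2.
Hypothesis lQab : forall j, de < `|lQ j - a| /\ de < `|lQ j - b|.

Let W := orect (a - de) (b + de) de.
Let eta := de / 64.

Hypothesis Eh : forall i j, hol W (fun w => E w i j).
Hypothesis Eb : forall w, W w -> mxb (E w) ep.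

Definition spl (i : 'I_(n + k)) : R :=
  match fintype.split i with inl i => lP i | inr j => lQ j end.

Let EQ w := drsubmx (E w).
Let E1 w := ulsubmx (E w) + ursubmx (E w) *m invmx (spm lQ EQ w) *m dlsubmx (E w).
Let f w := \det (spm spl E w).
Let d w := \det (spm lQ EQ w).
(** Where the far block is well invertible, [g] is the determinant of the Schur complement, of size
    [n]; elsewhere in the strip it may have poles at the zeros of [d]. *)
Let g w := f w / d w.

Lemma EQ_hol i j : hol W (fun w => EQ w i j).
Proof.
by move=> z Wz; have [D h] := Eh (rshift n i) (rshift n j) Wz; exists D; apply: hd_ext h => w; rewrite /EQ !mxE.
Qed.

Lemma EQ_bound w : W w -> mxb (EQ w) ep.
Proof. by move=> /Eb/mxb_ul[]. Qed.

Lemma spl_l i : spl (lshift k i) = lP i.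
Proof. by rewrite /spl; case: split_ordP => j; [move=> /lshift_inj ->|move/eqP; rewrite eq_lrshift]. Qed.

Lemma spl_r j : spl (rshift n j) = lQ j.
Proof. by rewrite /spl; case: split_ordP => i; [move/eqP; rewrite eq_rlshift|move=> /rshift_inj ->]. Qed.

(** At distance [3 * ep] from the far eigenvalues their block is bounded below by [2 * ep], so the
    Schur correction is at most [ep * (2 * ep)^-1 * ep = ep / 2]. *)
Lemma spm_schur w : W w -> (forall j, 3 * ep <= nr (w - (lQ j)%:C)) ->
  [/\ d w != 0, mxb (E1 w) (2 * ep) & f w = d w * \det (spm lP E1 w)].
Proof.
move=> Ww far; have e0 := ep0.
have lb : mxlb (spm lQ EQ w) (2 * ep).
  have -> : 2 * ep = 3 * ep - ep by ring.
  by apply: spm_lb => //; [lra|exact: EQ_bound].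
have [u ub] := mxlb_unit (mulr_gt0 (ltr0n _ 2) e0) lb.
have Edr : drsubmx (spm spl E w) = spm lQ EQ w.
  by apply/matrixP => i j; rewrite !mxE eq_rshift spl_r.
have Eul : ulsubmx (spm spl E w) = spm lP (fun w => ulsubmx (E w)) w.
  by apply/matrixP => i j; rewrite !mxE eq_lshift spl_l.
have Eur : ursubmx (spm spl E w) = - ursubmx (E w).
  by apply/matrixP => i j; rewrite !mxE eq_lrshift mulr0n sub0r.
have Edl : dlsubmx (spm spl E w) = - dlsubmx (E w).
  by apply/matrixP => i j; rewrite !mxE eq_rlshift mulr0n sub0r.
have [b1 b2 b3 b4] := mxb_ul (Eb Ww).
split.
- by move: u; rewrite unitmxE unitfE.
- apply: (@mxb_le R _ _ _ (ep + ep * (2 * ep)^-1 * ep)).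
    by rewrite (_ : ep * _ * ep = ep / 2); [lra|field; rewrite gt_eqF].
  apply: mxbD => //; apply: mxbM => //; first by rewrite mulr_ge0 ?invr_ge0 ?mulr_ge0// ltW.
  by apply: mxbM => //; exact: ltW.
- rewrite /f det_schur Edr// Eul Eur Edl /d; congr (_ * \det _).
  rewrite /spm /E1 !mulNmx mulmxN opprK opprD addrA; congr (_ - _ - _).
Qed.

Let d_hol : hol W d.
Proof. by apply: spm_hol => i j; exact: EQ_hol. Qed.

Let f_hol : hol W f.
Proof. exact: spm_hol. Qed.

Variables (zs : seq C) (phi : C -> C).
Hypothesis ph : hol W phi.
Hypothesis fE : forall w, W w -> f w = \prod_(z <- zs) (w - z) * phi w.
Hypothesis p0 : forall w, W w -> a - de / 8 <= complex.Re w <= b + de / 8 -> phi w != 0.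

(** The centre is lifted off the axis by [de / 32], to a point where the Schur complement is bounded
    below. The radius is a third of that of Jensen's disc, [de / 5], and still covers the zeros
    whose real part is within [de / 64] of [x] ([near_end]). *)
Definition near_pt (x : R) (z : C) := nr (z - (x +i* (de / 32))) <= de / 15.

Section Vertical.
Variable x : R.
Hypothesis xab : x = a \/ x = b.

Let y : C := x +i* (de / 32).

Let yW : dsk y (de / 4) `<=` W.
Proof.
have d0 := de0; have ab' := ab.
by apply: dsk_orect; rewrite /y /=; case: xab => e; lra.
Qed.

Let far w : dsk y (de / 4) w -> forall j, 3 * ep <= nr (w - (lQ j)%:C).
Proof.
move=> wd j; have h := nr_sub_Re w (lQ j); apply: le_trans h.
have := nrRe (w - y); rewrite raddfB /y /= => h.
have h2 := le_lt_trans h wd.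
have lx : de < `|lQ j - x| by have [] := lQab j; case: xab => ->.
have := ler_normD (complex.Re w - lQ j) (x - complex.Re w).
rewrite addrC addrA subrK (distrC x (lQ j)) (distrC x (complex.Re w)).
have := epde; have := de0; lra.
Qed.

Let g_ne_formula w : dsk y (de / 4) w -> d w != 0 /\ g w = \det (spm lP E1 w).
Proof.
move=> wd; have [d0 _ h] := spm_schur (yW wd) (far wd); split => //.
by rewrite /g h mulrC mulKf.
Qed.

(** The base of the power is at most [1 + 16 + 1]: the matrix at [y] is bounded below by [de / 64],
    and over the disc it moves by at most [de / 4 + 4 * ep]. It is rounded up to 32, a power of 2,
    for comparison with Jensen's [2 ^+ _]. *)
Let g_growth w : dsk y (de / 4) w -> nr (g w) <= 32 ^+ n * nr (g y).
Proof.
have dp := de0; have epd := epde; have ep0' := ep0.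
have yd : dsk y (de / 4) y by rewrite /dsk/= subrr nr0; lra.
move=> wd; rewrite (g_ne_formula wd).2 (g_ne_formula yd).2.
have [_ bw _] := spm_schur (yW wd) (far wd).
have [_ by' _] := spm_schur (yW yd) (far yd).
have lb : mxlb (spm lP E1 y) (de / 64).
  move=> v; apply: (@le_trans _ _ ((de / 32 - 2 * ep) * vn v)).
    by rewrite ler_wpM2r ?vn_ge0//; lra.
  apply: spm_lb => //; last by lra.
  by move=> i; have := nr_sub_real y (lP i); rewrite /= ger0_norm; lra.
have de64 : 0 < de / 64 by lra.
have [u ub] := mxlb_unit de64 lb.
rewrite mulrC; apply: det_ratio_bound => //.
have -> : spm lP E1 w = spm lP E1 y + ((w - y)%:M + (E1 y - E1 w)).
  rewrite /spm; move: (E1 w) (E1 y) => A B; apply/matrixP => i j; rewrite !mxE.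
  by case: eqVneq => _; rewrite ?mulr1n ?mulr0n; ring.
rewrite mulmxDr mulVmx//.
apply: (@mxb_le R _ _ _ (1 + (de / 64)^-1 * (de / 4 * 1 + (2 * ep + 2 * ep)))).
  have -> : (de / 64)^-1 * (de / 4 * 1 + (2 * ep + 2 * ep)) = 16 + 256 * ep / de.
    by field; rewrite gt_eqF.
  have : 256 * ep / de <= 1 by rewrite ler_pdivrMr//; lra.
  lra.
apply: mxbD; first exact: mxb1.
apply: mxbM => //; first by rewrite invr_ge0 ltW.
apply: mxbD; last exact: (mxbD by' (mxbN bw)).
rewrite -scalemx1; apply: (@mxb_le R _ _ _ (nr (w - y) * 1)); last exact/mxbZ/mxb1.
by rewrite ler_wpM2r// ltW.
Qed.

Let gy0 : g y != 0.
Proof.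
have dp := de0; have epd := epde; have ep0' := ep0.
have yd : dsk y (de / 4) y by rewrite /dsk/= subrr nr0; lra.
have [_ by' _] := spm_schur (yW yd) (far yd).
rewrite (g_ne_formula yd).2; apply: (@spm_det_neq0 R n lP E1 y (de / 32) (2 * ep)) => //.
  by move=> i; have := nr_sub_real y (lP i); rewrite /= ger0_norm; lra.
by apply/andP; split; lra.
Qed.

Let psi w := \prod_(z <- zs | ~~ near_pt x z) (w - z) * phi w / d w.

Let psi_hol : hol (dsk y (de / 4)) psi.
Proof.
apply: holM; last by apply: holV; [move=> w /g_ne_formula[]|exact: hol_sub yW d_hol].
apply: holM; last exact: hol_sub yW ph.
by apply: hol_prod => z _; apply: (@holB R C); [exact: hol_id|exact: hol_cst].
Qed.

Let gE w : dsk y (de / 4) w ->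
  g w = \prod_(z <- [seq z <- zs | near_pt x z]) (w - z) * psi w.
Proof.
move=> wd; rewrite /g fE; last exact: yW.
rewrite /psi !mulrA big_filter; congr (_ * _ * _).
by rewrite (bigID (near_pt x)).
Qed.

Let jensen : 2 ^+ (count (near_pt x) zs) * nr (g y) <= 32 ^+ n * nr (g y) /\
  forall w, nr (w - y) < de / 5 -> nr (psi w) <= 32 ^+ n * nr (psi y).
Proof.
have dp := de0.
have gyp : 0 < nr (g y) by rewrite lt_neqAle nr_ge0 eq_sym nr_eq0 gy0.
have [|||h1 h2] := @jensen_count R y (de / 5) (de / 4) g _ psi (32 ^+ n * nr (g y)) _ psi_hol gE.
- by apply/andP; split; lra.
- move=> z; rewrite mem_filter => /andP[h _]; rewrite -/y; move: h; rewrite /near_pt -/y; lra.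
- by move=> w wy; apply: g_growth; rewrite /dsk/= wy; lra.
split; first by rewrite -size_filter.
move=> w /h2; move: gyp; move: (nr (g y)) (nr (psi w)) (nr (psi y)) (32 ^+ n) => G u v c G0 h.
rewrite -(ler_pM2r G0); lra.
Qed.

Lemma near_count : (count (near_pt x) zs <= 5 * n)%N.
Proof.
have [h _] := jensen; have gyp : 0 < nr (g y) by rewrite lt_neqAle nr_ge0 eq_sym nr_eq0 gy0.
rewrite ler_pM2r// (_ : 32 = 2 ^+ 5) -?exprM in h; last by rewrite -natrX.
by rewrite -!natrX ler_nat leq_exp2l in h.
Qed.

(** Each of the at most [5 * n] near zeros turns the argument by at most [pi]. The zero-free factor
    [psi] has a logarithm on the disc of radius [de / 15], which stays within [8 * M] of its value
    at [y]; both ends of the side together give [16 * M], with [M] close to [5 * n]. *)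
Lemma vertical_bound (x' : R) : `|x' - x| <= de / 64 -> (forall z, z \in zs -> complex.Re z != x') ->
  `|complex.Im (segint (fun w => df g w / g w) (x' +i* (- eta)) (x' +i* eta))| <=
  5 * n%:R * pi + 80 * n%:R.
Proof.
move=> xx' nz; have dp := de0.
pose p := x' +i* (- eta) : C; pose q := x' +i* eta : C.
have pq_near w : onseg p q w -> nr (w - y) <= de / 20.
  apply: (cvx_cdsk (c := y)); rewrite /cdsk/=; apply: nr_le_sqr; try lra;
  rewrite /p /q /y /eta /=; have := xx'; rewrite ler_norml => /andP[h1 h2]; nra.
have dsub r : r <= de / 4 -> dsk y r `<=` dsk y (de / 4).
  by move=> h w; rewrite /dsk/= => /lt_le_trans; apply.
have psi0 w : dsk y (de / 15) w -> psi w != 0.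
  move=> wd; have wd4 : dsk y (de / 4) w by apply: dsub wd; lra.
  have [dn _] := g_ne_formula wd4.
  rewrite /psi !mulf_neq0 ?invr_eq0//.
    rewrite prodf_seq_neq0; apply/allP => z _; apply/implyP => nn.
    rewrite subr_eq0; apply: contraNneq nn => <-.
    by rewrite /near_pt -/y ltW.
  apply: p0; first exact: yW.
  have wr : `|complex.Re w - x| < de / 15.
    by apply: le_lt_trans wd; have := nrRe (w - y); rewrite raddfB.
  move: wr; rewrite ltr_norml => /andP[h1 h2].
  by have := ab; case: xab => e h3; apply/andP; split; lra.
have gE' w : onseg p q w -> df g w / g w =
    \sum_(z <- [seq z <- zs | near_pt x z]) (w - z)^-1 + df psi w / psi w.
  move=> ow; have wy := pq_near _ ow.
  have wd : dsk y (de / 4) w by rewrite /dsk/=; lra.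
  apply: (logd_dfE (@opn_dsk R y (de / 4)) wd psi_hol gE).
  rewrite gE// mulf_neq0 ?psi0//; last by rewrite /dsk/=; lra.
  rewrite prodf_seq_neq0; apply/allP => z; rewrite mem_filter => /andP[_ /nz zx] /=.
  rewrite subr_eq0; apply: contraNneq zx => <-.
  have /Re_onseg[t _ [-> _]] := ow; by rewrite /p /q /= subrr mulr0 addr0.
have lh : hol (dsk y (de / 15)) (fun w => df psi w / psi w).
  have ps : hol (dsk y (de / 15)) psi by apply: hol_sub psi_hol; apply: dsub; lra.
  by apply: holM; [exact: (df_hol cC (@opn_dsk R y _) ps)|exact: holV].
have lc w : onseg p q w -> cts (fun w => df psi w / psi w) w.
  by move=> /pq_near h; apply: (hol_cts lh); rewrite /dsk/=; lra.
have [|sc sb] := @sum_inv_bound R p q [seq z <- zs | near_pt x z].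
  move=> z; rewrite mem_filter => /andP[_ /nz zx].
  have zx' : x' - complex.Re z != 0 by rewrite subr_eq0 eq_sym.
  split; last by rewrite (@Im_inv_vertical R x' (- eta) eta z zx') atan_diff_le.
  move=> w ow; apply: contraNneq zx => <-.
  by have /Re_onseg[t _ [-> _]] := ow; rewrite /p /q /= subrr mulr0 addr0.
rewrite -/p -/q (segint_ext gE') (segintD cC sc lc) ImD (le_trans (ler_normD _ _))//.
apply: lerD.
  apply: (le_trans sb); rewrite ler_wpM2r ?pi_ge0// -natrM ler_nat size_filter.
  exact: near_count.
apply/ler_addgt0Pr => tau tau0.
(* [32 ^+ n] is [2 ^+ (5 * n)], at most [expR (5 * n)]. The term [tau / 16] makes [M] positive and
   costs [tau] in the end. *)
pose M := 5 * n%:R + tau / 16 : R.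
have M0 : 0 < M by rewrite /M ltr_wpDl ?mulr_ge0// divr_gt0.
have de15 : 0 < de / 15 by lra.
have ps15 : hol (dsk y (de / 15)) psi by apply: hol_sub psi_hol; apply: dsub; lra.
have psM w : dsk y (de / 15) w -> nr (psi w) <= expR M * nr (psi y).
  move=> wd; have [_ jj] := jensen.
  have wy : nr (w - y) < de / 5 by apply: (lt_trans wd); lra.
  apply: (le_trans (jj w wy)); rewrite ler_wpM2r ?nr_ge0//.
  have -> : (32 : R) = 2 ^+ 5 by rewrite -natrX.
  rewrite -exprM; apply: (@le_trans _ _ (expR (5 * n)%:R)); last first.
    by rewrite ler_expR natrM lerDl ltW// divr_gt0.
  rewrite -[(5 * n)%:R]mulr1 expRM_natl lerXn2r ?nnegrE ?expR_ge0//.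
  exact: expR_ge1Dx.
have [l ld lb] := borel_caratheodory de15 M0 ps15 psi0 psM.
have -> : segint (fun w => df psi w / psi w) p q = l q - l p.
  apply: (segint_FTC cC) => // w ow; apply: ld; rewrite /dsk/=.
  by apply: (le_lt_trans (pq_near _ ow)); lra.
have lbb w : onseg p q w -> nr (l w - l y) <= 8 * M.
  move=> /pq_near h.
  (* [2 * M * (de / 20) / (de / 16 - de / 20)] equals [8 * M]. *)
  apply: (le_trans (lb w (de / 16) (de / 20) h _)); first by apply/andP; split; lra.
  rewrite le_eqVlt; apply/orP; left; apply/eqP; field; rewrite gt_eqF//; lra.
apply: (le_trans (nrIm _)); apply: (le_trans (nr_triang (l y) _ _)).
have h1 := lbb _ (onseg_r p q); have h2 := lbb _ (onseg_l p q).
by rewrite (nrC (l y)); apply: (le_trans (lerD h1 h2)); rewrite /M; lra.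
Qed.

End Vertical.

Let far_Im u : 3 * eta / 4 <= `|complex.Im u| -> forall j, 3 * ep <= nr (u - (lQ j)%:C).
Proof.
move=> h j; apply: le_trans (nr_sub_real u (lQ j)); apply: le_trans h.
by have := epde; have := de0; rewrite /eta; lra.
Qed.

(** At height [eta] the Schur complement is a small perturbation of the diagonal matrix of the near
    eigenvalues, whose determinant [F] turns by at most [n * pi]. The logarithmic derivatives of [g]
    and [F] differ by at most [n * (256 * ep / eta ^+ 2)], so the side costs at most [n] more: this
    is the origin of [epab], and of the need for [ep] of order [de^2]. *)
Lemma horizontal_bound (y0 x0 x1 : R) : `|y0| = eta -> a - de / 2 <= x0 -> x0 <= x1 ->
  x1 <= b + de / 2 -> x1 - x0 <= b - a ->
  `|complex.Im (segint (fun w => df g w / g w) (x0 +i* y0) (x1 +i* y0))| <= n%:R * pi + n%:R.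
Proof.
move=> y0e x0a x01 x1b xab; have dp := de0; have epd := epde; have ep0' := ep0.
have eta0 : 0 < eta by rewrite /eta; lra.
pose p := x0 +i* y0 : C; pose q := x1 +i* y0 : C.
pose F w := \det (spm lP (fun=> 0) w).
have FE w : F w = \prod_(z <- [seq (lP i)%:C | i <- enum 'I_n]) (w - z) * 1.
  rewrite /F /spm subr0 det_diag mulr1 big_map big_enum.
  by apply: eq_bigr => i _; rewrite mxE.
have segW w : onseg p q w -> complex.Im w = y0 /\ dsk w (eta / 4) `<=` W.
  move=> /Re_onseg[t /andP[t0 t1] [h1 h2]].
  have hIm : complex.Im w = y0 by rewrite h2 /p /q /= subrr mulr0 addr0.
  split=> //; move: y0e; rewrite /eta => y0e.
  have := ler_norm y0; have := ler_norm (- y0); rewrite normrN y0e => g1 g2.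
  by apply: dsk_orect; rewrite ?hIm ?h1 /p /q /=; nra.
have Im_disc w u : onseg p q w -> dsk w (eta / 4) u -> 3 * eta / 4 <= `|complex.Im u|.
  move=> /segW[hw _] wu; have := nrIm (u - w); rewrite ImB hw => h.
  have := lerB_dist y0 (complex.Im u); rewrite y0e (distrC y0).
  rewrite /dsk/= in wu; lra.
have disc w u : onseg p q w -> dsk w (eta / 4) u ->
    [/\ d u != 0, g u = \det (spm lP E1 u), mxlb (spm lP E1 u) (eta / 2),
        mxlb (spm lP (fun=> 0) u) (eta / 2) & mxb (E1 u) (2 * ep)].
  move=> ow du; have iu := Im_disc _ _ ow du; have [_ sW] := segW _ ow.
  have [dn bE fEq] := spm_schur (sW _ du) (far_Im iu).
  have fP i : 3 * eta / 4 <= nr (u - (lP i)%:C) by exact: le_trans iu (nr_sub_real _ _).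
  split=> //; first by rewrite /g fEq mulrC mulKf.
    move=> v; apply: (@le_trans _ _ ((3 * eta / 4 - 2 * ep) * vn v)).
      by rewrite ler_wpM2r ?vn_ge0//; move: eta0; rewrite /eta; lra.
    by apply: spm_lb => //; lra.
  move=> v; apply: (@le_trans _ _ ((3 * eta / 4 - 0) * vn v)).
    by rewrite ler_wpM2r ?vn_ge0//; lra.
  by apply: spm_lb => //; [lra|move=> u'; rewrite mul0mx mul0r le_eqVlt; apply/orP; left; rewrite vn_eq0].
pose A := n%:R * (2 * ep / (eta / 2)).
have A0 : 0 <= A by rewrite mulr_ge0// divr_ge0//; lra.
have gh w : onseg p q w -> hol (dsk w (eta / 4)) g.
  move=> ow; have [_ sW] := segW _ ow; apply: holM; first exact: hol_sub sW f_hol.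
  by apply: holV; [move=> u /(disc _ _ ow)[]|exact: hol_sub sW d_hol].
have Fh U : hol U F by apply: spm_hol => i j; exact: hol_cst.
have gn w u : onseg p q w -> dsk w (eta / 4) u -> g u != 0.
  move=> ow /(disc _ _ ow)[_ -> lb _ _].
  have [|uX _] := mxlb_unit _ lb; first by lra.
  by move: uX; rewrite unitmxE unitfE.
have Fn w u : onseg p q w -> dsk w (eta / 4) u -> F u != 0.
  move=> ow /(disc _ _ ow)[_ _ _ lb _].
  have [|uX _] := mxlb_unit _ lb; first by lra.
  by move: uX; rewrite unitmxE unitfE.
have diff w : onseg p q w -> nr (df g w / g w - df F w / F w) <= 8 * A / (eta / 8).
  move=> ow; have e2 : 0 < eta / 2 by lra.
  have ep2 : 0 <= 2 * ep by lra.
  apply: (@log_deriv_diff R w (eta / 4) g F A (eta / 8)) => //.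
  - by apply/andP; split; lra.
  - exact: gh.
  - by move=> u; exact: gn.
  - by move=> u; exact: Fn.
  - move=> u /(disc _ _ ow)[_ -> _ lb bE].
    have bb : mxb ((fun=> 0 : 'M[C]_n) u - E1 u) (2 * ep) by rewrite /= sub0r; exact: (mxbN bE).
    exact: (spm_det_ratio e2 ep2 lb bb).
  - have ww : dsk w (eta / 4) w by rewrite /dsk/= subrr nr0; lra.
    have [_ -> lb _ bE] := disc w w ow ww.
    have bb : mxb (E1 w - (fun=> 0 : 'M[C]_n) w) (2 * ep) by rewrite /= subr0; exact: bE.
    exact: (spm_det_ratio e2 ep2 lb bb).
have wd w : dsk w (eta / 4) w by rewrite /dsk/= subrr nr0; lra.
have FEq w : onseg p q w -> df F w / F w = \sum_(z <- [seq (lP i)%:C | i <- enum 'I_n]) (w - z)^-1.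
  move=> ow; rewrite (@logd_dfE R (dsk w (eta / 4)) F _ (fun=> 1) w (@opn_dsk R w _) (wd w) (hol_cst _) (fun u _ => FE u)).
    by rewrite (df_hd (@hd_cst R C 1 w)) mul0r addr0.
  exact: Fn ow (wd w).
have [|sc sb] := @sum_inv_bound R p q [seq (lP i)%:C | i <- enum 'I_n].
  move=> z /mapP[i _ ->].
  have y00 : y0 - complex.Im (lP i)%:C != 0.
    by rewrite /= subr0 -normr_eq0 y0e gt_eqF.
  split; last by rewrite (@Im_inv_horizontal R x0 x1 y0 _ y00) atan_diff_le.
  move=> w /segW[hw _]; apply: contraNneq y00 => <-; rewrite hw subrr//.
have dc w : onseg p q w -> cts (fun w => df g w / g w - df F w / F w) w.
  move=> ow; have h : hol (dsk w (eta / 4)) (fun w => df g w / g w - df F w / F w).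
    apply: (@holB R C); apply: holM.
    - exact: (df_hol cC (@opn_dsk R w _) (gh _ ow)).
    - by apply: holV; [move=> u; exact: gn|exact: gh].
    - exact: (df_hol cC (@opn_dsk R w _) (Fh _)).
    - by apply: holV; [move=> u; exact: Fn|exact: Fh].
  exact: hol_cts h (wd w).
have -> : segint (fun w => df g w / g w) p q =
   segint (fun w => \sum_(z <- [seq (lP i)%:C | i <- enum 'I_n]) (w - z)^-1 + (df g w / g w - df F w / F w)) p q.
  by apply: segint_ext => w ow; rewrite -FEq// addrC subrK.
rewrite (segintD cC sc dc) ImD (le_trans (ler_normD _ _))//.
apply: lerD; first by move: sb; rewrite size_map size_enum_ord.
apply: (le_trans (nrIm _)); apply: (le_trans (segint_nr_le cC dc diff)).
have -> : q - p = (x1 - x0)%:C by apply/eqP; rewrite eq_complex /= subrr !eqxx.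
rewrite nr_real ger0_norm ?subr_ge0//.
have -> : 8 * A / (eta / 8) = n%:R * (256 * ep / eta ^+ 2).
  by rewrite /A; field; rewrite gt_eqF.
apply: (@le_trans _ _ (n%:R * 1)); last by rewrite mulr1.
rewrite -(mulrA n%:R); apply: ler_wpM2l; first exact: ler0n.
have h1 : 0 <= 256 * ep / eta ^+ 2 by apply: divr_ge0; [lra|exact: sqr_ge0].
apply: (le_trans (ler_wpM2l h1 xab)).
by rewrite mulrAC ler_pdivrMr ?exprn_gt0// mul1r.
Qed.
End ZeroComparison.

(** * The number of zeros of the far block *)

Section Homotopy.
Variable R : realType.
Notation C := R[i].
Implicit Types (w z : C) (zs : seq C).

Let cC := @complete_complex R.

Lemma cint_nr_le (a b eta M : R) (g : C -> C) : a <= b -> 0 <= eta ->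
  (forall w, cont a b eta w -> cts g w) -> (forall w, cont a b eta w -> nr (g w) <= M) ->
  nr (cint a b eta g) <= M * (2 * (b - a) + 4 * eta).
Proof.
move=> ab e0 gc gM.
have seg p q (l : R) : (forall w, onseg p q w -> cont a b eta w) -> nr (q - p) = l ->
    nr (segint g p q) <= M * l.
  move=> h <-; apply: (segint_nr_le cC) => w /h; [exact: gc|exact: gM].
have h1 := @seg (corner1 a eta) (corner2 b eta) (b - a) (fun w ow => Or41 _ _ _ ow).
have h2 := @seg (corner2 b eta) (corner3 b eta) (2 * eta) (fun w ow => Or42 _ _ _ ow).
have h3 := @seg (corner3 b eta) (corner4 a eta) (b - a) (fun w ow => Or43 _ _ _ ow).
have h4 := @seg (corner4 a eta) (corner1 a eta) (2 * eta) (fun w ow => Or44 _ _ _ ow).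
have e1 : nr (corner2 b eta - corner1 a eta) = b - a.
  have -> : corner2 b eta - corner1 a eta = (b - a)%:C by apply/eqP; rewrite eq_complex /= subrr !eqxx.
  by rewrite nr_real ger0_norm ?subr_ge0.
have e2 : nr (corner3 b eta - corner2 b eta) = 2 * eta.
  have : nr (corner3 b eta - corner2 b eta) ^+ 2 = (2 * eta) ^+ 2 by rewrite nr_sqr /=; ring.
  by move=> /eqP; rewrite eqrXn2 ?nr_ge0 ?mulr_ge0// => /eqP.
have e3 : nr (corner4 a eta - corner3 b eta) = b - a.
  have -> : corner4 a eta - corner3 b eta = (a - b)%:C by apply/eqP; rewrite eq_complex /= subrr !eqxx.
  by rewrite nr_real ler0_norm ?subr_le0// opprB.
have e4 : nr (corner1 a eta - corner4 a eta) = 2 * eta.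
  by rewrite nrC -e2; congr nr; apply/eqP; rewrite eq_complex /= !subrr !eqxx.
rewrite /cint; have -> : M * (2 * (b - a) + 4 * eta) =
  M * (b - a) + M * (2 * eta) + M * (b - a) + M * (2 * eta) by ring.
do 3 (apply: (le_trans (nrD _ _)); apply: lerD; last by auto).
exact: h1.
Qed.

Lemma count_enum (k : nat) (P : pred 'I_k) : count P (enum 'I_k) = #|P|.
Proof. by rewrite -size_filter enumT -cardE. Qed.

Lemma two_pi_gt1 : 1 < pi *+ 2 :> R.
Proof. by have := @pi_ge2 R; move: (pi : R) => x x2; rewrite mulr2n; lra. Qed.

Lemma frac_step (m M : nat) : 0 < M%:R :> R -> `|m.+1%:R / M%:R - m%:R / M%:R| <= M%:R^-1 :> R.
Proof. by move=> M0; rewrite -mulrBl -natrB// subSnn mul1r ger0_norm// invr_ge0 ltW. Qed.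

Lemma two_pi_multiples_eq (x y : R) (N1 N2 : nat) :
  x = (pi *+ 2) * N1%:R -> y = (pi *+ 2) * N2%:R -> `|x - y| < pi *+ 2 -> x = y.
Proof.
move=> -> ->; have p0 : 0 < pi *+ 2 :> R by rewrite pmulrn_rgt0// pi_gt0.
rewrite -mulrBr normrM (gtr0_norm p0) -[ltRHS]mulr1 ltr_pM2l// => h.
congr (_ * _%:R); apply/eqP; rewrite eqn_leq -ltnS -[(N2 <= N1)%N]ltnS -!(ltr_nat R) -!natr1.
by move: h; rewrite ltr_norml => /andP[h1 h2]; apply/andP; split; lra.
Qed.

Section OneBlock.
Variables (a b de ep : R) (k : nat) (lQ : 'I_k -> R) (EQ : C -> 'M[C]_k).
Hypotheses (de0 : 0 < de) (ab : 8 * de <= b - a) (ep0 : 0 < ep) (epde : ep <= de / 2048).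
Hypothesis lQab : forall j, de < `|lQ j - a| /\ de < `|lQ j - b|.
Let W := orect (a - de) (b + de) de.
Let eta := de / 64.
Hypothesis EQh : forall i j, hol W (fun w => EQ w i j).
Hypothesis EQb : forall w, W w -> mxb (EQ w) ep.
Variables (a' b' : R).
Hypotheses (aa' : a < a' < a + eta) (bb' : b - eta < b' < b).

(** Points of the horizontal sides are at distance [eta] from the far eigenvalues by their imaginary
    part, points of the vertical sides because [a'] and [b'] are close to [a] and [b], from which
    each [lQ j] is [de] away. *)
Lemma contour_disc w u : cont a' b' eta w -> dsk w (eta / 4) u ->
  W u /\ forall j, 3 * eta / 4 <= nr (u - (lQ j)%:C).
Proof.
move=> cw du; have dp := de0; have ab0 := ab; case/andP: aa' => a1 a2; case/andP: bb' => b1 b2.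
rewrite /eta in a2 b1; have e0 : 0 < eta by rewrite /eta; lra.
have [r1 r2] : rect a' b' eta w by apply: cont_rect cw; lra.
case/andP: r1 => r11 r12; case/andP: r2 => r21 r22.
split; first by apply: dsk_orect du; rewrite /eta in r21 r22 *; lra.
move=> j; suff : eta <= nr (w - (lQ j)%:C).
  move=> h; have := nr_triang u w (lQ j)%:C; rewrite nrC -/(nr _) => h2.
  have : nr (u - w) < eta / 4 by []. rewrite nrC in h2 *; rewrite nrC; lra.
have [l1 l2] := lQab j.
have hor : `|complex.Im w| = eta -> eta <= nr (w - (lQ j)%:C).
  by move=> <-; exact: nr_sub_real.
have ver (x x' : R) : `|x' - x| < eta -> de < `|lQ j - x| -> complex.Re w = x' -> eta <= nr (w - (lQ j)%:C).
  move=> xx lx wx; apply: le_trans (nr_sub_Re w (lQ j)); rewrite wx.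
  have := ler_normD (x' - lQ j) (x - x'); rewrite addrC addrA subrK.
  by rewrite (distrC x (lQ j)) (distrC x x'); move: xx; rewrite /eta; lra.
case: cw => /Re_onseg[t _ [hR hI]]; rewrite /= ?subrr ?mulr0 ?addr0 in hR hI.
- by apply: hor; rewrite hI normrN ger0_norm// ltW.
- apply: (ver b b') => //; rewrite ler0_norm ?ltrBlDr; rewrite /eta; lra.
- by apply: hor; rewrite hI ger0_norm// ltW.
- apply: (ver a a') => //; rewrite ger0_norm; rewrite /eta; lra.
Qed.

Let Et (t : R) w : 'M[C]_k := t%:C *: EQ w.
Let dt t w := \det (spm lQ (Et t) w).

Let Et_hol t i j : hol W (fun w => Et t w i j).
Proof.
move=> z Wz; have [D h] := EQh i j Wz; exists (0 * EQ z i j + t%:C * D).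
by apply: hd_ext (hdM (hd_cst t%:C z) h) => w; rewrite /Et mxE.
Qed.

Let Et_bound t w : 0 <= t <= 1 -> W w -> mxb (Et t w) ep.
Proof.
case/andP=> t0 t1 Ww; apply: (@mxb_le R _ _ _ (nr t%:C * ep)); last exact/mxbZ/EQb.
by rewrite nr_real ger0_norm// ler_piMl// ltW.
Qed.

Let dt_hol t : hol W (dt t).
Proof. by apply: spm_hol => i j; exact: Et_hol. Qed.

Let dt_lb t w u : 0 <= t <= 1 -> cont a' b' eta w -> dsk w (eta / 4) u ->
  mxlb (spm lQ (Et t) u) (eta / 2).
Proof.
move=> t01 cw du; have [Wu fu] := contour_disc cw du; have dp := de0; have epd := epde.
move=> v; apply: (@le_trans _ _ ((3 * eta / 4 - ep) * vn v)).
  by rewrite ler_wpM2r ?vn_ge0// /eta; lra.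
by apply: spm_lb => //; [rewrite /eta; lra|exact: Et_bound].
Qed.

Let eta0 : 0 < eta. Proof. by have := de0; rewrite /eta; lra. Qed.
Let ab' : a' < b'.
Proof. by have dp := de0; have ab0 := ab; case/andP: aa' => a1 a2; case/andP: bb' => b1 b2; rewrite /eta in a2 b1; lra. Qed.

Let dt_neq0 t w u : 0 <= t <= 1 -> cont a' b' eta w -> dsk w (eta / 4) u -> dt t u != 0.
Proof.
move=> t01 cw du; have e2 : 0 < eta / 2 by have := eta0; lra.
by have [uX _] := mxlb_unit e2 (dt_lb t01 cw du); move: uX; rewrite unitmxE unitfE.
Qed.

Let ww w : dsk w (eta / 4) w.
Proof. by rewrite /dsk/= subrr nr0; have := eta0; lra. Qed.

Let dsk_hol t w : 0 <= t <= 1 -> cont a' b' eta w -> hol (dsk w (eta / 4)) (dt t).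
Proof. by move=> t01 cw; apply: hol_sub (@dt_hol t) => u /(contour_disc cw)[]. Qed.

Let ld t w := df (dt t) w / dt t w.

Let ld_hol t w : 0 <= t <= 1 -> cont a' b' eta w -> hol (dsk w (eta / 4)) (ld t).
Proof.
move=> t01 cw; apply: holM; first exact: (df_hol cC (@opn_dsk R w _) (dsk_hol t01 cw)).
by apply: holV; [move=> u; exact: dt_neq0|exact: dsk_hol].
Qed.

Let Dt t := complex.Im (cint a' b' eta (ld t)).

Let Dt_nat t : 0 <= t <= 1 -> exists N : nat, Dt t = (pi *+ 2) * N%:R.
Proof.
move=> t01; have dp := de0; have ab0 := ab; case/andP: (aa') => a1 a2; case/andP: (bb') => b1 b2.
rewrite /eta in a2 b1.
have [zs [phi [zK ph fE p0]]] := spm_zeros de0 ep0 epde lQ (Et_hol t) (fun w => @Et_bound t w t01).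
exists (count (insideb a' b' eta) zs).
apply: (@argument_principle_split R a' b' eta W (dt t) zs phi) => //.
- exact: opn_orect.
- by move=> w [/andP[w1 w2] /andP[w3 w4]]; rewrite /eta in w3 w4; split; apply/andP; split; lra.
- move=> w [/andP[w1 w2] /andP[w3 w4]]; rewrite /eta in w3 w4.
  by apply: p0; [split; apply/andP; split; lra|apply/andP; split; lra].
- by move=> w cw; exact: dt_neq0 t01 cw (@ww w).
Qed.

Let Dt0 : Dt 0 = (pi *+ 2) * #|[pred j | a < lQ j < b]|%:R.
Proof.
have F w : dt 0 w = \prod_(z <- [seq (lQ i)%:C | i <- enum 'I_k]) (w - z) * 1.
  rewrite /dt /spm /Et scale0r subr0 det_diag mulr1 big_map big_enum.
  by apply: eq_bigr => i _; rewrite mxE.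
have t00 : 0 <= (0 : R) <= 1 by rewrite lexx ler01.
have o1 : opn (setT : set C) by move=> z _; exists 1.
have o2 : rect a' b' eta `<=` (setT : set C) by [].
have o3 w : rect a' b' eta w -> (1 : C) != 0 by rewrite oner_eq0.
have o4 w : cont a' b' eta w -> dt 0 w != 0 by move=> cw; exact: dt_neq0 t00 cw (@ww w).
have h := @argument_principle_split R a' b' eta setT (dt 0) _ (fun=> 1) ab' eta0 o1 o2 (@hol_cst R C _ _) (fun w _ => F w) o3 o4.
apply: (etrans h).
congr (_ * _%:R); rewrite count_map -count_enum; apply: eq_in_count => j _.
  rewrite /= /insideb /= oppr_lt0 eta0 /= andbT.
  have dp := de0; have [l1 l2] := lQab j; case/andP: aa' => a1 a2; case/andP: bb' => b1 b2.
  rewrite /eta in a2 b1; move: l1 l2; rewrite !lter_normr => /orP l1 /orP l2.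
  by apply/andP/andP => -[h1 h2]; split; case: l1 => h3; case: l2 => h4; lra.
Qed.

Let Q := k%:R * (ep / (eta / 2)) : R.

(** The Lipschitz constant involves the number [k] of far eigenvalues. This is harmless, since a
    Lipschitz function with values in the multiples of [2 * pi] is constant whatever the
    constant. *)
Let Dt_lip t s : 0 <= t <= 1 -> 0 <= s <= 1 ->
  `|Dt t - Dt s| <= 8 * (`|t - s| * Q) / (eta / 8) * (2 * (b' - a') + 4 * eta).
Proof.
move=> t01 s01; have e0 := eta0; have e2 : 0 < eta / 2 by lra.
have ep0' := ltW ep0.
have Q0 : 0 <= Q by rewrite mulr_ge0// divr_ge0// ltW.
pose h w := ld t w - ld s w.
have hc w : cont a' b' eta w -> cts h w.
  move=> cw; apply: (@hol_cts R C (dsk w (eta / 4))); last exact: ww.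
  by apply: (@holB R C); exact: ld_hol.
have sc w : cont a' b' eta w -> cts (ld s) w.
  by move=> cw; apply: (hol_cts (ld_hol s01 cw)); exact: ww.
have e : cint a' b' eta (ld t) = cint a' b' eta (ld s) + cint a' b' eta h.
  by rewrite -[RHS](cintD sc hc); apply: cint_ext => w _; rewrite /h addrC subrK.
have gen (x y : C) (u : C) (L : R) : x = y + u -> nr u <= L ->
    `|complex.Im x - complex.Im y| <= L.
  by move=> -> uL; rewrite ImD addrC addKr (le_trans (nrIm _)).
apply: (gen _ _ _ _ e); apply: cint_nr_le => //; try exact: ltW.
move=> w cw; apply: (@log_deriv_diff R w (eta / 4) (dt t) (dt s) (`|t - s| * Q) (eta / 8)).
- by apply/andP; split; lra.
- by rewrite mulr_ge0.
- exact: dsk_hol.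
- exact: dsk_hol.
- by move=> u; exact: dt_neq0.
- by move=> u; exact: dt_neq0.
- move=> u du; have [Wu _] := contour_disc cw du.
  have -> : `|t - s| * Q = k%:R * (`|t - s| * ep / (eta / 2)) by rewrite /Q; ring.
  apply: (spm_det_ratio e2 (mulr_ge0 (normr_ge0 _) ep0') (dt_lb s01 cw du)).
  have -> : Et s u - Et t u = (s - t)%:C *: EQ u by rewrite /Et rmorphB /= scalerBl.
  by rewrite distrC -nr_real; exact/mxbZ/EQb.
- have du := @ww w; have [Wu _] := contour_disc cw du.
  have -> : `|t - s| * Q = k%:R * (`|t - s| * ep / (eta / 2)) by rewrite /Q; ring.
  apply: (spm_det_ratio e2 (mulr_ge0 (normr_ge0 _) ep0') (dt_lb t01 cw du)).
  have -> : Et t w - Et s w = (t - s)%:C *: EQ w by rewrite /Et rmorphB /= scalerBl.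
  by rewrite -nr_real; exact/mxbZ/EQb.
Qed.

Let Dt01 : Dt 1 = Dt 0.
Proof.
pose L := 8 * Q / (eta / 8) * (2 * (b' - a') + 4 * eta).
have e0 := eta0; have pp := @pi_gt0 R.
have L0 : 0 <= L.
  apply: mulr_ge0; last by have := ab'; lra.
  apply: divr_ge0; last by lra.
  apply: mulr_ge0; first by [].
  apply: mulr_ge0; first by [].
  by apply: divr_ge0; [exact: ltW|lra].
(* Over a step of length [1 / M] the winding changes by less than 1, hence by nothing. *)
have [M M0 LM] : exists2 M : nat, 0 < M%:R :> R & L < M%:R.
  by exists (Num.truncn L).+1; [exact: ltr0Sn|exact: truncnS_gt].
have MM : M%:R / M%:R = 1 :> R by apply: divff; rewrite gt_eqF.
have i01 (j : nat) : (j <= M)%N -> 0 <= (j%:R / M%:R : R) <= 1.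
  move=> jM; apply/andP; split; first by apply: divr_ge0; [exact: ler0n|exact: ltW].
  by rewrite ler_pdivrMr// mul1r ler_nat.
have step t s : 0 <= t <= 1 -> 0 <= s <= 1 -> `|t - s| <= M%:R^-1 -> Dt t = Dt s.
  move=> t01 s01 ts; have [N1 e1] := Dt_nat t01; have [N2 e2] := Dt_nat s01.
  apply: (two_pi_multiples_eq e1 e2); apply: (le_lt_trans (Dt_lip t01 s01)).
  have -> : 8 * (`|t - s| * Q) / (eta / 8) * (2 * (b' - a') + 4 * eta) = `|t - s| * L.
    by rewrite /L; ring.
  apply: (@le_lt_trans _ _ (M%:R^-1 * L)); first exact: ler_wpM2r.
  apply: (@lt_trans _ _ 1); first by rewrite mulrC ltr_pdivrMr// mul1r.
  exact: two_pi_gt1.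
have ind m : (m <= M)%N -> Dt (m%:R / M%:R) = Dt 0.
  elim: m => [|m ih] mM; first by rewrite mul0r.
  have mM' : (m <= M)%N by exact: ltnW.
  apply: etrans (ih mM'); apply: step; [exact: i01|exact: i01|].
  exact: frac_step.
by have := ind M (leqnn M); rewrite MM.
Qed.

Lemma homotopy_count :
  complex.Im (cint a' b' eta (fun w => df (fun w => \det (spm lQ EQ w)) w / \det (spm lQ EQ w))) =
  (pi *+ 2) * #|[pred j | a < lQ j < b]|%:R.
Proof.
have g F : F = dt 1 -> complex.Im (cint a' b' eta (fun w => df F w / F w)) = Dt 1.
  move=> ->; reflexivity.
have e1 : (fun w => \det (spm lQ EQ w)) = dt 1.
  by apply/funext => w; rewrite /dt /spm /Et scale1r.
exact: (etrans (g _ e1) (etrans Dt01 Dt0)).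
Qed.

End OneBlock.
End Homotopy.

(** * Counting zeros over one interval *)

Section StripCount.
Variable R : realType.
Notation C := R[i].
Implicit Types (w z : C) (zs : seq C).

Let cC := @complete_complex R.

Lemma logd_dfM (u v : C -> C) w : (exists d, hd u w d) -> (exists d, hd v w d) -> u w != 0 -> v w != 0 ->
  df (fun z => u z * v z) w / (u w * v w) = df u w / u w + df v w / v w.
Proof.
move=> [d hu] [d' hv] u0 v0; rewrite (df_hd (hdM hu hv)) (df_hd hu) (df_hd hv).
by field; rewrite u0 v0.
Qed.

Lemma count_sandwich (T : eqType) (s : seq T) (p q n1 n2 : pred T) :
  {in s, forall x, p x -> [|| q x, n1 x | n2 x]} ->
  (count p s <= count q s + count n1 s + count n2 s)%N.
Proof.
elim: s => [|x s ih] h //=.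
have h1 : (p x <= q x + n1 x + n2 x)%N.
  by move: (h x (mem_head _ _)); case: (p x) (q x) (n1 x) (n2 x) => [] [] [] [] // /(_ erefl).
have h2 := ih (fun y ys => h y (@mem_behead _ (x :: s) y ys)).
apply: (leq_trans (leq_add h1 h2)); rewrite leq_eqVlt; apply/orP; left; apply/eqP; ring.
Qed.

(** The bound of [G] adds two vertical sides, [2 * (5 * r * p + 80 * r)], and two horizontal ones,
    [2 * (r * p + r)]. Divided by [2 * p] it is at most [6 * r + 81 * r / 2], as [p >= 2]. *)
Lemma winding_quotient (x y r G p : R) : 2 <= p -> 0 <= r -> p *+ 2 * x = p *+ 2 * y + G ->
  `|G| <= 12 * r * p + 162 * r -> `|x - y| <= 47 * r.
Proof.
move=> p2 r0 e; have p0 : 0 < p *+ 2 by rewrite mulr2n; lra.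
have -> : G = p *+ 2 * (x - y) by rewrite mulrBr e; lra.
rewrite normrM (gtr0_norm p0) => h; rewrite -(ler_pM2l p0); apply: (le_trans h).
rewrite mulr2n; nra.
Qed.

Lemma nat_dist_le (N1 N2 N3 m : nat) : (N1 <= N2 + 5 * m + 5 * m)%N -> (N2 <= N1 + 5 * m + 5 * m)%N ->
  `|N2%:R - N3%:R| <= 47 * m%:R :> R -> `|N1%:R - N3%:R| <= 57 * m%:R :> R.
Proof.
have e5 : (5 * m)%:R = 5 * m%:R :> R by rewrite natrM.
rewrite -!(ler_nat R); move: (5 * m)%N e5 => m5 e5; rewrite !natrD e5.
move: (N1%:R : R) (N2%:R : R) (N3%:R : R) (m%:R : R) => x1 x2 x3 x4 c1 c2.
by rewrite !ler_norml => /andP[? ?]; apply/andP; split; lra.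
Qed.

Variables (a b de ep : R) (n k : nat) (lP : 'I_n -> R) (lQ : 'I_k -> R).
Variable E : C -> 'M[C]_(n + k).
Hypotheses (de0 : 0 < de) (ab : 8 * de <= b - a) (ep0 : 0 < ep) (epde : ep <= de / 2048).
Hypothesis epab : 256 * ep * (b - a) <= (de / 64) ^+ 2.
Hypothesis lQab : forall j, de < `|lQ j - a| /\ de < `|lQ j - b|.

Let W := orect (a - de) (b + de) de.
Let eta := de / 64.

Hypothesis Eh : forall i j, hol W (fun w => E w i j).
Hypothesis Eb : forall w, W w -> mxb (E w) ep.

Let EQ w := drsubmx (E w).
Let f w := \det (spm (spl lP lQ) E w).
Let d w := \det (spm lQ EQ w).
Let g w := f w / d w.

Let EQh : forall i j, hol W (fun w => EQ w i j).
Proof. exact: EQ_hol. Qed.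
Let EQb : forall w, W w -> mxb (EQ w) ep.
Proof. by move=> w; apply: EQ_bound. Qed.
Let fh : hol W f. Proof. exact: spm_hol. Qed.
Let dh : hol W d. Proof. exact: spm_hol. Qed.

Variables (zs : seq C) (phi : C -> C).
Hypothesis zK : {in zs, forall z, rect (a - de / 8) (b + de / 8) (de / 64) z}.
Hypothesis ph : hol W phi.
Hypothesis fE : forall w, W w -> f w = \prod_(z <- zs) (w - z) * phi w.
Hypothesis p0 : forall w, W w -> a - de / 8 <= complex.Re w <= b + de / 8 -> phi w != 0.

Let zIm z : z \in zs -> `|complex.Im z| <= ep.
Proof.
move=> zz; have [/andP[z1 z2] /andP[z3 z4]] := zK zz; have dp := de0.
have Wz : W z by split; apply/andP; split; lra.
rewrite leNgt; apply/negP => h.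
have : f z != 0.
  apply: (@spm_det_neq0 R _ (spl lP lQ) E z `|complex.Im z| ep); last exact: Eb.
    by move=> i; exact: nr_sub_real.
  by rewrite h ltW.
by rewrite fE// (big_rem z)//= subrr !mul0r eqxx.
Qed.

Section Contour.
Variables (a' b' : R).
Hypotheses (aa' : a < a' < a + eta) (bb' : b - eta < b' < b).
Hypotheses (za : forall z, z \in zs -> complex.Re z != a') (zb : forall z, z \in zs -> complex.Re z != b').

Let eta0 : 0 < eta. Proof. by have := de0; rewrite /eta; lra. Qed.
Let ab' : a' < b'.
Proof. by have dp := de0; have ab0 := ab; case/andP: aa' => a1 a2; case/andP: bb' => b1 b2; rewrite /eta in a2 b1; lra. Qed.

Let rect_W w : rect a' b' eta w -> W w /\ a - de / 8 <= complex.Re w <= b + de / 8.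
Proof.
move=> [/andP[w1 w2] /andP[w3 w4]]; have dp := de0; case/andP: aa' => a1 a2; case/andP: bb' => b1 b2.
rewrite /eta in w3 w4; split; last by apply/andP; split; lra.
by split; apply/andP; split; lra.
Qed.

Let cont_W w : cont a' b' eta w -> rect a' b' eta w.
Proof. by apply: cont_rect; apply: ltW. Qed.

Let cont_f w : cont a' b' eta w -> f w != 0.
Proof.
move=> cw; have [Ww wR] := rect_W (cont_W cw).
rewrite fE// mulf_neq0 ?p0// prodf_seq_neq0; apply/allP => z zz /=.
rewrite subr_eq0; apply/eqP => wz.
have e0 := eta0; have epd := epde; have dp := de0.
have hz := zIm zz; have za' := za zz; have zb' := zb zz; rewrite -wz in hz za' zb'.
have hor : `|complex.Im w| = eta -> False by rewrite /eta; lra.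
case: cw => /Re_onseg[t _ [hR hI]]; rewrite /= ?subrr ?mulr0 ?addr0 in hR hI.
- by apply: hor; rewrite hI normrN ger0_norm// ltW.
- by rewrite hR eqxx in zb'.
- by apply: hor; rewrite hI ger0_norm// ltW.
- by rewrite hR eqxx in za'.
Qed.

Let cont_d w u : cont a' b' eta w -> dsk w (eta / 4) u -> W u /\ d u != 0.
Proof.
move=> cw du; have [Wu h] := contour_disc de0 ab lQab aa' bb' cw du; split => //.
apply: (@spm_det_neq0 R _ lQ EQ u _ ep h); last exact: EQb.
by have := de0; have := epde; have := ep0; rewrite /eta => *; apply/andP; split; lra.
Qed.

Let ww w : dsk w (eta / 4) w.
Proof. by rewrite /dsk/= subrr nr0; have := eta0; lra. Qed.

Let hg w : cont a' b' eta w -> hol (dsk w (eta / 4)) g.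
Proof.
move=> cw; have sW : dsk w (eta / 4) `<=` W by move=> u /(cont_d cw)[].
apply: holM; first exact: hol_sub sW fh.
by apply: holV; [move=> u /(cont_d cw)[]|exact: hol_sub sW dh].
Qed.

Let cont_g w : cont a' b' eta w -> g w != 0.
Proof. by move=> cw; rewrite /g mulf_neq0 ?cont_f// invr_neq0//; have [] := cont_d cw (@ww w). Qed.

Let W_op : opn W. Proof. exact: opn_orect. Qed.

Let ld_cts (h : C -> C) U w : opn U -> U w -> hol U h -> h w != 0 -> cts (fun w => df h w / h w) w.
Proof.
move=> oU Uw hh h0; have [d1 h1] := df_hol cC oU hh Uw; have [d2 h2] := hh _ Uw.
exact: (@hd_cts R C _ _ _ (hdM h1 (hdV h2 h0))).
Qed.

Let ld_split w : cont a' b' eta w -> df f w / f w = df d w / d w + df g w / g w.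
Proof.
move=> cw; have [Ww dn] := cont_d cw (@ww w); have gw := cont_g cw.
have fdg u : nr (u - w) < eta / 4 -> d u * g u = f u.
  by move=> uw; rewrite /g mulrC divfK//; have [] := cont_d cw uw.
have e4 : 0 < eta / 4 by have := eta0; lra.
have [d1 h1] := dh Ww; have [d2 h2] := hg cw (@ww w).
have <- := logd_dfM (ex_intro _ _ h1) (ex_intro _ _ h2) dn gw.
by rewrite (df_hd (hd_near e4 fdg (hdM h1 h2))) (df_hd (hdM h1 h2)) fdg// subrr nr0.
Qed.

Let cg w : cont a' b' eta w -> cts (fun w => df g w / g w) w.
Proof. by move=> cw; exact: (ld_cts (@opn_dsk R w _) (@ww w) (hg cw) (cont_g cw)). Qed.

Let cd w : cont a' b' eta w -> cts (fun w => df d w / d w) w.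
Proof. by move=> cw; have [Ww dn] := cont_d cw (@ww w); exact: (ld_cts W_op Ww dh dn). Qed.

Let G := complex.Im (cint a' b' eta (fun w => df g w / g w)).

Let G_bound : `|G| <= 12 * n%:R * pi + 162 * n%:R.
Proof.
have dp := de0; have ab0 := ab; case/andP: (aa') => a1 a2; case/andP: (bb') => b1 b2; have abl := ltW ab'.
rewrite /eta in a2 b1.
have hb y0 : `|y0| = eta ->
    `|complex.Im (segint (fun w => df g w / g w) (a' +i* y0) (b' +i* y0))| <= n%:R * pi + n%:R.
  by move=> hy; apply: (horizontal_bound lP lQ de0 ep0 epde epab Eh Eb hy); lra.
have va : `|complex.Im (segint (fun w => df g w / g w) (a' +i* (- eta)) (a' +i* eta))| <=
    5 * n%:R * pi + 80 * n%:R.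
  apply: (vertical_bound de0 ab ep0 epde lQab Eh Eb ph fE p0 (or_introl erefl) _ za).
  by rewrite ger0_norm; lra.
have vb : `|complex.Im (segint (fun w => df g w / g w) (b' +i* (- eta)) (b' +i* eta))| <=
    5 * n%:R * pi + 80 * n%:R.
  apply: (vertical_bound de0 ab ep0 epde lQab Eh Eb ph fE p0 (or_intror erefl) _ zb).
  by rewrite ler0_norm; lra.
have h1 := hb (- eta); have h2 := hb eta; rewrite normrN in h1.
have ee : `|eta| = eta by rewrite ger0_norm// ltW.
have e3 := segint_sym cC (fun x ox => cg (Or43 _ _ _ ox)).
have e4 := segint_sym cC (fun x ox => cg (Or44 _ _ _ ox)).
move: {h1 h2} (h1 ee) (h2 ee) va vb; rewrite /G /cint -/(corner1 a' eta) -/(corner2 b' eta).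
rewrite -/(corner3 b' eta) -/(corner4 a' eta) e3.
have -> : complex.Im (segint (fun w => df g w / g w) (corner1 a' eta) (corner4 a' eta)) =
   complex.Im (- segint (fun w => df g w / g w) (corner4 a' eta) (corner1 a' eta)) by rewrite e4.
move: (segint _ _ _) (segint _ _ _) (segint _ _ _) (segint _ _ _) => s1 s2 s3 s4.
rewrite !ImD; move: (pi : R) => q.
have ImN (x : C) : complex.Im (- x) = - complex.Im x by case: x.
rewrite !ImN; move: (complex.Im s1) (complex.Im s2) (complex.Im s3) (complex.Im s4) => x1 x2 x3 x4.
rewrite !ler_norml => /andP[? ?] /andP[? ?] /andP[? ?] /andP[? ?].
by apply/andP; split; lra.
Qed.

(** Along the contour [f = d * g], so the variations of the argument add up: that of [f] counts the
    zeros, that of [d] the far eigenvalues by homotopy, and that of [g] is bounded side by side. *)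
Lemma inside_count :
  `|(count (insideb a' b' eta) zs)%:R - #|[pred j | a < lQ j < b]|%:R| <= 47 * n%:R :> R.
Proof.
have hA := @argument_principle_split R a' b' eta W f zs phi ab' eta0 W_op
   (fun w rw => (rect_W rw).1) ph fE (fun w rw => p0 (rect_W rw).1 (rect_W rw).2) cont_f.
have hB := homotopy_count de0 ab ep0 epde lQab EQh EQb aa' bb'.
have hS : cint a' b' eta (fun w => df f w / f w) =
   cint a' b' eta (fun w => df d w / d w) + cint a' b' eta (fun w => df g w / g w).
  by apply: etrans (cintD cd cg); apply: cint_ext => w cw; exact: ld_split.
have hI := etrans (esym hA) (etrans (congr1 (@complex.Im R) hS) (etrans (ImD _ _) (congr1 (fun x => x + G) hB))).
exact: (winding_quotient (@pi_ge2 R) (ler0n _ n) hI G_bound).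
Qed.

End Contour.

Lemma near_end (x : R) z : z \in zs -> `|complex.Re z - x| <= de / 64 -> near_pt de x z.
Proof.
move=> zz h; have zI := zIm zz; have dp := de0; have epd := epde; have ep0' := ep0.
rewrite /near_pt; apply: nr_le_sqr; first by lra.
rewrite ImB raddfB /=; apply: (@le_trans _ _ ((de / 64) ^+ 2 + (de / 30) ^+ 2)); last by nra.
apply: lerD; first by rewrite -(real_normK (num_real (complex.Re z - x))) lerXn2r ?nnegrE//; lra.
have : `|complex.Im z - de / 32| <= de / 30.
  by move: zI; rewrite !ler_norml => /andP[? ?]; apply/andP; split; lra.
by move=> k1; rewrite -(real_normK (num_real (complex.Im z - _))) lerXn2r ?nnegrE//; lra.
Qed.

(** The predicate [p] is meant to be membership in the scaled domain, known only off the collars of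
    half width [de / 64] at [a] and [b]. The zeros in a collar lie in the disc of [near_pt], at most
    [5 * n] at either end, which adds [10 * n] to [47 * n]. *)
Lemma strip_count (p : pred C) :
  (forall z, z \in zs -> a + de / 64 <= complex.Re z <= b - de / 64 -> p z) ->
  (forall z, z \in zs -> p z -> a - de / 64 <= complex.Re z <= b + de / 64) ->
  `|(count p zs)%:R - #|[pred j | a < lQ j < b]|%:R| <= 57 * n%:R :> R.
Proof.
move=> hp1 hp2; have dp := de0; have ab0 := ab; have epd := epde.
have e0 : 0 < eta by rewrite /eta; lra.
(* The vertical sides are moved slightly inwards in order to avoid the finitely many zeros. *)
have [|a' aa' na'] := @avoid_finite R [seq complex.Re z | z <- zs] a (a + eta); first by lra.
have [|b' bb' nb'] := @avoid_finite R [seq complex.Re z | z <- zs] (b - eta) b; first by lra.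
have za z : z \in zs -> complex.Re z != a'.
  by move=> zz; apply: contraNneq na' => <-; exact: map_f.
have zb z : z \in zs -> complex.Re z != b'.
  by move=> zz; apply: contraNneq nb' => <-; exact: map_f.
have ed : 0 <= de / 64 by exact: divr_ge0 (ltW de0) (ler0n _ _).
have h := inside_count aa' bb' za zb.
have na := near_count de0 ab ep0 epde lQab Eh Eb ph fE (or_introl erefl).
have nb := near_count de0 ab ep0 epde lQab Eh Eb ph fE (or_intror erefl).
case/andP: aa' => a1 a2; case/andP: bb' => b1 b2; rewrite /eta in a2 b1.
have zI z : z \in zs -> - eta < complex.Im z < eta.
  by move=> /zIm; rewrite /eta ler_norml => /andP[? ?]; apply/andP; split; lra.
have ends z : z \in zs -> `|complex.Re z - a| <= de / 64 \/ `|complex.Re z - b| <= de / 64 ->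
    near_pt de a z || near_pt de b z.
  by move=> zz [/(near_end zz) ->|/(near_end zz) ->] //; rewrite orbT.
have c1 := @count_sandwich _ zs p (insideb a' b' eta) (near_pt de a) (near_pt de b).
have c2 := @count_sandwich _ zs (insideb a' b' eta) p (near_pt de a) (near_pt de b).
have {}c1 : (count p zs <= count (insideb a' b' eta) zs + 5 * n + 5 * n)%N.
  apply: (leq_trans (c1 _)); last exact: (leq_add (leq_add (leqnn _) na) nb).
  move=> z zz pz; rewrite /insideb zI// andbT; have /andP[z1 z2] := hp2 _ zz pz.
  have [k1|k1] := leP (complex.Re z) (a + de / 64).
    by apply/orP; right; apply: (ends z zz); left; rewrite ler_distl z1 k1.
  have [k2|k2] := leP (b - de / 64) (complex.Re z).
    by apply/orP; right; apply: (ends z zz); right; rewrite ler_distl k2 z2.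
  by apply/orP; left; rewrite (lt_trans a2 k1) (lt_trans k2 b1).
have {}c2 : (count (insideb a' b' eta) zs <= count p zs + 5 * n + 5 * n)%N.
  apply: (leq_trans (c2 _)); last exact: (leq_add (leq_add (leqnn _) na) nb).
  move=> z zz; rewrite /insideb zI// andbT => /andP[z1 z2].
  have [k1|k1] := leP (complex.Re z) (a + de / 64).
    apply/orP; right; apply: (ends z zz); left; rewrite ler_distl k1 andbT.
    by apply: le_trans (ltW (lt_trans a1 z1)); rewrite gerBl.
  have [k2|k2] := leP (b - de / 64) (complex.Re z).
    apply/orP; right; apply: (ends z zz); right; rewrite ler_distl k2 /=.
    by apply: (le_trans (ltW (lt_trans z2 b2))); rewrite lerDl.
  by rewrite (hp1 z zz)// (ltW k1) (ltW k2).
move: c1 c2 h; move: (count p zs) (count _ zs) #|_| => N1 N2 N3 c1 c2 h.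
exact: (nat_dist_le c1 c2 h).
Qed.

End StripCount.

(** * Inner products and orthonormal families *)

Section Inner.
Variables (R : realType) (H : completeNormedModType R[i]) (dot : {dot H for Num.Def.conjC}).
Hypothesis dn : forall x : H, `|x| ^+ 2 = dot x x.
Notation C := R[i].
Implicit Types (x y v : H) (a : C).
Local Notation cj := (@Num.conj_op (R[i])).

Let cH : complete_nm H := @complete_completeType R H.

Lemma dotDl x y v : dot (x + y) v = dot x v + dot y v. Proof. exact: linearDl. Qed.
Lemma dotBl x y v : dot (x - y) v = dot x v - dot y v. Proof. exact: linearBl. Qed.
Lemma dotNl x v : dot (- x) v = - dot x v. Proof. exact: linearNl. Qed.
Lemma dotZl a x v : dot (a *: x) v = a * dot x v. Proof. exact: linearZl_LR. Qed.
Lemma dot0l v : dot 0 v = 0. Proof. exact: linear0l. Qed.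
Lemma dotDr x y v : dot v (x + y) = dot v x + dot v y. Proof. exact: linearDr. Qed.
Lemma dotBr x y v : dot v (x - y) = dot v x - dot v y. Proof. exact: linearBr. Qed.
Lemma dotNr x v : dot v (- x) = - dot v x. Proof. exact: linearNr. Qed.
Lemma dotZr a x v : dot v (a *: x) = cj a * dot v x. Proof. exact: linearZr_LR. Qed.
Lemma dot0r v : dot v 0 = 0. Proof. exact: linear0r. Qed.
Lemma dot_suml (I : Type) (s : seq I) (P : pred I) (F : I -> H) v :
  dot (\sum_(i <- s | P i) F i) v = \sum_(i <- s | P i) dot (F i) v.
Proof.
by elim/big_ind2: _ => [|x1 x2 y1 y2 <- <-|//]; [exact: dot0l|exact: dotDl].
Qed.
Lemma dot_sumr (I : Type) (s : seq I) (P : pred I) (F : I -> H) v :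
  dot v (\sum_(i <- s | P i) F i) = \sum_(i <- s | P i) dot v (F i).
Proof.
by elim/big_ind2: _ => [|x1 x2 y1 y2 <- <-|//]; [exact: dot0r|exact: dotDr].
Qed.
Lemma dotC x y : dot y x = cj (dot x y).
Proof. by rewrite (hermC dot) expr0 mul1r. Qed.

Lemma dot_nr x : dot x x = (nr x ^+ 2)%:C.
Proof. by rewrite -dn nrE -rmorphXn. Qed.

Lemma nr_cj a : nr (cj a) = nr a.
Proof. by rewrite /nr norm_conjC. Qed.

Lemma mul_cj a : a * cj a = (nr a ^+ 2)%:C.
Proof. by rewrite -normCK nrE -rmorphXn. Qed.

Lemma dot_eq0 x : dot x x = 0 -> x = 0.
Proof. by rewrite dot_nr => /complexI/eqP; rewrite sqrf_eq0 nr_eq0 => /eqP. Qed.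

Lemma dot_nr1 x : dot x x = 1 -> nr x = 1.
Proof.
by rewrite dot_nr => /complexI/eqP; rewrite sqrp_eq1 ?nr_ge0// => /eqP.
Qed.

Lemma pythagoras x y : dot x y = 0 -> nr (x + y) ^+ 2 = nr x ^+ 2 + nr y ^+ 2.
Proof.
move=> h; apply: (@complexI R); rewrite rmorphD /= -!dot_nr dotDl !dotDr h (dotC x y) h.
by rewrite rmorph0 addr0 add0r.
Qed.

Lemma cauchy_schwarz x y : nr (dot x y) <= nr x * nr y.
Proof.
have [->|y0] := eqVneq y 0; first by rewrite dot0r !nr0 mulr0.
have ny : 0 < nr y by rewrite lt_neqAle nr_ge0 eq_sym nr_eq0 y0.
pose a := dot x y / (nr y ^+ 2)%:C.
have ny0 : (nr y ^+ 2)%:C != 0 by rewrite eq_complex /= eqxx andbT gt_eqF// exprn_gt0.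
have o : dot (x - a *: y) (a *: y) = 0.
  by rewrite dotZr dotBl dotZl dot_nr /a divfK// subrr mulr0.
have := pythagoras o; rewrite subrK nrZ => h.
have : nr (dot x y) = nr a * nr y ^+ 2.
  by rewrite /a nrM nrV nr_real ger0_norm ?sqr_ge0// divfK// gt_eqF// exprn_gt0.
move=> ->; rewrite expr2 mulrA ler_pM2r// -ler_sqr ?nnegrE ?mulr_ge0 ?nr_ge0// h.
by rewrite lerDr sqr_ge0.
Qed.

(** * Hilbert space and compact selfadjoint operators *)

Section Family.
Variable I : eqType.
Variable u : I -> H.
(** Zero vectors are allowed as padding, as in [orthonormal_basis], so that families indexed by
    [nat] also cover finite rank and finite dimension. *)
Definition ofam := (forall i, u i = 0 \/ dot (u i) (u i) = 1) /\ (forall i j, i <> j -> dot (u i) (u j) = 0).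
Hypothesis ou : ofam.

Lemma ofam_dot_idem i x : dot x (u i) * dot (u i) (u i) = dot x (u i).
Proof. by have [->|->] := ou.1 i; rewrite ?dot0r ?mul0r// mulr1. Qed.

Lemma nr_ofam i : nr (u i) <= 1.
Proof. by have [->|/dot_nr1 ->] := ou.1 i; rewrite ?nr0. Qed.

Lemma comb_dot (s : seq I) (c : I -> C) j : uniq s -> j \in s ->
  dot (\sum_(i <- s) c i *: u i) (u j) = c j * dot (u j) (u j).
Proof.
move=> us js; rewrite dot_suml (bigD1_seq j)//= dotZl big1 ?addr0// => i ij.
by rewrite dotZl (ou.2 i j) ?mulr0//; apply/eqP.
Qed.

Lemma comb_nr (s : seq I) (c : I -> C) : uniq s ->
  nr (\sum_(i <- s) c i *: u i) ^+ 2 <= \sum_(i <- s) nr (c i) ^+ 2.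
Proof.
elim: s => [|i s ih] /=; first by rewrite !big_nil nr0 expr0n.
case/andP=> is' us; rewrite !big_cons pythagoras; last first.
  rewrite dotZl dot_sumr big_seq big1 ?mulr0// => j js.
  rewrite dotZr (ou.2 i j) ?mulr0// => ij.
  by rewrite ij js in is'.
apply: lerD; last exact: ih.
rewrite nrZ lerXn2r ?nnegrE ?mulr_ge0 ?nr_ge0// -[leRHS]mulr1.
by rewrite ler_wpM2l ?nr_ge0// nr_ofam.
Qed.

Definition pr (s : seq I) x := \sum_(i <- s) dot x (u i) *: u i.

Lemma pr_dot s x j : uniq s -> j \in s -> dot (pr s x) (u j) = dot x (u j).
Proof. by move=> us js; rewrite comb_dot// ofam_dot_idem. Qed.

Lemma pr_orth s x (c : I -> C) : uniq s -> dot (x - pr s x) (\sum_(i <- s) c i *: u i) = 0.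
Proof.
by move=> us; rewrite dot_sumr big_seq big1// => j js; rewrite dotZr dotBl pr_dot// subrr mulr0.
Qed.

Lemma pr_pyth s x : uniq s -> nr x ^+ 2 = nr (x - pr s x) ^+ 2 + nr (pr s x) ^+ 2.
Proof. by move=> us; rewrite -pythagoras ?subrK// pr_orth. Qed.

Lemma pr_nr s x : uniq s -> nr (pr s x) ^+ 2 = \sum_(i <- s) nr (dot x (u i)) ^+ 2.
Proof.
move=> us; apply: (@complexI R); rewrite -dot_nr {2}/pr dot_sumr rmorph_sum.
by apply: eq_big_seq => i is'; rewrite dotZr pr_dot// mulrC mul_cj.
Qed.

Lemma bessel s x : uniq s -> \sum_(i <- s) nr (dot x (u i)) ^+ 2 <= nr x ^+ 2.
Proof. by move=> us; rewrite -pr_nr// (pr_pyth x us) lerDr sqr_ge0. Qed.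

Lemma prC_le s x : uniq s -> nr (x - pr s x) <= nr x.
Proof. by move=> us; rewrite -ler_sqr ?nnegrE ?nr_ge0// (pr_pyth x us) lerDl sqr_ge0. Qed.

Lemma comb_le s x (c : I -> C) (M : R) : uniq s -> 0 <= M -> (forall i, i \in s -> nr (c i) <= M) ->
  nr (\sum_(i <- s) (c i * dot x (u i)) *: u i) <= M * nr x.
Proof.
move=> us M0 cM; rewrite -ler_sqr ?nnegrE ?mulr_ge0 ?nr_ge0//.
apply: (le_trans (comb_nr _ us)); rewrite exprMn.
apply: (@le_trans _ _ (M ^+ 2 * \sum_(i <- s) nr (dot x (u i)) ^+ 2)); last first.
  by rewrite ler_wpM2l ?sqr_ge0// bessel.
rewrite mulr_sumr big_seq [leRHS]big_seq; apply: ler_sum => i is'.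
by rewrite nrM exprMn ler_wpM2r ?sqr_ge0// lerXn2r ?nnegrE ?nr_ge0// cM.
Qed.

End Family.

Lemma bounded_sum_cauchy (b : nat -> R) (B : R) : (forall i, 0 <= b i) ->
  (forall n, \sum_(i < n) b i <= B) -> forall e, 0 < e -> exists N, forall m n, (N <= m)%N -> (m <= n)%N ->
   \sum_(m <= i < n) b i <= e.
Proof.
move=> b0 bB e e0; pose S := [set \sum_(i < n) b i | n in setT].
have hS : has_sup S by split; [exists (\sum_(i < 0) b i); exists 0%N|exists B => _ [n _ <-]; exact: bB].
have [_ [N _ <-] hN] := sup_adherent e0 hS.
exists N => m n Nm mn.
have h1 : \sum_(i < n) b i <= sup S by apply: ub_le_sup; [exact: hS.2|exists n].
have h2 : \sum_(i < N) b i <= \sum_(i < m) b i.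
  by rewrite -!(big_mkord xpredT b) (@big_cat_nat _ _ _ N 0 m)//= lerDl sumr_ge0.
move: h1; rewrite -(big_mkord xpredT b) (@big_cat_nat _ _ _ m 0 n)//= big_mkord; lra.
Qed.

Lemma comb_cv (u : nat -> H) (c : nat -> C) (B : R) : ofam u -> (forall n, \sum_(i < n) nr (c i) ^+ 2 <= B) ->
  exists y, cv (fun n => \sum_(0 <= i < n) c i *: u i) y.
Proof.
move=> ou cB; apply: cH => e e0.
have [N hN] := bounded_sum_cauchy (fun i => sqr_ge0 (nr (c i))) cB (exprn_gt0 2 e0).
have key m n : (N <= m)%N -> (m <= n)%N -> nr (\sum_(0 <= i < n) c i *: u i - \sum_(0 <= i < m) c i *: u i) <= e.
  move=> Nm mn; rewrite (@big_cat_nat _ _ _ m 0 n)//= addrAC subrr add0r.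
  rewrite -ler_sqr ?nnegrE ?nr_ge0 ?(ltW e0)//; apply: le_trans (hN m n Nm mn).
  by apply: comb_nr => //; exact: iota_uniq.
exists N => m n Nm Nn; have [mn|/ltnW mn] := leqP m n; last exact: key.
by rewrite nrC; exact: key.
Qed.

Lemma cv_dotl (w : nat -> H) x v : cv w x -> cv (fun n => dot (w n) v) (dot x v).
Proof.
apply: (@cv_lip R H _ (fun y => dot y v) (nr v)) => y z.
by rewrite -dotBl mulrC; exact: cauchy_schwarz.
Qed.

Lemma pr_cv (u : nat -> H) x : ofam u -> exists2 y, cv (fun n => pr u (index_iota 0 n) x) y &
  forall i, dot (x - y) (u i) = 0.
Proof.
move=> ou; have [|y hy] := @comb_cv u (fun i => dot x (u i)) (nr x ^+ 2) ou.
  by move=> n; rewrite -(big_mkord xpredT (fun i => nr (dot x (u i)) ^+ 2)); apply: bessel => //; exact: iota_uniq.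
exists y => // i; rewrite dotBl; apply/eqP; rewrite subr_eq0 eq_sym; apply/eqP.
apply: (cv_unique (cv_dotl (u i) hy)) => e e0; exists i.+1 => n ni.
rewrite pr_dot ?iota_uniq// ?mem_index_iota//; first by rewrite subrr nr0 ltW.
Qed.

Lemma onb_cv (e : nat -> H) x : orthonormal_basis dot e -> cv (fun n => pr e (index_iota 0 n) x) x.
Proof.
move=> [e1 e2 e3]; have [y hy yo] := @pr_cv e x (conj e1 e2).
by have /eqP := e3 _ yo; rewrite subr_eq0 => /eqP xy; rewrite [X in cv _ X]xy.
Qed.

Definition nrmz x := (nr x)^-1%:C *: x.

Lemma nrmz1 x : x != 0 -> dot (nrmz x) (nrmz x) = 1.
Proof.
move=> x0; have nx : nr x != 0 by rewrite nr_eq0.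
by rewrite dot_nr /nrmz nrZ nr_real ger0_norm ?invr_ge0 ?nr_ge0// mulVf// expr1n.
Qed.

Lemma nrmz_or x : nrmz x = 0 \/ dot (nrmz x) (nrmz x) = 1.
Proof. by have [->|/nrmz1] := eqVneq x 0; [left; rewrite /nrmz scaler0|right]. Qed.

Lemma nrmzK x : (nr x)%:C *: nrmz x = x.
Proof.
have [->|x0] := eqVneq x 0; first by rewrite nr0 scale0r.
by rewrite /nrmz scalerA -rmorphM /= mulfV ?nr_eq0// scale1r.
Qed.

End Inner.

(** * Bounded operators, orthonormal bases and traces *)

Section Operators.
Variables (R : realType) (H : completeNormedModType R[i]) (dot : {dot H for Num.Def.conjC}).
Hypothesis dn : forall x : H, `|x| ^+ 2 = dot x x.
Notation C := R[i].
Implicit Types (x y v : H) (a : C) (T S : bop H).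
Local Notation cj := (@Num.conj_op (R[i])).

Let cH : complete_nm H := @complete_completeType R H.

Lemma bopDE T S x : (T + S) x = T x + S x. Proof. by []. Qed.
Lemma bopBE T S x : (T - S) x = T x - S x. Proof. by []. Qed.
Lemma bopZE a T x : (a *: T) x = a *: T x. Proof. by []. Qed.
Lemma bopME T S x : (T * S) x = T (S x). Proof. by []. Qed.
Lemma bop1E x : (1 : bop H) x = x. Proof. by []. Qed.
Lemma bop0E x : (0 : bop H) x = 0. Proof. by []. Qed.
Lemma bopB T x y : T (x - y) = T x - T y. Proof. exact: linearB. Qed.
Lemma bopD T x y : T (x + y) = T x + T y. Proof. exact: linearD. Qed.
Lemma bopZ T a x : T (a *: x) = a *: T x. Proof. exact: linearZ. Qed.
Lemma bop0 T : T 0 = 0. Proof. exact: linear0. Qed.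
Lemma bop_sumE (I : Type) (s : seq I) (P : pred I) (F : I -> bop H) x :
  (\sum_(i <- s | P i) F i) x = \sum_(i <- s | P i) F i x.
Proof. by elim/big_ind2: _ => [|x1 x2 y1 y2 <- <-|]. Qed.

Lemma bopMZl a T S : (a *: T) * S = a *: (T * S). Proof. exact/bop_eqP. Qed.
Lemma bopMZr a T S : T * (a *: S) = a *: (T * S).
Proof. by apply/bop_eqP => x; exact: linearZ. Qed.

Lemma nr_opnorm T : nr T = sup (opnorm_set T).
Proof. by rewrite /nr. Qed.

Lemma nr_bop T x : nr (T x) <= nr T * nr x.
Proof.
have [->|x0] := eqVneq x 0; first by rewrite linear0 !nr0 mulr0.
have nx : 0 < nr x by rewrite lt_neqAle nr_ge0 eq_sym nr_eq0 x0.
have h : nr (nrmz x) = 1 by rewrite /nrmz nrZ nr_real ger0_norm ?invr_ge0 ?nr_ge0// mulVf// gt_eqF.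
have h1 : nr (T (nrmz x)) <= nr T.
  rewrite nr_opnorm; apply: opnorm_set_ub; apply: opnorm_set_memE.
  by rewrite nrE h.
rewrite -{1}(nrmzK x) linearZ nrZ nr_real ger0_norm ?nr_ge0// mulrC.
by rewrite ler_pM2r.
Qed.

Lemma bop_nr_le T (M : R) : 0 <= M -> (forall x, nr (T x) <= M * nr x) -> nr T <= M.
Proof.
move=> M0 h; rewrite nr_opnorm; apply: opnorm_set_le => r [x x1 Tx].
have -> : r = nr (T x) by rewrite /nr Tx.
apply: (le_trans (h x)); rewrite -[leRHS]mulr1 ler_wpM2l//.
by move: x1; rewrite nrE -[1]/(1%:C) lecR.
Qed.

Lemma nr_bopM T S : nr (T * S) <= nr T * nr S.
Proof.
apply: bop_nr_le => [|x]; first by rewrite mulr_ge0 ?nr_ge0.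
rewrite bopME (le_trans (nr_bop _ _))// -mulrA ler_wpM2l ?nr_ge0//.
exact: nr_bop.
Qed.

Lemma nr_bop1 : nr (1 : bop H) <= 1.
Proof. by apply: bop_nr_le => // x; rewrite bop1E mul1r. Qed.

Lemma mkbop_subproof (f : H -> H) : linear f -> (exists M : R, forall x, nr (f x) <= M * nr x) ->
  f \in @bounded_linear R H.
Proof.
move=> lf [M hM]; rewrite inE; split=> //.
pose g := GRing.isLinear.Build _ _ _ _ f lf.
pose h : {linear H -> H} := HB.pack f g.
have : continuous h; last by [].
apply/linear_bounded_continuous/bounded_funP => r.
exists (`|M| * complex.Re r)%:C => x xr; rewrite nrE lecR.
have xr' : nr x <= complex.Re r by move: xr; rewrite nrE lecE => /andP[].
apply: (le_trans (hM x)); apply: (@le_trans _ _ (`|M| * nr x)).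
  by rewrite ler_wpM2r ?nr_ge0// ler_norm.
by rewrite ler_wpM2l.
Qed.

Lemma mkbop (f : H -> H) (M : R) : linear f -> (forall x, nr (f x) <= M * nr x) ->
  exists T : bop H, T =1 f.
Proof.
by move=> lf hM; exists (Bop (mkbop_subproof lf (ex_intro _ M hM))).
Qed.

Lemma bop_complete : complete_nm (bop H).
Proof.
move=> T cT.
have pt x : exists y, cv (fun n => T n x) y.
  apply: cH => e e0; have [|N hN] := cT (e / (1 + nr x)); first by rewrite divr_gt0// ltr_wpDr ?nr_ge0.
  exists N => m n Nm Nn; rewrite -bopBE (le_trans (nr_bop _ _))//.
  have x1 : 0 < 1 + nr x by rewrite ltr_wpDr ?nr_ge0.
  apply: (@le_trans _ _ (e / (1 + nr x) * nr x)); first by rewrite ler_wpM2r ?nr_ge0// hN.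
  by rewrite mulrAC ler_pdivrMr// ler_wpM2l ?(ltW e0)// lerDr.
have [f hf] := choice pt.
have lf : linear f.
  move=> a x y; apply: (cv_unique (hf _)).
  have := cvD (cvZ a (hf x)) (hf y); congr cv; apply/funext => n.
  by rewrite linearP.
have near (e : R) : 0 < e -> exists N, forall n x, (N <= n)%N -> nr (T n x - f x) <= e * nr x.
  move=> e0; have [N hN] := cT e e0; exists N => n x Nn.
  rewrite nrC; apply: (cv_le (hf x)); exists N => m Nm.
  by rewrite -bopBE (le_trans (nr_bop _ _))// ler_wpM2r ?nr_ge0// hN.
have [N hN] := near 1 ltr01.
have [|S hS] := @mkbop f (nr (T N) + 1) lf.
  move=> x; have := hN N x (leqnn _); rewrite nrC => h1; have h2 := nr_bop (T N) x.
  by have := nr_triang (T N x) (f x) 0; rewrite !subr0 => h3; rewrite mulrDl; lra.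
exists S => e e0; have [N' hN'] := near e e0; exists N' => n Nn.
by apply: bop_nr_le => [|x]; [exact: ltW|rewrite bopBE hS hN'].
Qed.

Lemma rk_ex v y : exists T : bop H, forall x, T x = dot x y *: v.
Proof.
have [|x|T hT] := @mkbop (fun x => dot x y *: v) (nr y * nr v).
- by move=> a x z; rewrite (dotDl dot) (dotZl dot) scalerDl scalerA.
- by rewrite nrZ mulrAC ler_wpM2r ?nr_ge0// mulrC; exact: (cauchy_schwarz dn).
- by exists T.
Qed.

Definition rk v y : bop H := xget 0 [set T : bop H | forall x, T x = dot x y *: v].

Lemma rkE v y x : rk v y x = dot x y *: v.
Proof.
rewrite /rk; case: xgetP => [T _ /(_ x)//|h]; have [T hT] := rk_ex v y.
by have := h T hT.
Qed.

Section Recursion.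
Variable pick : nat -> bop H -> H.
(** A Gram-Schmidt scheme with an abstract choice: [gsP n] is the projection onto the vectors chosen
    so far, and [pick] returns a unit vector of its kernel, or 0. It serves twice, with a dense
    sequence in [onb_exists] and with eigenvectors in [spectral]. *)
Fixpoint gsP n : bop H := if n is m.+1 then gsP m + rk (pick m (gsP m)) (pick m (gsP m)) else 0.
Definition gse n := pick n (gsP n).
Hypothesis pick_unit : forall n T, pick n T = 0 \/ dot (pick n T) (pick n T) = 1.
Hypothesis pick_orth : forall n T, (forall x, T (T x) = T x) -> T (pick n T) = 0.

Lemma gsPE n x : gsP n x = pr dot gse (index_iota 0 n) x.
Proof.
elim: n => [|n ih]; first by rewrite /pr big_nil.
have -> : gsP n.+1 x = gsP n x + rk (gse n) (gse n) x by [].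
by rewrite ih rkE /pr big_nat_recr.
Qed.

Lemma gse_ofam : ofam dot gse.
Proof.
split=> [i|]; first exact: pick_unit.
have key n : forall i j, (i < n)%N -> (j < n)%N -> i <> j -> dot (gse i) (gse j) = 0.
  elim: n => // n ih.
  have dp j x : (j < n)%N -> dot (gsP n x) (gse j) = dot x (gse j).
    move=> jn; rewrite gsPE /pr dot_suml (bigD1_seq j) ?mem_index_iota ?iota_uniq//=.
    rewrite dotZl big_seq_cond big1 => [|i /andP[]]; last first.
      by rewrite mem_index_iota => /andP[_ i_n] /eqP ij; rewrite dotZl ih// mulr0.
    by have [->|->] : gse j = 0 \/ dot (gse j) (gse j) = 1 := pick_unit j (gsP j); rewrite addr0 ?dot0r ?mul0r// mulr1.
  have idem x : gsP n (gsP n x) = gsP n x.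
    rewrite [LHS]gsPE [RHS]gsPE /pr big_seq [RHS]big_seq; apply: eq_bigr => j.
    by rewrite mem_index_iota => /andP[_ jn]; rewrite dp.
  have o j : (j < n)%N -> dot (gse n) (gse j) = 0.
    by move=> jn; rewrite -dp// /gse pick_orth// dot0l.
  move=> i j; rewrite !ltnS leq_eqVlt => /orP[/eqP ->|i_n]; rewrite leq_eqVlt => /orP[/eqP ->|jn] //.
  - by move=> _; exact: o.
  - by move=> _; rewrite dotC o// rmorph0.
  - exact: ih.
by move=> i j ij; apply: (key (maxn i j).+1) => //; rewrite ltnS ?leq_maxl ?leq_maxr.
Qed.

End Recursion.

Lemma separable_seq : separable H -> exists u : nat -> H, forall x (e : R), 0 < e -> exists n, nr (u n - x) < e.
Proof.
move=> [S /countable_injP[f fi] dS].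
exists (fun n => xget 0 [set s | S s /\ f s = n]) => x e e0.
have e0' : 0 < e%:C by rewrite -[0]/(0%:C) ltcR.
have [y [xy Sy]] := dS (ball x e%:C) (ex_intro _ x (ballxx x e0')) (ball_open x _).
exists (f y); case: xgetP => [z _ [Sz fz]|/(_ y)[]//].
have -> : z = y by apply: fi; rewrite ?inE.
by move: xy; rewrite -ball_normE /= distrC nrE ltcR.
Qed.

Lemma onb_exists : separable H -> exists e, orthonormal_basis dot e.
Proof.
move=> /separable_seq[u hu].
pose pick n (T : bop H) := nrmz (u n - T (u n)).
have pu n T : pick n T = 0 \/ dot (pick n T) (pick n T) = 1 by exact: (nrmz_or dn).
have po n T : (forall x, T (T x) = T x) -> T (pick n T) = 0.
  by move=> h; rewrite /pick /nrmz bopZ bopB h subrr scaler0.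
have [q1 q2] := gse_ofam pu po.
exists (gse pick); split=> // x xo; apply/eqP; rewrite -nr_eq0; apply/eqP.
have xu : forall n, dot x (u n) = 0.
  move=> n; rewrite -(subrK (gsP pick n (u n)) (u n)) dotDr.
  rewrite -(nrmzK (u n - _)) dotZr [dot x (nrmz _)](xo n) mulr0 add0r.
  by rewrite gsPE /pr dot_sumr big1// => i _; rewrite dotZr xo mulr0.
have h : forall e : R, 0 < e -> nr x <= e.
  move=> e e0; have [n hn] := hu x e e0.
  have hx : dot x (x - u n) = (nr x ^+ 2)%:C by rewrite dotBr xu subr0 (dot_nr dn).
  have := cauchy_schwarz dn x (x - u n); rewrite hx nr_real (ger0_norm (sqr_ge0 _)) expr2.
  have [x0|x0] := eqVneq (nr x) 0; first by move=> _; rewrite x0; exact: ltW.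
  have nx : 0 < nr x by rewrite lt_neqAle nr_ge0 eq_sym x0.
  rewrite (ler_pM2l nx) => h; apply: (le_trans h); rewrite nrC; exact: ltW.
apply/eqP; rewrite eq_le nr_ge0 andbT; apply/ler_addgt0Pr => e e0; rewrite add0r; exact: h.
Qed.

(** The representing vector has the coefficients [cj (f (e i))] in the basis. Testing [f] on finite
    parts of this series bounds the sum of their squares, and the series converges. *)
Lemma riesz (e : nat -> H) (f : H -> C) (M : R) : orthonormal_basis dot e ->
  (forall a x y, f (a *: x + y) = a * f x + f y) -> (forall x, nr (f x) <= M * nr x) ->
  exists z, forall x, f x = dot x z.
Proof.
move=> he lf hM; have [e1 e2 e3] := he.
have f0 : f 0 = 0 by have := lf 1 0 0; rewrite scale1r addr0 mul1r => /eqP; rewrite -subr_eq0 opprD addNKr oppr_eq0 => /eqP.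
have fs s (c : nat -> C) : f (\sum_(i <- s) c i *: e i) = \sum_(i <- s) c i * f (e i).
  by elim: s => [|i s ih]; rewrite ?big_nil// !big_cons lf ih.
have M0 : 0 <= `|M| by [].
have [|z hz] := @comb_cv R H dot dn e (fun i => cj (f (e i))) (`|M| ^+ 2) (conj e1 e2).
  move=> n; pose s := index_iota 0 n.
  have -> : \sum_(i < n) nr (cj (f (e i))) ^+ 2 = \sum_(i <- s) nr (f (e i)) ^+ 2.
    by rewrite /s big_mkord; apply: eq_bigr => i _; rewrite nr_cj.
  pose w := \sum_(i <- s) cj (f (e i)) *: e i.
  have fw : f w = (\sum_(i <- s) nr (f (e i)) ^+ 2)%:C.
    by rewrite fs rmorph_sum; apply: eq_bigr => i _; rewrite mulrC mul_cj.
  have w2 : nr w ^+ 2 <= \sum_(i <- s) nr (f (e i)) ^+ 2.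
    have := @comb_nr R H dot dn _ e (conj e1 e2) s (fun i => cj (f (e i))) (iota_uniq _ _).
    move=> h; apply: (le_trans h); rewrite le_eqVlt; apply/orP; left; apply/eqP.
    by apply: eq_bigr => i _; rewrite /= nr_cj.
  have S0 : 0 <= \sum_(i <- s) nr (f (e i)) ^+ 2 by rewrite sumr_ge0// => i _; exact: sqr_ge0.
  have := hM w; rewrite fw nr_real ger0_norm//.
  move: w2 S0; move: (\sum_(i <- s) _) (nr w) (nr_ge0 w) => Sg nw nw0 w2 S0 h.
  have h' : Sg <= `|M| * nw by apply: (le_trans h); rewrite ler_wpM2r// ler_norm.
  have h2 : Sg ^+ 2 <= `|M| ^+ 2 * Sg.
    apply: (@le_trans _ _ ((`|M| * nw) ^+ 2)); first by rewrite lerXn2r ?nnegrE ?mulr_ge0.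
    by rewrite exprMn ler_wpM2l ?sqr_ge0.
  have [->|S1] := eqVneq Sg 0; first exact: sqr_ge0.
  by move: h2; rewrite expr2 ler_pM2r// lt_neqAle S0 eq_sym S1.
exists z => x.
have c1 : cv (fun n => f (pr dot e (index_iota 0 n) x)) (f x).
  apply: (@cv_lip R H _ f `|M| _ _ _ (onb_cv dn x he)) => y y'.
  have -> : f y - f y' = f (y - y').
    have -> : y - y' = (-1) *: y' + y by rewrite scaleN1r addrC.
    by rewrite lf mulN1r addrC.
  by apply: (le_trans (hM _)); rewrite ler_wpM2r ?nr_ge0// ler_norm.
have c2 : cv (fun n => dot x (\sum_(0 <= i < n) cj (f (e i)) *: e i)) (dot x z).
  apply: (@cv_lip R H _ (fun y => dot x y) (nr x) _ _ _ hz) => y y'.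
  by rewrite -dotBr; exact: (cauchy_schwarz dn).
apply: (cv_unique c1); move: c2; congr cv; apply/funext => n.
rewrite /pr fs dot_sumr; apply: eq_bigr => i _.
by rewrite dotZr conjCK mulrC.
Qed.

(** The same choice as in [trace], so that convergence of the partial sums in [HT] determines
    [trace]. Convergence is established for operators [rk v y * T] of rank at most one and carried
    to their linear combinations. *)
Definition tbasis : nat -> H := xget (fun=> 0) [set e | orthonormal_basis dot e].
Definition HT T (t : C) := cv (fun n => \sum_(0 <= i < n) dot (T (tbasis i)) (tbasis i)) t.

Lemma HT_trace T t : HT T t -> trace dot T = t.
Proof.
move=> h; rewrite /trace; apply: cvg_lim => //.
apply/cvgrPdist_le => e e0; have [er e0'] : e = (complex.Re e)%:C /\ 0 < complex.Re e.
  by move: e0; rewrite ltcE /= => /andP[/eqP ie re]; split => //; apply/eqP; rewrite eq_complex /= ie !eqxx.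
have [N hN] := h _ e0'; exists N => // n /= Nn.
by rewrite distrC er nrE lecR; exact: hN.
Qed.

Lemma HTD T S t s : HT T t -> HT S s -> HT (T + S) (t + s).
Proof.
move=> h1 h2; have := cvD h1 h2; congr cv; apply/funext => n.
by rewrite -big_split; apply: eq_bigr => i _; rewrite bopDE dotDl.
Qed.

Lemma HTZ a T t : HT T t -> HT (a *: T) (a * t).
Proof.
move=> h1; have := cvZ a h1; congr cv; apply/funext => n.
by rewrite scaler_sumr; apply: eq_bigr => i _; rewrite bopZE dotZl.
Qed.

Lemma HT_rk (sep : separable H) T v y : HT (rk v y * T) (dot (T v) y).
Proof.
have [e0 he0] := onb_exists sep.
have he : orthonormal_basis dot tbasis by rewrite /tbasis; case: xgetP => // /(_ e0).
have hv := onb_cv dn v he.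
have : cv (fun n => dot (T (pr dot tbasis (index_iota 0 n) v)) y) (dot (T v) y).
  apply: (@cv_lip R H _ (fun x => dot (T x) y) (nr T * nr y) _ _ _ hv) => x x'.
  rewrite -dotBl -bopB (le_trans (cauchy_schwarz dn _ _))// mulrAC ler_wpM2r ?nr_ge0//.
  exact: nr_bop.
congr cv; apply/funext => n; rewrite /pr linear_sum dot_suml; apply: eq_bigr => i _.
by rewrite bopME rkE dotZl mulrC -dotZl -bopZ.
Qed.

End Operators.

(** * The spectral theorem for compact selfadjoint operators *)

Section Spectral.
Variables (R : realType) (H : completeNormedModType R[i]) (dot : {dot H for Num.Def.conjC}).
Hypothesis dn : forall x : H, `|x| ^+ 2 = dot x x.
Notation C := R[i].
Implicit Types (x y v : H) (a : C) (T S P Q : bop H).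

Lemma compact_cluster T (u : nat -> H) : compact_operator T -> (forall n, nr (u n) <= 1) ->
  exists y, forall (e : R) N, 0 < e -> exists2 n, (N <= n)%N & nr (T (u n) - y) < e.
Proof.
move=> cT u1; pose F := (fun n => T (u n)) @ \oo.
have FP : ProperFilter F by exact: fmap_proper_filter.
have [|y [_ cy]] := cT F FP.
  exists 0%N => // n _ /=; apply: subset_closure; exists (u n) => //.
  by rewrite /= nrE -[1]/(1%:C) lecR.
exists y => e N e0.
have e0' : 0 < e%:C by rewrite -[0]/(0%:C) ltcR.
have h1 : F [set T (u n) | n in [set n | (N <= n)%N]].
  by exists N => // n /= Nn; exists n.
have [_ [[n /= Nn <-] hb]] := cy _ _ h1 (nbhsx_ballx y _ e0').
exists n => //; move: hb; rewrite -ball_normE /= distrC nrE ltcR//.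
Qed.

Lemma opnorm_approx T (e : R) : 0 < e -> exists2 x, nr x <= 1 & nr T - e < nr (T x).
Proof.
move=> e0; have [r [x x1 xr] h] := sup_adherent e0 (opnorm_has_sup T).
exists x; first by move: x1; rewrite nrE -[1]/(1%:C) lecR.
by rewrite {2}/nr xr.
Qed.

Lemma cjr (r : R) : @Num.conj_op (R[i]) r%:C = r%:C.
Proof. by rewrite conj_Creal// complex_real. Qed.

(** The norm [t] of [G = T * (1 - P)] is almost attained in the unit ball, and selfadjointness makes
    [G (G x)] close to [t ^+ 2 *: x] at such points [x]. A cluster point [y] of their images
    satisfies [G (G y) = t ^+ 2 *: y]; reading this as [(G - t) (G + t) y = 0] yields the eigenvalue
    [t], or [- t] if [(G + t) y] vanishes. *)
Lemma max_eigenvector T P : compact_operator T -> selfadjoint dot T -> selfadjoint dot P ->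
  (forall x, P (P x) = P x) -> (forall x, P (T x) = T (P x)) -> T * (1 - P) != 0 ->
  exists u, [/\ dot u u = 1, P u = 0 & exists2 l : R, T u = l%:C *: u & `|l| = nr (T * (1 - P)) ].
Proof.
move=> cT sT sP iP comm G0; pose G := T * (1 - P).
have GE x : G x = T (x - P x) by [].
have sG x y : dot (G x) y = dot x (G y).
  rewrite !GE !bopB dotBl dotBr; congr (_ - _); first exact: sT.
  by rewrite sT sP comm.
pose t := nr G; have t0 : 0 < t by rewrite lt_neqAle nr_ge0 eq_sym nr_eq0 G0.
have PG x : P (G x) = 0 by rewrite GE comm bopB iP subrr bop0.
have apx n : exists x, nr x <= 1 /\ t - n.+1%:R^-1 < nr (G x).
  by have [|x h1 h2] := @opnorm_approx G n.+1%:R^-1; [rewrite invr_gt0|exists x].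
have [x_ hx] := choice apx.
pose u n := x_ n - P (x_ n).
have u1 n : nr (u n) <= 1.
  apply: (@le_trans _ _ (nr (x_ n))); last exact: (hx n).1.
  have uP : dot (u n) (P (x_ n)) = 0 by rewrite dotBl (sP (x_ n) (P _)) iP subrr.
  have := pythagoras dn uP; rewrite /u subrK => h.
  by rewrite -ler_sqr ?nnegrE ?nr_ge0// h lerDl sqr_ge0.
have [y hy] := compact_cluster cT u1.
have ynr : t <= nr y.
  apply/ler_addgt0Pr => e e0; have e2 : 0 < e / 2 by rewrite divr_gt0.
  have [N hN] : exists N : nat, (e / 2)^-1 < N.+1%:R by exists (Num.truncn (e / 2)^-1); exact: truncnS_gt.
  have [n Nn hn] := hy (e / 2) N e2; have [_ h2] := hx n.
  have h3 : n.+1%:R^-1 <= e / 2.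
    rewrite -[leRHS]invrK lef_pV2 ?posrE ?invr_gt0//; apply: (le_trans (ltW hN)).
    by rewrite ler_nat.
  have := nr_triang (T (u n)) (G (x_ n)) (y + 0).
  have -> : T (u n) = G (x_ n) by [].
  rewrite subrr nr0 add0r addr0 => _.
  have := nr_triang y (G (x_ n)) 0; rewrite !subr0; rewrite -[T (u n)]/(G (x_ n)) in hn.
  move: h2 h3 hn; move: (n.+1%:R^-1) (nr (G _)) (nr (_ - y)) (nr y) => ? ? ? ?; lra.
(* Expanding the square and using [nr (G (G x)) <= t * nr (G x)] leaves at most
   [t ^+ 4 - t ^+ 2 * nr (G x) ^+ 2]. *)
have near2 x (e : R) : nr x <= 1 -> 0 <= e <= t -> t - e <= nr (G x) -> nr (G (G x) - (t ^+ 2)%:C *: x) ^+ 2 <= 2 * t ^+ 3 * e.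
  move=> x1 /andP[e0 et] hG.
  have Gx : nr (G x) <= t by apply: (le_trans (nr_bop _ _)); rewrite -[leRHS]mulr1 ler_wpM2l ?(ltW t0).
  have GGx : nr (G (G x)) <= t * nr (G x) by exact: nr_bop.
  have id2 : nr (G (G x) - (t ^+ 2)%:C *: x) ^+ 2 = nr (G (G x)) ^+ 2 - 2 * t ^+ 2 * nr (G x) ^+ 2 + t ^+ 4 * nr x ^+ 2.
    apply: (@complexI R); rewrite -(dot_nr dn) dotBl !dotBr !dotZr !dotZl.
    rewrite cjr (sG (G x) x) -(sG x (G x)) !(dot_nr dn).
    move: (nr (G (G x)) ^+ 2) (nr (G x) ^+ 2) (nr x ^+ 2) => a1 a2 a3.
    by apply/eqP; rewrite eq_complex /=; apply/andP; split; apply/eqP; ring.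
  rewrite id2; have h1 : nr (G (G x)) ^+ 2 <= t ^+ 2 * nr (G x) ^+ 2.
    by rewrite -exprMn lerXn2r ?nnegrE ?mulr_ge0 ?nr_ge0 ?(ltW t0).
  have h2 : (t - e) ^+ 2 <= nr (G x) ^+ 2 by rewrite lerXn2r ?nnegrE ?nr_ge0 ?subr_ge0.
  have h3 : nr x ^+ 2 <= 1 by rewrite expr_le1 ?nr_ge0.
  have h4 : t ^+ 4 * nr x ^+ 2 <= t ^+ 4 by rewrite ler_piMr// exprn_ge0// ltW.
  have h5 : t ^+ 2 * (t - e) ^+ 2 <= t ^+ 2 * nr (G x) ^+ 2 by rewrite ler_wpM2l// sqr_ge0.
  move: h1 h4 h5; move: (nr (G (G x)) ^+ 2) (nr (G x) ^+ 2) (nr x ^+ 2) => a1 a2 a3 h1 h4 h5.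
  have : t ^+ 2 * (t - e) ^+ 2 = t ^+ 4 - 2 * t ^+ 3 * e + t ^+ 2 * e ^+ 2 by ring.
  have : 0 <= t ^+ 2 * e ^+ 2 by rewrite mulr_ge0 ?sqr_ge0.
  lra.
have GGy : G (G y) = (t ^+ 2)%:C *: y.
  apply/eqP; rewrite -subr_eq0 -nr_eq0 eq_le nr_ge0 andbT; apply/ler_addgt0Pr => e e0; rewrite add0r.
  pose K := 2 * t ^+ 2 + t; have K0 : 0 < K by rewrite /K addr_gt0// mulr_gt0// exprn_gt0.
  pose f := e / K; have f0 : 0 < f by rewrite divr_gt0.
  pose g := Num.min t (f ^+ 2 / (2 * t ^+ 3)).
  have t3 : 0 < 2 * t ^+ 3 by rewrite mulr_gt0// exprn_gt0.
  have g0 : 0 < g by rewrite lt_min t0 divr_gt0// exprn_gt0.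
  have gt : g <= t by rewrite ge_min lexx.
  have gf : 2 * t ^+ 3 * g <= f ^+ 2 by rewrite mulrC -ler_pdivlMr// ge_min lexx orbT.
  have [N hN] : exists N : nat, g^-1 < N.+1%:R by exists (Num.truncn g^-1); exact: truncnS_gt.
  have [n Nn hn] := hy f N f0; have [h1 h2] := hx n.
  have h3 : n.+1%:R^-1 <= g.
    rewrite -[leRHS]invrK lef_pV2 ?posrE ?invr_gt0//; apply: (le_trans (ltW hN)).
    by rewrite ler_nat.
  have h4 : nr (G (G (x_ n)) - (t ^+ 2)%:C *: x_ n) <= f.
    rewrite -ler_sqr ?nnegrE ?nr_ge0 ?(ltW f0)//; apply: le_trans gf; apply: near2 => //.
      by rewrite (ltW g0).
    by apply: ltW; apply: le_lt_trans h2; rewrite lerD2l lerN2.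
  pose z := x_ n; rewrite -[T (u n)]/(G z) -/z in hn h4 *.
  have -> : G (G y) - (t ^+ 2)%:C *: y =
     G (G (y - G z)) + (G (G (G z) - (t ^+ 2)%:C *: z) + (t ^+ 2)%:C *: (G z - y)).
    rewrite !bopB bopZ; module_solve (R[i] : comPzRingType) H.
  apply: (le_trans (nrD _ _)); apply: (@le_trans _ _ (t * (t * f) + (t * f + t ^+ 2 * f))); last first.
    have -> : t * (t * f) + (t * f + t ^+ 2 * f) = K * f by rewrite /K; ring.
    by rewrite /f mulrC divfK// gt_eqF.
  have tt := ltW t0; apply: lerD.
    apply: (le_trans (nr_bop _ _)); rewrite ler_wpM2l//; apply: (le_trans (nr_bop _ _)).
    by rewrite ler_wpM2l// nrC ltW.
  apply: (le_trans (nrD _ _)); apply: lerD.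
    by apply: (le_trans (nr_bop _ _)); rewrite ler_wpM2l.
  by rewrite nrZ nr_real ger0_norm ?sqr_ge0// ler_wpM2l ?sqr_ge0// ltW.
have y0 : y != 0 by rewrite -nr_eq0 gt_eqF// (lt_le_trans t0).
have [v [l v0 [Gv lt]]] : exists v, exists2 l : R, v != 0 & G v = l%:C *: v /\ `|l| = t.
  have [v0|v0] := eqVneq (G y + t%:C *: y) 0.
    exists y; exists (- t) => //; split; last by rewrite normrN ger0_norm// ltW.
    by rewrite rmorphN scaleNr; apply/eqP; rewrite -addr_eq0 v0.
  exists (G y + t%:C *: y); exists t => //; split; last by rewrite ger0_norm// ltW.
  by rewrite bopD bopZ GGy scalerDr scalerA rmorphXn addrC expr2.
have l0 : l%:C != 0 by rewrite eq_complex /= eqxx andbT -normr_eq0 lt gt_eqF.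
have Pv : P v = 0.
  by have := PG v; rewrite Gv bopZ => /eqP; rewrite scaler_eq0 (negbTE l0) => /eqP.
exists (nrmz v); split; first exact: (nrmz1 dn).
  by rewrite /nrmz bopZ Pv scaler0.
exists l => //; rewrite /nrmz bopZ; have := Gv; rewrite GE Pv subr0 => ->.
by rewrite !scalerA mulrC.
Qed.

Theorem spectral T : compact_operator T -> selfadjoint dot T ->
  exists (e : nat -> H) (l : nat -> R), [/\ ofam dot e /\ (forall i, T (e i) = (l i)%:C *: e i),
    forall i j, (i <= j)%N -> `|l j| <= `|l i|,
    forall n x, nr (T (x - pr dot e (index_iota 0 n) x)) <= `|l n| * nr x,
    forall eps, 0 < eps -> exists N, `|l N| <= eps & forall i, (e i == 0) = (l i == 0)].
Proof.
move=> cT sT.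
(* The condition [l != 0] ends the choice once [T * (1 - P) = 0]: from then on [pick] returns its
   default value 0, and both [e] and [l] are padded with zeros. *)
pose good P u := [/\ dot u u = 1, P u = 0 & exists2 l : R, T u = l%:C *: u & `|l| = nr (T * (1 - P)) /\ l != 0].
pose pick (n : nat) (P : bop H) := xget 0 [set u | good P u].
have pu n P : pick n P = 0 \/ dot (pick n P) (pick n P) = 1.
  by rewrite /pick; case: xgetP => [u _ []|]; [right|left].
have po n P : (forall x, P (P x) = P x) -> P (pick n P) = 0.
  by move=> _; rewrite /pick; case: xgetP => [u _ []//|_]; exact: bop0.
pose e := gse dot pick; pose l n := complex.Re (dot (T (e n)) (e n)); pose P n := gsP dot pick n.
have oe : ofam dot e by exact: gse_ofam.
have PE n x : P n x = pr dot e (index_iota 0 n) x by exact: gsPE.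
have eP n : good (P n) (e n) \/ e n = 0 /\ ~ (exists u, good (P n) u).
  rewrite /e /gse /pick; case: xgetP => [u _ g|h]; [by left|right; split => //].
  by move=> [u g]; exact: h g.
have lE n (r : R) : dot (e n) (e n) = 1 -> T (e n) = r%:C *: e n -> l n = r.
  by move=> e1 h; rewrite /l h dotZl e1 mulr1.
have Te n : T (e n) = (l n)%:C *: e n.
  have [[e1 _ [r Tr _]]|[e0 _]] := eP n; last by rewrite e0 bop0 scaler0.
  by rewrite (lE n r).
have sP n : selfadjoint dot (P n).
  move=> x y; rewrite !PE /pr dot_suml dot_sumr; apply: eq_bigr => i _.
  by rewrite dotZl dotZr -dotC mulrC.
have iP n x : P n (P n x) = P n x.
  rewrite [LHS]PE [RHS]PE /pr big_seq [RHS]big_seq; apply: eq_bigr => i is'.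
  by rewrite PE (pr_dot oe)// iota_uniq.
have cm n x : P n (T x) = T (P n x).
  rewrite !PE /pr linear_sum; apply: eq_bigr => i _.
  by rewrite [RHS]bopZ sT Te dotZr cjr scalerA mulrC.
have ln n : `|l n| = nr (T * (1 - P n)).
  have [[e1 _ [r Tr [<- _]]]|[e0 ne]] := eP n; first by rewrite (lE n r).
  rewrite /l e0 dot0r normr0; apply/eqP; rewrite eq_sym nr_eq0; apply/eqP; apply: contrapT => /eqP G0.
  have [u [u1 Pu [r Tu hr]]] := max_eigenvector cT sT (sP n) (iP n) (cm n) G0.
  apply: ne; exists u; split => //; exists r => //; split => //.
  by rewrite -normr_eq0 hr nr_eq0.
have bd n x : nr (T (x - pr dot e (index_iota 0 n) x)) <= `|l n| * nr x.
  by rewrite ln -PE; exact: (@nr_bop R H (T * (1 - P n)) x).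
have e0l i : (e i == 0) = (l i == 0).
  have [[e1 _ [r Tr [_ r0]]]|[e0 _]] := eP i.
    rewrite (lE i r)// (negbTE r0); apply/negbTE/eqP => e0.
    by move/eqP: e1; rewrite e0 dot0l eq_sym oner_eq0.
  by rewrite /l e0 dot0r !eqxx.
have mono i j : (i <= j)%N -> `|l j| <= `|l i|.
  move=> ij; have [/eqP|e1] := oe.1 j.
    by rewrite e0l => /eqP ->; rewrite normr0.
  have := bd i (e j); have -> : pr dot e (index_iota 0 i) (e j) = 0.
    rewrite /pr big_seq big1// => k; rewrite mem_index_iota => /andP[_ ki].
    by rewrite (oe.2 j k) ?scale0r// => jk; rewrite -jk ltnNge ij in ki.
  by rewrite subr0 (dot_nr1 dn e1) mulr1 Te nrZ nr_real (dot_nr1 dn e1) mulr1.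
(* If all [|l n|] exceeded [eps], the vectors [T (e n)] would be orthogonal of norm above [eps] and
   could not cluster. *)
exists e, l; split => // eps eps0; apply: contrapT => nN.
have big n : eps < `|l n| by rewrite ltNge; apply/negP => h; apply: nN; exists n.
have e1 n : nr (e n) = 1.
  have [/eqP|/(dot_nr1 dn)//] := oe.1 n; rewrite e0l => /eqP ln0.
  by have := big n; rewrite ln0 normr0 ltNge ltW.
have [|y hy] := @compact_cluster T e cT; first by move=> n; rewrite e1.
have eps2 : 0 < eps / 2 by rewrite divr_gt0.
have [n _ hn] := hy (eps / 2) 0%N eps2; have [m nm hm] := hy (eps / 2) n.+1 eps2.
have o : dot (T (e n)) (- T (e m)) = 0.
  by rewrite dotNr !Te dotZl dotZr (oe.2 n m) ?mulr0 ?oppr0// => nm'; rewrite nm' ltnn in nm.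
have := pythagoras dn o; rewrite nrN !Te !nrZ !nr_real !e1 !mulr1 -!Te => h.
have h1 : nr (T (e n) - T (e m)) < eps.
  by apply: (le_lt_trans (nr_triang y _ _)); rewrite (nrC y); lra.
have := big n; have := nr_ge0 (T (e n) - T (e m)); move: h1 h.
move: (nr _) `|l n| `|l m| => b1 b2 b3; nra.
Qed.

End Spectral.

Lemma sum_count_undup (T : eqType) (q : seq T) : (\sum_(x <- undup q) count_mem x q)%N = size q.
Proof.
rewrite -(perm_size (perm_count_undup q)) size_flatten /shape -map_comp sumnE big_map.
by apply: eq_bigr => x _; rewrite /= size_nseq.
Qed.

Lemma esum_seq (R : realType) (T : choiceType) (S : set T) (F : T -> \bar R) (s : seq T) : uniq s ->
  (forall x, x \in s -> S x) -> (forall x, S x -> (0 <= F x)%E) -> (forall x, S x -> x \notin s -> F x = 0%E) ->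
  (\esum_(x in S) F x = \sum_(x <- s) F x)%E.
Proof.
move=> us sS F0 Fs; rewrite (esumID [set` s])//.
have -> : S `&` [set` s] = [set` s] by apply/seteqP; split => [x []//|x xs]; split => //; exact: sS.
rewrite [X in (_ + X)%E]esum1 => [|x [Sx /negP xs]]; last exact: Fs.
rewrite adde0 esum_fset; last by move=> x; rewrite inE => /sS; exact: F0.
  by rewrite -fsbig_seq.
exact: finite_seq.
Qed.

Lemma bop_lsum (R : realType) (H : normedModType R[i]) (T : bop H) (I : Type) (s : seq I) (P : pred I) (F : I -> H) :
  T (\sum_(i <- s | P i) F i) = \sum_(i <- s | P i) T (F i).
Proof. exact: linear_sum. Qed.

(** * Spectral projections and eigenvalue counts *)

Section SpectralConsequences.
Variables (R : realType) (H : completeNormedModType R[i]) (dot : {dot H for Num.Def.conjC}).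
Hypothesis dn : forall x : H, `|x| ^+ 2 = dot x x.
Hypothesis sep : separable H.
Notation C := R[i].
Implicit Types (x y v : H) (a : C) (S P : bop H).

(** Along vectors violating the bound the images [T (Q x)] cluster at some [y]. But
    [dot (T (Q x)) y = dot x (Q w)], where [w] represents the functional [dot (T x) y] of [x] and
    plays the role of the adjoint applied to [y]; as [Q w] tends to 0, the images would be small. *)
Lemma compact_strong (T : bop H) (Q : nat -> bop H) : compact_operator T -> (forall k, selfadjoint dot (Q k)) ->
  (forall k x, nr (Q k x) <= nr x) -> (forall x, cv (fun k => Q k x) 0) ->
  forall e, 0 < e -> exists N, forall n, (N <= n)%N -> nr (T * Q n) <= e.
Proof.
move=> cT sQ Q1 Qs e e0; apply: contrapT => nN.
have bad N : exists nx : nat * H, [/\ (N <= nx.1)%N, nr nx.2 <= 1 & e < nr (T (Q nx.1 nx.2))].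
  apply: contrapT => h; apply: nN; exists N => n Nn; rewrite leNgt; apply/negP => h2.
  have d0 : 0 < nr (T * Q n) - e by rewrite subr_gt0.
  have [x x1 hx] := opnorm_approx (T * Q n) d0.
  by apply: h; exists (n, x); split => //=; move: hx; rewrite opprB addrC subrK.
have [f hf] := choice bad.
have [N|y hy] := @compact_cluster R H T (fun N => Q (f N).1 (f N).2) cT.
  by have [_ h1 _] := hf N; exact: le_trans (Q1 _ _) h1.
have [b hb] := onb_exists dn sep.
have [||w hw] := @riesz R H dot dn b (fun x => dot (T x) y) (nr T * nr y) hb.
- by move=> a x z; rewrite bopD bopZ dotDl dotZl.
- move=> x; apply: (le_trans (cauchy_schwarz dn _ _)); rewrite mulrAC ler_wpM2r ?nr_ge0//.
  exact: nr_bop.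
have e4 : 0 < e ^+ 2 / 4 by rewrite divr_gt0// exprn_gt0.
have e2 : 0 < e / 2 by rewrite divr_gt0.
have [M hM] := Qs w _ e4; have [n Mn hn] := hy (e / 2) M e2; have [h1 h2 h3] := hf n.
set u := Q (f n).1 (f n).2 in hn h3.
have k1 : nr (dot (T u) y) <= e ^+ 2 / 4.
  rewrite hw /u sQ; apply: (le_trans (cauchy_schwarz dn _ _)); rewrite -[leRHS]mul1r.
  apply: ler_pM; rewrite ?nr_ge0//.
  by have := hM _ (leq_trans Mn h1); rewrite subr0.
have k2 : nr (T u) ^+ 2 <= nr (dot (T u) y) + nr (T u) * (e / 2).
  have -> : nr (T u) ^+ 2 = nr (dot (T u) y + dot (T u) (T u - y)).
    by rewrite -dotDr addrC subrK (dot_nr dn) nr_real ger0_norm ?sqr_ge0.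
  apply: (le_trans (nrD _ _)); rewrite lerD2l; apply: (le_trans (cauchy_schwarz dn _ _)).
  by rewrite ler_wpM2l ?nr_ge0// ltW.
move: h3 k1 k2; move: (nr (dot (T u) y)) (nr (T u)) => p q h3 k1 k2.
have : e * (e / 2) < q * (q - e / 2) by apply: ltr_pM; lra.
by nra.
Qed.

Variables (T : bop H) (e : nat -> H) (l : nat -> R) (Pi0 : bop H).
Hypothesis sT : selfadjoint dot T.
Hypothesis oe : ofam dot e.
Hypothesis Te : forall i, T (e i) = (l i)%:C *: e i.
Hypothesis mono : forall i j, (i <= j)%N -> `|l j| <= `|l i|.
Hypothesis Tpr : forall n x, nr (T (x - pr dot e (index_iota 0 n) x)) <= `|l n| * nr x.
Hypothesis l0 : forall eps, 0 < eps -> exists N, `|l N| <= eps.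
Hypothesis e0l : forall i, (e i == 0) = (l i == 0).
Hypothesis hPi : orthogonal_projection dot [set x | T x = 0] Pi0.

Lemma TPi0 x : T (Pi0 x) = 0. Proof. by have [] := hPi x. Qed.
Lemma Pi0_orth x y : T y = 0 -> dot (x - Pi0 x) y = 0. Proof. by have [_] := hPi x; apply. Qed.

Lemma Pi0_eq x y : T y = 0 -> (forall z, T z = 0 -> dot (x - y) z = 0) -> Pi0 x = y.
Proof.
move=> Ty h; apply/eqP; rewrite -subr_eq0; apply/eqP; apply: (dot_eq0 dn).
have k : T (Pi0 x - y) = 0 by rewrite bopB TPi0 Ty subrr.
have -> : dot (Pi0 x - y) (Pi0 x - y) = dot (x - y) (Pi0 x - y) - dot (x - Pi0 x) (Pi0 x - y).
  by rewrite -dotBl; congr (dot _ _); module_solve (R[i] : comPzRingType) H.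
by rewrite h// Pi0_orth// subrr.
Qed.

Lemma e_ker i z : T z = 0 -> dot (e i) z = 0.
Proof.
move=> Tz; have := sT (e i) z; rewrite Te Tz dot0r dotZl => /eqP; rewrite mulf_eq0 => /orP[|/eqP//].
rewrite eq_complex /= eqxx andbT -e0l => /eqP ->; exact: dot0l.
Qed.

Lemma Pi0_e i : Pi0 (e i) = 0.
Proof. by apply: Pi0_eq => [|z Tz]; [exact: bop0|rewrite subr0 e_ker]. Qed.

Lemma Pi0_T x : Pi0 (T x) = 0.
Proof. by apply: Pi0_eq => [|z Tz]; [exact: bop0|rewrite subr0 sT Tz dot0r]. Qed.

Lemma Pi0_sa : selfadjoint dot Pi0.
Proof.
move=> x y; have h1 := Pi0_orth x (TPi0 y); have h2 := Pi0_orth y (TPi0 x).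
move: h1; rewrite dotBl => /eqP; rewrite subr_eq0 => /eqP ->.
have : dot (Pi0 x) (y - Pi0 y) = 0 by rewrite dotC h2 rmorph0.
by rewrite dotBr => /eqP; rewrite subr_eq0 => /eqP.
Qed.

Definition prb (s : seq nat) : bop H := \sum_(i <- s) rk dot (e i) (e i).

Lemma prbE s x : prb s x = pr dot e s x.
Proof. by rewrite /prb bop_sumE; apply: eq_bigr => i _; rewrite (rkE dn). Qed.

(** The spectral projection on the nonzero eigenvalues of index at least [k], written without an
    infinite sum. *)
Definition Qop k : bop H := 1 - Pi0 - prb (index_iota 0 k).

Lemma QopE k x : Qop k x = x - Pi0 x - pr dot e (index_iota 0 k) x.
Proof. by rewrite -prbE. Qed.

Lemma Qop_sa k : selfadjoint dot (Qop k).
Proof.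
move=> x y; rewrite !QopE !dotBl !dotBr Pi0_sa; congr (_ - _).
rewrite /pr dot_suml dot_sumr; apply: eq_bigr => i _.
by rewrite dotZl dotZr -dotC mulrC.
Qed.

Lemma Qop_le k x : nr (Qop k x) <= nr x.
Proof.
pose w := x - pr dot e (index_iota 0 k) x.
have Pw : Pi0 x = Pi0 w.
  rewrite /w bopB /pr bop_lsum big1 ?subr0// => i _.
  by rewrite bopZ Pi0_e scaler0.
have -> : Qop k x = w - Pi0 w by rewrite -Pw QopE /w addrAC.
apply: (@le_trans _ _ (nr w)); last by apply: prC_le => //; exact: iota_uniq.
have := pythagoras dn (Pi0_orth w (TPi0 w)); rewrite subrK => h.
by rewrite -ler_sqr ?nnegrE ?nr_ge0// h lerDl sqr_ge0.
Qed.

(** Completeness of the eigenvectors: what is left of [x] after all of them is annihilated by [T],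
    thanks to [Tpr] and the decay of [l], hence equals [Pi0 x]. *)
Lemma Qop_cv x : cv (fun k => Qop k x) 0.
Proof.
have [y hy yo] := @pr_cv R H dot dn e x oe.
have Ty : T (x - y) = 0.
  apply/eqP; rewrite -nr_eq0 eq_le nr_ge0 andbT; apply/ler_addgt0Pr => d d0; rewrite add0r.
  have [|N hN] := l0 (eps := d / 2 / (nr x + 1)); first by rewrite !divr_gt0// ltr_wpDl ?nr_ge0.
  have d3 : 0 < d / 2 / (nr T + 1) by rewrite !divr_gt0// ltr_wpDl ?nr_ge0.
  have [M hM] := hy _ d3; pose n := maxn N M.
  have -> : T (x - y) = T (x - pr dot e (index_iota 0 n) x) + T (pr dot e (index_iota 0 n) x - y).
    by rewrite -bopD addrA subrK.
  apply: (le_trans (nrD _ _)); rewrite (splitr d); apply: lerD.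
    apply: (le_trans (Tpr _ _)); apply: (@le_trans _ _ (d / 2 / (nr x + 1) * nr x)).
      by rewrite ler_wpM2r ?nr_ge0// (le_trans _ hN)// mono// leq_maxl.
    by rewrite mulrAC ler_pdivrMr ?ltr_wpDl ?nr_ge0// ler_wpM2l ?lerDl// ltW// divr_gt0.
  apply: (le_trans (nr_bop _ _)); apply: (@le_trans _ _ (nr T * (d / 2 / (nr T + 1)))).
    by rewrite ler_wpM2l ?nr_ge0// hM// leq_maxr.
  by rewrite mulrCA mulrA ler_pdivrMr ?ltr_wpDl ?nr_ge0// ler_wpM2l ?lerDl// ltW// divr_gt0.
have Pxy : Pi0 x = x - y.
  apply: Pi0_eq => // z Tz; rewrite opprB addrC subrK.
  apply: (cv_unique (cv_dotl dn z hy)) => d d0; exists 0%N => n _.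
  rewrite /pr dot_suml big1 ?subrr ?nr0 ?(ltW d0)// => i _.
  by rewrite dotZl e_ker// mulr0.
move=> d d0; have [N hN] := hy _ d0; exists N => n Nn.
by rewrite subr0 QopE Pxy opprB [x + _]addrC subrK nrC; exact: hN.
Qed.

(** Beyond the first [m] vectors [T] is bounded by [|l m| < |t|], so an eigenvector for [t] has no
    component there; it is also orthogonal to the [e i] with another eigenvalue. More such vectors
    than indices are dependent, the relation being a kernel vector of their coefficient matrix. *)
Lemma edim_eig (m : nat) (t : R) : `|l m| < `|t| ->
  edim (Defs.eigenspace T t%:C) = ((count (fun i => l i == t) (iota 0 m))%:R%:E)%E.
Proof.
move=> mt; pose s := [seq i <- iota 0 m | l i == t].
have t0 : t != 0 by rewrite -normr_gt0 (le_lt_trans _ mt).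
have us : uniq s by rewrite filter_uniq// iota_uniq.
have ls i : i \in s -> l i = t by rewrite mem_filter => /andP[/eqP].
have e1 i : i \in s -> dot (e i) (e i) = 1.
  by move=> /ls li; have [/eqP|//] := oe.1 i; rewrite e0l li (negbTE t0).
rewrite -size_filter -/s; apply/eqP; rewrite eq_le; apply/andP; split.
  apply: ge_ereal_sup => _ [k [f [fE fI]] <-]; rewrite lee_fin ler_nat leqNgt; apply/negP => sk.
  pose M := \matrix_(j < k, i < size s) dot (f j) (e (nth 0%N s i)).
  have fS j : f j = \sum_(i < size s) M j i *: e (nth 0%N s i).
    have fj : T (f j) = t%:C *: f j := fE j.
    have h1 : f j = pr dot e (index_iota 0 m) (f j).
      apply/eqP; rewrite -subr_eq0 -nr_eq0; set v := f j - _.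
      have Tv : T v = t%:C *: v.
        rewrite /v bopB scalerBr fj; congr (_ - _); rewrite /pr bop_lsum scaler_sumr.
        apply: eq_bigr => i _; rewrite [LHS]bopZ Te !scalerA; congr (_ *: _).
        have := sT (f j) (e i); rewrite fj Te dotZl dotZr cjr => ->; exact: mulrC.
      have := Tpr m (f j - pr dot e (index_iota 0 m) (f j)); rewrite -/v.
      have -> : pr dot e (index_iota 0 m) v = 0.
        rewrite /v /pr big_seq big1// => i im; rewrite dotBl (pr_dot oe) ?iota_uniq//.
        by rewrite subrr scale0r.
      rewrite subr0 Tv nrZ nr_real => h; apply/eqP/le_anti; rewrite nr_ge0 andbT leNgt; apply/negP => v0.
      by move: h; rewrite ler_pM2r// leNgt mt.
    have h2 i : l i != t -> dot (f j) (e i) = 0.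
      move=> lit; have := sT (f j) (e i); rewrite fj Te dotZl dotZr cjr => /eqP.
      rewrite -subr_eq0 -mulrBl mulf_eq0 => /orP[|/eqP//]; rewrite subr_eq0 => /eqP/complexI/esym/eqP.
      by rewrite (negbTE lit).
    rewrite {1}h1 /pr /index_iota subn0 (bigID (fun i => l i == t)) /= [X in _ + X]big1 ?addr0 => [|i /h2 ->]; last first.
      exact: scale0r.
    rewrite -big_filter -/s (big_nth 0%N) big_mkord.
    by apply: eq_bigr => i _; rewrite mxE.
  have rk0 : kermx M != 0.
    by rewrite -mxrank_eq0 mxrank_ker -lt0n subn_gt0 (leq_ltn_trans (rank_leq_col _)).
  have [i [j ij]] : exists i j, kermx M i j != 0.
    apply: contrapT => h; move/eqP: rk0; apply; apply/matrixP => i j; rewrite [RHS]mxE.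
    by apply/eqP; apply: contrapT => /negP h2; apply: h; exists i, j.
  move/eqP: ij; apply; apply: (fI (fun j => kermx M i j)).
  under eq_bigr => j' _ do rewrite fS scaler_sumr.
  rewrite exchange_big big1 //= => q _.
  under eq_bigr => j' _ do rewrite scalerA.
  rewrite -scaler_suml; have kM : (kermx M *m M) i q = 0 by rewrite mulmx_ker mxE.
  by move: kM; rewrite mxE => ->; exact: scale0r.
apply: ereal_sup_ubound; exists (size s) => //; exists (fun i : 'I_(size s) => e (nth 0%N s i)).
split=> [i|c hc i].
  by rewrite /Defs.eigenspace/= Te ls// mem_nth.
have := congr1 (fun x => dot x (e (nth 0%N s i))) hc; rewrite /= dot0l dot_suml (bigD1 i)//=.
rewrite dotZl e1 ?mem_nth// mulr1 big1 ?addr0// => j ji.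
rewrite dotZl (oe.2 _ _ _) ?mulr0// => /eqP; rewrite nth_uniq// => /eqP h.
by move/eqP: ji; apply; exact: ord_inj.
Qed.

Lemma eigenvalue_countE (m : nat) (L : set R) : (forall t, L t -> `|l m| < `|t|) ->
  eigenvalue_count T L = ((count (fun i => `[< L (l i) >]) (iota 0 m))%:R%:E)%E.
Proof.
move=> Lm; pose q := [seq l i | i <- iota 0 m & `[< L (l i) >]].
have cq t : L t -> count (fun i => l i == t) (iota 0 m) = count_mem t q.
  move=> Lt; rewrite /q count_map count_filter; apply: eq_count => i /=.
  by case: eqVneq => // ->; apply/esym/asboolP.
have qL t : t \in q -> L t.
  move=> tq; have [i hi ->] : exists2 i, i \in [seq i <- iota 0 m | `[< L (l i) >]] & t = l i by exact: (elimT mapP tq).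
  by move: hi; rewrite mem_filter => /andP[/asboolP].
rewrite /eigenvalue_count (@esum_seq R R L _ (undup q)) ?undup_uniq//.
- rewrite big_seq (eq_bigr (fun t => ((count_mem t q)%:R%:E)%E)) => [|t]; last first.
    by rewrite mem_undup => /qL Lt; rewrite (edim_eig (Lm t Lt)) cq.
  rewrite -big_seq sumEFin; congr (_%:E); rewrite -natr_sum sum_count_undup.
  by rewrite size_map size_filter.
- by move=> t; rewrite mem_undup; exact: qL.
- by move=> t Lt; rewrite (edim_eig (Lm t Lt)) lee_fin.
- move=> t Lt; rewrite mem_undup => tq; rewrite (edim_eig (Lm t Lt)) cq//.
  by have -> : count_mem t q = 0%N by exact/count_memPn.
Qed.

End SpectralConsequences.

(** * Residues of operator-valued functions *)

Section Residue.
Variable R : realType.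
Notation C := R[i].
Implicit Types (w z u : C).

Lemma half_up (x c k : R) : x - c <= k + k -> c <= x -> `|x - (c + k)| <= k.
Proof. by move=> h1 h2; rewrite ler_norml; apply/andP; split; lra. Qed.

Lemma half_dn (x c k : R) : - (k + k) <= x - c -> x <= c -> `|x - (c + - k)| <= k.
Proof. by move=> h1 h2; rewrite ler_norml; apply/andP; split; lra. Qed.

Lemma ReD (x y : C) : complex.Re (x + y) = complex.Re x + complex.Re y.
Proof. by case: x => ? ?; case: y. Qed.

(** The radius in [multiplicity] is any isolating one and speaks of a closed disc, whereas residues
    need holomorphy on a larger open disc. The compactness argument is a subdivision of squares. *)
Lemma disc_tube (O : set C) w (r : R) : 0 < r -> opn O -> (forall z, nr (z - w) <= r -> O z) ->
  exists2 r', r < r' & dsk w r' `<=` O.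
Proof.
move=> r0 oO hO.
(* A square with centre [x.1] and half side [|x.2|]; the absolute value makes the size nonnegative
   for every pair, as [nested_cells] demands. *)
pose cell (x : C * R) u := `|complex.Re u - complex.Re x.1| <= `|x.2| /\ `|complex.Im u - complex.Im x.1| <= `|x.2|.
pose Bad x := forall e : R, 0 < e -> exists u, [/\ cell x u, nr (u - w) < r + e & ~ O u].
suff nb : ~ Bad (w, r + 1).
  have [e [e0 he]] : exists e : R, 0 < e /\ forall u, cell (w, r + 1) u -> nr (u - w) < r + e -> O u.
    apply: contrapT => h; apply: nb => e e0; apply: contrapT => h2; apply: h; exists e; split => // u c1 c2.
    by apply: contrapT => nO; apply: h2; exists u.
  exists (r + Num.min e 1); first by rewrite ltrDl lt_min e0 ltr01.
  move=> u; rewrite /dsk/= => hu.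
  have u1 : nr (u - w) < r + e by apply: (lt_le_trans hu); rewrite lerD2l ge_min lexx.
  have u2 : nr (u - w) <= `|r + 1|.
    rewrite ger0_norm; last by rewrite addr_ge0// ltW.
    by apply: ltW; apply: (lt_le_trans hu); rewrite lerD2l ge_min lexx orbT.
  apply: he => //; split=> /=; apply: le_trans u2.
    by have := nrRe (u - w); rewrite raddfB.
  by have := nrIm (u - w); rewrite ImB.
move=> b0.
have [||z hz] := @nested_cells R _ Bad fst (fun x => `|x.2|) (w, r + 1) _ b0.
- by move=> x.
- move=> [c h] bx.
  pose k := `|h| / 2.
  have k0 : 0 <= k by rewrite divr_ge0.
  have child (s1 s2 : R) : `|s1| = k -> `|s2| = k -> Bad (c + (s1 +i* s2), k) -> exists y, [/\ Bad y, `|y.2| <= `|(c, h).2| / 2 & nr (y.1 - (c, h).1) <= `|(c, h).2|].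
    move=> e1 e2 by'; exists (c + (s1 +i* s2), k); split => //=; first by rewrite ger0_norm.
    rewrite addrC addKr; apply: (le_trans (nr_le_ReIm _)); rewrite /= e1 e2 /k; lra.
  apply: contrapT => nc.
  have ok (s1 s2 : R) : `|s1| = k -> `|s2| = k -> exists e : R, 0 < e /\ forall u, cell (c + (s1 +i* s2), k) u -> nr (u - w) < r + e -> O u.
    move=> e1 e2; apply: contrapT => h1; apply: nc; apply: (child s1 s2) => // e e0.
    apply: contrapT => h2; apply: h1; exists e; split => // u c1 c2.
    by apply: contrapT => nO; apply: h2; exists u.
  have kk : `|k| = k by rewrite ger0_norm.
  have nk : `|- k| = k by rewrite normrN.
  have [e1 [e10 h1]] := ok k k kk kk; have [e2 [e20 h2]] := ok k (- k) kk nk.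
  have [e3 [e30 h3]] := ok (- k) k nk kk; have [e4 [e40 h4]] := ok (- k) (- k) nk nk.
  pose e := Num.min (Num.min e1 e2) (Num.min e3 e4).
  have e0 : 0 < e by rewrite !lt_min e10 e20 e30 e40.
  have [u [[/= cu1 cu2] uw nO]] := bx e e0.
  have le_e : [/\ e <= e1, e <= e2, e <= e3 & e <= e4].
    by split; rewrite !ge_min lexx ?orbT.
  case: le_e => l1 l2 l3 l4.
  have hh : `|h| = k + k by rewrite /k -splitr.
  rewrite hh !ler_norml in cu1 cu2; case/andP: cu1 => c1 c2; case/andP: cu2 => c3 c4.
  apply: nO; case: (leP (complex.Re c) (complex.Re u)) => d1; case: (leP (complex.Im c) (complex.Im u)) => d2.
  + apply: h1; last by apply: (lt_le_trans uw); rewrite lerD2l.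
    split; rewrite [(_, _).1]/= [(_, _).2]/= kk ?ReD ?ImD; [exact: (half_up c2 d1)|exact: (half_up c4 d2)].
  + apply: h2; last by apply: (lt_le_trans uw); rewrite lerD2l.
    split; rewrite [(_, _).1]/= [(_, _).2]/= kk ?ReD ?ImD; [exact: (half_up c2 d1)|exact: (half_dn c3 (ltW d2))].
  + apply: h3; last by apply: (lt_le_trans uw); rewrite lerD2l.
    split; rewrite [(_, _).1]/= [(_, _).2]/= kk ?ReD ?ImD; [exact: (half_dn c1 (ltW d1))|exact: (half_up c4 d2)].
  + apply: h4; last by apply: (lt_le_trans uw); rewrite lerD2l.
    split; rewrite [(_, _).1]/= [(_, _).2]/= kk ?ReD ?ImD; [exact: (half_dn c1 (ltW d1))|exact: (half_dn c3 (ltW d2))].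
have [e e0 he] : exists2 e : R, 0 < e & forall u, nr (u - z) < e -> nr (u - w) < r + e -> O u.
  have [zr|zr] := leP (nr (z - w)) r.
    by have [e e0 he] := oO _ (hO _ zr); exists e => // u /he.
  exists ((nr (z - w) - r) / 2); first by rewrite divr_gt0// subr_gt0.
  move=> u; rewrite nrC => h1 h2; exfalso.
  have h3 := nr_triang u z w; move: h1 h2 h3.
  by move: (nr (z - u)) (nr (u - w)) (nr (z - w)) => x1 x2 x3; lra.
have e8 : 0 < e / 8 by rewrite divr_gt0.
have [[c h] [by' dy cy]] := hz _ e8.
have [u [[/= cu1 cu2] uw nO]] := by' e e0.
apply: nO; apply: he => //; apply: (le_lt_trans (nr_triang c _ _)).
have : nr (u - c) <= `|h| + `|h|.
  apply: (le_trans (nr_le_ReIm _)); rewrite ImB raddfB /=; exact: lerD.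
by move: dy cy => /=; move: (nr (c - z)) (nr (u - c)) `|h| => x1 x2 x3; lra.
Qed.

Lemma onseg_real (p q : R) x : onseg p%:C q%:C x -> exists2 t : R, 0 <= t <= 1 & x = (p + t * (q - p))%:C.
Proof. by move=> [t t01 ->]; exists t => //; rewrite !rmorphD rmorphM rmorphB. Qed.

Lemma onseg_real_in (p q a b : R) x : a <= p <= b -> a <= q <= b -> onseg p%:C q%:C x ->
  exists2 t : R, a <= t <= b & x = t%:C.
Proof.
move=> /andP[p1 p2] /andP[q1 q2] /onseg_real[t /andP[t0 t1] ->]; exists (p + t * (q - p)) => //.
by apply/andP; split; nra.
Qed.

(** On each piece the increment of [G] is the segment integral of [Phi], and differs from the tagged
    term by at most [L * d] times the length. *)
Lemma Riemann_FTC (V : normedModType R[i]) (cV : complete_nm V) (G Phi : C -> V) (a b L : R) :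
  a <= b -> 0 <= L ->
  (forall t, a <= t <= b -> hd G t%:C (Phi t%:C)) -> (forall t, a <= t <= b -> cts Phi t%:C) ->
  (forall s t, a <= s <= b -> a <= t <= b -> nr (Phi s%:C - Phi t%:C) <= L * `|s - t|) ->
  is_Riemann_integral (fun t => Phi t%:C) a b (G b%:C - G a%:C).
Proof.
move=> ab L0 hG cP lip e e0; pose K := L * (b - a) + 1.
have K0 : 0 < K by rewrite ltr_wpDl// mulr_ge0// subr_ge0.
pose d := e / (2 * K); have d0 : 0 < d by rewrite divr_gt0// mulr_gt0.
exists d => // n t xi t0 tn ht.
have up i : (i <= n)%N -> a <= t i.
  elim: i => [|i ih] i_n; first by rewrite t0.
  by apply: (le_trans (ih (ltnW i_n))); have [/andP[h1 h2] _] := ht i i_n; exact: le_trans h1 h2.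
have dw k : (k <= n)%N -> t (n - k)%N <= b.
  elim: k => [|k ih] kn; first by rewrite subn0 tn.
  apply: le_trans (ih (ltnW kn)); have kn' : (n - k.+1 < n)%N by rewrite ltn_subrL (leq_ltn_trans _ kn).
  have [/andP[h1 h2] _] := ht _ kn'; rewrite subnSK// in h2; exact: le_trans h1 h2.
have mem i : (i <= n)%N -> a <= t i <= b.
  by move=> i_n; rewrite up//= -(subKn i_n) dw// leq_subr.
have term (i : 'I_n) : nr ((t i.+1 - t i)%:C *: Phi (xi i)%:C - (G (t i.+1)%:C - G (t i)%:C)) <= L * d * (t i.+1 - t i).
  have i_n := ltn_ord i; have [/andP[h1 h2] h3] := ht i i_n.
  have m1 := mem i (ltnW i_n); have m2 := mem i.+1 i_n.
  have sg x : onseg (t i)%:C (t i.+1)%:C x -> exists2 s : R, t i <= s <= t i.+1 & x = s%:C.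
    by apply: onseg_real_in; rewrite lexx (le_trans h1 h2).
  have inab s : t i <= s <= t i.+1 -> a <= s <= b.
    by case/andP=> s1 s2; case/andP: m1 => m11 _; case/andP: m2 => _ m22; rewrite (le_trans m11 s1) (le_trans s2 m22).
  have c1 x : onseg (t i)%:C (t i.+1)%:C x -> cts Phi x by move=> /sg[s /inab hs ->]; exact: cP.
  have c2 x : onseg (t i)%:C (t i.+1)%:C x -> hd G x (Phi x) by move=> /sg[s /inab hs ->]; exact: hG.
  rewrite -(segint_FTC cV c1 c2) nrC.
  have xib : a <= xi i <= b by apply: inab; rewrite h1.
  have c3 x : onseg (t i)%:C (t i.+1)%:C x -> nr (Phi x - Phi (xi i)%:C) <= L * d.
    move=> /sg[s hs ->]; apply: (le_trans (lip _ _ (inab _ hs) xib)); rewrite ler_wpM2l//.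
    by case/andP: hs => s1 s2; rewrite ler_norml; apply/andP; split; lra.
  have := segint_le cV c1 c3; rewrite -rmorphB /= nr_real (ger0_norm _)// subr_ge0.
  exact: le_trans h1 h2.
have -> : G b%:C - G a%:C = \sum_(i < n) (G (t i.+1)%:C - G (t i)%:C).
  rewrite -(big_mkord xpredT (fun i => G (t i.+1)%:C - G (t i)%:C)).
  by rewrite (telescope_sumr (fun i => G (t i)%:C)) ?t0 ?tn.
rewrite -sumrB nrE ltcR; apply: (le_lt_trans (nr_sum _ _ _)).
apply: (@le_lt_trans _ _ (\sum_(i < n) L * d * (t i.+1 - t i))); first by apply: ler_sum => i _.
rewrite -mulr_sumr -(big_mkord xpredT (fun i => t i.+1 - t i)) telescope_sumr// tn t0.
have : L * d * (b - a) <= d * K.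
  have -> : L * d * (b - a) = d * (L * (b - a)) by ring.
  by rewrite ler_wpM2l ?(ltW d0)// /K lerDl.
have : d * K = e / 2 by rewrite /d; field; rewrite gt_eqF.
by lra.
Qed.

Lemma Riemann_unique (V : normedModType R[i]) (f : R -> V) (a b : R) l l' : a < b ->
  is_Riemann_integral f a b l -> is_Riemann_integral f a b l' -> l = l'.
Proof.
move=> ab h1 h2; apply: contrapT => /eqP; rewrite -subr_eq0 -nr_eq0 => n0.
have e0 : 0 < nr (l - l') / 2 by rewrite divr_gt0// lt_neqAle nr_ge0 eq_sym n0.
have [d1 d10 k1] := h1 _ e0; have [d2 d20 k2] := h2 _ e0.
pose d := Num.min d1 d2; have d0 : 0 < d by rewrite lt_min d10.
have [n hn] : exists n : nat, (b - a) / d < n.+1%:R by exists (Num.truncn ((b - a) / d)); exact: truncnS_gt.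
pose t (i : nat) : R := a + i%:R * ((b - a) / n.+1%:R).
have n1 : 0 < n.+1%:R :> R by [].
have tS i : t i.+1 - t i = (b - a) / n.+1%:R by rewrite /t -natr1; ring.
have st : 0 < (b - a) / n.+1%:R by rewrite divr_gt0// subr_gt0.
have sd : (b - a) / n.+1%:R < d.
  by rewrite ltr_pdivrMr// mulrC -ltr_pdivrMr.
have t0 : t 0%N = a by rewrite /t mul0r addr0.
have tn : t n.+1 = b by rewrite /t mulrC divfK ?gt_eqF// addrC subrK.
have ok (d' : R) i : d <= d' -> (i < n.+1)%N -> t i <= t i <= t i.+1 /\ t i.+1 - t i < d'.
  move=> dd _; rewrite tS (lt_le_trans sd dd) lexx /=; split => //.
  by rewrite -subr_ge0 tS ltW.
have m1 : d <= d1 by rewrite ge_min lexx.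
have m2 : d <= d2 by rewrite ge_min lexx orbT.
have := k1 n.+1 t t t0 tn (fun i => ok d1 i m1); have := k2 n.+1 t t t0 tn (fun i => ok d2 i m2).
rewrite !nrE !ltcR; move: (\sum_(i < n.+1) _) => S g2 g1.
have := nr_triang S l l'; rewrite (nrC l S); move: g1 g2.
by move: (nr (S - l)) (nr (S - l')) (nr (l - l')) => x1 x2 x3; lra.
Qed.

Lemma hd_deq (V : normedModType R[i]) (f : C -> V) z d d' : d = d' -> hd f z d -> hd f z d'.
Proof. by move=> ->. Qed.

Let I : C := 0 +i* 1.
(** The path of [circle_integral], extended to complex time so that complex derivatives apply. *)
Definition pth (r : R) (t : C) : C := r%:C * cexp (I * t).

Lemma pth_real r (t : R) : pth r t%:C = r%:C * expi t.
Proof.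
rewrite /pth /cexp; have -> : I * t%:C = 0 +i* t.
  by apply/eqP; rewrite eq_complex /=; apply/andP; split; apply/eqP; ring.
by rewrite /= expR0 mul1r.
Qed.

Lemma hd_pth r t : hd (pth r) t (I * pth r t).
Proof.
have h1 : hd (fun x : C => I * x) t I.
  by apply: hd_deq (hdM (hd_cst I t) (hd_id t)); rewrite mul0r add0r mulr1.
have h2 := @hd_comp R C (@cexp R) (fun x => I * x) t I _ h1 (hd_cexp (I * t)).
apply: hd_deq (hdM (hd_cst r%:C t) h2).
rewrite /pth mul0r add0r; change (r%:C * (I * cexp (I * t)) = I * (r%:C * cexp (I * t))).
by rewrite mulrCA.
Qed.

Lemma pth_neq0 r t : 0 < r -> pth r t != 0.
Proof.
move=> r0; rewrite -nr_eq0 /pth nrM nr_cexp nr_real mulf_neq0// ?gt_eqF ?expR_gt0//.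
by rewrite normr_gt0 gt_eqF.
Qed.

Lemma nr_pth r (t : R) : 0 < r -> nr (pth r t%:C) = r.
Proof. by move=> r0; rewrite pth_real nrM nr_expi mulr1 nr_real gtr0_norm. Qed.

Lemma hd_pthV r t n : 0 < r ->
  hd (fun x => - (n.+1%:R)^-1 * (pth r x) ^- n.+1) t (I * (pth r t) ^- n.+1).
Proof.
move=> r0; have p0 := pth_neq0 t r0.
have hq : hd (fun x => (pth r x)^-1) t (- I * (pth r t)^-1).
  by apply: hd_deq (hdV (hd_pth r t) p0); move: (pth r t) p0 => p p0; field.
have h2 := hdM (hd_cst (- (n.+1%:R)^-1 : C) t) (hdX n.+1 hq).
have n0 : n.+1%:R != 0 :> C by rewrite pnatr_eq0.
apply: hd_ext (hd_deq _ h2) => [x|]; first by rewrite exprVn.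
rewrite mul0r add0r /= -exprVn exprS; move: (pth r t)^-1 => q; move: (q ^+ n) (n.+1%:R : C) n0 => qn m m0.
by field.
Qed.

(** The integrand has an explicit primitive [G] in time: a primitive of [h] along the path, negative
    powers of the path for the poles of higher order, and [(I * t) *: T 0%N] for the simple pole.
    All but the last are periodic. *)
Lemma circle_residue (V : normedModType R[i]) (cV : complete_nm V) (f h : C -> V) (T : nat -> V) k w (r r' : R) :
  0 < r -> r < r' -> hol (dsk w r') h ->
  (forall z, dsk w r' z -> z != w -> f z = \sum_(l < k.+1) (z - w) ^- l.+1 *: T l + h z) ->
  circle_integral f w r = (I * (pi *+ 2)%:C) *: T 0%N.
Proof.
move=> r0 rr' hh fE; have r'0 : 0 < r' by exact: lt_trans rr'.
pose p := pth r.
pose Phi t := (I * p t) *: (\sum_(l < k.+1) (p t) ^- l.+1 *: T l + h (w + p t)).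
pose U := [set t : C | nr (p t) < r'].
have wU t : U t -> dsk w r' (w + p t) by rewrite /U /dsk/= addrC addKr.
have Ur (t : R) : U t%:C by rewrite /U/= nr_pth.
have oU : opn U.
  move=> t Ut; have e0 : 0 < r' - nr (p t) by rewrite subr_gt0.
  have [d d0 hd'] := hd_cts (hd_pth r t) (divr_gt0 e0 (ltr0n R 2)).
  exists d => // u /hd' hu; rewrite /U/=; have := nr_triang (p t) (p u) 0; rewrite !subr0 => h1.
  by apply: (le_lt_trans h1); move: hu e0; rewrite -/(p u) -/(p t); move: (nr (p u - p t)) (nr (p t)) => x1 x2; lra.
have hp : hol U p by move=> t _; exists (I * p t); exact: hd_pth.
have hwp : forall t, hd (fun t => w + p t) t (I * p t).
  by move=> t; apply: hd_deq (hdD (hd_cst w t) (hd_pth r t)); rewrite add0r.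
have hhp : hol U (fun t => h (w + p t)).
  by move=> t Ut; have [d hd'] := hh _ (wU _ Ut); exists ((I * p t) *: d); exact: (@hd_comp R V h (fun t => w + p t) t _ _ (hwp t) hd').
have p0 t : p t != 0 by exact: pth_neq0.
have hPhi : hol U Phi.
  apply: hol_scale; first by apply: holM => //; exact: hol_cst.
  move=> t Ut; have [d1 k1] : exists d, hd (fun t => \sum_(l < k.+1) (p t) ^- l.+1 *: T l) t d.
    apply: (@hol_sum R V U _ _ _ (fun (l : 'I_k.+1) t => (p t) ^- l.+1 *: T l)) => // l _.
    apply: hol_scale; last exact: hol_cst.
    by apply: holV; [move=> z _; rewrite expf_neq0|apply: holX].
  have [d2 k2] := hhp _ Ut; exists (d1 + d2); exact: hdD.
pose Hh := segint h w.
have wd : dsk w r' w by rewrite /dsk/= subrr nr0.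
have hHh := primitive cV (@tri_dsk R w r') (@opn_dsk R w r') hh wd.
pose G t := Hh (w + p t) + (I * t) *: T 0%N + \sum_(j < k) (- (j.+1%:R)^-1 * (p t) ^- j.+1) *: T j.+1.
have hG t : U t -> hd G t (Phi t).
  move=> Ut; have g1 := @hd_comp R V Hh (fun t => w + p t) t _ _ (hwp t) (hHh _ (wU _ Ut)).
  have g2 : hd (fun x : C => (I * x) *: T 0%N) t (I *: T 0%N).
    have h1 : hd (fun x : C => I * x) t I.
      by apply: hd_deq (hdM (hd_cst I t) (hd_id t)); rewrite mul0r add0r mulr1.
    by apply: hd_deq (hd_scale h1 (hd_cst (T 0%N) t)); rewrite scaler0 addr0.
  have g3 : hd (fun x => \sum_(j < k) (- (j.+1%:R)^-1 * (p x) ^- j.+1) *: T j.+1) t (\sum_(j < k) (I * (p t) ^- j.+1) *: T j.+1).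
    apply: (@hd_sum R V _ _ _ (fun (j : 'I_k) x => (- (j.+1%:R)^-1 * (p x) ^- j.+1) *: T j.+1) (fun j => (I * (p t) ^- j.+1) *: T j.+1)) => j _.
    by apply: hd_deq (hd_scale (hd_pthV t j r0) (hd_cst (T j.+1) t)); rewrite scaler0 addr0.
  apply: hd_deq (hdD (hdD g1 g2) g3).
  rewrite /Phi big_ord_recl /= !scalerDr scaler_sumr expr1 scalerA mulfK//.
  rewrite -[LHS]addrA [LHS]addrC; congr (_ + _ + _).
  apply: eq_bigr => j _; rewrite scalerA; congr (_ *: _).
  by rewrite /bump /= add1n; have := p0 t; move: (p t) => q q0; rewrite [q ^+ j.+2]exprS; field; rewrite q0 expf_neq0.
have cdf t : U t -> cts (df Phi) t by move=> Ut; exact: hol_cts (df_hol cV oU hPhi) Ut.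
have pp : 0 <= pi *+ 2 :> R by rewrite mulrn_wge0// pi_ge0.
have [|M M0 hM] := @seg_bounded R V (df Phi) 0%:C (pi *+ 2)%:C.
  by move=> x /onseg_real[t _ ->]; exact: cdf.
have ftc : is_Riemann_integral (fun t => Phi t%:C) 0 (pi *+ 2) (G (pi *+ 2)%:C - G 0%:C).
  apply: (@Riemann_FTC V cV G Phi 0 (pi *+ 2) M) => //.
  - by move=> t _; exact: hG.
  - by move=> t _; exact: hol_cts hPhi (Ur t).
  - move=> s t hs ht.
    have c1 x : onseg t%:C s%:C x -> cts (df Phi) x by move=> /onseg_real[q _ ->]; exact: cdf.
    have c2 x : onseg t%:C s%:C x -> hd Phi x (df Phi x) by move=> /onseg_real[q _ ->]; exact: hol_hd hPhi (Ur _).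
    rewrite -(segint_FTC cV c1 c2); have -> : `|s - t| = nr (s%:C - t%:C) by rewrite -rmorphB nr_real.
    apply: (segint_nr_le cV) => // x /(onseg_real_in ht hs)[q /andP[q0 q1] ->]; apply: hM.
    have pn0 : pi *+ 2 != 0 :> R by rewrite gt_eqF// pmulrn_rgt0// pi_gt0.
    exists (q / (pi *+ 2)).
      by rewrite divr_ge0//= ler_pdivrMr ?mul1r// lt_neqAle eq_sym pn0.
    by rewrite -rmorphB -rmorphM -rmorphD /= add0r subr0 divfK.
have GE : G (pi *+ 2)%:C - G 0%:C = (I * (pi *+ 2)%:C) *: T 0%N.
  have pE : p (pi *+ 2)%:C = p 0%:C.
    rewrite /p !pth_real; congr (_ * _); rewrite mulr2n expiD.
    by apply/eqP; rewrite eq_complex /expi /= cospi sinpi cos0 sin0; apply/andP; split; apply/eqP; ring.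
  rewrite /G pE mulr0 scale0r addr0.
  move: (Hh _) (\sum_(j < k) _) ((I * _) *: _) => x1 x2 x3; module_solve (R[i] : comPzRingType) V.
have fPhi : (fun t : R => (I * r%:C * expi t) *: f (w + r%:C * expi t)) = (fun t => Phi t%:C).
  apply/funext => t; rewrite /Phi -mulrA -pth_real -/(p _); congr (_ *: _).
  have e : w + p t%:C - w = p t%:C by rewrite addrC addKr.
  have ne : w + p t%:C != w by rewrite -subr_eq0 e.
  by rewrite (fE _ (wU _ (Ur t)) ne) e.
rewrite /circle_integral -/I fPhi /Riemann_integral -GE; case: xgetP => [l _ /= hl|/(_ _ ftc)//].
by apply: Riemann_unique hl ftc; have := @pi_gt0 R; move: (pi : R) => q q0; rewrite mulr2n; lra.
Qed.

End Residue.

(** * Laurent expansions with explicit traces *)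

Section LaurentTrace.
Variables (R : realType) (H : completeNormedModType R[i]) (dot : {dot H for Num.Def.conjC}).
Hypothesis dn : forall x : H, `|x| ^+ 2 = dot x x.
Hypothesis sep : separable H.
Notation C := R[i].
Let cH : complete_nm H := @complete_completeType R H.
Let cB := @bop_complete R H.

Lemma rkBl (x x' y : H) : rk dot (x - x') y = rk dot x y - rk dot x' y.
Proof. by apply/bop_eqP => z; rewrite bopBE !(rkE dn) scalerBr. Qed.
Lemma rkDl (x x' y : H) : rk dot (x + x') y = rk dot x y + rk dot x' y.
Proof. by apply/bop_eqP => z; rewrite bopDE !(rkE dn) scalerDr. Qed.
Lemma rkZl a (x y : H) : rk dot (a *: x) y = a *: rk dot x y.
Proof. by apply/bop_eqP => z; rewrite bopZE !(rkE dn) !scalerA mulrC. Qed.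
Lemma nr_rk (x y : H) : nr (rk dot x y) <= nr x * nr y.
Proof.
apply: bop_nr_le => [|z]; first by rewrite mulr_ge0 ?nr_ge0.
rewrite (rkE dn) nrZ mulrC -mulrA ler_wpM2l ?nr_ge0// mulrC; exact: cauchy_schwarz.
Qed.

Lemma hol_rkM (U : set C) (v : C -> H) (Cz : C -> bop H) (y : H) : hol U v -> hol U Cz ->
  hol U (fun z => rk dot (v z) y * Cz z).
Proof.
move=> hv hC z Uz; have [d1 h1] := hv _ Uz; have [d2 h2] := hC _ Uz; eexists.
apply: (@hd_bil R H (bop H) (bop H) (fun x S => rk dot x y * S) (nr y) v Cz z d1 d2) => //.
- by move=> x x' S; rewrite rkBl mulrBl.
- by move=> x S S'; rewrite mulrBr.
- by move=> a x S; rewrite rkZl bopMZl.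
- by move=> a x S; rewrite bopMZr.
- move=> x S; apply: (le_trans (nr_bopM _ _)); rewrite ler_wpM2r ?nr_ge0// mulrC; exact: nr_rk.
Qed.

Lemma hol_dot (U : set C) (v : C -> H) (Cz : C -> bop H) (y : H) : hol U v -> hol U Cz ->
  hol U (fun z => dot (Cz z (v z)) y).
Proof.
move=> hv hC z Uz; have [d1 h1] := hv _ Uz; have [d2 h2] := hC _ Uz; eexists.
apply: (@hd_bil R H (bop H) C (fun x S => dot (S x) y) (nr y) v Cz z d1 d2) => //.
- by move=> x x' S; rewrite bopB dotBl.
- by move=> x S S'; rewrite bopBE dotBl.
- by move=> a x S; rewrite bopZ dotZl.
- by move=> a x S; rewrite bopZE dotZl.
- move=> x S; apply: (le_trans (cauchy_schwarz dn _ _)); rewrite mulrC -mulrA ler_wpM2l ?nr_ge0//.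
  by rewrite mulrC; exact: nr_bop.
Qed.

(** Two expansions side by side: that of an operator function and that of the scalar function [g]
    meant to be its trace, where each polar coefficient [t l] is the trace of [T l]. Residues can
    then be compared without exchanging a trace and an integral. *)
Definition laurent (w : C) (rho : R) k (f : C -> bop H) (g : C -> C) :=
  exists (T : nat -> bop H) (t : nat -> C) (h : C -> bop H) (hs : C -> C),
  [/\ hol (dsk w rho) h, hol (dsk w rho) hs, forall l, HT dot (T l) (t l) &
  forall z, dsk w rho z -> z != w ->
    (z - w) ^- k *: f z = \sum_(l < k) (z - w) ^- l.+1 *: T l + h z /\
    (z - w) ^- k * g z = \sum_(l < k) (z - w) ^- l.+1 * t l + hs z].

Lemma laurentD w rho k f g f' g' : laurent w rho k f g -> laurent w rho k f' g' ->
  laurent w rho k (fun z => f z + f' z) (fun z => g z + g' z).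
Proof.
move=> [T [t [h [hs [h1 h2 h3 h4]]]]] [T' [t' [h' [hs' [h1' h2' h3' h4']]]]].
exists (fun l => T l + T' l), (fun l => t l + t' l), (fun z => h z + h' z), (fun z => hs z + hs' z).
split=> [z dz|z dz|l|z dz zw].
- by have [d k1] := h1 _ dz; have [d' k2] := h1' _ dz; exists (d + d'); exact: hdD.
- by have [d k1] := h2 _ dz; have [d' k2] := h2' _ dz; exists (d + d'); exact: hdD.
- exact: HTD.
- have [e1 e2] := h4 _ dz zw; have [e1' e2'] := h4' _ dz zw.
  rewrite scalerDr mulrDr e1 e2 e1' e2'; split.
    rewrite addrACA -big_split; congr (_ + _); apply: eq_bigr => l _; exact/esym/scalerDr.
  by rewrite addrACA -big_split; congr (_ + _); apply: eq_bigr => l _; rewrite mulrDr.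
Qed.

Lemma HT0 : HT dot 0 0.
Proof.
move=> e e0; exists 0%N => n _; rewrite big1 ?subrr ?nr0 ?(ltW e0)// => i _.
by rewrite bop0E dot0l.
Qed.

(** Induction on [k]. Writing [v z = v w + (z - w) *: v1 z], and likewise for [Cz], the value at [w]
    is a multiple of rank-one type whose trace is given by [HT_rk]; the rest is [z - w] times two
    terms of the same shape, for which order [k] suffices. *)
Lemma laurent_rk w rho k (v : C -> H) (Cz : C -> bop H) y :
  hol (dsk w rho) v -> hol (dsk w rho) Cz ->
  laurent w rho k (fun z => rk dot (v z) y * Cz z) (fun z => dot (Cz z (v z)) y).
Proof.
elim: k v Cz => [|k ih] v Cz hv hC.
  exists (fun=> 0), (fun=> 0), (fun z => rk dot (v z) y * Cz z), (fun z => dot (Cz z (v z)) y).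
  split; [exact: hol_rkM|exact: hol_dot|by move=> _; exact: HT0|].
  by move=> z _ _; rewrite !big_ord0 !add0r expr0 invr1 scale1r mul1r.
have oD := @opn_dsk R w rho.
have hv0 : hol (dsk w rho) (fun z => v z - v w).
  by move=> z dz; have [d k1] := hv _ dz; exists (d - 0); apply: hdB => //; exact: hd_cst.
have hC0 : hol (dsk w rho) (fun z => Cz z - Cz w).
  by move=> z dz; have [d k1] := hC _ dz; exists (d - 0); apply: hdB => //; exact: hd_cst.
have [v1 hv1 vE] := hol_div cH oD hv0 (subrr _).
have [C1 hC1 CE] := hol_div cB oD hC0 (subrr _).
have hv0c : hol (dsk w rho) (fun=> v w) by exact: hol_cst.
have [T [t [h [hs [h1 h2 h3 h4]]]]] := laurentD (ih _ _ hv0c hC1) (ih _ _ hv1 hC).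
exists (fun l => if l == k then rk dot (v w) y * Cz w else T l).
exists (fun l => if l == k then dot (Cz w (v w)) y else t l), h, hs.
split=> // [l|z dz zw].
  by case: eqP => // _; exact: HT_rk.
have zw0 : z - w != 0 by rewrite subr_eq0.
have [e1 e2] := h4 _ dz zw.
have kS : (z - w) ^- k.+1 * (z - w) = (z - w) ^- k.
  by rewrite exprS invfM mulrC mulrA mulfV// mul1r.
have vz : v z = v w + (z - w) *: v1 z by rewrite -(vE _ dz) addrC subrK.
have Czz : Cz z = Cz w + (z - w) *: C1 z by rewrite -(CE _ dz) addrC subrK.
have lt_neq (l : 'I_k) : ((l : nat) == k) = false by rewrite ltn_eqF.
split.
- have -> : rk dot (v z) y * Cz z = rk dot (v w) y * Cz w +
     (z - w) *: (rk dot (v w) y * C1 z + rk dot (v1 z) y * Cz z).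
    rewrite {1}vz rkDl rkZl mulrDl {1}Czz mulrDr -addrA; congr (_ + _).
    by rewrite bopMZr bopMZl scalerDr.
  rewrite scalerDr scalerA kS e1 big_ord_recr /= eqxx addrA; congr (_ + _).
  rewrite addrC; congr (_ + _); apply: eq_bigr => l _; by rewrite lt_neq.
- have -> : dot (Cz z (v z)) y = dot (Cz w (v w)) y +
     (z - w) * (dot (C1 z (v w)) y + dot (Cz z (v1 z)) y).
    rewrite {1}vz bopD bopZ dotDl dotZl {1}Czz bopDE bopZE dotDl dotZl -addrA; congr (_ + _).
    by rewrite mulrDr.
  rewrite mulrDr mulrA kS e2 big_ord_recr /= eqxx addrA; congr (_ + _).
  rewrite addrC; congr (_ + _); apply: eq_bigr => l _; by rewrite lt_neq.
Qed.

Lemma laurent_sum w rho k (I : Type) (s : seq I) (F : I -> C -> bop H) (G : I -> C -> C) :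
  (forall i, laurent w rho k (F i) (G i)) ->
  laurent w rho k (fun z => \sum_(i <- s) F i z) (fun z => \sum_(i <- s) G i z).
Proof.
move=> h; elim: s => [|i s ih].
  exists (fun=> 0), (fun=> 0), (fun=> 0), (fun=> 0); split; try exact: hol_cst.
    by move=> _; exact: HT0.
  move=> z _ _; rewrite !big_nil scaler0 mulr0 !addr0; split; rewrite big1// => l _.
    exact: scaler0.
  exact: mulr0.
have := laurentD (h i) ih; congr laurent; apply/funext => z; by rewrite big_cons.
Qed.

End LaurentTrace.

Lemma dominant_sign (R : realType) (y f err : R) : y != 0 -> `|f| <= `|y| / 4 -> `|err| <= `|y| / 4 ->
  (0 < y + (f - err)) = (0 < y).
Proof.
move=> y0; rewrite !ler_norml => /andP[f1 f2] /andP[g1 g2].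
have [y1|y1|y1] := ltgtP 0 y; last by rewrite -y1 eqxx in y0.
  by rewrite gtr0_norm// in f1 f2 g1 g2; lra.
by rewrite ltr0_norm// in f1 f2 g1 g2; apply/negbTE; rewrite -leNgt; lra.
Qed.

(** * Transversality at the real boundary points *)

Section Geometry.
Variable R : realType.
Notation C := R[i].
Implicit Types (w z u : C).
Variable Omega : set C.
Hypothesis oO : open Omega.
Hypothesis smO : smooth_boundary Omega.
Hypothesis trO : transverse_to_real_axis Omega.

Definition bd_pt z := ~ Omega z /\ forall r : R, 0 < r -> exists2 u, nr (u - z) < r & Omega u.

Lemma nbhs_nr (A : set C) z : nbhs z A <-> exists2 r : R, 0 < r & forall u, nr (u - z) < r -> A u.
Proof.
split.
  move=> /nbhs_ballP[e /= e0 h]; exists (complex.Re e).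
    by move: e0; rewrite ltcE /= => /andP[].
  move=> u ur; apply: h; rewrite -ball_normE /= distrC nrE.
  by move: e0; rewrite ltcE /= => /andP[/eqP ie _]; rewrite ltcE /= ie eqxx.
move=> [r r0 h]; apply/nbhs_ballP; exists r%:C; first by rewrite /= -[0]/(0%:C) ltcR.
by move=> u; rewrite -ball_normE /= distrC nrE ltcR; exact: h.
Qed.

Lemma Omega_near z : Omega z -> exists2 r : R, 0 < r & forall u, nr (u - z) < r -> Omega u.
Proof. by move=> Oz; apply/nbhs_nr; exact: open_nbhs_nbhs. Qed.

Lemma closure_nr z : closure Omega z <-> forall r : R, 0 < r -> exists2 u, nr (u - z) < r & Omega u.
Proof.
split=> [h r r0|h B /nbhs_nr[r r0 hB]].
  have [|u [Ou hu]] := h [set u | nr (u - z) < r]; first by apply/nbhs_nr; exists r.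
  by exists u.
by have [u ur Ou] := h r r0; exists u; split => //; exact: hB.
Qed.

Lemma boundaryP z : boundary Omega z <-> bd_pt z.
Proof.
rewrite /boundary /bd_pt; split=> [[/closure_nr h nO]|[nO h]].
  by split => // Oz; apply: nO; rewrite /interior; exact: open_nbhs_nbhs.
split; first exact/closure_nr.
by move=> /interior_subset.
Qed.

Lemma exterior_near z : ~ Omega z -> ~ boundary Omega z ->
  exists2 r : R, 0 < r & forall u, nr (u - z) < r -> ~ Omega u.
Proof.
move=> nO nb; apply: contrapT => h; apply: nb; apply/boundaryP; split => // r r0.
apply: contrapT => h2; apply: h; exists r => // u ur Ou; apply: h2; by exists u.
Qed.

Definition right_side (sg : bool) (x t : R) := if sg then x < t else t < x.

(** By transversality the coefficient [c] of [Re w - x] in the first-order expansion of the defining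
    function does not vanish. In a cone around the real axis this term outweighs the vertical
    displacement and the remainder, and its sign decides membership. *)
Lemma boundary_cone (x : R) : boundary Omega x%:C -> exists (rho k : R) (sg : bool), [/\ 0 < rho, 0 < k &
  forall u, nr (u - x%:C) < rho -> k * `|complex.Im u| < `|complex.Re u - x| ->
    (Omega u <-> right_side sg x (complex.Re u))].
Proof.
move=> bx; have [nOx clx] := (boundaryP _).1 bx.
(* Transversality is used on the vector [i] alone: its tangential part has imaginary part 1, so the
   tangent is not real. *)
have [v [a [[r [u [g [[r0 u1 sg chart] [t vE]]]]] ie]]] := trO bx (0 +i* 1).
have {}u1 : nr u = 1 by rewrite /nr u1.
move: vE ie; set p := complex.Re (u * x%:C); set g' := derive1 g p => vE ie.
pose ur := complex.Re u; pose ui := complex.Im u.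
have uu : ur ^+ 2 + ui ^+ 2 = 1 by rewrite -nr_sqr u1 expr1n.
have uV : u^-1 = ur -i* ui.
  have u0 : u != 0 by rewrite -nr_eq0 u1 oner_eq0.
  apply: (mulfI u0); rewrite mulfV//; apply/eqP; rewrite eq_complex /=.
  move: uu; rewrite /ur /ui; case: (u) => /= x1 x2 e; apply/andP; split; apply/eqP; last by ring.
  by rewrite -e; ring.
pose c := ui - g' * ur; pose c2 := ur + g' * ui.
have c0 : c != 0.
  have : complex.Im (0 +i* 1 : C) = complex.Im v by rewrite ie ImD /= addr0.
  rewrite vE uV /= => e; apply/eqP => cz.
  have : (1 : R) = - t * c by rewrite e /c; ring.
  by rewrite cz mulr0 => /eqP; rewrite oner_eq0.
have dg : is_derive p 1 g g' by rewrite /g' derive1E; apply: DeriveDef => //; exact: (sg 0%N p).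
have c8 : 0 < `|c| / 8 by rewrite divr_gt0// normr_gt0.
have [d d0 hg] := real_derive_eps dg c8.
have pE : p = ur * x by rewrite /p /ur /=; case: (u) => /= x1 x2; ring.
have IE : complex.Im (u * x%:C) = ui * x by rewrite /ui; case: (u) => /= x1 x2; ring.
have ReE w : complex.Re (u * w) = p + (ur * (complex.Re w - x) - ui * complex.Im w).
  by rewrite pE /ur /ui; case: (u) (w) => /= x1 x2 [y1 y2] /=; ring.
have ImE w : complex.Im (u * w) = ui * x + (ui * (complex.Re w - x) + ur * complex.Im w).
  by rewrite /ur /ui; case: (u) (w) => /= x1 x2 [y1 y2] /=; ring.
have ur1 : `|ur| <= 1 by rewrite -u1 /ur nrRe.
have ui1 : `|ui| <= 1 by rewrite -u1 /ui nrIm.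
have devb w : `|ur * (complex.Re w - x) - ui * complex.Im w| <= `|complex.Re w - x| + `|complex.Im w|.
  apply: (le_trans (ler_normB _ _)); rewrite !normrM; apply: lerD; exact: ler_piMl.
have Rw w : `|complex.Re w - x| <= nr (w - x%:C) by have := nrRe (w - x%:C); rewrite raddfB.
have Iw w : `|complex.Im w| <= nr (w - x%:C) by have := nrIm (w - x%:C); rewrite ImB /= subr0.
(* The boundary point lies on the graph: it is outside the open epigraph, and strictly below the
   graph it would not be a limit of points of [Omega]. *)
have fx : ui * x = g p.
  apply/eqP; rewrite eq_le; apply/andP; split.
    rewrite leNgt; apply/negP => h; apply: nOx; apply/chart; rewrite ?subrr ?normr0 -?[0]/(0%:C) ?ltcR//.
    by rewrite IE -/p.
  rewrite leNgt; apply/negP => h.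
  pose K := `|g'| + `|c| / 8; have K0 : 0 < K by rewrite ltr_wpDl.
  pose e := Num.min r (Num.min (d / 2) ((g p - ui * x) / (2 * K + 2))).
  have e0 : 0 < e by rewrite !lt_min r0 !divr_gt0 ?subr_gt0// addr_gt0// mulr_gt0.
  have [w wx Ow] := clx e e0.
  have [w1 [w2 w3]] : nr (w - x%:C) < r /\ nr (w - x%:C) < d / 2 /\ nr (w - x%:C) < (g p - ui * x) / (2 * K + 2).
    by move: wx; rewrite !lt_min => /andP[-> /andP[-> ->]].
  have : g (complex.Re (u * w)) < complex.Im (u * w) by apply/chart; rewrite ?nrE ?ltcR.
  rewrite ReE ImE; set y := ur * _ - _.
  have yb : `|y| <= 2 * nr (w - x%:C) by apply: (le_trans (devb w)); have := Rw w; have := Iw w; lra.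
  have hgy := hg y.
  have {}hgy : `|g (p + y) - g p| <= K * (2 * nr (w - x%:C)).
    have yd : `|y| < d by lra.
    have := hgy yd; have := ler_normD (g (p + y) - g p - y * g') (y * g'); rewrite subrK normrM => h1 h2.
    apply: (le_trans h1); apply: (@le_trans _ _ (K * `|y|)); last by rewrite ler_wpM2l// ltW.
    have -> : K * `|y| = `|c| / 8 * `|y| + `|y| * `|g'| by rewrite /K; ring.
    exact: lerD.
  have zb : ui * (complex.Re w - x) + ur * complex.Im w <= 2 * nr (w - x%:C).
    apply: (le_trans (ler_norm _)); apply: (le_trans (ler_normD _ _)); rewrite !normrM.
    have h1 : `|ui| * `|complex.Re w - x| <= `|complex.Re w - x| by exact: ler_piMl.
    have h2 : `|ur| * `|complex.Im w| <= `|complex.Im w| by exact: ler_piMl.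
    by have := Rw w; have := Iw w; lra.
  move: w3; rewrite ltr_pdivlMr ?addr_gt0 ?mulr_gt0// => w3.
  move: hgy; rewrite ler_norml => /andP[hgy _] h3.
  by move: hgy zb w3 h3; move: (nr _) (g (p + y)) (g p) (ui * x) (ui * _ + _) => q1 q2 q3 q4 q5; lra.
(* This slope makes [|c2 * Y|] at most a quarter of [|c * X|]; the remainder takes another quarter,
   as in [dominant_sign]. *)
pose k := 1 + 4 * `|c2| / `|c|.
have c0' : 0 < `|c| by rewrite normr_gt0.
have k1 : 1 <= k by rewrite /k lerDl divr_ge0// mulr_ge0.
have kc : 4 * `|c2| <= `|c| * k.
  have -> : `|c| * k = `|c| + 4 * `|c2| by rewrite /k; field; rewrite gt_eqF.
  by rewrite lerDr ltW.
exists (Num.min r (d / 2)), k, (0 < c); split.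
- by rewrite lt_min r0 divr_gt0.
- exact: lt_le_trans k1.
move=> w; rewrite lt_min => /andP[wr wd] cone.
have -> : Omega w <-> g (complex.Re (u * w)) < complex.Im (u * w) by apply: chart; rewrite nrE ltcR.
rewrite ReE ImE fx; set y := ur * _ - _.
have yb : `|y| <= `|complex.Re w - x| + `|complex.Im w| by exact: devb.
have yd : `|y| < d by have := Rw w; have := Iw w; lra.
have hgy := hg y yd.
pose X := complex.Re w - x; pose Y := complex.Im w; rewrite -/X -/Y in cone yb hgy *.
have Y1 : `|Y| <= `|X| by apply: ltW; apply: le_lt_trans cone; rewrite ler_peMl.
have X0 : 0 < `|X| by apply: le_lt_trans cone; rewrite mulr_ge0// (le_trans ler01).
pose err := g (p + y) - g p - y * g'.
have errb : `|err| <= `|c| / 4 * `|X|.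
  apply: (le_trans hgy); apply: (@le_trans _ _ (`|c| / 8 * (2 * `|X|))); last by lra.
  by rewrite ler_wpM2l ?(ltW c8)//; lra.
have c2b : `|c2 * Y| <= `|c| / 4 * `|X|.
  rewrite normrM; have a1 : `|c| * (k * `|Y|) <= `|c| * `|X| by rewrite ler_wpM2l// ltW.
  have a2 : 4 * (`|c2| * `|Y|) <= `|c| * (k * `|Y|) by rewrite !mulrA ler_wpM2r.
  have -> : `|c| / 4 * `|X| = (`|c| * `|X|) / 4 by ring.
  by move: a1 a2; move: (`|c2| * `|Y|) (`|c| * (k * `|Y|)) (`|c| * `|X|) => q1 q2 q3; lra.
have gE : g (p + y) = g p + y * g' + err by rewrite /err; ring.
have key : (g (p + y) < g p + (ui * X + ur * Y)) = (0 < c * X + (c2 * Y - err)).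
  rewrite gE -subr_gt0; congr (0 < _); rewrite /y /c /c2 -/X -/Y; ring.
have q4 : `|c| / 4 * `|X| = `|c * X| / 4 by rewrite normrM mulrAC.
rewrite q4 in errb c2b; have cX0 : c * X != 0 by rewrite mulf_neq0// -normr_gt0.
rewrite key (dominant_sign cX0 c2b errb) /right_side; case: (ltrP 0 c) => cs.
  by rewrite (pmulr_rgt0 X cs) subr_gt0.
have cs' : c < 0 by rewrite lt_neqAle c0.
by rewrite (nmulr_rgt0 X cs') subr_lt0.
Qed.

Definition incone (s : seq R) (k : R) w := forall x, x \in s -> k * `|complex.Im w| < `|complex.Re w - x|.

(** Real boundary points are isolated, because next to a boundary point [t] the cone makes
    membership locally constant on either side of [t]. *)
Lemma local_structure (t : R) : exists (rho k : R) (s : seq R), [/\ 0 < rho, 0 < k,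
  forall x, x \in s -> boundary Omega x%:C,
  forall x : R, boundary Omega x%:C -> `|x - t| < rho -> x \in s &
  forall w, `|complex.Re w - t| < rho -> `|complex.Im w| < rho -> incone s k w ->
    (Omega w <-> Omega (complex.Re w)%:C)].
Proof.
have close (r : R) w : `|complex.Re w - t| < r / 2 -> `|complex.Im w| < r / 2 -> nr (w - t%:C) < r.
  move=> h1 h2; apply: (le_lt_trans (nr_le_ReIm _)); rewrite raddfB ImB /= subr0; lra.
have closeR (r : R) w : 0 < r -> `|complex.Re w - t| < r / 2 -> nr ((complex.Re w)%:C - t%:C) < r.
  by move=> r0 h1; rewrite -rmorphB nr_real; lra.
have [bt|nbt] := pselect (boundary Omega t%:C).
  have [rho [k [sg [r0 k0 h]]]] := boundary_cone bt.
  have r2 : 0 < rho / 2 by rewrite divr_gt0.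
  exists (rho / 2), k, [:: t]; split.
  - exact: r2.
  - exact: k0.
  - by move=> x; rewrite inE => /eqP ->.
  - move=> x bx xt; rewrite inE; apply/eqP; apply: contrapT => /eqP xt0.
    have [nOx clx] := (boundaryP _).1 bx.
    have x0 : 0 < `|x - t| by rewrite normr_gt0 subr_eq0.
    have hx : Omega x%:C <-> right_side sg t x.
      by apply: h => /=; rewrite ?normr0 ?mulr0// -rmorphB nr_real; lra.
    pose q := Num.min (rho / 2) (`|x - t| / (k + 2)).
    have q0 : 0 < q by rewrite lt_min r2 divr_gt0// addr_gt0.
    have [u uq Ou] := clx q q0; apply: nOx; apply/hx.
    have [u1 u2] : nr (u - x%:C) < rho / 2 /\ nr (u - x%:C) < `|x - t| / (k + 2).
      by move: uq; rewrite lt_min => /andP[].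
    have Ru : `|complex.Re u - x| <= nr (u - x%:C) by have := nrRe (u - x%:C); rewrite raddfB.
    have Iu : `|complex.Im u| <= nr (u - x%:C) by have := nrIm (u - x%:C); rewrite ImB /= subr0.
    rewrite ltr_pdivlMr ?addr_gt0// in u2.
    have tr : `|x - t| <= `|complex.Re u - t| + `|complex.Re u - x|.
      have := ler_normD (complex.Re u - t) (x - complex.Re u).
      by rewrite addrC addrA subrK [`|x - complex.Re u|]distrC.
    have ku : k * `|complex.Im u| <= k * nr (u - x%:C) by rewrite ler_wpM2l// ltW.
    have : right_side sg t (complex.Re u).
      apply/h => //.
        by apply: (le_lt_trans (nr_triang x%:C _ _)); rewrite -(rmorphB _ x t) nr_real; lra.
      by have := nr_ge0 (u - x%:C); lra.
    have := nr_ge0 (u - x%:C).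
    rewrite /right_side; case: (sg) => hu nn.
      rewrite ltNge; apply/negP => xl; have := ler0_norm (x := x - t); rewrite subr_le0 => /(_ xl) e.
      by have := ler_norm (complex.Re u - x); rewrite e in u2; nra.
    rewrite ltNge; apply/negP => xl; have := ger0_norm (x := x - t); rewrite subr_ge0 => /(_ xl) e.
    by have := ler_norm (- (complex.Re u - x)); rewrite normrN e in u2 *; nra.
  - move=> w w1 w2 cw; have ct := cw t (mem_head _ _).
    have -> : Omega w <-> right_side sg t (complex.Re w) by apply: h => //; exact: close.
    have -> // : Omega (complex.Re w)%:C <-> right_side sg t (complex.Re w).
    apply: h; first exact: closeR.
    by rewrite /= normr0 mulr0 (le_lt_trans _ ct)// mulr_ge0// ltW.
have [rho r0 h] : exists2 rho : R, 0 < rho & (forall u, nr (u - t%:C) < rho -> Omega u) \/ (forall u, nr (u - t%:C) < rho -> ~ Omega u).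
  have [Ot|nOt] := pselect (Omega t%:C).
    by have [r r0 hr] := Omega_near Ot; exists r => //; left.
  by have [r r0 hr] := exterior_near nOt nbt; exists r => //; right.
have r2 : 0 < rho / 2 by rewrite divr_gt0.
exists (rho / 2), 1, [::]; split; [exact: r2|exact: ltr01|by []| |].
  move=> x /boundaryP[nOx clx] xt; exfalso.
  have xt' : `|x - t| < rho by move: xt; have := normr_ge0 (x - t); lra.
  case: h => h; first by apply: nOx; apply: h; rewrite -rmorphB nr_real.
  have [|u u1 Ou] := clx (rho / 2); first by rewrite divr_gt0.
  by apply: (h u) => //; apply: (le_lt_trans (nr_triang x%:C _ _)); rewrite -rmorphB nr_real; lra.
move=> w w1 w2 _; have k1 := close _ _ w1 w2; have k2 := closeR _ _ r0 w1.
by case: h => h; split => // O1; [exact: h|exact: h|case: (h _ k1 O1)|case: (h _ k2 O1)].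
Qed.

Variable B : R.
Hypothesis B0 : 0 < B.
Hypothesis OB : forall z, Omega z -> nr z < B.

Lemma boundary_B (x : R) : boundary Omega x%:C -> - B <= x <= B.
Proof.
move=> /boundaryP[_ cl]; rewrite -ler_norml leNgt; apply/negP => h.
have [|u u1 /OB u2] := cl (`|x| - B); first by rewrite subr_gt0.
have := nr_triang u x%:C 0; rewrite !subr0 nr_real nrC; lra.
Qed.

(** Local structures over short pieces of [[- B, B]] are glued by bisection, with the larger slope,
    the smaller height and the union of the lists; finiteness of the real boundary comes along. *)
Theorem real_structure : exists (eta k : R) (s : seq R), [/\ 0 < eta, 0 < k,
  forall x : R, x \in s <-> boundary Omega x%:C &
  forall w, `|complex.Im w| < eta -> incone s k w -> (Omega w <-> Omega (complex.Re w)%:C)].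
Proof.
have ReB' (x y : C) : complex.Re (x - y) = complex.Re x - complex.Re y by case: x => ? ?; case: y.
pose G (p q : C) := exists (eta k : R) (s : seq R), [/\ 0 < eta, 0 < k,
  forall x, x \in s -> boundary Omega x%:C,
  forall x : R, boundary Omega x%:C -> complex.Re p <= x <= complex.Re q -> x \in s &
  forall w, complex.Re p <= complex.Re w <= complex.Re q -> `|complex.Im w| < eta -> incone s k w ->
    (Omega w <-> Omega (complex.Re w)%:C)].
have [|t [p0 q0]|eta [k [s [e0 k0 s1 s2 h]]]] := @bisection R G (- B)%:C B%:C.
- move=> a b _ _ [e1 [k1 [s1 [p1 p2 p3 p4 p5]]]] [e2 [k2 [s2 [q1 q2 q3 q4 q5]]]].
  exists (Num.min e1 e2), (Num.max k1 k2), (s1 ++ s2); split.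
  + by rewrite lt_min p1.
  + by rewrite lt_max p2.
  + by move=> x; rewrite mem_cat => /orP[/p3|/q3].
  + move=> x bx /andP[x1 x2]; rewrite mem_cat; case: (leP x (complex.Re (mid a b))) => xm.
      by rewrite p4// x1.
    by rewrite q4 ?orbT// (ltW xm).
  + move=> w /andP[w1 w2]; rewrite lt_min => /andP[i1 i2] cw.
    have c1 : incone s1 k1 w.
      move=> x xs; apply: le_lt_trans (cw x _); last by rewrite mem_cat xs.
      by rewrite ler_wpM2r// le_max lexx.
    have c2 : incone s2 k2 w.
      move=> x xs; apply: le_lt_trans (cw x _); last by rewrite mem_cat xs orbT.
      by rewrite ler_wpM2r// le_max lexx orbT.
    case: (leP (complex.Re w) (complex.Re (mid a b))) => wm.
      by apply: p5 => //; rewrite w1.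
    by apply: q5 => //; rewrite (ltW wm).
- move=> _; have [rho [k [s [r0 k0 s1 s2 h]]]] := local_structure (complex.Re t).
  exists (rho / 4); first by rewrite divr_gt0.
  move=> a b _ _ ba ax; exists rho, k, s.
  have a1 : `|complex.Re a - complex.Re t| < rho / 2.
    by have := nrRe (a - t); rewrite raddfB /=; lra.
  have b1 : `|complex.Re b - complex.Re t| < rho.
    have := nrRe (b - a); rewrite raddfB /= => h1.
    have := ler_normD (complex.Re b - complex.Re a) (complex.Re a - complex.Re t); rewrite addrA subrK; lra.
  have bet (y : R) : complex.Re a <= y <= complex.Re b -> `|y - complex.Re t| < rho.
    move: a1 b1; rewrite !ltr_norml => /andP[? ?] /andP[? ?] /andP[? ?].
    by apply/andP; split; lra.
  split; [exact: r0|exact: k0|exact: s1| |].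
    by move=> x bx /bet; exact: s2.
  by move=> w /bet; exact: h.
exists eta, k, s; split; [exact: e0|exact: k0| |].
  by move=> x; split; [exact: s1|move=> bx; apply: s2 => //; exact: boundary_B].
move=> w iw cw; case: (boolP (- B <= complex.Re w <= B)) => [wB|]; first exact: h.
rewrite -ler_norml -ltNge => wB; split=> /OB; rewrite ?nr_real => h1.
  by have := nrRe w; lra.
by lra.
Qed.

Theorem real_constancy (p q : R) : p <= q -> (forall x : R, boundary Omega x%:C -> ~ (p <= x <= q)) ->
  (Omega p%:C <-> Omega q%:C).
Proof.
move=> pq nb.
pose G (a b : C) := complex.Re a <= complex.Re b -> (forall x : R, boundary Omega x%:C -> ~ (complex.Re a <= x <= complex.Re b)) ->
  (Omega (complex.Re a)%:C <-> Omega (complex.Re b)%:C).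
suff : G p%:C q%:C by apply.
apply: (@bisection R G p%:C q%:C) => [a b _ _ h1 h2 ab nx|t [t0 t01 tE]].
  have mE : complex.Re (mid a b) = (complex.Re a + complex.Re b) / 2.
    rewrite /mid; have -> : (2 : C)^-1 = (2^-1)%:C by rewrite -[2]/(2%:R) -[in LHS](rmorph_nat (@real_complex R)) fmorphV.
    by case: (a) (b) => a1 a2 [b1 b2] /=; ring.
  have m1 : complex.Re a <= complex.Re (mid a b) by rewrite mE; lra.
  have m2 : complex.Re (mid a b) <= complex.Re b by rewrite mE; lra.
  have -> : Omega (complex.Re a)%:C <-> Omega (complex.Re (mid a b))%:C.
    by apply: h1 => // x bx /andP[x1 x2]; apply: (nx x bx); rewrite x1 (le_trans x2).
  by apply: h2 => // x bx /andP[x1 x2]; apply: (nx x bx); rewrite x2 (le_trans _ x1).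
set y := complex.Re t.
have tr : t = y%:C.
  by rewrite /y tE -rmorphB -rmorphM -rmorphD.
have nby : ~ boundary Omega y%:C.
  move=> by'; apply: (nb _ by'); rewrite /y tE -rmorphB -rmorphM -rmorphD /=; case/andP: t01 => t1 t2.
  by apply/andP; split; nra.
have [rho r0 h] : exists2 rho : R, 0 < rho & (forall u, nr (u - y%:C) < rho -> Omega u) \/ (forall u, nr (u - y%:C) < rho -> ~ Omega u).
  have [Ot|nOt] := pselect (Omega y%:C).
    by have [r r0 hr] := Omega_near Ot; exists r => //; left.
  by have [r r0 hr] := exterior_near nOt nby; exists r => //; right.
exists (rho / 4); first by rewrite divr_gt0.
move=> a b _ _ ba ax ab _.
have a1 : nr ((complex.Re a)%:C - y%:C) < rho.
  rewrite -rmorphB nr_real; have := nrRe (a - t); rewrite raddfB /= -/y; lra.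
have b1 : nr ((complex.Re b)%:C - y%:C) < rho.
  rewrite -rmorphB nr_real; have := nrRe (b - a); rewrite raddfB /= => h1.
  have := ler_normD (complex.Re b - complex.Re a) (complex.Re a - y); rewrite addrA subrK.
  by have := nrRe (a - t); rewrite raddfB /= -/y; lra.
by case: h => h; split => // O1; [exact: h|exact: h|case: (h _ a1 O1)|case: (h _ b1 O1)].
Qed.

End Geometry.

Lemma inverse_increment (R : realType) (V : lmodType R[i]) (t : R[i]) (gw gz a b : V) :
  gw - gz - t *: (- a) = - (gz - gw - t *: b) + t *: (a - b).
Proof. by module_solve (R[i] : comPzRingType) V. Qed.

(** * Reduction of characteristic values to a determinant *)

Section Inverses.
Variables (R : realType) (H : completeNormedModType R[i]).
Notation C := R[i].
Implicit Types (T S F : bop H).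
Let cB := @bop_complete R H.

Lemma inverse_unique T S S' : is_inverse T S -> is_inverse T S' -> S = S'.
Proof. by move=> [h1 h2] [h3 h4]; rewrite -[S]mulr1 -h3 mulrA h2 mul1r. Qed.

Lemma inverseE T S : is_inverse T S -> inverse T = S.
Proof.
move=> h; rewrite /inverse; case: xgetP => [S' _ /= h'|/(_ S)//].
exact: inverse_unique h' h.
Qed.

Lemma inverseP T : invertible T -> is_inverse T (inverse T).
Proof. by move=> [S h]; rewrite (inverseE h). Qed.

Lemma nr_bopX T (q : R) n : nr T <= q -> 0 <= q -> nr (T ^+ n) <= q ^+ n.
Proof.
move=> Tq q0; elim: n => [|n ih]; first by rewrite !expr0; exact: nr_bop1.
by rewrite !exprS; apply: (le_trans (nr_bopM _ _)); apply: ler_pM; rewrite ?nr_ge0.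
Qed.

Lemma neumann T : nr T <= 1 / 2 -> exists2 S, is_inverse (1 - T) S & nr S <= 2.
Proof.
move=> T2; have q0 : 0 <= 1 / 2 :> R by rewrite divr_ge0.
pose u n := \sum_(i < n) T ^+ i.
have Tn n : nr (T ^+ n) <= 1 / 2 ^+ n.
  by apply: (le_trans (nr_bopX n T2 q0)); rewrite expr_div_n expr1n.
have [|S hS] := cB (cauchy_geo ler01 (u := u) _).
  by move=> n; rewrite /u big_ord_recr /= addrAC subrr add0r.
have T0 : cv (fun n => T ^+ n) 0.
  move=> e e0; have [N hN] : exists N : nat, e^-1 < N.+1%:R by exists (Num.truncn e^-1); exact: truncnS_gt.
  exists N => n Nn; rewrite subr0; apply: (le_trans (Tn n)).
  rewrite div1r -[leRHS]invrK lef_pV2 ?posrE ?invr_gt0 ?exprn_gt0//.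
  apply: (le_trans (ltW hN)); rewrite -natrX ler_nat.
  by apply: (leq_trans _ (ltn_expl n (ltnSn 1))); rewrite ltnS.
have e1 n : (1 - T) * u n = 1 - T ^+ n.
  elim: n => [|n ih]; first by rewrite /u big_ord0 mulr0 expr0 subrr.
  by rewrite /u big_ord_recr /= mulrDr -/(u n) ih mulrBl mul1r -exprS addrA subrK.
have e2 n : u n * (1 - T) = 1 - T ^+ n.
  elim: n => [|n ih]; first by rewrite /u big_ord0 mul0r expr0 subrr.
  by rewrite /u big_ord_recr /= mulrDl -/(u n) ih mulrBr mulr1 -exprSr addrA subrK.
have lim1 : cv (fun n => 1 - T ^+ n) (1 - 0).
  by move=> e /T0[N hN]; exists N => n /hN; rewrite !subr0 addrAC subrr add0r nrN.
exists S.
  split; apply/esym; rewrite -[1]subr0.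
    apply: (cv_unique lim1); have := @cv_lip R (bop H) (bop H) (fun X => (1 - T) * X) (nr (1 - T)) u S _ hS.
    have -> : (fun n => (1 - T) * u n) = (fun n => 1 - T ^+ n) by apply/funext.
    by rewrite subr0; apply => x y; rewrite -mulrBr; exact: nr_bopM.
  apply: (cv_unique lim1); have := @cv_lip R (bop H) (bop H) (fun X => X * (1 - T)) (nr (1 - T)) u S _ hS.
  have -> : (fun n => u n * (1 - T)) = (fun n => 1 - T ^+ n) by apply/funext.
  by rewrite subr0; apply => x y; rewrite -mulrBl mulrC; exact: nr_bopM.
apply: (nr_cv_le hS) => n; apply: (@le_trans _ _ (2 - 1 / 2 ^+ n * 2)); last first.
  by rewrite lerBlDr lerDl mulr_ge0// divr_ge0// exprn_ge0.
elim: n => [|n ih]; first by rewrite /u big_ord0 nr0 expr0; lra.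
rewrite /u big_ord_recr /=; apply: (le_trans (nrD _ _)); have := Tn n; move: ih; rewrite -/(u n) => h1 h2.
apply: (le_trans (lerD h1 h2)); rewrite exprS.
have p0 : 2 ^+ n != 0 :> R by rewrite expf_neq0// pnatr_eq0.
by rewrite le_eqVlt; apply/orP; left; apply/eqP; field.
Qed.

Lemma near_inverse F F0 S0 : is_inverse F0 S0 -> nr (F - F0) * nr S0 <= 1 / 2 ->
  exists2 S, is_inverse F S & nr S <= 2 * nr S0.
Proof.
move=> [h1 h2] h; pose T := S0 * (F0 - F).
have [|N [n1 n2] n3] := @neumann T.
  by apply: (le_trans (nr_bopM _ _)); rewrite mulrC nrC.
have FE : F = F0 * (1 - T) by rewrite mulrBr mulr1 /T mulrA h1 mul1r opprB addrC subrK.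
exists (N * S0); last by apply: (le_trans (nr_bopM _ _)); rewrite ler_wpM2r ?nr_ge0.
split; rewrite FE.
  by rewrite mulrA -[F0 * _ * N]mulrA n1 mulr1.
by rewrite mulrA -[N * S0 * F0]mulrA h2 mulr1.
Qed.

Lemma hd_bopM (f g : C -> bop H) z d d' : hd f z d -> hd g z d' ->
  hd (fun w => f w * g w) z (d * g z + f z * d').
Proof.
apply: (@hd_bil R (bop H) (bop H) (bop H) (fun x y => x * y) 1) => [x x' y|x y y'|a x y|a x y|x y].
- exact: mulrBl.
- exact: mulrBr.
- exact: bopMZl.
- exact: bopMZr.
- by rewrite mul1r; exact: nr_bopM.
Qed.

Lemma hol_bopM (U : set C) (f g : C -> bop H) : hol U f -> hol U g -> hol U (fun w => f w * g w).
Proof. by move=> hf hg z Uz; have [d h] := hf _ Uz; have [d' h'] := hg _ Uz; eexists; exact: hd_bopM h h'. Qed.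

Lemma holDV (V : normedModType R[i]) (U : set C) (f g : C -> V) : hol U f -> hol U g -> hol U (fun w => f w + g w).
Proof. by move=> hf hg z Uz; have [d h] := hf _ Uz; have [d' h'] := hg _ Uz; exists (d + d'); exact: hdD. Qed.

Lemma hol_app (U : set C) (f : C -> bop H) (v : C -> H) : hol U f -> hol U v -> hol U (fun w => f w (v w)).
Proof.
move=> hf hv z Uz; have [d1 h1] := hf _ Uz; have [d2 h2] := hv _ Uz; eexists.
apply: (@hd_bil R (bop H) H H (fun S x => S x) 1 f v z d1 d2) => //.
- by move=> x x' y; rewrite bopB.
- by move=> a x y; rewrite bopZ.
- by move=> S x; rewrite mul1r; exact: nr_bop.
Qed.

Lemma opn_invertible (U : set C) (F : C -> bop H) : opn U -> hol U F ->
  opn [set z | U z /\ invertible (F z)].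
Proof.
move=> oU hF z [Uz [S0 hS]]; have [r1 r10 h1] := oU _ Uz.
have e0 : 0 < 1 / 2 / (nr S0 + 1) by rewrite !divr_gt0// ltr_wpDl ?nr_ge0.
have [r2 r20 h2] := hol_cts hF Uz e0.
exists (Num.min r1 r2); first by rewrite lt_min r10.
move=> w; rewrite lt_min => /andP[/h1 Uw /h2 hw]; split => //.
have [|S hS' _] := @near_inverse (F w) (F z) S0 hS; last by exists S.
apply: (@le_trans _ _ (1 / 2 / (nr S0 + 1) * nr S0)); first by rewrite ler_wpM2r ?nr_ge0.
by rewrite mulrAC ler_pdivrMr ?ltr_wpDl ?nr_ge0// ler_wpM2l ?divr_ge0// lerDl.
Qed.

(** The identity [G w - G z = - (G w * (F w - F z) * G z)], used twice, isolates the derivative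
    [- (G z * D * G z)]; [near_inverse] bounds [G] uniformly near [z]. *)
Lemma hol_inverse (U : set C) (F : C -> bop H) : opn U -> hol U F -> (forall z, U z -> invertible (F z)) ->
  hol U (fun z => inverse (F z)).
Proof.
move=> oU hF iF z Uz; have [D hD] := hF _ Uz; pose G w := inverse (F w).
have hG w : U w -> is_inverse (F w) (G w) by move=> /iF; exact: inverseP.
have [r1 r10 h1] := oU _ Uz; have [g1 g2] := hG _ Uz.
have Gd w : U w -> G w - G z = - (G w * (F w - F z) * G z).
  move=> Uw; have [k1 k2] := hG _ Uw; rewrite mulrBr mulrBl k2 mul1r -mulrA g1 mulr1.
  by rewrite opprB.
pose K := nr (G z) + 1; have K0 : 0 < K by rewrite ltr_wpDl ?nr_ge0.
have e0 : 0 < 1 / 2 / K by rewrite !divr_gt0.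
have [r2 r20 h2] := hol_cts hF Uz e0.
have Gb w : nr (w - z) < Num.min r1 r2 -> U w /\ nr (G w) <= 2 * K.
  rewrite lt_min => /andP[/h1 Uw /h2 hw]; split => //.
  have [|S hS Sb] := @near_inverse (F w) (F z) (G z) (hG _ Uz).
    apply: (@le_trans _ _ (1 / 2 / K * nr (G z))); first by rewrite ler_wpM2r ?nr_ge0.
    by rewrite mulrAC ler_pdivrMr// ler_wpM2l ?divr_ge0// lerDl.
  rewrite /G (inverseE hS); apply: (le_trans Sb); rewrite ler_wpM2l// /K lerDl//.
exists (- (G z * D * G z)) => e e0'.
pose L := nr D + 1; have L0 : 0 < L by rewrite ltr_wpDl ?nr_ge0.
have [r3 r30 h3] := hd_bound hD.
pose M := 2 * K * K * (1 + K * L * L); have M0 : 0 < M by rewrite !mulr_gt0// addr_gt0// !mulr_gt0.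
have eM : 0 < e / (2 * M) by rewrite divr_gt0// mulr_gt0.
have [r4 r40 h4] := hD _ eM.
pose r5 := e / (2 * M).
exists (Num.min (Num.min r1 r2) (Num.min r3 (Num.min r4 r5))).
  by rewrite !lt_min r10 r20 r30 r40.
move=> w; rewrite lt_min => /andP[/Gb[Uw Gw]]; rewrite !lt_min => /andP[/h3 w3 /andP[/h4 w4 w5]].
have -> : inverse (F w) - inverse (F z) - (w - z) *: - (G z * D * G z) =
   - (G w * (F w - F z - (w - z) *: D) * G z) + (w - z) *: (G w * (F w - F z) * G z * D * G z).
  have e3 : G w * (F w - F z) * G z = G z - G w.
    by apply: oppr_inj; rewrite -Gd// opprB.
  have e4 : G w * (F w - F z - (w - z) *: D) * G z = G w * (F w - F z) * G z - (w - z) *: (G w * D * G z).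
    by rewrite mulrBr mulrBl bopMZr bopMZl.
  rewrite -/(G w) -/(G z) e4 e3 2!mulrBl.
  exact: inverse_increment.
have Gz : nr (G z) <= K by rewrite /K lerDl.
have Dz : nr D <= L by rewrite /L lerDl.
have w3' : nr (F w - F z) <= L * nr (w - z) by rewrite /L [nr D + 1]addrC.
have K2 : 0 <= 2 * K by rewrite mulr_ge0// ltW.
have b1 : nr (G w * (F w - F z - (w - z) *: D) * G z) <= 2 * K * (r5 * nr (w - z)) * K.
  apply: (le_trans (nr_bopM _ _)); apply: ler_pM; rewrite ?nr_ge0//.
  by apply: (le_trans (nr_bopM _ _)); apply: ler_pM; rewrite ?nr_ge0.
have b2 : nr (G w * (F w - F z) * G z * D * G z) <= 2 * K * (L * nr (w - z)) * K * L * K.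
  do 2 (apply: (le_trans (nr_bopM _ _)); apply: ler_pM; rewrite ?nr_ge0//).
  do 2 (apply: (le_trans (nr_bopM _ _)); apply: ler_pM; rewrite ?nr_ge0//).
apply: (le_trans (nrD _ _)); rewrite nrN.
have wz := nr_ge0 (w - z).
have b2' : nr ((w - z) *: (G w * (F w - F z) * G z * D * G z : bop H)) <=
    nr (w - z) * (2 * K * (L * nr (w - z)) * K * L * K).
  apply: (le_trans _ (ler_wpM2l wz b2)); rewrite le_eqVlt; apply/orP; left; apply/eqP; exact: nrZ.
apply: (le_trans (lerD b1 b2')).
have b3 : nr (w - z) * (2 * K * (L * nr (w - z)) * K * L * K) <= nr (w - z) * (2 * K * (L * r5) * K * L * K).
  rewrite ler_wpM2l// !ler_wpM2r ?(ltW K0) ?(ltW L0)// ler_wpM2l// ler_wpM2l ?(ltW L0)// ltW//.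
apply: (le_trans (lerD (lexx _) b3)).
have -> : 2 * K * (r5 * nr (w - z)) * K + nr (w - z) * (2 * K * (L * r5) * K * L * K) = (r5 * M) * nr (w - z).
  by rewrite /M; ring.
rewrite ler_wpM2r//; have -> : r5 * M = e / 2 by rewrite /r5; field; rewrite gt_eqF.
by rewrite ler_pdivrMr// ler_peMr ?(ltW e0')//; lra.
Qed.

End Inverses.

(** Jacobi's formula, with cofactors so that it holds also where the matrix is singular. *)
Lemma hd_det (R : realType) n (m : R[i] -> 'M[R[i]]_n) (m' : 'M[R[i]]_n) z :
  (forall i j, hd (fun w => m w i j) z (m' i j)) ->
  hd (fun w => \det (m w)) z (\sum_i \sum_j m' i j * cofactor (m z) i j).
Proof.
move=> hm; have prodD (s : {perm 'I_n}) (q : seq 'I_n) : uniq q -> hd (fun w => \prod_(i <- q) m w i (s i)) z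
    (\sum_(i <- q) m' i (s i) * \prod_(j <- q | j != i) m z j (s j)).
  elim: q => [|i q ih] /=.
    rewrite big_nil => _; apply: hd_ext (hd_cst (1 : R[i]) z) => w; by rewrite big_nil.
  case/andP=> iq uq; have h := hdM (hm i (s i)) (ih uq).
  apply: hd_ext (hd_deq _ h) => [w|]; first by rewrite big_cons.
  rewrite !big_cons eqxx /=; congr (_ + _).
    congr (_ * _); rewrite big_seq [RHS]big_seq_cond; apply: eq_bigl => j.
    by case jq : (j \in q) => //=; apply/esym/eqP => ji; rewrite -ji jq in iq.
  rewrite mulr_sumr big_seq [RHS]big_seq; apply: eq_bigr => j jq.
  rewrite big_cons; have -> : (i != j) by apply/eqP => ij; rewrite ij jq in iq.
  by rewrite mulrCA.
have h : hd (fun w => \det (m w)) z (\sum_(s : 'S_n) (-1) ^+ s * (\sum_i m' i (s i) * \prod_(j | j != i) m z j (s j))).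
  apply: (@hd_sum R R[i] _ _ _ (fun (s : 'S_n) w => (-1) ^+ s * \prod_i m w i (s i))) => s _.
  by apply: hd_deq (hdM (hd_cst ((-1) ^+ s : R[i]) z) (prodD s (index_enum _) (index_enum_uniq _))); rewrite mul0r add0r.
apply: hd_deq h.
under eq_bigr => s _ do rewrite mulr_sumr.
rewrite exchange_big; apply: eq_bigr => i _.
pose mi := \matrix_(a, b) (if a == i then m' a b else m z a b).
transitivity (\det mi).
  rewrite /determinant; apply: eq_bigr => s _; congr (_ * _).
  rewrite [RHS](bigD1 i)//= mxE eqxx; congr (_ * _); apply: eq_bigr => j ji.
  by rewrite mxE (negbTE ji).
rewrite (expand_det_row _ i); apply: eq_bigr => j _; rewrite mxE eqxx; congr (_ * _).
rewrite /cofactor; congr (_ * \det _); apply/matrixP => a b; rewrite !mxE.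
by rewrite eq_sym (negbTE (neq_lift _ _)).
Qed.

(** * Inverting a finite-rank perturbation of the identity *)

Section Reduction.
Variables (R : realType) (H : completeNormedModType R[i]) (dot : {dot H for Num.Def.conjC}).
Hypothesis dn : forall x : H, `|x| ^+ 2 = dot x x.
Notation C := R[i].
Variables (N : nat) (u : 'I_N -> H).
Hypothesis ou : forall p q, dot (u p) (u q) = (p == q)%:R.

Definition LL (n : 'M[C]_N) : bop H := \sum_p \sum_q n p q *: rk dot (u p) (u q).

Lemma LLE n x : LL n x = \sum_p \sum_q (n p q * dot x (u q)) *: u p.
Proof.
rewrite /LL bop_sumE; apply: eq_bigr => p _; rewrite bop_sumE; apply: eq_bigr => q _.
by rewrite bopZE (rkE dn) scalerA.
Qed.

Lemma LL_dot n x p : dot (LL n x) (u p) = \sum_q n p q * dot x (u q).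
Proof.
rewrite LLE dot_suml (bigD1 p)//= [X in _ + X]big1 ?addr0 => [|p' pp]; last first.
  by rewrite dot_suml big1// => q _; rewrite dotZl ou (negbTE pp) mulr0.
by rewrite dot_suml; apply: eq_bigr => q _; rewrite dotZl ou eqxx mulr1.
Qed.

Lemma LLM a b : LL a * LL b = LL (a *m b).
Proof.
apply/bop_eqP => x; rewrite bopME [LHS]LLE [RHS]LLE; apply: eq_bigr => p _.
under eq_bigr => q _ do rewrite LL_dot.
rewrite -!scaler_suml; congr (_ *: _).
under [RHS]eq_bigr => q _ do rewrite mxE mulr_suml.
rewrite exchange_big; apply: eq_bigr => r _; rewrite mulr_sumr.
by apply: eq_bigr => q _; rewrite mulrA.
Qed.

Lemma LLB a b : LL (a - b) = LL a - LL b.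
Proof.
apply/bop_eqP => x; rewrite bopBE !LLE -sumrB; apply: eq_bigr => p _.
by rewrite -sumrB; apply: eq_bigr => q _; rewrite !mxE mulrBl scalerBl.
Qed.

Definition PP : bop H := LL 1%:M.

Lemma PPE x : PP x = \sum_p dot x (u p) *: u p.
Proof.
rewrite LLE; apply: eq_bigr => p _; rewrite (bigD1 p)//= mxE eqxx mul1r big1 ?addr0// => q qp.
by rewrite mxE eq_sym (negbTE qp) mul0r scale0r.
Qed.

Lemma PLL n : PP * LL n = LL n. Proof. by rewrite LLM mul1mx. Qed.
Lemma LLP n : LL n * PP = LL n. Proof. by rewrite LLM mulmx1. Qed.

Definition ymx (Y : bop H) : 'M[C]_N := \matrix_(p, q) dot (Y (u q)) (u p).
Definition redmx (Y : bop H) : 'M[C]_N := 1%:M - ymx Y.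

Lemma PYP Y : PP * Y * PP = LL (ymx Y).
Proof.
apply/bop_eqP => x; rewrite !bopME PPE LLE; apply: eq_bigr => p _.
rewrite PPE bop_lsum dot_suml -scaler_suml; congr (_ *: _); apply: eq_bigr => q _.
by rewrite bopZ dotZl mxE mulrC.
Qed.

Lemma red_r Y n : redmx Y *m n = 1%:M -> PP * (Y * LL n) = LL n - PP.
Proof.
move=> h; rewrite -{1}(PLL n) !mulrA PYP -[LL (ymx Y) * LL n]opprK -mulNr.
have -> : - LL (ymx Y) = LL (redmx Y) - PP by rewrite LLB addrAC subrr add0r.
by rewrite mulrBl LLM h PLL opprB.
Qed.

Lemma red_l Y n : n *m redmx Y = 1%:M -> LL n * (Y * PP) = LL n - PP.
Proof.
move=> h; rewrite -{1}(LLP n) -mulrA [PP * _]mulrA PYP -[LL n * LL (ymx Y)]opprK -mulrN.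
have -> : - LL (ymx Y) = LL (redmx Y) - PP by rewrite LLB addrAC subrr add0r.
by rewrite mulrBr LLM h LLP opprB.
Qed.

(** Since [Y * PP] has finite rank, only its compression to the range of [PP] has to be inverted:
    [(1 - Y P)^-1 = 1 + Y n], with [n] the inverse of the compression of [1 - Y], extended by 0. *)
Lemma red_inverse Y n : redmx Y *m n = 1%:M -> n *m redmx Y = 1%:M ->
  is_inverse (1 - Y * PP) (1 + Y * LL n).
Proof.
move=> h1 h2; split.
  rewrite mulrBl mul1r mulrDr mulr1 -!mulrA red_r// mulrBr; move: (Y * LL n) (Y * PP) (1 : bop H) => q1 q2 q3.
  by module_solve (R[i] : comPzRingType) (bop H).
rewrite mulrDl mul1r mulrBr mulr1 -!mulrA red_l// mulrBr; move: (Y * LL n) (Y * PP) (1 : bop H) => q1 q2 q3.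
by module_solve (R[i] : comPzRingType) (bop H).
Qed.

Lemma red_invertible Y : invertible (1 - Y * PP) <-> \det (redmx Y) != 0.
Proof.
split=> [[S [h1 h2]]|d0].
  apply/negP; rewrite -det_tr => /det0P[c c0 cM].
  (* A null vector of the compression satisfies [x = P (Y x)]. Then [1 - Y P] kills [Y x], so
     [Y x = 0], and [x = 0]. *)
  pose x := \sum_q c 0 q *: u q.
  have xu p : dot x (u p) = c 0 p.
    rewrite dot_suml (bigD1 p)//= dotZl ou eqxx mulr1 big1 ?addr0// => q qp.
    by rewrite dotZl ou (negbTE qp) mulr0.
  have Px : PP (Y x) = x.
    rewrite PPE /x; apply: eq_bigr => p _; congr (_ *: _).
    have := congr1 (fun M : 'rV[C]_N => M 0 p) cM; rewrite !mxE => /eqP.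
    under eq_bigr => q _ do rewrite !mxE mulrBr.
    rewrite sumrB (bigD1 p)//= eqxx mulr1 big1 ?addr0 => [|q qp]; last by rewrite eq_sym (negbTE qp) mulr0.
    rewrite subr_eq0 => /eqP ->; rewrite bop_lsum dot_suml; apply: eq_bigr => q _.
    by rewrite bopZ dotZl.
  have y0 : Y x = 0.
    have <- : (S * (1 - Y * PP)) (Y x) = Y x by rewrite h2.
    by rewrite bopME bopBE bop1E bopME Px subrr bop0.
  move/eqP: c0; apply; apply/rowP => p; rewrite -xu -Px y0 bop0 mxE; exact: dot0l.
have uM : redmx Y \in unitmx by rewrite unitmxE unitfE.
by exists (1 + Y * LL (invmx (redmx Y))); apply: red_inverse; rewrite ?mulmxV ?mulVmx.
Qed.

End Reduction.

(** For [F = U X V] with [X = 1 - Y P], the singular part of [F' F^-1] is isolated in the term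
    containing [Le], which has finite rank; the first two terms are holomorphic wherever [U] and [V]
    are invertible. *)
Lemma logder_ring (B : pzRingType) (dU U X V dV Vi Di Ui Y dY P Le : B) :
  V * Vi = 1 -> X * Di = 1 -> P * Di = Le -> Di = 1 + Y * Le ->
  ((dU * X + U * - (dY * P)) * V + U * X * dV) * (Vi * Di * Ui) =
  dU * Ui + U * X * (dV * Vi) * Ui + U * (- dY + X * (dV * Vi) * Y) * Le * Ui.
Proof.
move=> v1 x1 e2 e3.
have e1 T : T * V * (Vi * Di * Ui) = T * Di * Ui by rewrite !mulrA -(mulrA T) v1 mulr1.
have e4 : (dU * X + U * - (dY * P)) * Di = dU - U * dY * Le.
  by rewrite mulrDl -(mulrA _ X) x1 mulr1 mulrN mulNr -!mulrA e2.
rewrite mulrDl e1 e4 mulrBl.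
have -> : U * X * dV * (Vi * Di * Ui) = U * X * (dV * Vi) * Ui + U * X * (dV * Vi) * Y * Le * Ui.
  by rewrite e3 !mulrA mulrDr mulr1 mulrDl !mulrA.
have -> : U * (- dY + X * (dV * Vi) * Y) * Le * Ui = - (U * dY * Le * Ui) + U * X * (dV * Vi) * Y * Le * Ui.
  by rewrite mulrDr !mulrDl mulrN !mulNr !mulrA.
by rewrite addrACA.
Qed.

(** * Multiplicities as orders of zeros of the determinant *)

Section Multiplicity.
Variables (R : realType) (H : completeNormedModType R[i]) (dot : {dot H for Num.Def.conjC}).
Hypothesis dn : forall x : H, `|x| ^+ 2 = dot x x.
Hypothesis sep : separable H.
Notation C := R[i].
Let cH : complete_nm H := @complete_completeType R H.
Let cB := @bop_complete R H.
Let cC := @complete_complex R.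

Lemma invertibleM (T S : bop H) : invertible T -> invertible S -> invertible (T * S).
Proof.
move=> [T' [t1 t2]] [S' [s1 s2]]; exists (S' * T'); split.
  by rewrite mulrA -(mulrA T) s1 mulr1.
by rewrite mulrA -(mulrA S') t2 mulr1.
Qed.

Lemma invertible_inverse (T : bop H) : invertible T -> invertible (inverse T).
Proof. by move=> /inverseP[h1 h2]; exists T. Qed.

Variables (D : set C) (A : C -> bop H).
Hypotheses (oD : opn D) (hA : hol D A).
Let F := charF A.

Lemma charF_hol : hol [set z | D z /\ z != 0] F.
Proof.
apply: holB; first exact: hol_cst.
apply: hol_scale; last by apply: hol_sub hA => z [].
by apply: holV => [z []//|]; exact: hol_id.
Qed.

Lemma opn_D0 : opn [set z | D z /\ z != 0].
Proof.
move=> z [Dz z0]; have [r r0 h] := oD Dz.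
have nz : 0 < nr z by rewrite lt_neqAle nr_ge0 eq_sym nr_eq0 z0.
exists (Num.min r (nr z)); first by rewrite lt_min r0.
move=> w; rewrite lt_min => /andP[/h Dw wz]; split => //; apply/eqP => w0.
by move: wz; rewrite w0 sub0r nrN ltxx.
Qed.

Variables (AA : set C) (U V Y : C -> bop H) (N : nat) (u : 'I_N -> H).
Hypothesis ou : forall p q, dot (u p) (u q) = (p == q)%:R.
Hypotheses (oA : opn AA) (AD : forall z, AA z -> D z /\ z != 0).
Hypotheses (hU : hol AA U) (hV : hol AA V) (hY : hol AA Y).
Hypotheses (iU : forall z, AA z -> invertible (U z)) (iV : forall z, AA z -> invertible (V z)).
Let P := PP dot u.
Let X z := 1 - Y z * P.
Hypothesis FE : forall z, AA z -> F z = U z * X z * V z.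
Hypothesis dV0 : forall z x q, AA z -> dot (df V z x) (u q) = 0.
Let m z := redmx dot u (Y z).

Lemma charval_det z : AA z -> (charval D A z <-> \det (m z) = 0).
Proof.
move=> Az; have [Dz z0] := AD Az; split=> [[_ _ nF]|d0].
  apply: contrapT => /eqP/(red_invertible dn ou) iX; apply: nF; rewrite -/(F z) FE//.
  by apply: invertibleM; [apply: invertibleM => //; exact: iU|exact: iV].
split => // iF; have : invertible (X z).
  have [u1 u2] := inverseP (iU Az); have [v1 v2] := inverseP (iV Az).
  have -> : X z = inverse (U z) * F z * inverse (V z).
    by rewrite FE// !mulrA u2 mul1r -mulrA v1 mulr1.
  apply: invertibleM; last exact: invertible_inverse (iV Az).
  by apply: invertibleM => //; exact: invertible_inverse (iU Az).
by move=> /(red_invertible dn ou); rewrite -/(m z) d0 eqxx.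
Qed.

Let dm z : 'M[C]_N := \matrix_(p, q) - dot (df Y z (u q)) (u p).

Lemma hd_m z p q : AA z -> hd (fun w => m w p q) z (dm z p q).
Proof.
move=> Az; have h := @hd_lin R (bop H) C (fun S => dot (S (u q)) (u p)) (nr (u q) * nr (u p)) Y z _ _ _ _ (hol_hd hY Az).
have {}h : hd (fun w => dot (Y w (u q)) (u p)) z (dot (df Y z (u q)) (u p)).
  apply: h => [S S'|a S|S].
  - by rewrite bopBE dotBl.
  - by rewrite bopZE dotZl.
  - apply: (le_trans (cauchy_schwarz dn _ _)); have -> : nr (u q) * nr (u p) * nr S = nr S * nr (u q) * nr (u p) by ring.
    by rewrite ler_wpM2r ?nr_ge0//; exact: nr_bop.
apply: hd_ext (hd_deq _ (hdB (hd_cst ((p == q)%:R : C) z) h)) => [w|]; first by rewrite !mxE.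
by rewrite sub0r !mxE.
Qed.

Let Ui z := inverse (U z).
Let Vi z := inverse (V z).
Let L z := df V z * Vi z.
Let Le z := LL dot u (invmx (m z)).
Let Zf z := - df Y z + X z * L z * Y z.
Let h0 z := df U z * Ui z + U z * X z * L z * Ui z.

Lemma X_hd z : AA z -> hd X z (- (df Y z * P)).
Proof.
move=> Az; apply: hd_deq (hdB (hd_cst (1 : bop H) z) (hd_bopM (hol_hd hY Az) (hd_cst P z))).
by rewrite mulr0 addr0 sub0r.
Qed.

Lemma logder z : AA z -> \det (m z) != 0 -> df F z * inverse (F z) = h0 z + U z * Zf z * Le z * Ui z.
Proof.
move=> Az d0; have [u1 u2] := inverseP (iU Az); have [v1 v2] := inverseP (iV Az).
rewrite -/(Ui z) in u1 u2; rewrite -/(Vi z) in v1 v2.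
have uM : m z \in unitmx by rewrite unitmxE unitfE.
have [x1 x2] := red_inverse dn ou (mulmxV uM) (mulVmx uM).
rewrite -/P -/(X z) -/(Le z) in x1 x2.
have rr := red_r dn ou (mulmxV uM); rewrite -/P -/(Le z) in rr.
pose Di := 1 + Y z * Le z; rewrite -/Di in x1 x2.
have iF : inverse (F z) = Vi z * Di * Ui z.
  apply: inverseE; rewrite FE//; split.
    by rewrite !mulrA -(mulrA _ (V z)) v1 mulr1 -(mulrA _ (X z)) x1 mulr1.
  by rewrite !mulrA -(mulrA _ (Ui z)) u2 mulr1 -(mulrA _ Di) x2 mulr1.
have [r r0 hr] := oA Az.
have hF : hd F z ((df U z * X z + U z * - (df Y z * P)) * V z + U z * X z * df V z).
  apply: (hd_near r0 (f := fun w => U w * X w * V w)); first by move=> w /hr /FE ->.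
  exact: hd_bopM (hd_bopM (hol_hd hU Az) (X_hd Az)) (hol_hd hV Az).
have e2 : P * Di = Le z by rewrite mulrDr mulr1 rr addrC subrK.
rewrite (df_hd hF) iF; exact: (@logder_ring _ (df U z) (U z) (X z) (V z) (df V z) (Vi z) Di (Ui z) (Y z) (df Y z) P (Le z) v1 x1 e2 erefl).
Qed.

(** [dV0] makes [P * L] vanish, so [X] acts as the identity on the range of [L], and the compression
    of [Zf] is that of [- df Y], the derivative of [m]. With Jacobi's formula the trace of the
    singular part becomes the logarithmic derivative of the determinant. *)
Lemma Zf_dot z p q : AA z -> dot (Zf z (u p)) (u q) = dm z q p.
Proof.
move=> Az; have l0 x q' : dot (L z x) (u q') = 0 by rewrite /L bopME; exact: dV0.
have P0 x : P (L z x) = 0.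
  by rewrite /P PPE// big1// => q' _; rewrite l0 scale0r.
pose y := L z (Y z (u p)).
have h : (X z * L z * Y z) (u p) = y.
  by transitivity (y - Y z (P y)); [|rewrite /y P0 bop0 subr0].
transitivity (dot (- df Y z (u p) + (X z * L z * Y z) (u p)) (u q)); first by [].
by rewrite h dotDl /y l0 addr0 dotNl /dm mxE.
Qed.

(** The singular part of [F' F^-1] is a sum of terms of rank at most one with a pole at [w];
    [laurent_rk] expands it along with its scalar trace, which is [nu / (z - w)] plus a holomorphic
    function. *)
Lemma multiplicityE w (rho : R) k (d1 : C -> C) : 0 < rho -> dsk w rho `<=` AA -> hol (dsk w rho) d1 ->
  (forall z, dsk w rho z -> d1 z != 0) ->
  (forall z, dsk w rho z -> \det (m z) = (z - w) ^+ k.+1 * d1 z) ->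
  multiplicity dot D A w = k.+1%:R.
Proof.
move=> rho0 sub hd1 d10 dE; set nu := k.+1.
have wd : dsk w rho w by rewrite /dsk/= subrr nr0.
have oK := @opn_dsk R w rho.
have dne z : dsk w rho z -> z != w -> \det (m z) != 0.
  by move=> dz zw; rewrite dE// mulf_neq0 ?d10// expf_neq0// subr_eq0.
have hUi : hol AA Ui by exact: hol_inverse oA hU iU.
have hVi : hol AA Vi by exact: hol_inverse oA hV iV.
have hX : hol AA X by move=> z Az; exists (- (df Y z * P)); exact: X_hd.
have hL : hol AA L by exact: (hol_bopM (df_hol cB oA hV) hVi).
have hndY : hol AA (fun z => - df Y z).
  by move=> z Az; have [d h] := df_hol cB oA hY Az; exists (- d); exact: hdN.
have hZ : hol AA Zf by exact: (holDV hndY (hol_bopM (hol_bopM hX hL) hY)).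
have hh0 : hol AA h0.
  exact: (holDV (hol_bopM (df_hol cB oA hU) hUi) (hol_bopM (hol_bopM (hol_bopM hU hX) hL) hUi)).
have hm p q : hol AA (fun z => m z p q) by move=> z Az; eexists; exact: hd_m.
have hadj p q : hol AA (fun z => (\adj (m z)) p q).
  have h : hol AA (fun z => (-1) ^+ (q + p) * \det (row' q (col' p (m z)))).
    apply: holM; first exact: hol_cst.
    apply: hol_det => i j z Az; have [d h] := hm (lift q i) (lift p j) z Az.
    by exists d; apply: hd_ext h => z'; rewrite !mxE.
  by move=> z Az; have [d h'] := h z Az; exists d; apply: hd_ext h' => z'; rewrite mxE.
pose Nm z (i : 'I_N * 'I_N) := (d1 z)^-1 * (\adj (m z)) i.1 i.2.
pose v i z := Nm z i *: U z (Zf z (u i.1)).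
have hNm i : hol (dsk w rho) (fun z => Nm z i).
  by apply: holM; [exact: holV|exact: hol_sub sub (hadj _ _)].
have hv i : hol (dsk w rho) (v i).
  apply: hol_scale; first exact: hNm.
  apply: (hol_sub sub); apply: (hol_app hU); apply: (hol_app hZ); exact: hol_cst.
have hUiw : hol (dsk w rho) Ui by exact: hol_sub sub hUi.
have nE z i : dsk w rho z -> z != w -> (z - w) ^- nu * Nm z i = invmx (m z) i.1 i.2.
  move=> dz zw; have uM : m z \in unitmx by rewrite unitmxE unitfE dne.
  by rewrite /invmx uM mxE dE// /Nm mulrA -invfM [_ * d1 z]mulrC.
have [T [t [hL1 [hs [l1 l2 l3 l4]]]]] := @laurent_sum R H dot w rho nu _ (index_enum _)
   (fun i z => rk dot (v i z) (u i.2) * Ui z) (fun i z => dot (Ui z (v i z)) (u i.2))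
   (fun i => @laurent_rk R H dot dn sep w rho nu (v i) Ui (u i.2) (hv i) hUiw).
have lincomb (S : bop H) (c : 'I_N -> 'I_N -> C) :
    S (\sum_p \sum_q c p q *: u p) = \sum_p \sum_q c p q *: S (u p).
  rewrite bop_lsum; apply: eq_bigr => p _; rewrite bop_lsum; apply: eq_bigr => q _; exact: bopZ.
have key z : dsk w rho z -> z != w -> U z * Zf z * Le z * Ui z =
    (z - w) ^- nu *: \sum_i rk dot (v i z) (u i.2) * Ui z.
  move=> dz zw; apply/bop_eqP => x; rewrite bopZE bop_sumE scaler_sumr.
  transitivity ((U z * Zf z) (Le z (Ui z x))) => //.
  rewrite (LLE dn) lincomb (pair_bigA _ (fun p q => (invmx (m z) p q * dot (Ui z x) (u q)) *: (U z * Zf z) (u p))).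
  apply: eq_bigr => i _.
  rewrite -[RHS]/((z - w) ^- nu *: (rk dot (v i z) (u i.2) (Ui z x))) (rkE dn) /v !scalerA -nE//.
  by congr (_ *: _); ring.
have opE z : dsk w rho z -> z != w -> df F z * inverse (F z) =
    \sum_(l < nu) (z - w) ^- l.+1 *: T l + (h0 z + hL1 z).
  move=> dz zw; rewrite logder ?dne//; last exact: sub.
  by rewrite key// (l4 z dz zw).1 addrCA.
have scE z : dsk w rho z -> z != w ->
    (z - w) ^- nu * (\sum_i dot (Ui z (v i z)) (u i.2)) = nu%:R / (z - w) + df d1 z / d1 z.
  move=> dz zw; have Az := sub _ dz; have uM : m z \in unitmx by rewrite unitmxE unitfE dne.
  have [u1 u2] := inverseP (iU Az).
  have UiU x : Ui z (U z x) = x by rewrite -[LHS]/((Ui z * U z) x) u2.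
  have t1 i : (z - w) ^- nu * dot (Ui z (v i z)) (u i.2) = (\det (m z))^-1 * (dm z i.2 i.1 * cofactor (m z) i.2 i.1).
    rewrite /v bopZ UiU dotZl Zf_dot// mulrA nE// /invmx uM mxE mxE.
    by rewrite -mulrA [cofactor _ _ _ * _]mulrC.
  rewrite mulr_sumr; under eq_bigr => i _ do rewrite t1.
  rewrite -mulr_sumr -(pair_bigA _ (fun p q => dm z q p * cofactor (m z) q p)) exchange_big /=.
  have hd1' := hd_det (fun i j => hd_m i j Az).
  have zw0 : z - w != 0 by rewrite subr_eq0.
  have hd2 : hd (fun y => \det (m y)) z (nu%:R * (z - w) ^+ k * d1 z + (z - w) ^+ nu * df d1 z).
    have [r r0 hr] := oK _ dz.
    apply: (hd_near r0 (f := fun y => (y - w) ^+ nu * d1 y)); first by move=> y /hr /dE ->.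
    have h1 : hd (fun y : C => y - w) z 1 by apply: hd_deq (hdB (hd_id z) (hd_cst w z)); rewrite subr0.
    by apply: hd_deq (hdM (hdX nu h1) (hol_hd hd1 dz)); rewrite mulr1.
  rewrite (hd_unique hd1' hd2) dE//; have := d10 _ dz; move: (d1 z) (df d1 z) => a b a0.
  by rewrite [(z - w) ^+ k.+1]exprS; field; rewrite a0 zw0 expf_neq0.
(* The two expansions belong to the same scalar function, so their circle integrals agree, hence
   their residues. *)
have t0E : t 0%N = nu%:R.
  pose f z := (z - w) ^- nu * (\sum_i dot (Ui z (v i z)) (u i.2)).
  have r2 : 0 < rho / 2 by rewrite divr_gt0.
  have r3 : rho / 2 < rho by rewrite ltr_pdivrMr// ltr_pMr//; lra.
  have f1 z : dsk w rho z -> z != w -> f z = \sum_(l < k.+1) (z - w) ^- l.+1 *: t l + hs z.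
    by move=> dz zw; exact: (l4 z dz zw).2.
  have hq : hol (dsk w rho) (fun z => df d1 z / d1 z).
    move=> z dz; have [a e1] := df_hol cC oK hd1 dz; have [b e2] := holV d10 hd1 dz.
    by eexists; exact: (hdM e1 e2).
  have f2 z : dsk w rho z -> z != w -> f z = \sum_(l < 1) (z - w) ^- l.+1 *: (nu%:R : C) + df d1 z / d1 z.
    move=> dz zw; rewrite big_ord_recl big_ord0 addr0 expr1 /f scE//; congr (_ + _); exact: mulrC.
  have c1 := circle_residue cC r2 r3 l2 f1.
  have c2 := @circle_residue R C cC f (fun z => df d1 z / d1 z) (fun=> nu%:R) 0 w _ _ r2 r3 hq f2.
  have I0 : (0 +i* 1) * (pi *+ 2)%:C != 0 :> R[i].
    rewrite mulf_neq0//; first by rewrite eq_complex /= oner_eq0 andbF.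
    by rewrite eq_complex /= eqxx andbT gt_eqF// pmulrn_rgt0// pi_gt0.
  by apply: (mulfI I0); exact: (etrans (esym c1) c2).
pose Oi := [set z | (D z /\ z != 0) /\ invertible (F z)].
have oOi : opn Oi by exact: opn_invertible opn_D0 charF_hol.
pose f' z := df F z * inverse (F z).
have hf' : hol Oi f'.
  apply: hol_bopM; first by apply: hol_sub (df_hol cB opn_D0 charF_hol) => z [].
  by apply: (hol_inverse oOi) => [|z []//]; apply: hol_sub charF_hol => z [].
pose O := [set z | z = w \/ Oi z].
have dOi z : dsk w rho z -> z != w -> Oi z.
  move=> dz zw; have Az := sub _ dz; split; first exact: AD.
  apply: contrapT => nF; have [Dz z0] := AD Az.
  have : charval D A z by split.
  by move=> /(charval_det Az) d0; have := dne z dz zw; rewrite d0 eqxx.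
have oO : opn O.
  move=> z [->|/oOi[r r0 h]]; last by exists r => // y /h; right.
  by exists rho => // y dy; have [->|yw] := eqVneq y w; [left|right; exact: dOi].
have isoE : exists r, isolating_radius D A w r.
  exists (rho / 2); split; first by rewrite divr_gt0.
  move=> z; rewrite nrE lecR => zr.
  have dz : dsk w rho z by apply: (le_lt_trans zr); rewrite ltr_pdivrMr// ltr_pMr//; lra.
  have [Dz z0] := AD (sub _ dz); split => // cz; apply/eqP; apply: contrapT => /negP zw.
  by have := dne z dz zw; rewrite (charval_det (sub _ dz)).1 ?eqxx.
set r := xget 1 [set r | isolating_radius D A w r].
have [r0 hr] : isolating_radius D A w r.
  by rewrite /r; case: xgetP => [//|h]; have [q hq] := isoE; have := h q hq.
have inO z : nr (z - w) <= r -> O z.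
  move=> zr; have [|Dz z0 cz] := hr z; first by rewrite nrE lecR.
  have [->|zw] := eqVneq z w; [by left|right; split => //].
  by apply: contrapT => nF; have /cz zw' : charval D A z; [split|rewrite zw' eqxx in zw].
have [r' rr' tube] := disc_tube r0 oO inO.
pose Sg z := \sum_(l < nu) (z - w) ^- l.+1 *: T l.
(* The isolating radius [r] may exceed [rho]: the regular part is glued from [h0 + hL1] near [w] and
   from the function minus its polar part elsewhere. *)
pose ht z := if nr (z - w) < rho then h0 z + hL1 z else f' z - Sg z.
have htE z : z != w -> ht z = f' z - Sg z.
  move=> zw; rewrite /ht; case: ifP => // dz.
  by rewrite /f' opE// -/(Sg z) [RHS]addrAC subrr add0r.
have hht : hol (dsk w r') ht.
  move=> z dz; have [zr|zr] := ltP (nr (z - w)) rho.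
    have [d hd'] := holDV (hol_sub sub hh0) l1 zr.
    exists d; apply: (hd_near (r := rho - nr (z - w)) (f := fun y => h0 y + hL1 y)) hd'; first by rewrite subr_gt0.
    move=> y yz; rewrite /ht ifT//; apply: (le_lt_trans (nr_triang z _ _)).
    by rewrite -ltrBrDr.
  have zw0 : 0 < nr (z - w) by exact: lt_le_trans zr.
  have zw : z != w by rewrite -subr_eq0 -nr_eq0 gt_eqF.
  have Oz : Oi z by have [/eqP|//] := tube _ dz; rewrite (negbTE zw).
  have [d1' h1'] := hf' _ Oz.
  have [d2' h2'] : exists d, hd Sg z d.
    apply: (@hol_sum R (bop H) [set z | z != w] _ _ _ (fun (l : 'I_nu) z => (z - w) ^- l.+1 *: T l)) => // l _.
    apply: hol_scale; last exact: hol_cst.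
    apply: holV => [y yw|]; first by rewrite expf_neq0// subr_eq0.
    by apply: holX; apply: (@holB R C); [exact: hol_id|exact: hol_cst].
  exists (d1' - d2'); apply: (hd_near zw0 (f := fun y => f' y - Sg y)); last exact: hdB.
  move=> y yz; rewrite htE//; apply/eqP => yw; by move: yz; rewrite yw nrC ltxx.
have fE z : dsk w r' z -> z != w -> derive1 F z * inverse (F z) = \sum_(l < k.+1) (z - w) ^- l.+1 *: T l + ht z.
  move=> dz zw; rewrite htE// addrC subrK /f'.
  have [/eqP|[Dz _]] := tube _ dz; first by rewrite (negbTE zw).
  by rewrite (derive1_df (hol_hd charF_hol Dz)).
have := circle_residue cB r0 rr' hht fE => ci.
rewrite /multiplicity -/r ci (HT_trace (HTZ _ (l3 0%N))) t0E mulKf//.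
rewrite mulf_neq0//; first by rewrite eq_complex /= oner_eq0 andbF.
by rewrite eq_complex /= eqxx andbT gt_eqF// pmulrn_rgt0// pi_gt0.
Qed.

End Multiplicity.

(** * Finite diagonal operators in the eigenvectors *)

Section Diagonal.
Variables (R : realType) (H : completeNormedModType R[i]) (dot : {dot H for Num.Def.conjC}).
Hypothesis dn : forall x : H, `|x| ^+ 2 = dot x x.
Notation C := R[i].
Variable e : nat -> H.
Hypothesis oe : ofam dot e.

Definition W (s : seq nat) (c : nat -> C) : bop H := \sum_(i <- s) c i *: rk dot (e i) (e i).

Lemma WE s c x : W s c x = \sum_(i <- s) (c i * dot x (e i)) *: e i.
Proof. by rewrite /W bop_sumE; apply: eq_bigr => i _; rewrite bopZE (rkE dn) scalerA. Qed.

Lemma W_dot s c x j : uniq s -> j \in s -> dot (W s c x) (e j) = c j * dot x (e j).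
Proof. by move=> us js; rewrite WE (comb_dot oe)// -mulrA (ofam_dot_idem oe). Qed.

Lemma W_dot0 s c x j : j \notin s -> dot (W s c x) (e j) = 0.
Proof.
move=> js; rewrite WE dot_suml big_seq big1// => i is'; rewrite dotZl (oe.2 i j) ?mulr0// => ij.
by rewrite -ij is' in js.
Qed.

Lemma WM_sub s s' a b : uniq s -> uniq s' -> {subset s <= s'} -> W s a * W s' b = W s (fun i => a i * b i).
Proof.
move=> us us' ss; apply/bop_eqP => x; rewrite bopME [LHS]WE [RHS]WE big_seq [RHS]big_seq; apply: eq_bigr => i is'.
by rewrite W_dot ?ss// mulrA.
Qed.

Lemma WM_sup s s' a b : uniq s -> uniq s' -> {subset s <= s'} -> W s' b * W s a = W s (fun i => b i * a i).
Proof.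
move=> us us' ss; apply/bop_eqP => x; rewrite bopME [LHS]WE (bigID (fun i => i \in s)) /= [X in _ + X]big1 ?addr0; last first.
  by move=> i is'; rewrite W_dot0// mulr0 scale0r.
rewrite -big_filter [RHS]WE; have -> : \sum_(i <- s) ((b i * a i) * dot x (e i)) *: e i = \sum_(i <- [seq i <- s' | i \in s]) ((b i * a i) * dot x (e i)) *: e i.
  apply: perm_big; apply: uniq_perm; rewrite ?filter_uniq// => i; rewrite mem_filter.
  by case is' : (i \in s) => //=; rewrite ss.
rewrite big_seq [RHS]big_seq; apply: eq_bigr => i; rewrite mem_filter => /andP[is' _].
by rewrite W_dot// mulrA.
Qed.

Lemma W_nr s c (M : R) : uniq s -> 0 <= M -> (forall i, i \in s -> nr (c i) <= M) -> nr (W s c) <= M.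
Proof. by move=> us M0 cM; apply: bop_nr_le => // x; rewrite WE; exact: (comb_le dn oe). Qed.

Lemma WD s a b : W s a + W s b = W s (fun i => a i + b i).
Proof. by rewrite /W -big_split; apply: eq_bigr => i _; exact/esym/scalerDl. Qed.

Lemma WB s a b : W s a - W s b = W s (fun i => a i - b i).
Proof. by rewrite /W -sumrB; apply: eq_bigr => i _; exact/esym/scalerBl. Qed.

Lemma WZ s t a : t *: W s a = W s (fun i => t * a i).
Proof. by rewrite /W scaler_sumr; apply: eq_bigr => i _; exact: scalerA. Qed.

Lemma W_eq s a b : {in s, a =1 b} -> W s a = W s b.
Proof. by move=> ab; rewrite /W big_seq [RHS]big_seq; apply: eq_bigr => i /ab ->. Qed.

Lemma W0 s : W s (fun=> 0) = 0.
Proof. by rewrite /W big1// => i _; exact: scale0r. Qed.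

Lemma W_prb s : prb dot e s = W s (fun=> 1).
Proof. by rewrite /W; apply: eq_bigr => i _; rewrite scale1r. Qed.

(** The hypothesis is the scalar identity [(1 - a i) (1 + b i) = 1], expanded. *)
Lemma W_1inv s a b : uniq s -> (forall i, i \in s -> b i - a i - a i * b i = 0) ->
  is_inverse (1 - W s a) (1 + W s b).
Proof.
move=> us ab.
have h : W s b - W s a - W s (fun i => a i * b i) = 0.
  by rewrite !WB -(W0 s); apply: W_eq => i /ab.
have h' : W s b - W s a - W s (fun i => b i * a i) = 0.
  by rewrite !WB -(W0 s); apply: W_eq => i /ab <-; rewrite [b i * _]mulrC.
split.
  rewrite mulrDr mulr1 mulrBl mul1r WM_sub// -[RHS]addr0 -h -!addrA; congr (1 + _).
  by rewrite addrCA.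
by rewrite mulrBr mulr1 mulrDl mul1r WM_sub// opprD -[RHS]addr0 -h' -!addrA.
Qed.

End Diagonal.

(** * The factorization of [I - A(z)/z] on an annulus *)

Section Factorization.
Variables (R : realType) (H : completeNormedModType R[i]) (dot : {dot H for Num.Def.conjC}).
Hypothesis dn : forall x : H, `|x| ^+ 2 = dot x x.
Hypothesis sep : separable H.
Notation C := R[i].
Variables (D : set C) (A : C -> bop H).
Hypotheses (oD : opn D) (hA : hol D A) (D0 : D 0).
Hypothesis cA : forall z, D z -> compact_operator (A z).
Let T := A 0.
Let A1 := df A 0.
Variables (e : nat -> H) (l : nat -> R) (Pi0 : bop H).
Hypothesis sT : selfadjoint dot T.
Hypothesis oe : ofam dot e.
Hypothesis Te : forall i, T (e i) = (l i)%:C *: e i.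
Hypothesis mono : forall i j, (i <= j)%N -> `|l j| <= `|l i|.
Hypothesis Tpr : forall n x, nr (T (x - pr dot e (index_iota 0 n) x)) <= `|l n| * nr x.
Hypothesis l0 : forall eps, 0 < eps -> exists N, `|l N| <= eps.
Hypothesis e0l : forall i, (e i == 0) = (l i == 0).
Hypothesis hPi : orthogonal_projection dot [set x | T x = 0] Pi0.
Let K := A1 * Pi0.
Hypothesis iK : invertible (1 - K).
Let S := inverse (1 - K).

Let Qk := Qop dot e Pi0.

(** A difference quotient at one small [h] approximates [A1] up to [eps / 2]. By [compact_strong]
    the products of [A h] and [A 0] with [Qk] fall below [eps / 4 * h], and division by [h] leaves a
    total of [eps]. *)
Lemma A1_Q_small eps : 0 < eps -> exists N, nr (A1 * Qk N) <= eps.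
Proof.
move=> e0; have e2 : 0 < eps / 2 by rewrite divr_gt0.
have hA1 := hol_hd hA D0; have [r r0 hr] := oD D0.
have [r1 r10 h1] := hA1 _ e2.
pose h := Num.min r r1 / 2; have h0 : 0 < h by rewrite divr_gt0// lt_min r0.
have hh : h < Num.min r r1 by rewrite /h ltr_pdivrMr// ltr_pMr ?lt_min ?r0//; lra.
have [hr1 hr2] : h < r /\ h < r1 by move: hh; rewrite lt_min => /andP[].
have nh : nr (h%:C - 0) = h by rewrite subr0 nr_real gtr0_norm.
have Dh : D h%:C by apply: hr; rewrite nh.
have e4 : 0 < eps / 4 * h by rewrite mulr_gt0// divr_gt0.
have st z : D z -> forall d, 0 < d -> exists N, forall n, (N <= n)%N -> nr (A z * Qk n) <= d.
  move=> Dz; apply: (compact_strong dn sep (cA Dz)).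
  - by move=> n; apply: Qop_sa; first [exact: dn|exact: hPi|exact: sT].
  - by move=> n x; exact: (Qop_le dn sT oe Te e0l hPi).
  - by move=> x; exact: (Qop_cv dn sT oe Te mono Tpr l0 e0l hPi).
have [N1 k1] := st _ Dh _ e4; have [N2 k2] := st _ D0 _ e4.
exists (maxn N1 N2); set n := maxn N1 N2.
have g1 := k1 n (leq_maxl _ _); have g2 := k2 n (leq_maxr _ _).
have g3 : nr (A h%:C - T - h%:C *: A1) <= eps / 2 * h.
  have := h1 h%:C; rewrite nh subr0 => /(_ hr2); exact.
have hE : h%:C *: (A1 * Qk n) = A h%:C * Qk n - A 0 * Qk n - (A h%:C - T - h%:C *: A1) * Qk n.
  have zl (V0 : zmodType) (a b c : V0) : c = a - b - (a - b - c) by rewrite opprB addrC subrK.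
  by rewrite 2!mulrBl bopMZl; exact: zl.
have : h * nr (A1 * Qk n) <= h * eps.
  have <- : nr (h%:C *: (A1 * Qk n)) = h * nr (A1 * Qk n).
    by rewrite (@nrZ R (bop H)) nr_real gtr0_norm.
  rewrite hE; apply: (le_trans (nrB _ _)).
  have q1 : nr ((A h%:C - T - h%:C *: A1) * Qk n) <= eps / 2 * h.
    apply: (le_trans (nr_bopM _ _)); rewrite -[leRHS]mulr1; apply: ler_pM; rewrite ?nr_ge0//.
    by apply: bop_nr_le => // x; rewrite mul1r; exact: (Qop_le dn sT oe Te e0l hPi).
  have q2 := le_trans (nrB (A h%:C * Qk n) (A 0 * Qk n)) (lerD g1 g2).
  by apply: (le_trans (lerD q2 q1)); rewrite le_eqVlt; apply/orP; left; apply/eqP; field.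
by rewrite ler_pM2l.
Qed.

(** When [l N = 0] also [e N = 0], which adds nothing to the projection; so [N] can be lowered until
    all [l i] below it are nonzero. Their moduli then have a positive minimum, and small scales stay
    below it. *)
Lemma A1_Q_small_nz eps : 0 < eps -> exists N, nr (A1 * Qk N) <= eps /\ forall i, (i < N)%N -> l i != 0.
Proof.
move=> /A1_Q_small[N]; elim: N => [|N ih] hN; first by exists 0%N.
have [lN|lN] := eqVneq (l N) 0.
  apply: ih; suff -> : Qk N = Qk N.+1 by [].
  rewrite /Qk /Qop /prb big_nat_recr//=; have -> : e N = 0 by apply/eqP; rewrite e0l lN.
  suff -> : rk dot 0 0 = 0 :> bop H by rewrite addr0.
  by apply/bop_eqP => x; rewrite (rkE dn) scaler0.
exists N.+1; split => // i; rewrite ltnS => iN.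
by rewrite -normr_gt0 (lt_le_trans _ (mono iN))// normr_gt0.
Qed.

Let Bz z := z^-1 *: (A z - T).

Lemma KT : K * T = 0.
Proof. by apply/bop_eqP => x; rewrite !bopME (Pi0_T dn sT hPi) bop0. Qed.

(** The interface between operators and matrices: the count of characteristic values takes from [A]
    only these properties. Orders of vanishing appear as local factorizations, which is what the
    product over the zeros supplies. *)
Definition reduced_by (U : set C) (ep : R) N (lx : 'I_N -> R) (E : C -> 'M[C]_N) :=
  [/\ forall p p', hol U (fun z => E z p p'), forall z, U z -> mxb (E z) ep,
    forall z, U z -> (charval D A z <-> \det (spm lx E z) = 0) &
    forall w (rho : R) j (d1 : C -> C), 0 < rho -> dsk w rho `<=` U -> hol (dsk w rho) d1 ->
      (forall z, dsk w rho z -> d1 z != 0) ->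
      (forall z, dsk w rho z -> \det (spm lx E z) = (z - w) ^+ j.+1 * d1 z) ->
      multiplicity dot D A w = j.+1%:R].

Section Scale.
Variables (k m : nat).
Hypothesis km : (k <= m)%N.
Variables (th Th : R).
Hypotheses (th0 : 0 < th) (thTh : th < Th).
Hypothesis lk : forall i, (i < k)%N -> 2 * Th < `|l i|.
Hypothesis lk' : forall i, (k <= i)%N -> `|l i| <= 2 * Th.
Hypothesis lm : `|l m| <= th / 2.
Let AA := [set z : C | th < nr z < Th].
Hypothesis AAD : AA `<=` D.
Variables (N : nat) (ix : 'I_N -> nat).
Hypothesis ixI : injective ix.
Hypothesis ixE : perm_eq [seq ix p | p <- enum 'I_N] (index_iota k m).
Hypothesis lnz : forall i, (i < m)%N -> l i != 0.
Let u p := e (ix p).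
Let P := PP dot u.
Let sk := index_iota 0 k.
Let sm := index_iota 0 m.
Let Pk := W dot e sk (fun=> 1).
Let Pm := W dot e sm (fun=> 1).

Lemma ix_m p : (k <= ix p < m)%N.
Proof. by rewrite -mem_index_iota -(perm_mem ixE) map_f ?mem_enum. Qed.

Lemma ou p q : dot (u p) (u q) = (p == q)%:R.
Proof.
have [->|pq] := eqVneq p q.
  have [/eqP|//] := oe.1 (ix q); rewrite e0l (negbTE (lnz _))//.
  by have /andP[] := ix_m q.
by rewrite (oe.2 _ _ _)// => /ixI /eqP; rewrite (negbTE pq).
Qed.

Lemma P_W : P = W dot e (index_iota k m) (fun=> 1).
Proof.
apply/bop_eqP => x; rewrite (PPE dn) (WE dn) -(perm_big _ ixE) /= big_map big_enum.
by apply: eq_bigr => p _; rewrite mul1r.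
Qed.

Lemma Pm_split : Pm = Pk + P.
Proof. by rewrite P_W /Pm /Pk /W /sm (@big_cat_nat _ _ _ k 0 m). Qed.

Lemma T_W s : T * W dot e s (fun=> 1) = W dot e s (fun i => (l i)%:C).
Proof.
apply/bop_eqP => x; rewrite bopME !(WE dn) bop_lsum; apply: eq_bigr => i _.
by rewrite bopZ Te mul1r scalerA mulrC.
Qed.

Lemma W_T s : uniq s -> W dot e s (fun=> 1) * T = W dot e s (fun i => (l i)%:C).
Proof.
move=> us; apply/bop_eqP => x; rewrite bopME !(WE dn); apply: eq_bigr => i _.
by rewrite mul1r sT Te dotZr cjr.
Qed.

Let Ts := T * (1 - Pm).
Let C0 := T * (1 - P).

Lemma C0E : C0 = Ts + T * Pk.
Proof. by rewrite /C0 /Ts -mulrDr Pm_split opprD addrA [1 - Pk - P]addrAC subrK. Qed.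

Lemma nr_Ts : nr Ts <= th / 2.
Proof.
apply: bop_nr_le => [|x]; first by rewrite divr_ge0// ltW.
have -> : Ts x = T (x - pr dot e sm x) by rewrite -prbE// W_prb.
by apply: (le_trans (Tpr _ _)); rewrite ler_wpM2r ?nr_ge0.
Qed.

Lemma sub_sk : {subset sk <= sm}.
Proof. by move=> i; rewrite !mem_index_iota /= => /leq_trans; exact. Qed.

Lemma Ts_TPk : Ts * (T * Pk) = 0.
Proof.
rewrite T_W /Ts -mulrA mulrBl mul1r (WM_sup dn oe)//; try exact: iota_uniq.
  have -> : W dot e sk (fun i => 1 * (l i)%:C) = W dot e sk (fun i => (l i)%:C).
    by apply: W_eq => i _; rewrite mul1r.
  by rewrite subrr mulr0.
exact: sub_sk.
Qed.

(** [V] treats the large and the small eigenvalues together; [V_fact] splits it into a factor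
    inverted by a Neumann series and a diagonal one inverted explicitly by [G]. *)
Let V z := 1 - z^-1 *: C0.
Let cc z i : C := (l i)%:C / (z - (l i)%:C).
Let G z := 1 + W dot e sk (cc z).
Let Nz z := inverse (1 - z^-1 *: Ts).
Let r z := G z * Nz z.

Lemma AA_nz z : AA z -> z != 0.
Proof. by case/andP=> h _; rewrite -nr_eq0 gt_eqF// (lt_trans th0). Qed.

Lemma N_inv z : AA z -> is_inverse (1 - z^-1 *: Ts) (Nz z) /\ nr (Nz z) <= 2.
Proof.
move=> Az; have /andP[z1 z2] := Az.
have [|N0 hN nN] := @neumann R H (z^-1 *: Ts).
  rewrite (@nrZ R (bop H)) nrV mulrC ler_pdivrMr ?(lt_trans th0)//.
  by apply: (le_trans nr_Ts); lra.
by rewrite /Nz (inverseE hN).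
Qed.

Lemma zl z i : AA z -> (i < k)%N -> `|l i| / 2 <= nr (z - (l i)%:C).
Proof.
move=> /andP[z1 z2] ik; have := lk ik; have := nr_triang z (l i)%:C 0.
by rewrite !subr0 nr_real (nrC (l i)%:C); lra.
Qed.

Lemma zl0 z i : AA z -> (i < k)%N -> z - (l i)%:C != 0.
Proof.
move=> Az ik; rewrite -nr_eq0 gt_eqF// (lt_le_trans _ (zl Az ik))//.
by have := lk ik; have := th0; have := thTh; lra.
Qed.

Lemma mem_sk i : i \in sk -> (i < k)%N.
Proof. by rewrite mem_index_iota. Qed.

Lemma cc_le z i : AA z -> i \in sk -> nr (cc z i) <= 2.
Proof.
move=> Az /mem_sk ik; rewrite /cc nrM nrV nr_real ler_pdivrMr.
  by have := zl Az ik; lra.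
by rewrite lt_neqAle nr_ge0 eq_sym nr_eq0 zl0.
Qed.

Lemma G_nr z : AA z -> nr (G z) <= 3.
Proof.
move=> Az; apply: (le_trans (nrD _ _)); have -> : (3 : R) = 1 + 2 by ring.
apply: lerD; first exact: nr_bop1.
by apply: (W_nr dn oe) => //; [exact: iota_uniq|move=> i; exact: cc_le].
Qed.

Lemma G_inv z : AA z -> is_inverse (1 - z^-1 *: (T * Pk)) (G z).
Proof.
move=> Az; have z0 := AA_nz Az; rewrite T_W WZ; apply: (W_1inv dn oe); first exact: iota_uniq.
move=> i /mem_sk ik; have := zl0 Az ik; rewrite /cc; move: ((l i)%:C) => q q0.
by field; rewrite ?z0 ?q0.
Qed.

Lemma V_fact z : V z = (1 - z^-1 *: Ts) * (1 - z^-1 *: (T * Pk)).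
Proof.
rewrite mulrBr mulr1 mulrBl mul1r bopMZr bopMZl Ts_TPk !scaler0 subr0 /V C0E scalerDr opprD.
by rewrite addrA.
Qed.

Lemma V_inv z : AA z -> is_inverse (V z) (r z) /\ nr (r z) <= 6.
Proof.
move=> Az; have [[n1 n2] n3] := N_inv Az; have [g1 g2] := G_inv Az; split.
  rewrite V_fact /r; split.
    by rewrite mulrA -(mulrA _ _ (G z)) g1 mulr1.
  by rewrite mulrA -(mulrA _ (Nz z)) n2 mulr1.
apply: (le_trans (nr_bopM _ _)); have -> : (6 : R) = 3 * 2 by ring.
by apply: ler_pM; rewrite ?nr_ge0// G_nr.
Qed.

Let Epp z := S * (Bz z - K) * inverse (V z).

Lemma invV z : AA z -> inverse (V z) = r z.
Proof. by move=> /V_inv[h _]; exact: inverseE. Qed.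

(** There are three contributions. [Bz z] is close to [A1] for small [z]; [A1] is small on the
    eigenvectors of index at least [k0]; and on those below [k0] the inverse of [V] is small,
    because [z / (z - l i)] is at most [eta]. The part of [A1] on the kernel of [T] is [K], which is
    subtracted. *)
Lemma Epp_bound z k0 (eta b1 b2 : R) : AA z -> (k0 <= k)%N -> 0 <= eta ->
  (forall i, (i < k0)%N -> 2 * Th <= eta * `|l i|) -> nr (Bz z - A1) <= b1 -> nr (A1 * Qk k0) <= b2 ->
  nr (Epp z) <= nr S * (6 * b1 + 6 * b2 + nr A1 * (2 * eta)).
Proof.
move=> Az k0k eta0 heta hb1 hb2; have [[v1 v2] r6] := V_inv Az; have [_ n2] := N_inv Az.
rewrite /Epp invV// -mulrA; apply: (le_trans (nr_bopM _ _)); rewrite ler_wpM2l ?nr_ge0//.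
pose P0 := W dot e (index_iota 0 k0) (fun=> 1).
have -> : (Bz z - K) * r z = (Bz z - A1) * r z + A1 * Qk k0 * r z + A1 * (P0 * r z).
  rewrite -mulrA -addrA -mulrDr -mulrDl /Qk /Qop W_prb -/P0 subrK mulrA -mulrDl; congr (_ * _).
  by rewrite mulrBr mulr1 addrA subrK.
have hP0 : nr (P0 * r z) <= 2 * eta.
  rewrite /r mulrA; apply: (le_trans (nr_bopM _ _)); rewrite mulrC; apply: ler_pM; rewrite ?nr_ge0//.
  have us : uniq (index_iota 0 k0) by exact: iota_uniq.
  rewrite /G mulrDr mulr1 (WM_sub dn oe) ?iota_uniq//; last first.
    by move=> i; rewrite !mem_index_iota /= => /leq_trans; exact.
  rewrite WD; apply: (W_nr dn oe) => // i; rewrite mem_index_iota /= => ik0.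
  have ik := leq_trans ik0 k0k; have zn := zl0 Az ik.
  have -> : 1 + 1 * cc z i = z / (z - (l i)%:C) by rewrite /cc; field.
  rewrite nrM nrV ler_pdivrMr; last by rewrite lt_neqAle nr_ge0 eq_sym nr_eq0 zn.
  have z2 : nr z <= Th by case/andP: Az => _ /ltW.
  have h1 := heta i ik0; have h2 := ler_wpM2l eta0 (zl Az ik).
  by move: h1 h2 z2; rewrite mulrA; move: (eta * `|l i|) (eta * nr _) (nr z) => q1 q2 q3; lra.
apply: (le_trans (nrD _ _)); apply: lerD.
  apply: (le_trans (nrD _ _)); apply: lerD.
    by apply: (le_trans (nr_bopM _ _)); rewrite mulrC; apply: ler_pM; rewrite ?nr_ge0.
  by apply: (le_trans (nr_bopM _ _)); rewrite mulrC; apply: ler_pM; rewrite ?nr_ge0.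
by apply: (le_trans (nr_bopM _ _)); rewrite ler_wpM2l ?nr_ge0.
Qed.

Variable q : R.
Hypotheses (q0 : 0 <= q) (q2 : q <= 1 / 2).
Hypothesis hEpp : forall z, AA z -> nr (Epp z) <= q.
Let X1 z := inverse (1 - Epp z).

Lemma X1_inv z : AA z -> is_inverse (1 - Epp z) (X1 z) /\ nr (X1 z - 1) <= 2 * q.
Proof.
move=> Az; have [|X hX nX] := @neumann R H (Epp z); first exact: le_trans (hEpp Az) q2.
have XE : X1 z = X by exact: inverseE.
rewrite XE; split => //; have [x1 x2] := hX.
have -> : X - 1 = X * Epp z by rewrite -x2 mulrBr mulr1 opprB addrC subrK.
by apply: (le_trans (nr_bopM _ _)); apply: ler_pM; rewrite ?nr_ge0// hEpp.
Qed.

Let U z := (1 - K) * (1 - Epp z).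
Let Y z := z^-1 *: (X1 z * T).

Lemma PC0 : P * C0 = 0.
Proof.
rewrite /C0 mulrA P_W W_T ?iota_uniq// mulrBr mulr1 (WM_sub dn oe) ?iota_uniq//.
have -> : W dot e (index_iota k m) (fun i => (l i)%:C * 1) = W dot e (index_iota k m) (fun i => (l i)%:C).
  by apply: W_eq => i _; rewrite mulr1.
by rewrite subrr.
Qed.

(** [K * T = 0], since [Pi0 * T = 0], so [1 - K] can be taken out on the left without touching
    [z^-1 *: T]. What remains is [1 - z^-1 *: T - S * (Bz z - K)], whose last term is
    [Epp z * V z]. *)
Lemma factor z : AA z -> charF A z = U z * (1 - Y z * P) * V z.
Proof.
move=> Az; have [[v1 v2] _] := V_inv Az; have [[x1 x2] _] := X1_inv Az; have [k1 k2] := inverseP iK.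
have PV : P * V z = P by rewrite /V mulrBr mulr1 bopMZr PC0 scaler0 subr0.
have e1 : (1 - Y z * P) * V z = V z - z^-1 *: (X1 z * T * P).
  by rewrite mulrBl mul1r -(mulrA (Y z) P) PV /Y bopMZl.
have e2 : (1 - Epp z) * (X1 z * T * P) = T * P by rewrite !mulrA x1 mul1r.
have e3 : Epp z * V z = S * (Bz z - K) by rewrite /Epp invV// -mulrA v2 mulr1.
have e4 : (1 - Epp z) * (V z - z^-1 *: (X1 z * T * P)) = 1 - z^-1 *: T - S * (Bz z - K).
  rewrite mulrBr bopMZr e2 mulrBl mul1r e3 /V /C0 mulrBr mulr1 scalerBr opprB.
  by rewrite addrA addrAC [X in X - _]addrAC addrK.
have e5 : (1 - K) * T = T by rewrite mulrBl mul1r KT subr0.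
rewrite /U -mulrA -mulrA e1 e4 mulrBr mulrBr mulr1 bopMZr e5 mulrA k1 mul1r /Bz /charF scalerBr.
by rewrite opprB addrA [1 - K - _ + K]addrAC subrK opprB addrA subrK.
Qed.

Lemma opn_AA : opn AA.
Proof.
move=> z /andP[z1 z2]; exists (Num.min (nr z - th) (Th - nr z)); first by rewrite lt_min !subr_gt0 z1.
move=> w; rewrite lt_min => /andP[w1 w2]; apply/andP.
have h1 := nr_triang w z 0; have h2 := nr_triang z w 0; rewrite !subr0 in h1 h2; rewrite (nrC z w) in h1.
by split; lra.
Qed.

Lemma hd_V z : AA z -> hd V z ((z ^+ 2)^-1 *: C0).
Proof.
move=> Az; have z0 := AA_nz Az.
apply: hd_deq (hdB (hd_cst (1 : bop H) z) (hd_scale (hdV (hd_id z) z0) (hd_cst C0 z))).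
by rewrite scaler0 addr0 sub0r mulN1r scaleNr opprK.
Qed.

Lemma hol_V : hol AA V.
Proof. by move=> z Az; eexists; exact: hd_V. Qed.

Lemma iV z : AA z -> invertible (V z).
Proof. by move=> /V_inv[h _]; exists (r z). Qed.

Lemma hol_B : hol AA (fun z => Bz z - K).
Proof.
apply: holB; last exact: hol_cst.
apply: hol_scale; first by apply: holV; [exact: AA_nz|exact: hol_id].
by apply: holB; [exact: hol_sub AAD hA|exact: hol_cst].
Qed.

Lemma hol_Epp : hol AA Epp.
Proof.
apply: hol_bopM; last exact: (hol_inverse opn_AA hol_V iV).
by apply: hol_bopM; [exact: hol_cst|exact: hol_B].
Qed.

Lemma hol_1Epp : hol AA (fun z => 1 - Epp z).
Proof. by apply: holB; [exact: hol_cst|exact: hol_Epp]. Qed.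

Lemma hol_X1 : hol AA X1.
Proof. by apply: (hol_inverse opn_AA hol_1Epp) => z /X1_inv[h _]; exists (X1 z). Qed.

Lemma hol_U : hol AA U.
Proof. by apply: hol_bopM; [exact: hol_cst|exact: hol_1Epp]. Qed.

Lemma iU z : AA z -> invertible (U z).
Proof. by move=> /X1_inv[h _]; apply: invertibleM => //; exists (X1 z). Qed.

Lemma hol_Y : hol AA Y.
Proof.
apply: hol_scale; first by apply: holV; [exact: AA_nz|exact: hol_id].
by apply: hol_bopM; [exact: hol_X1|exact: hol_cst].
Qed.

Lemma dV_dot z x p : AA z -> dot (df V z x) (u p) = 0.
Proof.
move=> Az; rewrite (df_hd (hd_V Az)) bopZE dotZl.
have -> : dot (C0 x) (u p) = dot (P (C0 x)) (u p).
  rewrite /P (PPE dn) dot_suml (bigD1 p)//= dotZl ou eqxx mulr1 big1 ?addr0// => p' pp.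
  by rewrite dotZl ou (negbTE pp) mulr0.
by rewrite -bopME PC0 bop0E dot0l mulr0.
Qed.

(** Chosen so that [spm lx Emx z] is [z] times the compression [redmx]: as [T] multiplies [u p'] by
    its eigenvalue, the compression of [z *: Y z] has entries [l (ix p')] times those of [X1 z], and
    the identity part of [X1 z] yields the diagonal. *)
Definition Emx z : 'M[C]_N := \matrix_(p, p') ((l (ix p'))%:C * dot ((X1 z - 1) (u p')) (u p)).
Let lx p := l (ix p).

Lemma spm_red z : AA z -> spm lx Emx z = z *: redmx dot u (Y z).
Proof.
move=> Az; have z0 := AA_nz Az; apply/matrixP => p p'; rewrite !mxE.
have -> : dot (Y z (u p')) (u p) = z^-1 * ((l (ix p'))%:C * (dot ((X1 z - 1) (u p')) (u p) + (p == p')%:R)).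
  rewrite /Y bopZE bopME dotZl {1}/u Te bopZ dotZl bopBE bop1E dotBl -/(u p') ou.
  by rewrite [p' == p]eq_sym subrK.
have [->|pp] := eqVneq p p'.
  rewrite !mulr1n /lx; move: (dot _ _) ((l (ix p'))%:C) => a b; field.
  exact: z0.
by rewrite !mulr0n addr0 !sub0r mulrN mulVKf.
Qed.

Lemma ofam_u : ofam dot u.
Proof. by split=> [p|p p' /eqP pp]; rewrite ou ?eqxx ?(negbTE pp)//; right. Qed.

Lemma Emx_bound z : AA z -> mxb (Emx z) (4 * q * Th).
Proof.
move=> Az v; have [_ nX] := X1_inv Az.
have Th0 : 0 <= Th by rewrite ltW// (lt_trans th0).
have M0 : 0 <= 4 * q * Th by rewrite !mulr_ge0.
pose y := \sum_p ((lx p)%:C * v p 0) *: u p.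
rewrite -ler_sqr ?nnegrE ?vn_ge0 ?mulr_ge0 ?vn_ge0// exprMn !vn_sqr /vn2.
have e1 p : (Emx z *m v) p 0 = dot ((X1 z - 1) y) (u p).
  rewrite mxE /y bop_lsum dot_suml; apply: eq_bigr => p' _.
  by rewrite mxE bopZ dotZl /lx mulrAC.
under eq_bigr => p _ do rewrite e1.
apply: (le_trans (bessel dn ofam_u _ (index_enum_uniq _))).
apply: (@le_trans _ _ ((2 * q * nr y) ^+ 2)).
  rewrite lerXn2r ?nnegrE ?nr_ge0 ?mulr_ge0 ?nr_ge0//.
  by apply: (le_trans (nr_bop _ _)); rewrite ler_wpM2r ?nr_ge0.
rewrite exprMn (_ : (4 * q * Th) ^+ 2 = (2 * q) ^+ 2 * (2 * Th) ^+ 2); last by ring.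
rewrite -(mulrA ((2 * q) ^+ 2)) ler_wpM2l ?sqr_ge0//.
apply: (le_trans (comb_nr dn ofam_u _ (index_enum_uniq _))); rewrite mulr_sumr; apply: ler_sum => p _.
rewrite nrM exprMn ler_wpM2r ?sqr_ge0// lerXn2r ?nnegrE ?nr_ge0 ?mulr_ge0//.
by rewrite nr_real lk'//; have /andP[] := ix_m p.
Qed.

Lemma Emx_hol p p' : hol AA (fun z => Emx z p p').
Proof.
have h : hol AA (fun z => (l (ix p'))%:C * dot ((X1 z - 1) (u p')) (u p)).
  apply: holM; first exact: hol_cst.
  apply: (hol_dot dn (v := fun=> u p')); first exact: hol_cst.
  by apply: holB; [exact: hol_X1|exact: hol_cst].
by move=> z Az; have [d hd'] := h z Az; exists d; apply: hd_ext hd' => w; rewrite mxE.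
Qed.

Lemma charval_spm z : AA z -> (charval D A z <-> \det (spm lx Emx z) = 0).
Proof.
move=> Az; have z0 := AA_nz Az; rewrite spm_red// detZ.
have AD w : AA w -> D w /\ w != 0 by move=> Aw; split; [exact: AAD|exact: AA_nz].
rewrite (charval_det dn ou AD iU iV factor Az); split=> [->|/eqP]; first by rewrite mulr0.
by rewrite mulf_eq0 expf_eq0 (negbTE z0) andbF => /eqP.
Qed.

Lemma multiplicity_spm w (rho : R) j (d1 : C -> C) : 0 < rho -> dsk w rho `<=` AA -> hol (dsk w rho) d1 ->
  (forall z, dsk w rho z -> d1 z != 0) ->
  (forall z, dsk w rho z -> \det (spm lx Emx z) = (z - w) ^+ j.+1 * d1 z) ->
  multiplicity dot D A w = j.+1%:R.
Proof.
move=> rho0 sub hd1 d10 dE.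
have AD z : AA z -> D z /\ z != 0 by move=> Az; split; [exact: AAD|exact: AA_nz].
have zN z : dsk w rho z -> z ^+ N != 0 by move=> /sub/AA_nz z0; rewrite expf_neq0.
apply: (@multiplicityE R H dot dn sep D A oD hA AA U V Y N u ou opn_AA AD hol_U hol_V hol_Y iU iV factor
  (fun z x p Az => dV_dot x p Az) w rho j (fun z => (z ^+ N)^-1 * d1 z)) => //.
- apply: holM => //; apply: holV; first exact: zN.
  by apply: holX; exact: hol_id.
- by move=> z dz; rewrite mulf_neq0 ?invr_eq0 ?zN ?d10.
- move=> z dz; have := dE z dz; rewrite spm_red ?detZ; last exact: sub.
  by move=> h; rewrite mulrCA -h mulKf// zN.
Qed.

Lemma reduced_exists ep : 4 * q * Th <= ep -> exists E, reduced_by AA ep lx E.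
Proof.
move=> hep; exists Emx; split.
- exact: Emx_hol.
- by move=> z Az v; apply: (le_trans (Emx_bound Az v)); rewrite ler_wpM2r ?vn_ge0.
- exact: charval_spm.
- by move=> w rho j d1; exact: multiplicity_spm.
Qed.

End Scale.
End Factorization.

(** * Comparison of the two counts *)

Lemma seq_min_pos (R : realType) (T : eqType) (s : seq T) (f : T -> R) :
  (forall x, x \in s -> 0 < f x) -> exists2 d : R, 0 < d & forall x, x \in s -> d <= f x.
Proof.
elim: s => [|x s ih] h; first by exists 1.
have [|d d0 hd] := ih; first by move=> y ys; apply: h; rewrite inE ys orbT.
exists (Num.min (f x) d); first by rewrite lt_min d0 h// mem_head.
move=> y; rewrite inE => /predU1P[->|/hd yd]; first by rewrite ge_min lexx.
by rewrite ge_min yd orbT.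
Qed.

Lemma seq_max (R : realType) (s : seq R) (t : R) : (exists2 x, x \in s & x < t) ->
  exists a, [/\ a \in s, a < t & forall x, x \in s -> x < t -> x <= a].
Proof.
elim: s => [[x]|y s ih [x]]; first by rewrite in_nil.
case: (boolP (has (fun z => z < t) s)) => [/hasP[z zs zt] _ _|/hasPn hn].
  have [|a [as1 at1 ha]] := ih; first by exists z.
  have [yt|yt] := ltP y t.
    exists (Num.max y a); split; first by rewrite inE; case: leP => _; rewrite ?eqxx ?as1 ?orbT.
      by rewrite gt_max yt.
    move=> w; rewrite inE => /predU1P[->|ws] wt; first by rewrite le_max lexx.
    by rewrite le_max (ha w) ?orbT.
  exists a; split => //; first by rewrite inE as1 orbT.
  by move=> w; rewrite inE => /predU1P[->|ws] wt; [move: wt; rewrite ltNge yt|exact: ha].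
rewrite inE => /predU1P[->|/hn/negbTE ->]// yt; exists y; split => //; first exact: mem_head.
by move=> w; rewrite inE => /predU1P[->|/hn/negbTE ->].
Qed.

Lemma seq_min (R : realType) (s : seq R) (t : R) : (exists2 x, x \in s & t < x) ->
  exists b, [/\ b \in s, t < b & forall x, x \in s -> t < x -> b <= x].
Proof.
move=> [x xs xt]; have [|a [/mapP[b bs ->]]] := @seq_max R [seq - x | x <- s] (- t).
  by exists (- x); [exact: map_f|rewrite ltrN2].
rewrite ltrN2 => bt h; exists b; split => // y ys yt; rewrite -lerN2; apply: h; first exact: map_f.
by rewrite ltrN2.
Qed.

(** * The real trace of the domain as a finite union of intervals *)

Section Components.
Variable R : realType.
Notation C := R[i].
Variable Omega : set C.
Hypothesis oO : open Omega.
Hypothesis trO : transverse_to_real_axis Omega.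
Variable B : R.
Hypothesis OB : forall z, Omega z -> nr z < B.
Variable X : seq R.
Hypothesis XE : forall x, x \in X <-> boundary Omega x%:C.

Lemma boundary_notin x : boundary Omega x%:C -> ~ Omega x%:C.
Proof. by move=> /(boundaryP oO)[]. Qed.

Definition trace_component (c : R * R) := [/\ c.1 \in X, c.2 \in X, c.1 < c.2 &
  forall t, c.1 < t < c.2 -> Omega t%:C].

Definition components := [seq c <- undup (allpairs pair X X) | `[< trace_component c >]].

Lemma componentsP c : c \in components <-> trace_component c.
Proof.
rewrite /components mem_filter mem_undup; split=> [/andP[/asboolP]//|tc].
have [h1 h2 _ _] := tc; apply/andP; split; first exact/asboolP.
by case: c tc h1 h2 => a b /= _ aX bX; apply: allpairs_f.
Qed.

Lemma component_sep c x : trace_component c -> x \in X -> x <= c.1 \/ c.2 <= x.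
Proof.
move=> [_ _ _ h] /XE/boundary_notin xX; have [xc|xc] := leP x c.1; first by left.
by have [xd|xd] := leP c.2 x; [right|case: xX; apply: h; rewrite xc].
Qed.

(** The nearest boundary points on both sides of [t] exist because [Omega] is bounded; between them
    there is no boundary, and membership is constant by [real_constancy]. *)
Lemma component_at t : Omega t%:C -> exists2 c, trace_component c & c.1 < t < c.2.
Proof.
move=> Ot; have tB : - B < t < B by have := OB Ot; rewrite nr_real ltr_norml.
have /andP[t1 t2] := tB.
have nB p : Omega p%:C -> - B < p < B by move/OB; rewrite nr_real ltr_norml.
have tX x : x \in X -> x != t by move=> /XE/boundary_notin xX; apply/eqP => xt; rewrite xt in xX.
have [a [aX at1 ha]] : exists a, [/\ a \in X, a < t & forall x, x \in X -> x < t -> x <= a].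
  apply: seq_max; apply: contrapT => h.
  have /(real_constancy oO (ltW t1))[_ /(_ Ot)/nB] : forall x : R, boundary Omega x%:C -> ~ - B <= x <= t.
    move=> x /XE xX /andP[_ xt]; apply: h; exists x => //.
    by rewrite lt_neqAle tX.
  by rewrite ltxx.
have [b [bX bt hb]] : exists b, [/\ b \in X, t < b & forall x, x \in X -> t < x -> b <= x].
  apply: seq_min; apply: contrapT => h.
  have /(real_constancy oO (ltW t2))[/(_ Ot)/nB] : forall x : R, boundary Omega x%:C -> ~ t <= x <= B.
    move=> x /XE xX /andP[xt _]; apply: h; exists x => //.
    by rewrite lt_neqAle eq_sym tX.
  by rewrite ltxx andbF.
exists (a, b); last by rewrite /= at1.
split => //=; first exact: lt_trans bt.
move=> u /andP[au ub]; have [ut|/ltW tu] := leP u t.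
  have : forall x : R, boundary Omega x%:C -> ~ u <= x <= t.
    move=> x /XE xX /andP[ux xt]; have := ha x xX; rewrite lt_neqAle tX//= => /(_ xt) xa.
    by move: (le_lt_trans xa au); rewrite ltNge ux.
  by move=> /(real_constancy oO ut)[_]; exact.
have : forall x : R, boundary Omega x%:C -> ~ t <= x <= u.
  move=> x /XE xX /andP[tx xu]; have := hb x xX; rewrite lt_neqAle eq_sym tX//= => /(_ tx) bx.
  by move: (lt_le_trans ub bx); rewrite ltNge xu.
by move=> /(real_constancy oO tu)[h _]; exact: h.
Qed.

Variable d0 : R.
Hypothesis d00 : 0 < d0.
Hypothesis Xsep : forall x y, x \in X -> y \in X -> x != y -> d0 <= `|x - y|.

Lemma one_sided x : x \in X -> exists2 sg : bool, exists2 rho : R, 0 < rho < d0 &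
  forall t, `|t - x| < rho -> t != x -> Omega t%:C <-> right_side sg x t & True.
Proof.
move=> /XE/(boundary_cone oO trO)[rho [k [sg [r0 k0 h]]]]; exists sg => //.
exists (Num.min rho (d0 / 2)); first by rewrite lt_min r0 divr_gt0//= gt_min; apply/orP; right; have := d00; lra.
move=> t; rewrite lt_min => /andP[tx _] txn; apply: (h t%:C).
  by rewrite -rmorphB nr_real.
by rewrite /= normr0 mulr0 normr_gt0 subr_eq0.
Qed.

Lemma endpoint x : x \in X -> exists2 c, trace_component c & x = c.1 \/ x = c.2.
Proof.
move=> xX; have [sg [rho /andP[r0 rd] h] _] := one_sided xX.
pose t := if sg then x + rho / 2 else x - rho / 2.
have tx : `|t - x| = rho / 2.
  by rewrite /t; case: (sg); rewrite addrAC subrr add0r ?normrN gtr0_norm// divr_gt0.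
have Ot : Omega t%:C.
  apply/h; first by rewrite tx; lra.
    by rewrite -subr_eq0 -normr_gt0 tx divr_gt0.
  by rewrite /right_side /t; case: (sg); lra.
have [c tc /andP[c1 c2]] := component_at Ot; have [cX1 cX2 c12 _] := tc; exists c => //.
have := component_sep tc xX; move: tx Ot c1 c2; rewrite /t; case: (sg) => tx _ c1 c2 cx.
  left; apply/eqP/negPn/negP => /(Xsep xX cX1); have xc : x <= c.1 by case: cx => //; lra.
  by rewrite ler0_norm ?subr_le0//; lra.
right; apply/eqP/negPn/negP => /(Xsep xX cX2); have xc : c.2 <= x by case: cx => //; lra.
by rewrite ger0_norm ?subr_ge0//; lra.
Qed.

(** Two components cannot share an end, since by [one_sided] the domain lies on one side only of a
    real boundary point. Their facing ends are distinct points of [X], hence [d0] apart. *)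
Lemma components_sep c c' : trace_component c -> trace_component c' -> c != c' ->
  c.2 + d0 <= c'.1 \/ c'.2 + d0 <= c.1.
Proof.
wlog cc : c c' / c.1 <= c'.1.
  move=> h t1 t2 n; have [/h|/ltW/h] := leP c.1 c'.1; first exact.
  by rewrite eq_sym in n => /(_ t2 t1 n)[]; [right|left].
move=> tc tc' n; have [cX1 cX2 c12 hc] := tc; have [cX1' cX2' c12' hc'] := tc'.
have ne : c.1 != c'.1.
  apply: contraNneq n => e1; have e2 : c.2 = c'.2.
    have [h|h] := component_sep tc cX2'; first by move: h; rewrite e1 leNgt c12'.
    have [h'|h'] := component_sep tc' cX2; first by move: h'; rewrite -e1 leNgt c12.
    by apply/eqP; rewrite eq_le h h'.
  by move: e1 e2; case: (c) (c') => [a b] [a' b'] /= -> ->.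
have c1c : c.1 < c'.1 by rewrite lt_neqAle ne.
have c2c : c.2 <= c'.1 by have [h|//] := component_sep tc cX1'; move: h; rewrite leNgt c1c.
have ne2 : c.2 != c'.1.
  apply/eqP => e2; have [sg [rho /andP[r0 rd] h] _] := one_sided cX2.
  pose r := Num.min (rho / 2) (Num.min ((c.2 - c.1) / 2) ((c'.2 - c'.1) / 2)).
  have rr : 0 < r by rewrite !lt_min !divr_gt0 ?subr_gt0.
  have [r1 [r2 r3]] : r <= rho / 2 /\ r <= (c.2 - c.1) / 2 /\ r <= (c'.2 - c'.1) / 2.
    by rewrite /r !ge_min !lexx !orbT.
  have Op : Omega (c.2 + r)%:C by apply: hc'; rewrite -e2; apply/andP; split; lra.
  have Om : Omega (c.2 - r)%:C by apply: hc; apply/andP; split; lra.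
  have rn : r < rho by lra.
  have hp : right_side sg c.2 (c.2 + r).
    have q1 : `|c.2 + r - c.2| < rho by rewrite addrAC subrr add0r gtr0_norm.
    have q2 : c.2 + r != c.2 by rewrite -subr_eq0 addrAC subrr add0r gt_eqF.
    exact: (h _ q1 q2).1 Op.
  have hm : right_side sg c.2 (c.2 - r).
    have q1 : `|c.2 - r - c.2| < rho by rewrite addrAC subrr add0r normrN gtr0_norm.
    have q2 : c.2 - r != c.2 by rewrite -subr_eq0 addrAC subrr add0r oppr_eq0 gt_eqF.
    exact: (h _ q1 q2).1 Om.
  by move: hp hm; rewrite /right_side; case: (sg); lra.
left; have := Xsep cX2 cX1' ne2; rewrite ler0_norm ?subr_le0//; lra.
Qed.

Lemma component_length c : trace_component c -> d0 <= c.2 - c.1.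
Proof.
move=> [c1 c2 c12 _]; have := Xsep c2 c1; rewrite gt_eqF// gtr0_norm ?subr_gt0//; exact.
Qed.

Lemma component_inj c c' t : trace_component c -> trace_component c' ->
  c.1 - d0 / 2 <= t <= c.2 + d0 / 2 -> c'.1 - d0 / 4 <= t <= c'.2 + d0 / 4 -> c = c'.
Proof.
move=> tc tc' /andP[h1 h2] /andP[h3 h4]; apply/eqP/negPn/negP => /(components_sep tc tc').
by have := d00; case; lra.
Qed.

Lemma count_component t : count (fun c => c.1 < t < c.2) components = `[< Omega t%:C >].
Proof.
have u : uniq components by rewrite filter_uniq// undup_uniq.
case: asboolP => [Ot|nO].
  have [c tc ct] := component_at Ot; have cc := (componentsP c).2 tc.
  rewrite -[RHS](_ : count_mem c components = _); last by rewrite count_uniq_mem// cc.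
  apply: eq_in_count => c' /componentsP tc'; apply/idP/eqP => [ct'|->//].
  move/andP: ct => [x1 x2]; move/andP: ct' => [x3 x4].
  by apply: (@component_inj _ _ t tc' tc); apply/andP; split; have := d00; lra.
apply/eqP; rewrite -leqn0 leqNgt -has_count; apply/hasPn => c /componentsP[_ _ _ h].
by apply/negP => /h.
Qed.

Lemma component_far c c0 : trace_component c -> (forall z, Omega z -> c0 <= nr z) -> 0 < c0 ->
  c0 <= c.1 \/ c.2 <= - c0.
Proof.
move=> [c1 c2 c12 h] hc c00.
have far t : c.1 < t < c.2 -> c0 <= t \/ t <= - c0.
  move=> /h/hc; rewrite nr_real; have [t0|t0] := leP 0 t; first by rewrite ger0_norm//; left.
  by rewrite ltr0_norm//; right; lra.
have [h1|h1] := leP c0 c.1; first by left.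
have [h2|h2] := leP c.2 (- c0); first by right.
pose y := Num.min c.2 c0; pose x := Num.max c.1 (- c0).
have xy : x < y by rewrite /x /y gt_max !lt_min c12 h1 h2/=; lra.
have xa : c.1 <= x /\ - c0 <= x by rewrite /x !le_max !lexx orbT.
have yb : y <= c.2 /\ y <= c0 by rewrite /y !ge_min !lexx orbT.
have hxy : c.1 < (x + y) / 2 < c.2 by apply/andP; split; lra.
by case: (far _ hxy); lra.
Qed.

End Components.

(** * The reduction at every small scale *)

Section Reduction.
Variables (R : realType) (H : completeNormedModType R[i]) (dot : {dot H for Num.Def.conjC}).
Hypothesis dn : forall x : H, `|x| ^+ 2 = dot x x.
Hypothesis sep : separable H.
Notation C := R[i].
Variables (D : set C) (A : C -> bop H).
Hypotheses (oD : opn D) (hA : hol D A) (D0 : D 0).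
Hypothesis cA : forall z, D z -> compact_operator (A z).
Variables (e : nat -> H) (l : nat -> R) (Pi0 : bop H).
Hypothesis sT : selfadjoint dot (A 0).
Hypothesis oe : ofam dot e.
Hypothesis Te : forall i, A 0 (e i) = (l i)%:C *: e i.
Hypothesis mono : forall i j, (i <= j)%N -> `|l j| <= `|l i|.
Hypothesis Tpr : forall n x, nr (A 0 (x - pr dot e (index_iota 0 n) x)) <= `|l n| * nr x.
Hypothesis l0 : forall eps, 0 < eps -> exists N, `|l N| <= eps.
Hypothesis e0l : forall i, (e i == 0) = (l i == 0).
Hypothesis hPi : orthogonal_projection dot [set x | A 0 x = 0] Pi0.
Hypothesis iK : invertible (1 - df A 0 * Pi0).

Lemma first_le eps : 0 < eps -> exists k, `|l k| <= eps /\ forall i, (i < k)%N -> eps < `|l i|.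
Proof.
move=> /l0 h; case: (ex_minnP (P := fun n => `|l n| <= eps) h) => k hk hm; exists k; split => // i ik.
by rewrite ltNge; apply/negP => /hm; rewrite leqNgt ik.
Qed.

(** Quantified over all enumerations of the indices, because each interval reorders them, its near
    eigenvalues first, to obtain the block matrix. *)
Definition reducible (U : set C) ep k m := forall N (ix : 'I_N -> nat), injective ix ->
  perm_eq [seq ix p | p <- enum 'I_N] (index_iota k m) ->
  exists E, reduced_by dot D A U ep (fun p => l (ix p)) E.

Lemma reduction th Th ep : 0 < th -> th < Th -> 0 < ep -> exists2 s0, 0 < s0 & forall s, 0 < s < s0 ->
  exists k m, [/\ forall i, (i < k)%N -> 2 * (Th * s) < `|l i|, (k <= m)%N, `|l m| <= th * s / 2 &
    reducible [set z | th * s < nr z < Th * s] (ep * s) k m].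
Proof.
move=> th0 thTh ep0; have Th0 : 0 < Th by exact: lt_trans thTh.
pose q := Num.min (1 / 2) (ep / (4 * Th)).
have q0 : 0 < q by rewrite /q lt_min !divr_gt0 ?mulr_gt0.
have [q2 qep] : q <= 1 / 2 /\ q <= ep / (4 * Th) by rewrite /q !ge_min !lexx orbT.
pose M := nr (inverse (1 - df A 0 * Pi0)) + 1.
pose M1 := nr (df A 0) + 1.
have [M0 M10] : 0 < M /\ 0 < M1 by split; rewrite ltr_wpDl ?nr_ge0.
(* Each of the three terms of [Epp_bound] receives [q / (3 * M)]. *)
pose b1 := q / (18 * M); pose eta := q / (6 * M * M1).
have [b10 eta0] : 0 < b1 /\ 0 < eta by split; rewrite divr_gt0 ?mulr_gt0.
have [k0 [hk0 nzk0]] := A1_Q_small_nz dn sep oD hA D0 cA sT oe Te mono Tpr l0 e0l hPi b10.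
have [|d d0 hd0] := @seq_min_pos R _ (iota 0 k0) (fun i => `|l i|).
  by move=> i; rewrite mem_iota /= => /nzk0; rewrite normr_gt0.
have [r r0 hr] := oD D0; have [r1 r10 hr1] := hol_hd hA D0 b10.
(* The bound [d / 2] puts the first [k0] eigenvalues above the annulus, and [eta * d / 2] makes them
   large enough for the third term of [Epp_bound]. *)
pose t0 := Num.min (Num.min r r1) (Num.min (d / 2) (eta * d / 2)).
have t00 : 0 < t0 by rewrite /t0 !lt_min r0 r10 (divr_gt0 d0)// divr_gt0// (mulr_gt0 eta0 d0).
exists (t0 / Th); first by rewrite divr_gt0.
move=> s /andP[s0]; rewrite ltr_pdivlMr// mulrC => hs.
move: (hs); rewrite /t0 !lt_min => /andP[/andP[sr sr1] /andP[sd seta]].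
have Ths0 : 0 < Th * s by rewrite mulr_gt0.
have ths0 : 0 < th * s by rewrite mulr_gt0.
have ths : th * s < Th * s by rewrite ltr_pM2r.
have [|k [hk1 hk2]] := @first_le (2 * (Th * s)); first by rewrite mulr_gt0.
have [|m [hm1 hm2]] := @first_le (th * s / 2); first by rewrite divr_gt0.
have km : (k <= m)%N by rewrite leqNgt; apply/negP => /hk2; move: hm1; lra.
have lk' i : (k <= i)%N -> `|l i| <= 2 * (Th * s) by move=> /mono h; exact: le_trans hk1.
have dl i : (i < k0)%N -> d <= `|l i| by move=> h; apply: hd0; rewrite mem_iota.
have k0k : (k0 <= k)%N by rewrite leqNgt; apply/negP => /dl; move: hk1 sd; lra.
have lnz i : (i < m)%N -> l i != 0 by move=> /hm2 h; rewrite -normr_gt0; apply: lt_trans h; rewrite divr_gt0.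
have sub : [set z : C | th * s < nr z < Th * s] `<=` D.
  by move=> z /andP[_ z2]; apply: hr; rewrite subr0; exact: lt_trans sr.
exists k, m; split => // N ix ixI ixE.
apply: (reduced_exists dn sep oD hA sT oe Te Tpr e0l hPi iK km ths0 ths hk2 lk' hm1 sub ixI ixE lnz (ltW q0) q2).
  move=> z Az; have z0 : z != 0 by case/andP: Az => h _; rewrite -nr_eq0 gt_eqF// (lt_trans ths0).
  have hB : nr (z^-1 *: (A z - A 0) - df A 0) <= b1.
    have -> : z^-1 *: (A z - A 0) - df A 0 = z^-1 *: (A z - A 0 - z *: df A 0).
      by rewrite [RHS]scalerBr scalerA mulVf// scale1r.
    rewrite (@nrZ R (bop H)) nrV mulrC ler_pdivrMr; last by rewrite lt_neqAle nr_ge0 eq_sym nr_eq0 z0.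
    have := hr1 z; rewrite subr0; apply; case/andP: Az => _ h; exact: lt_trans sr1.
  have heta i : (i < k0)%N -> 2 * (Th * s) <= eta * `|l i|.
    move=> /dl/(ler_wpM2l (ltW eta0)); move: seta; move: (eta * d) (eta * _) (Th * s) => x y t; lra.
  apply: (le_trans (Epp_bound dn oe Te Tpr km ths0 ths hk2 hm1 ixE Az k0k (ltW eta0) heta hB hk0)).
  have i1 : 6 * b1 = q / (3 * M) by rewrite /b1; field; rewrite gt_eqF.
  have i2 : nr (df A 0) * (2 * eta) <= q / (3 * M).
    have -> : q / (3 * M) = M1 * (2 * eta) by rewrite /eta; field; rewrite !gt_eqF.
    have e2 : 0 <= 2 * eta by rewrite mulr_ge0 ?(ltW eta0).
    apply: (ler_wpM2r e2); rewrite /M1; move: (nr _) => x; lra.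
  have -> : q = M * (q / (3 * M) + q / (3 * M) + q / (3 * M)) by field; rewrite gt_eqF.
  have q3 : 0 <= q / (3 * M) by apply: ltW; rewrite divr_gt0 ?mulr_gt0.
  rewrite i1; apply: ler_pM; first exact: nr_ge0.
  - apply: addr_ge0; first exact: addr_ge0.
    by apply: mulr_ge0; [exact: nr_ge0|rewrite mulr_ge0 ?(ltW eta0)].
  - by rewrite /M; move: (nr _) => x; lra.
  - by apply: lerD.
have := ler_wpM2r (ltW Ths0) qep; have -> : ep / (4 * Th) * (Th * s) = ep * s / 4 by field; rewrite gt_eqF.
by rewrite -[4 * q * _]mulrA; move: (q * _) (ep * s) => x y; lra.
Qed.

End Reduction.

Lemma hol_neq0_near (R : realType) (U : set R[i]) (f : R[i] -> R[i]) z : opn U -> hol U f -> U z -> f z != 0 ->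
  exists2 rho, 0 < rho & dsk z rho `<=` U /\ forall w, dsk z rho w -> f w != 0.
Proof.
move=> oU hf Uz fz; have [r1 r10 h1] := oU z Uz; have [d hd'] := hf z Uz; have [r2 r20 h2] := hd' _ ltr01.
have fz0 : 0 < nr (f z) by rewrite lt_neqAle nr_ge0 eq_sym nr_eq0 fz.
pose M := 1 + nr d; have M0 : 0 < M by rewrite ltr_pwDl ?nr_ge0.
pose rho := Num.min (Num.min r1 r2) (nr (f z) / M).
exists rho; first by rewrite /rho !lt_min r10 r20 divr_gt0.
have hlt w : dsk z rho w -> [/\ nr (w - z) < r1, nr (w - z) < r2 & nr (w - z) < nr (f z) / M].
  by rewrite /dsk /= /rho !lt_min => /andP[/andP[-> ->] ->].
split=> w /hlt[w1 w2 w3]; first exact: h1.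
apply/eqP => fw; have := h2 w w2; rewrite fw sub0r mul1r => h.
move: w3; rewrite ltr_pdivlMr//; apply/negP; rewrite -leNgt.
have -> : nr (f z) = nr ((- f z - (w - z) *: d) + (w - z) *: d) by rewrite subrK nrN.
apply: (le_trans (nrD _ _)); rewrite (@nrZ R (R[i])^o) /M mulrDr mulr1.
by apply: lerD.
Qed.

Lemma nth_count (P : pred nat) (s : seq nat) : #|[pred j : 'I_(size s) | P (nth 0%N s j)]| = count P s.
Proof. by rewrite -sum1_card -sum1_count (big_nth 0%N) big_mkord. Qed.

(** * Characteristic values near one interval *)

Section Strip.
Variables (R : realType) (H : completeNormedModType R[i]) (dot : {dot H for Num.Def.conjC}).
Notation C := R[i].
Variables (D : set C) (A : C -> bop H) (U : set C) (ep : R) (l : nat -> R) (k m : nat).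
Hypothesis ep0 : 0 < ep.
Hypothesis red : reducible dot D A l U ep k m.

Lemma charval_im z : U z -> charval D A z -> `|complex.Im z| <= ep.
Proof.
move=> Uz cz; rewrite leNgt; apply/negP => hz.
have ixI : injective (fun i : 'I_(m - k) => (k + i)%N) by move=> i j /addnI/val_inj.
have ixE : perm_eq [seq (k + val p)%N | p <- enum 'I_(m - k)] (index_iota k m).
  by rewrite (map_comp (addn k) val) val_enum_ord -iotaDl addn0.
have [E [_ Eb cE _]] := red ixI ixE.
have := cE z Uz => -[/(_ cz)/eqP d0 _]; move: d0; apply/negP.
by apply: (spm_det_neq0 (d := `|complex.Im z|) _ _ (Eb z Uz)) => [i|]; [exact: nr_sub_real|rewrite ltW].
Qed.

Variables (a b de : R).
Hypotheses (de0 : 0 < de) (ab : 8 * de <= b - a) (epde : ep <= de / 2048).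
Hypothesis epab : 256 * ep * (b - a) <= (de / 64) ^+ 2.
Hypothesis WU : orect (a - de) (b + de) de `<=` U.

Let near i := (`|l i - a| <= de) || (`|l i - b| <= de).

(** The list [zs] repeats each characteristic value according to its multiplicity. The constant 58
    adds to that of [strip_count] one for the near eigenvalues between [a] and [b], which are not
    among the [lQ] counted there. *)
Lemma strip : exists zs : seq C,
  [/\ {in zs, forall z, rect (a - de / 8) (b + de / 8) (de / 64) z},
   forall z, orect (a - de) (b + de) de z -> a - de / 8 <= complex.Re z <= b + de / 8 ->
     (charval D A z <-> z \in zs),
   forall z, z \in zs -> multiplicity dot D A z = (count_mem z zs)%:R &
   forall p : pred C, (forall z, z \in zs -> a + de / 64 <= complex.Re z <= b - de / 64 -> p z) ->
     (forall z, z \in zs -> p z -> a - de / 64 <= complex.Re z <= b + de / 64) ->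
     `|(count p zs)%:R - (count (fun i => a < l i < b) (index_iota k m))%:R| <=
       58 * (count near (index_iota k m))%:R :> R].
Proof.
pose Pl := [seq i <- index_iota k m | near i].
pose Ql := [seq i <- index_iota k m | ~~ near i].
pose lP (j : 'I_(size Pl)) := l (nth 0%N Pl j).
pose lQ (j : 'I_(size Ql)) := l (nth 0%N Ql j).
pose ix (j : 'I_(size Pl + size Ql)) := nth 0%N (Pl ++ Ql) j.
have pPQ : perm_eq (Pl ++ Ql) (index_iota k m) by rewrite perm_filterC.
have ixI : injective ix.
  move=> i j /eqP; rewrite nth_uniq ?size_cat ?ltn_ord//; last by rewrite (perm_uniq pPQ) iota_uniq.
  by move=> /eqP/val_inj.
have ixE : perm_eq [seq ix p | p <- enum 'I_(size Pl + size Ql)] (index_iota k m).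
  rewrite (map_comp (nth 0%N (Pl ++ Ql)) val) val_enum_ord -size_cat.
  by have -> : [seq nth 0%N (Pl ++ Ql) i | i <- iota 0 (size (Pl ++ Ql))] = Pl ++ Ql by exact: mkseq_nth.
have [E [hE Eb cE mE]] := red ixI ixE.
have lE : (fun p => l (ix p)) = spl lP lQ.
  apply/funext => p; rewrite -(splitK p); case: (fintype.split p) => j /=.
    by rewrite spl_l /ix nth_cat /= ltn_ord.
  by rewrite spl_r /ix nth_cat /= ltnNge leq_addr /= addKn.
rewrite lE in cE mE.
have hEW i j : hol (orect (a - de) (b + de) de) (fun w => E w i j) by exact: hol_sub WU (hE i j).
have EbW w : orect (a - de) (b + de) de w -> mxb (E w) ep by move=> /WU; exact: Eb.
have [zs [phi [zK ph fE p0]]] := spm_zeros de0 ep0 epde (spl lP lQ) hEW EbW.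
have zW z : z \in zs -> orect (a - de) (b + de) de z.
  by move=> /zK[/andP[x1 x2] /andP[x3 x4]]; split; apply/andP; split; have := de0; lra.
have zB z : z \in zs -> a - de / 8 <= complex.Re z <= b + de / 8 by move=> /zK[].
exists zs; split => //.
- move=> z Wz Bz; rewrite (cE z (WU Wz)) (fE z Wz); split=> [/eqP|zz].
    rewrite mulf_eq0 (negbTE (p0 z Wz Bz)) orbF prodf_seq_eq0 => /hasP[w wz /=].
    by rewrite subr_eq0 => /eqP ->.
  by apply/eqP; rewrite mulf_eq0 prodf_seq_eq0; apply/orP; left; apply/hasP; exists z; rewrite //= subrr.
- move=> z zz; have Wz := zW z zz.
  pose d1 w := \prod_(z' <- zs | z' != z) (w - z') * phi w.
  have hd1 : hol (orect (a - de) (b + de) de) d1.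
    by apply: holM => //; apply: hol_prod => z' _; apply: holB; [exact: hol_id|exact: hol_cst].
  have d1z : d1 z != 0.
    rewrite mulf_neq0 ?p0 ?zB// prodf_seq_neq0; apply/allP => w _; apply/implyP => wz.
    by rewrite subr_eq0 eq_sym.
  have [rho r0 [rW rd]] := hol_neq0_near (@opn_orect _ _ _ _) hd1 Wz d1z.
  have cz : (0 < count_mem z zs)%N by rewrite -has_count has_pred1.
  rewrite -[count_mem z zs]prednK//; apply: (mE z rho _ d1 r0) => //.
  + by move=> w /rW/WU.
  + exact: hol_sub rW hd1.
  + move=> w /rW Ww; rewrite (fE w Ww) (bigID (fun z' => z' == z)) /= -mulrA prednK//; congr (_ * _).
    rewrite -big_filter -size_filter; elim: [seq _ <- zs | _] (filter_all (pred1 z) zs) => [|y s ih] /=.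
      by rewrite big_nil expr0.
    by move=> /andP[/eqP -> /ih hs]; rewrite big_cons exprS hs.
- move=> p pin pout.
  have lQab j : de < `|lQ j - a| /\ de < `|lQ j - b|.
    have : nth 0%N Ql j \in Ql by rewrite mem_nth.
    by rewrite mem_filter /near negb_or -!ltNge => /andP[/andP[]].
  have := strip_count de0 ab ep0 epde epab lQab hEW EbW zK ph fE p0 pin pout.
  have -> : #|[pred j | a < lQ j < b]| = count (fun i => a < l i < b) Ql.
    exact: (nth_count (fun i => a < l i < b) Ql).
  have -> : count (fun i => a < l i < b) (index_iota k m) =
      (count (fun i => (a < l i < b)%R) Pl + count (fun i => (a < l i < b)%R) Ql)%N.
    by rewrite -count_cat; apply/esym/seq.permP.
  have -> : count near (index_iota k m) = size Pl by rewrite size_filter.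
  have : ((count (fun i => a < l i < b) Pl)%:R : R) <= (size Pl)%:R by rewrite ler_nat count_size.
  have : 0 <= ((count (fun i => a < l i < b) Pl)%:R : R) by rewrite ler0n.
  rewrite natrD !ler_norml; move: (count p zs) (count _ Pl) (count _ Ql) (size Pl) => n1 n2 n3 n4.
  move: n1%:R n2%:R n3%:R n4%:R => x1 x2 x3 x4 h1 h2 /andP[h3 h4].
  by apply/andP; split; lra.
Qed.

End Strip.

(** * Membership of nearly real points *)

Section Location.
Variable R : realType.
Notation C := R[i].
Variable Omega : set C.
Hypothesis oO : open Omega.
Hypothesis trO : transverse_to_real_axis Omega.
Variable B : R.
Hypothesis OB : forall z, Omega z -> nr z < B.
Variable X : seq R.
Hypothesis XE : forall x, x \in X <-> boundary Omega x%:C.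
Variable d0 : R.
Hypothesis d00 : 0 < d0.
Hypothesis Xsep : forall x y, x \in X -> y \in X -> x != y -> d0 <= `|x - y|.
Variables (eta kap : R).
Hypothesis kap0 : 0 < kap.
Hypothesis cone : forall w, `|complex.Im w| < eta -> incone X kap w -> (Omega w <-> Omega (complex.Re w)%:C).
Variables (delta eps : R).
Hypotheses (delta0 : 0 < delta) (deltad : delta <= d0 / 8) (kapeps : kap * eps < delta / 64) (epseta : eps < eta).

Lemma kap_le (u : C) : `|complex.Im u| <= eps -> kap * `|complex.Im u| < delta / 64.
Proof. by move=> h; apply: le_lt_trans kapeps; rewrite ler_pM2l. Qed.

(** Either the cone condition holds and the real part lies in the real trace, or the real part is
    within [delta / 64] of a boundary point, which is an end of a component by [endpoint]. *)
Lemma locate (u : C) : Omega u -> `|complex.Im u| <= eps ->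
  exists2 c, trace_component Omega X c & c.1 - delta / 8 <= complex.Re u <= c.2 + delta / 8.
Proof.
move=> Ou hu; have hk := kap_le hu; have dd := delta0; have [h|h] := pselect (incone X kap u).
  have /(component_at oO OB XE)[c tc /andP[c1 c2]] := (cone (le_lt_trans hu epseta) h).1 Ou.
  by exists c => //; apply/andP; split; lra.
move/existsNP: h => [x /not_implyP[xX /negP]]; rewrite -leNgt => hx.
have [c tc xc] := endpoint oO trO OB XE d00 Xsep xX; exists c => //; have [_ _ c12 _] := tc.
have := le_lt_trans hx hk; rewrite ltr_norml => /andP[h1 h2].
by case: xc => xc; rewrite -?xc; rewrite -?xc in c12; apply/andP; split; lra.
Qed.

Lemma inside_component c (u : C) : trace_component Omega X c -> `|complex.Im u| <= eps ->
  c.1 + delta / 64 <= complex.Re u <= c.2 - delta / 64 -> Omega u.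
Proof.
move=> tc hu /andP[h1 h2]; have hk := kap_le hu; have dd := delta0.
apply/(cone (le_lt_trans hu epseta)).
  move=> x xX; apply: (lt_le_trans hk); rewrite ler_normr; apply/orP.
  by have [h|h] := component_sep oO XE tc xX; [left|right]; lra.
by have [_ _ _ h] := tc; apply: h; apply/andP; split; lra.
Qed.

(** In the part to be excluded the cone condition holds at every boundary point, the other ones
    being about [d0] away. So the real part lies in the real trace, and separation of the components
    places it in [c], a contradiction. *)
Lemma outside_component c (u : C) : trace_component Omega X c -> `|complex.Im u| <= eps -> Omega u ->
  c.1 - delta / 8 <= complex.Re u <= c.2 + delta / 8 ->
  c.1 - delta / 64 <= complex.Re u <= c.2 + delta / 64.
Proof.
move=> tc hu Ou /andP[h1 h2]; have hk := kap_le hu; have dd := delta0; have dd' := deltad.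
have [cX1 cX2 c12 _] := tc.
have contra : incone X kap u -> c.1 < complex.Re u < c.2.
  move=> h; have /(component_at oO OB XE)[c' tc' ct] := (cone (le_lt_trans hu epseta) h).1 Ou.
  suff -> : c = c' by [].
  apply: (component_inj oO trO XE d00 Xsep (t := complex.Re u) tc tc').
    by apply/andP; split; lra.
  by move/andP: ct => [x1 x2]; apply/andP; split; lra.
have far y : y \in X -> `|complex.Re u - y| <= delta / 8 -> delta / 64 < `|complex.Re u - y| -> incone X kap u.
  move=> yX uy1 uy2 x xX; apply: (lt_trans hk); have [->//|xy] := eqVneq x y.
  have := Xsep yX xX; rewrite eq_sym xy => /(_ isT) h.
  have := ler_normB (complex.Re u - x) (complex.Re u - y); have -> : complex.Re u - x - (complex.Re u - y) = y - x by ring.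
  by move: uy1 h; move: `|_| `|_| `|_| => a b1 b2; lra.
apply/andP; split; rewrite leNgt; apply/negP => h.
  have e1 : `|complex.Re u - c.1| = c.1 - complex.Re u by rewrite ler0_norm; lra.
  by have := contra (far _ cX1 _ _); rewrite e1 => /(_ ltac:(lra) ltac:(lra)) /andP[x1 x2]; lra.
have e1 : `|complex.Re u - c.2| = complex.Re u - c.2 by rewrite ger0_norm; lra.
by have := contra (far _ cX2 _ _); rewrite e1 => /(_ ltac:(lra) ltac:(lra)) /andP[x1 x2]; lra.
Qed.

End Location.

Lemma Re_scale (R : realType) (r : R) (z : R[i]) : complex.Re (r%:C * z) = r * complex.Re z.
Proof. by case: z => x y /=; rewrite mul0r subr0. Qed.

Lemma Im_scale (R : realType) (r : R) (z : R[i]) : complex.Im (r%:C * z) = r * complex.Im z.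
Proof. by case: z => x y /=; rewrite mul0r addr0. Qed.

Lemma count_iota_tail (P : pred nat) k m : (k <= m)%N -> (forall i, (i < k)%N -> ~~ P i) ->
  count P (iota 0 m) = count P (index_iota k m).
Proof.
move=> km h; rewrite /index_iota -{1}(subnKC km) iotaD count_cat add0n.
suff -> : count P (iota 0 k) = 0%N by rewrite add0n.
apply/eqP; rewrite -leqn0 leqNgt -has_count; apply/hasPn => i; rewrite mem_iota; exact: h.
Qed.

Lemma count_tail_le (P Q : pred nat) k m : (k <= m)%N -> subpred P Q ->
  (count P (index_iota k m) <= count Q (iota 0 m))%N.
Proof.
move=> km h; rewrite /index_iota -{2}(subnKC km) iotaD count_cat add0n.
by apply: leq_trans (leq_addl _ _); exact: sub_count.
Qed.

Lemma count_flatten_sum (T : Type) (I : Type) (F : I -> seq T) (s : seq I) (P : pred T) :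
  count P (flatten [seq F c | c <- s]) = (\sum_(c <- s) count P (F c))%N.
Proof. by rewrite count_flatten sumnE !big_map. Qed.

Lemma count_exchange (I J : Type) (s : seq I) (r : seq J) (P : I -> pred J) :
  (\sum_(j <- r) count (fun i => P i j) s = \sum_(i <- s) count (P i) r)%N.
Proof.
under eq_bigr => j _ do rewrite -sum1_count big_mkcond.
rewrite exchange_big; apply: eq_bigr => i _; by rewrite -sum1_count [RHS]big_mkcond.
Qed.

Lemma annulus_num (R : realType) (c1 c2 B c0 d x y n : R) : - B <= c1 -> c2 <= B ->
  c1 - d < x < c2 + d -> - d < y < d -> d <= c0 / 8 -> d <= 1 / 8 -> 0 < c0 ->
  `|x| <= n -> n <= `|x| + `|y| -> c0 <= c1 \/ c2 <= - c0 -> c0 / 2 < n < B + 1.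
Proof.
move=> h1 h2 /andP[h3 h4] h5 h6 h7 h8 h9 h10 h11.
have {}h5 : `|y| < d by rewrite ltr_norml.
have h12 : `|x| < B + d by rewrite ltr_norml; apply/andP; split; lra.
have h13 := ler_norm x; have h14 : - x <= `|x| by rewrite -normrN ler_norm.
by apply/andP; split; [case: h11; lra|lra].
Qed.

Lemma strip_num (R : realType) (c1 c2 d ep x y : R) : c1 - d / 8 <= x <= c2 + d / 8 -> `|y| <= ep ->
  0 < d -> ep <= d / 2048 -> (c1 - d < x < c2 + d) /\ (- d < y < d).
Proof. by rewrite ler_norml => /andP[h1 h2] /andP[h3 h4] h5 h6; split; apply/andP; split; lra. Qed.

Lemma rect_orect (R : realType) (a b d : R) w : 0 < d -> rect (a - d / 8) (b + d / 8) (d / 64) w ->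
  orect (a - d) (b + d) d w.
Proof. by move=> d0 [/andP[x1 x2] /andP[x3 x4]]; split; apply/andP; split; lra. Qed.

Lemma Re_nat (R : realType) n : complex.Re (n%:R : R[i]) = n%:R.
Proof. by elim: n => [//|n ih]; rewrite -natr1 ReD ih -natr1. Qed.

(** * Summation over the intervals *)

Section Assembly.
Variables (R : realType) (H : completeNormedModType R[i]) (dot : {dot H for Num.Def.conjC}).
Notation C := R[i].
Variables (D : set C) (A : C -> bop H) (e : nat -> H) (l : nat -> R).
Hypothesis sT : selfadjoint dot (A 0).
Hypothesis oe : ofam dot e.
Hypothesis Te : forall i, A 0 (e i) = (l i)%:C *: e i.
Hypothesis Tpr : forall n x, nr (A 0 (x - pr dot e (index_iota 0 n) x)) <= `|l n| * nr x.
Hypothesis e0l : forall i, (e i == 0) = (l i == 0).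
Variable Omega : set C.
Hypothesis oO : open Omega.
Hypothesis trO : transverse_to_real_axis Omega.
Variables (B c0 : R).
Hypothesis OB : forall z, Omega z -> nr z < B.
Hypothesis c00 : 0 < c0.
Hypothesis Oc0 : forall z, Omega z -> c0 <= nr z.
Variable X : seq R.
Hypothesis XE : forall x, x \in X <-> boundary Omega x%:C.
Variable d0 : R.
Hypothesis d00 : 0 < d0.
Hypothesis Xsep : forall x y, x \in X -> y \in X -> x != y -> d0 <= `|x - y|.
Variables (eta kap : R).
Hypothesis kap0 : 0 < kap.
Hypothesis cone : forall w, `|complex.Im w| < eta -> incone X kap w -> (Omega w <-> Omega (complex.Re w)%:C).
Variables (delta eps s : R).
Hypotheses (delta0 : 0 < delta) (deltad : delta <= d0 / 8) (deltac : delta <= c0 / 8) (delta1 : delta <= 1 / 8).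
Hypotheses (kapeps : kap * eps < delta / 64) (epseta : eps < eta) (eps0 : 0 < eps).
Hypotheses (epsdelta : eps <= delta / 2048) (epsB : 256 * eps * (2 * B) <= (delta / 64) ^+ 2).
Hypothesis s0 : 0 < s.
Variables (k m : nat).
Let U := [set z : C | c0 / 2 * s < nr z < (B + 1) * s].
Hypothesis red : reducible dot D A l U (eps * s) k m.
Hypotheses (lk : forall i, (i < k)%N -> 2 * ((B + 1) * s) < `|l i|) (km : (k <= m)%N).
Hypothesis lm : `|l m| <= c0 / 2 * s / 2.

Let cs := components Omega X.
Let L := [set (s * x)%R | x in real_trace Omega].
Let L' := [set (s * x)%R | x in boundary_nbhd Omega delta].
Let near (c : R * R) i := (`|l i - c.1 * s| <= delta * s) || (`|l i - c.2 * s| <= delta * s).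
Let un (z : C) := (s^-1)%:C * z.

Lemma un_Re z : complex.Re z = complex.Re (un z) * s.
Proof. by rewrite Re_scale mulrC mulVKf// gt_eqF. Qed.

Lemma un_Im z : complex.Im z = complex.Im (un z) * s.
Proof. by rewrite Im_scale mulrC mulVKf// gt_eqF. Qed.

Lemma un_K z : s%:C * un z = z.
Proof. by rewrite mulrA -rmorphM mulfV ?gt_eqF// mul1r. Qed.

Lemma un_nr z : nr z = nr (un z) * s.
Proof. by rewrite -{1}(un_K z) nrM nr_real gtr0_norm// mulrC. Qed.

Lemma un_band z c x : (c.1 * s - x * s <= complex.Re z <= c.2 * s + x * s) =
  (c.1 - x <= complex.Re (un z) <= c.2 + x).
Proof. by rewrite un_Re -mulrBl -mulrDl !ler_pM2r. Qed.

Lemma un_band' z c x : (c.1 * s + x * s <= complex.Re z <= c.2 * s - x * s) =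
  (c.1 + x <= complex.Re (un z) <= c.2 - x).
Proof. by rewrite un_Re -mulrBl -mulrDl !ler_pM2r. Qed.

Lemma un_im_le z x : (`|complex.Im z| <= x * s) = (`|complex.Im (un z)| <= x).
Proof. by rewrite un_Im normrM (gtr0_norm s0) ler_pM2r. Qed.

Lemma orect_un z c : orect (c.1 * s - delta * s) (c.2 * s + delta * s) (delta * s) z <->
  (c.1 - delta < complex.Re (un z) < c.2 + delta) /\ (- delta < complex.Im (un z) < delta).
Proof. by rewrite /orect /= (un_Re z) (un_Im z) -mulrBl -mulrDl -mulNr !ltr_pM2r. Qed.

Lemma image_un z : [set (s%:C * z)%R | z in Omega] z <-> Omega (un z).
Proof.
split=> [[w Ow <-]|Ou]; last by exists (un z) => //; exact: un_K.
by rewrite /un mulrA -rmorphM mulVf ?gt_eqF// mul1r.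
Qed.

Lemma L_un t : L t <-> Omega (s^-1 * t)%:C.
Proof.
split=> [[x Ox <-]|Ot]; first by rewrite mulKf ?gt_eqF.
by exists (s^-1 * t) => //; rewrite mulVKf ?gt_eqF.
Qed.

Lemma component_bounds c : trace_component Omega X c -> - B <= c.1 <= B /\ - B <= c.2 <= B.
Proof. by move=> [/XE h1 /XE h2 _ _]; split; [exact: (boundary_B oO OB h1)|exact: (boundary_B oO OB h2)]. Qed.

Lemma strip_sub c : trace_component Omega X c ->
  orect (c.1 * s - delta * s) (c.2 * s + delta * s) (delta * s) `<=` U.
Proof.
move=> tc w /orect_un[w1 w2]; have [/andP[b1 _] /andP[_ b4]] := component_bounds tc.
rewrite /U /= (un_nr w) !ltr_pM2r//.
exact: (annulus_num b1 b4 w1 w2 deltac delta1 c00 (nrRe (un w)) (nr_le_ReIm (un w)) (component_far tc Oc0 c00)).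
Qed.

Definition strip_zeros (c : R * R) (zs : seq C) := [/\ {in zs, forall z, orect (c.1 * s - delta * s) (c.2 * s + delta * s) (delta * s) z /\
     c.1 - delta / 8 <= complex.Re (un z) <= c.2 + delta / 8},
   forall z, orect (c.1 * s - delta * s) (c.2 * s + delta * s) (delta * s) z ->
     c.1 - delta / 8 <= complex.Re (un z) <= c.2 + delta / 8 -> (charval D A z <-> z \in zs),
   forall z, z \in zs -> multiplicity dot D A z = (count_mem z zs)%:R &
   `|(count (fun z => `[< Omega (un z) >]) zs)%:R - (count (fun i => c.1 * s < l i < c.2 * s) (index_iota k m))%:R| <=
       58 * (count (near c) (index_iota k m))%:R :> R].

Lemma strip_zeros_exist c : trace_component Omega X c -> exists zs, strip_zeros c zs.
Proof.
move=> tc; have [/andP[b1 b2] /andP[b3 b4]] := component_bounds tc.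
have es0 : 0 < eps * s by rewrite mulr_gt0.
have ds0 : 0 < delta * s by rewrite mulr_gt0.
have h1 : 8 * (delta * s) <= c.2 * s - c.1 * s.
  rewrite -mulrBl mulrA ler_pM2r//; have := component_length Xsep tc; have := deltad; lra.
have h2 : eps * s <= delta * s / 2048 by rewrite mulrAC ler_pM2r.
have h3 : 256 * (eps * s) * (c.2 * s - c.1 * s) <= (delta * s / 64) ^+ 2.
  have e0 : 0 <= 256 * eps by exact: mulr_ge0 (ler0n _ _) (ltW eps0).
  have cB : c.2 - c.1 <= 2 * B by lra.
  have := le_trans (ler_wpM2l e0 cB) epsB; rewrite -(ler_pM2r (exprn_gt0 2 s0)).
  have -> : 256 * eps * (c.2 - c.1) * s ^+ 2 = 256 * (eps * s) * (c.2 * s - c.1 * s) by ring.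
  by have -> : (delta / 64) ^+ 2 * s ^+ 2 = (delta * s / 64) ^+ 2 by field.
have [zs [zK zC zM zN]] := strip es0 red ds0 h1 h2 h3 (strip_sub tc).
have zO z : z \in zs -> orect (c.1 * s - delta * s) (c.2 * s + delta * s) (delta * s) z.
  by move=> /zK; exact: rect_orect.
have e8 : delta * s / 8 = delta / 8 * s by rewrite mulrAC.
have e64 : delta * s / 64 = delta / 64 * s by rewrite mulrAC.
rewrite e8 in zK zC; rewrite e64 in zN zK.
have zB z : z \in zs -> c.1 - delta / 8 <= complex.Re (un z) <= c.2 + delta / 8.
  by move=> /zK[x _]; rewrite -un_band.
have zI z : z \in zs -> `|complex.Im (un z)| <= eps.
  move=> zz; rewrite -un_im_le; apply: (charval_im es0 red); first exact: strip_sub tc _ (zO z zz).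
  by apply/zC => //; [exact: zO|rewrite un_band zB].
exists zs; split => //.
- by move=> z zz; split; [exact: zO|exact: zB].
- by move=> z Wz Bz; apply: zC => //; rewrite un_band.
- apply: zN => z zz.
    by rewrite un_band' => h; apply/asboolP; apply: (inside_component oO XE kap0 cone delta0 kapeps epseta tc (zI z zz) h).
  move=> /asboolP Oz; rewrite un_band.
  exact: (outside_component oO trO OB XE d00 Xsep kap0 cone delta0 deltad kapeps epseta tc (zI z zz) Oz (zB z zz)).
Qed.

Lemma near_count_le c : trace_component Omega X c ->
  (count (near c) (index_iota k m) <= count (fun i => `[< L' (l i) >]) (iota 0 m))%N.
Proof.
move=> [/XE c1 /XE c2 _ _]; apply: count_tail_le => // i.
have main (x : R) : boundary Omega x%:C -> `|l i - x * s| <= delta * s -> L' (l i).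
  move=> bx h; exists (s^-1 * l i); last by rewrite mulVKf ?gt_eqF.
  exists x => //; exists (s^-1 * l i - x); last by rewrite addrC subrK.
  rewrite /= in_itv /= -ler_norml -(ler_pM2r s0).
  have -> : `|s^-1 * l i - x| * s = `|l i - x * s|.
    have -> : l i - x * s = (s^-1 * l i - x) * s by rewrite mulrBl [s^-1 * _]mulrC mulfVK ?gt_eqF.
    by rewrite normrM (gtr0_norm s0).
  exact: h.
by move=> /orP[h|h]; apply/asboolP; [exact: main c1 h|exact: main c2 h].
Qed.

Lemma eigenvalue_count_trace : eigenvalue_count (A 0) L =
  ((\sum_(c <- cs) count (fun i => (c.1 * s < l i < c.2 * s)%R) (index_iota k m))%N%:R%:E)%E.
Proof.
rewrite (eigenvalue_countE sT oe Te Tpr e0l (m := m)); last first.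
  move=> t /L_un/Oc0; rewrite nr_real normrM gtr0_norm ?invr_gt0// mulrC ler_pdivlMr// => h.
  apply: (le_lt_trans lm); apply: (lt_le_trans _ h); have : 0 < c0 * s by rewrite mulr_gt0.
  have -> : c0 / 2 * s / 2 = c0 * s / 4 by field.
  by move: (c0 * s) => x; lra.
congr (_%:R%:E); rewrite -count_exchange.
have -> : count (fun i => `[< L (l i) >]) (iota 0 m) =
    count (fun i => `[< Omega (s^-1 * l i)%:C >]) (iota 0 m).
  by apply: eq_count => i; apply/asbool_equiv_eq; exact: L_un.
rewrite (count_iota_tail km); last first.
  move=> i ik; apply/asboolP => /OB; rewrite nr_real normrM gtr0_norm ?invr_gt0// mulrC ltr_pdivrMr//.
  have := lk ik; have := normr_ge0 (l i); have := s0; rewrite [(B + 1) * s]mulrDl mul1r.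
  by move: (B * s) (`|l i|) => x y; lra.
rewrite -sum1_count big_mkcond; apply: eq_bigr => i _.
transitivity (nat_of_bool `[< Omega (s^-1 * l i)%:C >]); first by case: asbool.
rewrite -(count_component oO trO OB XE d00 Xsep); apply: eq_count => c /=.
by rewrite mulrC ltr_pdivlMr// ltr_pdivrMr.
Qed.

Lemma eigenvalue_count_nbhd : eigenvalue_count (A 0) L' =
  ((count (fun i => `[< L' (l i) >]) (iota 0 m))%:R%:E)%E.
Proof.
apply: (eigenvalue_countE sT oe Te Tpr e0l (m := m)) => t [y [x bx [t1]]].
rewrite /= in_itv /= => ht <- <-; apply: (le_lt_trans lm).
have cx : c0 <= `|x|.
  rewrite -nr_real leNgt; apply/negP => h; have [_ hb] := (boundaryP oO _).1 bx.
  have [|u ux /Oc0] := hb (c0 - nr x%:C); first by rewrite subr_gt0.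
  have := nr_triang x%:C u 0; rewrite !subr0; lra.
have xt : c0 - delta <= `|x + t1|.
  move: ht; rewrite -ler_norml => ht; have := ler_normB (x + t1) t1; rewrite addrK; lra.
rewrite normrM gtr0_norm// mulrAC -mulrA [s * _]mulrC mulrA ltr_pM2r//; have := deltac; have := c00; lra.
Qed.

(** The bands of distinct components are disjoint by [component_inj], so the lists concatenate
    without counting a value twice; by [locate] every characteristic value in the scaled domain
    belongs to one of them. *)
Lemma charval_count_trace (zs : R * R -> seq C) : (forall c, c \in cs -> strip_zeros c (zs c)) ->
  charval_count dot D A [set (s%:C * z)%R | z in Omega] =
  ((\sum_(c <- cs) count (fun z => `[< Omega (un z) >]) (zs c))%N%:R%:E)%E.
Proof.
move=> hz; pose q0 := flatten [seq zs c | c <- cs].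
pose q := [seq z <- q0 | `[< Omega (un z) >]].
have ucs : uniq cs by rewrite filter_uniq// undup_uniq.
have es0 : 0 < eps * s by rewrite mulr_gt0.
have memq z : z \in q0 <-> exists2 c, c \in cs & z \in zs c.
  split=> [/flattenP[y /mapP[c cc ->] zc]|[c cc zc]]; first by exists c.
  by apply/flattenP; exists (zs c) => //; exact: map_f.
have same c c' z : c \in cs -> c' \in cs -> z \in zs c -> z \in zs c' -> c = c'.
  move=> cc cc' zc zc'; have [h1 _ _ _] := hz c cc; have [h2 _ _ _] := hz c' cc'.
  have [_ /andP[x1 x2]] := h1 z zc; have [_ /andP[x3 x4]] := h2 z zc'; have dd := deltad; have d00' := delta0.
  by apply: (component_inj oO trO XE d00 Xsep (t := complex.Re (un z)));
    [exact/componentsP|exact/componentsP|apply/andP; split; lra|apply/andP; split; lra].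
have qS z : z \in q <-> [set w | [set (s%:C * z)%R | z in Omega] w /\ charval D A w] z.
  rewrite mem_filter; split=> [/andP[/asboolP Oz /memq[c cc zc]]|[/image_un Oz cz]].
    split; first exact/image_un.
    by have [h1 h2 _ _] := hz c cc; have [h3 h4] := h1 z zc; apply/(h2 z h3 h4).
  apply/andP; split; first exact/asboolP.
  have Uz : U z.
    rewrite /U /= (un_nr z) !ltr_pM2r//; have x1 := Oc0 Oz; have x2 := OB Oz; have x3 := c00.
    by apply/andP; split; lra.
  have Iz : `|complex.Im (un z)| <= eps by rewrite -un_im_le; exact: (charval_im es0 red).
  have [c tc zB] := locate oO trO OB XE d00 Xsep kap0 cone delta0 kapeps epseta Oz Iz.
  have cc : c \in cs by exact/componentsP.
  apply/memq; exists c => //; have [_ h2 _ _] := hz c cc; apply/(h2 z) => //.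
  by apply/orect_un; exact: (strip_num zB Iz delta0 epsdelta).
have qM z : z \in q -> multiplicity dot D A z = (count_mem z q)%:R.
  rewrite mem_filter => /andP[Oz /memq[c cc zc]]; have [_ _ h3 _] := hz c cc; rewrite h3//; congr (_%:R).
  rewrite count_filter; have -> : count (predI (pred1 z) (fun z => `[< Omega (un z) >])) q0 = count_mem z q0.
    by apply: eq_count => w /=; case: eqP => [->|//]; rewrite Oz.
  rewrite count_flatten_sum (bigD1_seq c)//= big_seq_cond big1 ?addn0// => c' /andP[cc' ncc].
  apply/eqP; rewrite -leqn0 leqNgt -has_count has_pred1; apply/negP => zc'.
  by move: ncc; rewrite (same _ _ _ cc' cc zc' zc) eqxx.
have qF z : z \in undup q -> (complex.Re (multiplicity dot D A z))%:E = ((count_mem z q)%:R : R)%:E.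
  by rewrite mem_undup => zq; rewrite (qM z zq) Re_nat.
have S1 z : z \in undup q -> [set w | [set (s%:C * z)%R | z in Omega] w /\ charval D A w] z.
  by move=> zq; apply/qS; rewrite -mem_undup.
have S2 z : [set w | [set (s%:C * z)%R | z in Omega] w /\ charval D A w] z -> z \in undup q.
  by move=> /qS zq; rewrite mem_undup.
have S3 z : [set w | [set (s%:C * z)%R | z in Omega] w /\ charval D A w] z ->
    (0 <= (complex.Re (multiplicity dot D A z))%:E)%E.
  by move=> /S2 zq; rewrite (qF z zq) lee_fin ler0n.
have S4 z : [set w | [set (s%:C * z)%R | z in Omega] w /\ charval D A w] z -> z \notin undup q ->
    (complex.Re (multiplicity dot D A z))%:E = 0.
  by move=> /S2 ->.
rewrite /charval_count (esum_seq (undup_uniq q) S1 S3 S4) (eq_big_seq _ qF) sumEFin -natr_sum.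
by rewrite sum_count_undup /q size_filter count_flatten_sum.
Qed.

Lemma counts_close :
  (`| charval_count dot D A [set (s%:C * z)%R | z in Omega] - eigenvalue_count (A 0%R) L |
     <= (58 * (size cs)%:R)%:E * eigenvalue_count (A 0%R) L')%E.
Proof.
have /choice[zs hz] : forall c, exists zs, c \in cs -> strip_zeros c zs.
  move=> c; have [cc|_] := boolP (c \in cs); last by exists [::].
  by have [zs h] := strip_zeros_exist ((componentsP _ _ _).1 cc); exists zs.
rewrite (charval_count_trace hz) eigenvalue_count_trace eigenvalue_count_nbhd.
rewrite -EFinB -EFinM abse_EFin lee_fin !natr_sum -sumrB.
apply: (le_trans (ler_norm_sum _ _ _)).
set n := count _ (iota 0 m); have -> : 58 * (size cs)%:R * n%:R = \sum_(c <- cs) 58 * n%:R :> R.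
  by rewrite big_const_seq count_predT iter_addr_0 -mulr_natr; ring.
rewrite big_seq [leRHS]big_seq; apply: ler_sum => c cc.
have [_ _ _ h] := hz c cc; apply: (le_trans h); rewrite ler_wpM2l// ler_nat.
by apply: near_count_le; exact/componentsP.
Qed.

End Assembly.

(** * The choice of the constants *)

Lemma bounded_nr (R : realType) (Omega : set R[i]) : bounded_set Omega ->
  exists2 B, 0 < B & forall z, Omega z -> nr z < B.
Proof.
move=> [M [Mr hM]]; have [x Mx] := complex_realP _ Mr.
have [x0 xx] : 0 < `|x| + 1 /\ x < `|x| + 1.
  by have := ler_norm x; have := normr_ge0 x; split; lra.
exists (`|x| + 2) => [|z Oz]; first by lra.
have /hM/(_ z Oz) : M < (`|x| + 1)%:C by rewrite Mx ltcR.
by rewrite /= nrE lecR; lra.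
Qed.

Lemma open_opn (R : realType) (U : set R[i]) : open U -> opn U.
Proof. by move=> oU z Uz; exact: Omega_near. Qed.

Lemma ln_le_expN1 (R : realType) (d : R) : 0 < d -> d < expR (-1) -> 1 <= `|ln d| ^+ 2.
Proof.
move=> d0 d1; have : ln d < -1 by rewrite -[-1](@expRK R) ltr_ln ?posrE// expR_gt0.
move=> h; have h1 : 1 <= `|ln d| by rewrite ler0_norm; lra.
by rewrite -[leLHS](expr1n _ 2) lerXn2r ?nnegrE.
Qed.

Lemma eps_exists (R : realType) (delta kap eta B : R) : 0 < delta -> 0 < kap -> 0 < eta -> 0 < B ->
  exists eps, [/\ 0 < eps, kap * eps < delta / 64, eps < eta, eps <= delta / 2048 &
    256 * eps * (2 * B) <= (delta / 64) ^+ 2].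
Proof.
move=> d0 k0 e0 B0; have x0 : 0 < delta / 64 by lra.
have y0 : 0 < delta / 2048 by lra.
have w0 : 0 < 256 * (2 * B) by lra.
have k2 : 0 < kap + kap by lra.
have z0 := exprn_gt0 2 x0.
suff [eps [h1 h2 h3 h4 h5]] : exists eps, [/\ 0 < eps, kap * eps < delta / 64, eps < eta, eps <= delta / 2048 &
    eps * (256 * (2 * B)) <= (delta / 64) ^+ 2].
  by exists eps; split => //; rewrite -mulrA mulrCA.
move: (delta / 64) (delta / 2048) (256 * _) x0 y0 w0 z0 => x y w x0 y0 w0 z0.
have eh : 0 < eta / 2 by lra.
exists (Num.min (Num.min (x / (kap + kap)) (eta / 2)) (Num.min y (x ^+ 2 / w))).
have p1 := divr_gt0 x0 k2; have p2 := divr_gt0 z0 w0.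
split.
- by rewrite !lt_min p1 eh y0 p2.
- apply: (@le_lt_trans _ _ (kap * (x / (kap + kap)))); first by rewrite ler_pM2l// !ge_min lexx.
  have -> : kap * (x / (kap + kap)) = x / 2 by field; rewrite !gt_eqF.
  by lra.
- by apply: (@le_lt_trans _ _ (eta / 2)); [rewrite !ge_min lexx orbT|lra].
- by rewrite !ge_min lexx orbT.
- by rewrite -ler_pdivlMr// !ge_min lexx !orbT.
Qed.

Theorem theorem3p1 (R : realType)
    (H : completeNormedModType R[i]) (dot : {dot H for Num.Def.conjC})
    (dot_norm : forall x : H, `|x| ^+ 2 = dot x x) (H_separable : separable H)
    (D : set R[i]) (A : R[i] -> bop H)
    (D_domain : domain D) (D0 : D 0)
    (A_compact : forall z, D z -> compact_operator (A z))
    (A_holomorphic : holomorphic_on D A)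
    (A0_selfadjoint : selfadjoint dot (A 0))
    (Pi0 : bop H)
    (Pi0_proj : orthogonal_projection dot [set x | A 0 x = 0] Pi0)
    (A'0Pi0_inv : invertible (1 - derive1 A 0 * Pi0))
    (Omega : set R[i])
    (Omega_domain : domain Omega) (Omega_bounded : bounded_set Omega)
    (Omega_compact : compact (closure Omega))
    (Omega_n0 : ~ closure Omega 0)
    (Omega_smooth : smooth_boundary Omega)
    (Omega_transverse : transverse_to_real_axis Omega) :
  exists2 C : R, 0 < C & exists2 delta1 : R, 0 < delta1 &
    forall delta : R, 0 < delta < delta1 ->
    exists2 s_delta : R, 0 < s_delta & forall s : R, 0 < s < s_delta ->
      (`| charval_count dot D A [set (s%:C * z)%R | z in Omega]
          - eigenvalue_count (A 0%R) [set (s * x)%R | x in real_trace Omega] |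
       <= (C * `|ln delta| ^+ 2)%:E
          * eigenvalue_count (A 0%R)
              [set (s * x)%R | x in boundary_nbhd Omega delta])%E.
Proof.
have oD : opn D by apply: open_opn; case: D_domain.
have oO : open Omega by case: Omega_domain.
have hA : hol D A by move=> z Dz; eexists; exact: derivable_hd (A_holomorphic z Dz).
have iK : invertible (1 - df A 0 * Pi0) by rewrite -(derive1_df (hol_hd hA D0)).
have [e [l [[oe Te] mono Tpr l0 e0l]]] := spectral dot_norm (A_compact 0 D0) A0_selfadjoint.
have [B B0 OB] := bounded_nr Omega_bounded.
have [c0 c00 Oc0] : exists2 c0 : R, 0 < c0 & forall z, Omega z -> c0 <= nr z.
  apply: contrapT => h; apply: Omega_n0; apply/closure_nr => r r0; apply: contrapT => h'.
  apply: h; exists r => // z Oz; rewrite leNgt; apply/negP => zr; apply: h'; exists z => //.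
  by rewrite subr0.
have [eta [kap [X [eta0 kap0 XE cone]]]] := real_structure oO Omega_transverse OB.
have [d0 d00 Xsep] : exists2 d0 : R, 0 < d0 & forall x y, x \in X -> y \in X -> x != y -> d0 <= `|x - y|.
  have [|d dd0 hd] := @seq_min_pos R _ (allpairs pair X X) (fun c => if c.1 == c.2 then 1 else `|c.1 - c.2|).
    by move=> c _; case: eqP => // /eqP n; rewrite normr_gt0 subr_eq0.
  exists d => // x y xX yX xy; have := hd (x, y) (allpairs_f pair xX yX) => /=.
  by rewrite (negbTE xy).
pose N : R := (size (components Omega X))%:R.
have N0 : 0 <= N by rewrite ler0n.
(* Each component contributes 58; the added 1 keeps the constant positive when there is no
   component. *)
exists (58 * N + 1); first by rewrite ltr_wpDl// mulr_ge0.
(* Small against the gaps between the real boundary points and against the distance to 0;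
   [expR (-1)] makes [|ln delta| ^+ 2] at least 1. *)
exists (Num.min (Num.min (d0 / 8) (c0 / 8)) (Num.min (1 / 8) (expR (-1)))).
  by rewrite !lt_min (divr_gt0 d00)// (divr_gt0 c00)// divr_gt0// expR_gt0.
move=> delta /andP[delta0]; rewrite !lt_min => /andP[/andP[/ltW deltad /ltW deltac] /andP[/ltW delta1 deltae]].
(* [eps] is fixed by [delta] before the scale is chosen, which is how the threshold [s0] comes to
   depend on [delta]. *)
have [eps [eps0 kapeps epseta e3 epsB]] := eps_exists delta0 kap0 eta0 B0.
have cB : c0 / 2 < B + 1.
  by have [_ _ [z Oz]] := Omega_domain; have := Oc0 z Oz; have := OB z Oz; lra.
have [s0 s00 hs] := reduction dot_norm H_separable oD hA D0 A_compact A0_selfadjoint oe Te mono Tpr l0 e0l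
  Pi0_proj iK (divr_gt0 c00 (ltr0Sn R 1)) cB eps0.
exists s0 => // s /andP[sp sl].
have [k [m [lk km lm red]]] := hs s (introT andP (conj sp sl)).
have key := counts_close A0_selfadjoint oe Te Tpr e0l oO Omega_transverse OB c00 Oc0 XE d00 Xsep kap0 cone
  delta0 deltad deltac delta1 kapeps epseta eps0 e3 epsB sp red lk km lm.
apply: (le_trans key); apply: lee_wpmul2r.
  apply: esum_ge0 => t _; apply: ereal_sup_ubound; exists 0%N => //.
  by exists (fun=> 0); split => [[]|c _ []].
rewrite lee_fin -/N; have hl := ln_le_expN1 delta0 deltae.
have n0 : 0 <= 58 * N + 1 by rewrite addr_ge0// mulr_ge0.
by have := ler_wpM2l n0 hl; rewrite mulr1; apply: le_trans; rewrite lerDl.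
Qed.
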